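(* Let $\alpha=k+\sigma$ with $k\in\mathbb N=\{0,1,2,\dots\}$ and $0<\sigma\leqslant 1$. Suppose that $F\in\mathcal E_\alpha^{\infty-}$ or $F\in\mathbb D_\alpha^{\infty-}$ is a nonnegative Wiener functional, that $G\in\mathbb D_{k+1}^{\infty-}$, and that $A$ is a measurable set such that $G1_A=0$ and $$E\Big[\Big|\frac1F\Big|^p1_{A^c}\Big]<\infty\quad\text{for every } p>1.$$ Then $$\frac1F\cdot G\in\mathbb D_{\alpha-}^{\infty-}.$$ Furthermore, if $\alpha$ is a positive integer and $F,G\in\mathbb D_\alpha^{\infty-}$, then $$\frac1F\cdot G\in\mathbb D_\alpha^{\infty-}.$$
   Context: $(B,\mathbb H,\mu)$ is an abstract Wiener space, $E[\cdot]$ expectation with respect to $\mu$, $D$ the Malliavin gradient, $D^*$ its dual, $L=-D^*D$ the Ornstein-Uhlenbeck operator. For $1<p<\infty$, $\alpha\in\mathbb R$: $\mathbb D_\alpha^p=(1-L)^{-\alpha/2}(\mathbb L^p)$ with norm $\|F\|_{\alpha,p}=\|(1-L)^{\alpha/2}F\|_{\mathbb L^p}$ (real-valued functionals); $\mathbb D_\alpha^{\infty-}=\bigcap_{1<p<\infty}\mathbb D_\alpha^p$; $\mathbb D_{\alpha-}^{\infty-}=\bigcap_{0<\beta<\alpha}\mathbb D_\beta^{\infty-}$. For $0<\alpha<1$, $\mathcal E_\alpha^p=(\mathbb L^p,\mathbb D_1^p)_{\alpha,p}$ (real interpolation), with norm $\|F\|_{\mathcal E_\alpha^p}=\big[\int_0^1[\epsilon^{-\alpha}K(\epsilon,p,F)]^p\frac{d\epsilon}{\epsilon}\big]^{1/p}$,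 $K(\epsilon,p,F)=\inf\{\|F_1\|_p+\epsilon\|F_2\|_{1,p}:F_1+F_2=F\}$. For general $\alpha=k+\sigma$ with $0<\sigma<1$, $\mathcal E_\alpha^p=(\mathbb D_k^p,\mathbb D_{k+1}^p)_{\sigma,p}$; for positive integers $\alpha$, $\mathcal E_\alpha^p=\mathbb D_\alpha^p$. $\mathcal E_\alpha^{\infty-}=\bigcap_{1<p<\infty}\mathcal E_\alpha^p$. The product $\frac1F\cdot G$ is understood to be $0$ on $A$ (where $G=0$). *)

(* Defs.v *)
From HB Require Import structures.
From mathcomp Require Import all_boot all_order all_algebra.
From mathcomp Require Import all_classical all_reals all_analysis.
Set Implicit Arguments.
Unset Strict Implicit.
Unset Printing Implicit Defensive.
Import Order.TTheory GRing.Theory Num.Theory.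
Import numFieldNormedType.Exports.
Local Open Scope classical_set_scope.
Local Open Scope ring_scope.

Definition separable (T : topologicalType) :=
  exists S : set T, countable S /\ dense S.

(* The last field says that mu has characteristic function
   l |-> exp (- |l|_H^2 / 2) on B^*; here h is the Riesz representative in H of
   the restriction of l to H. *)
Record abstractWienerSpace (R : realType) := AbstractWienerSpace {
  wB : completeNormedModType R;
  wH : completeNormedModType R;
  wdot : {dot wH for (@idfun R)};
  wi : {linear wH -> wB};
  wmu : probability (g_sigma_algebraType (@open wB)) R;
  wdotE : forall h, wdot h h = `|h| ^+ 2;
  wB_separable : separable wB;
  wH_separable : separable wH;
  wi_inj : injective wi;
  wi_continuous : continuous wi;
  wi_dense : dense (range wi);
  wmu_gauss : forall (l : {scalar wB}) (h : wH), continuous (l : wB -> R) ->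
    (forall k, l (wi k) = wdot h k) ->
    (\int[wmu]_x cos (l x) = expR (- (`|h| ^+ 2 / 2))) /\
    (\int[wmu]_x sin (l x) = 0)
}.

(* B with its Borel sigma-algebra; Wiener functionals are maps wspace W -> R, and
   all the notions below are invariant under a.e. equality of measurable maps. *)
Definition wspace (R : realType) (W : abstractWienerSpace R) :=
  g_sigma_algebraType (@open (wB W)).

Definition ae_equal (R : realType) (W : abstractWienerSpace R)
    (F G : wspace W -> R) :=
  {ae wmu W, forall x, F x = G x}.

Definition norm_Lp (R : realType) (W : abstractWienerSpace R)
    (p : R) (F : wspace W -> R) : \bar R :=
  'N[wmu W]_(p%:E)[EFin \o F]%E.

Definition in_Lp (R : realType) (W : abstractWienerSpace R)
    (p : R) (F : wspace W -> R) :=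
  measurable_fun setT F /\ (norm_Lp p F < +oo)%E.

(* H is separable, so that weak measurability is strong measurability. *)
Definition in_L2H (R : realType) (W : abstractWienerSpace R)
    (U : wspace W -> wH W) :=
  (forall h, measurable_fun setT (fun x => wdot W (U x) h)) /\
  (\int[wmu W]_x (`|U x| ^+ 2)%:E < +oo)%E.

Inductive cylinder_poly (R : realType) (W : abstractWienerSpace R) :
    (wB W -> R) -> Prop :=
| cylinder_cst c : cylinder_poly (fun=> c)
| cylinder_lin (l : {scalar wB W}) :
    continuous (l : wB W -> R) -> cylinder_poly l
| cylinder_add f g :
    cylinder_poly f -> cylinder_poly g -> cylinder_poly (fun x => f x + g x)
| cylinder_mul f g :
    cylinder_poly f -> cylinder_poly g -> cylinder_poly (fun x => f x * g x).

Definition cylinder_grad (R : realType) (W : abstractWienerSpace R)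
    (f : wB W -> R) (U : wB W -> wH W) :=
  forall x h, is_derive x (wi W h) f (wdot W (U x) h).

(* D F = U, for D the closed operator from L^2 to L^2(H). *)
Definition malliavin_grad (R : realType) (W : abstractWienerSpace R)
    (F : wspace W -> R) (U : wspace W -> wH W) :=
  [/\ in_Lp 2 F, in_L2H U &
    exists (f : nat -> wB W -> R) (u : nat -> wB W -> wH W),
      [/\ forall n, cylinder_poly (f n) /\ cylinder_grad (f n) (u n),
        norm_Lp 2 ((f n : wspace W -> R) \- F) @[n --> \oo] --> 0%E &
        (\int[wmu W]_x (`|u n x - U x| ^+ 2)%:E)%E @[n --> \oo] --> 0%E]].

(* D^* U = V. *)
Definition divergence (R : realType) (W : abstractWienerSpace R)
    (U : wspace W -> wH W) (V : wspace W -> R) :=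
  [/\ in_L2H U, in_Lp 2 V &
    forall F DF, malliavin_grad F DF ->
      \int[wmu W]_x wdot W (DF x) (U x) = \int[wmu W]_x (F x * V x)].

(* L F = G, for L = - D^* D. *)
Definition ornstein_uhlenbeck (R : realType) (W : abstractWienerSpace R)
    (F G : wspace W -> R) :=
  exists U, malliavin_grad F U /\ divergence U (fun x => - G x).

(* (1 - L)^s V = F, on finite sums of eigenvectors of L: spectral calculus. *)
Definition power_eigensum (R : realType) (W : abstractWienerSpace R)
    (s : R) (V F : wspace W -> R) :=
  exists (n : nat) (lam : 'I_n -> R) (Phi : 'I_n -> wspace W -> R),
    [/\ forall j, 0 <= lam j /\
          ornstein_uhlenbeck (Phi j) (fun x => - lam j * Phi j x),
      forall x, V x = \sum_(j < n) Phi j x &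
      forall x, F x = \sum_(j < n) (1 + lam j) `^ s * Phi j x].

(* (1 - L)^(- a / 2) V = F in L^p, for 0 <= a.  The spectrum of L is discrete
   and the finite sums of its eigenvectors (Wiener chaos) are dense in L^p, where
   (1 - L)^(- a / 2) is a contraction: its graph is the closure in L^p x L^p of
   its graph on these sums. *)
Definition bessel_potential (R : realType) (W : abstractWienerSpace R)
    (a p : R) (V F : wspace W -> R) :=
  [/\ in_Lp p V, in_Lp p F &
    exists v f : nat -> wspace W -> R,
      [/\ forall n, power_eigensum (- (a / 2)) (v n) (f n),
        norm_Lp p (v n \- V) @[n --> \oo] --> 0%E &
        norm_Lp p (f n \- F) @[n --> \oo] --> 0%E]].

Definition sobolev (R : realType) (W : abstractWienerSpace R)
    (a p : R) (F : wspace W -> R) :=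
  exists V, bessel_potential a p V F.

(* V = (1 - L)^(a / 2) F is a.e. unique, so that the infimum is its L^p norm if
   F is in the space, and +oo otherwise. *)
Definition sobolev_norm (R : realType) (W : abstractWienerSpace R)
    (a p : R) (F : wspace W -> R) : \bar R :=
  ereal_inf [set norm_Lp p V | V in [set V | bessel_potential a p V F]].

Definition sobolev_infty (R : realType) (W : abstractWienerSpace R)
    (a : R) (F : wspace W -> R) :=
  forall p : R, 1 < p -> sobolev a p F.

Definition sobolev_minus_infty (R : realType) (W : abstractWienerSpace R)
    (a : R) (F : wspace W -> R) :=
  forall b : R, 0 < b < a -> sobolev_infty b F.

(* For k = 0, the first norm is that of D_0^p = L^p. *)
Definition K_functional (R : realType) (W : abstractWienerSpace R)
    (k : nat) (p eps : R) (F : wspace W -> R) : \bar R :=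
  ereal_inf [set (sobolev_norm k%:R p F12.1
                  + eps%:E * sobolev_norm k.+1%:R p F12.2)%E
            | F12 in [set F12 : (wspace W -> R) * (wspace W -> R) |
                ae_equal (fun x => F12.1 x + F12.2 x) F]].

Definition interpolation_norm (R : realType) (W : abstractWienerSpace R)
    (k : nat) (sigma p : R) (F : wspace W -> R) : \bar R :=
  ((\int[lebesgue_measure]_(eps in `]0%R, 1%R[)
     (((eps `^ (- sigma))%:E * K_functional k p eps F) `^ p * (eps^-1)%:E))
   `^ p^-1)%E.

(* Finiteness of the norm entails that F lies in the sum D_k^p + D_(k+1)^p. *)
Definition interpolation_space (R : realType) (W : abstractWienerSpace R)
    (k : nat) (sigma p : R) (F : wspace W -> R) :=
  measurable_fun setT F /\ (interpolation_norm k sigma p F < +oo)%E.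

(* E_a^p, for 0 < a. *)
Definition fractional_sobolev (R : realType) (W : abstractWienerSpace R)
    (a p : R) (F : wspace W -> R) :=
  let k := Num.truncn a in
  if a == k%:R then sobolev a p F else interpolation_space k (a - k%:R) p F.

Definition fractional_sobolev_infty (R : realType) (W : abstractWienerSpace R)
    (a : R) (F : wspace W -> R) :=
  forall p : R, 1 < p -> fractional_sobolev a p F.

(* (1 / F) * G, understood as 0 on A. *)
Definition quotient_off (R : realType) (W : abstractWienerSpace R)
    (A : set (wspace W)) (F G : wspace W -> R) : wspace W -> R :=
  (fun x => (F x)^-1 * G x) \_ (~` A).

(* Main.v *)
Require Import Defs.
From HB Require Import structures.
From mathcomp Require Import all_boot all_order all_algebra.
From mathcomp Require Import all_classical all_reals all_analysis.
From mathcomp Require Import measurable_realfun.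
From mathcomp Require Import ring lra zify.
Set Implicit Arguments.
Unset Strict Implicit.
Unset Printing Implicit Defensive.
Import Order.TTheory GRing.Theory Num.Theory.
Import numFieldNormedType.Exports.
Local Open Scope classical_set_scope.
Local Open Scope ring_scope.

(* On the square of the Wiener space let R_t be the rotation by the angle t, and
   view F as the functional F(x) of the first coordinate.  The rotations preserve
   the measure, and F o R_t = F(x cos t + y sin t) encodes the smoothness of F:
   for 0 < s < 1, membership in D_s, up to an arbitrarily small loss in s, is the
   L^p Hoelder continuity of t |-> F o R_t (subordination to the Ornstein-Uhlenbeck
   semigroup, whose Mehler formula averages F o R_t over y), while F lies in
   D_(s+1) exactly when t |-> F o R_t is differentiable at 0 in every L^p with
   derivative in D_s of the square space.  The latter is Meyer's inequality: the
   multiplier (1 + n)^(-1/2) is an average of the rotation group against a kernel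
   that differs from cot(t/2) by a bounded function, and the conjugate function is
   bounded in L^p, uniformly in the trigonometric polynomial, because the p-th
   power of an analytic polynomial has mean zero.

   As rotation is an algebra morphism, the derivative UF of F o R_t at 0 is a
   derivation, U(G/F) = UG/F - G UF/F^2, and all negative moments of F are finite.
   Induction on the integer part of alpha therefore reduces the claim to orders
   below 1, where it follows from the Hoelder characterisation, and for integer
   alpha to order 0, where it is Hoelder's inequality.  The induction step needs
   the difference quotients of G/F to converge in every L^p, which they inherit
   from those of F and G.  Functionals in the interpolation spaces satisfy the
   Hoelder bound after splitting them by the K-functional. *)

(** * Norms and moments on a probability space *)

(** Vector-valued Sobolev spaces are avoided: the gradient of [F] is carried by a scalar functional
    on the square space, so a derivative is again a functional on a Gaussian space and the induction
    can be repeated. This is why the statements quantify over an abstract [gspace], a class closed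
    under [gsq], and the Wiener space returns only at the end. Operators are never defined directly.
    A functional is known by its symbols, the pairings with Hermite functionals; an operator
    prescribes new symbols, and a bound of the resulting form by the L^q norm on finite combinations
    produces a functional in L^p. For p >= 2 all of this happens inside L^2, where a minimisation
    replaces the duality of L^p. Since only the intersection over all p matters, p >= 2 is enough,
    and for the conjugate function even p = 2^(m+1), where the p-th power of a complex number is an
    iterated square. The set A enters through the relations F I = 1 - a, a I = 0, N a = 0 alone, so
    that no division occurs once [I] is built. *)

Section Lp_norms.
Context {R : realType} {d : measure_display} {T : measurableType d}.
Variable P : probability T R.
Implicit Types (f g h : T -> R) (p q : R).

Definition memL p f := measurable_fun setT f /\ ('N[P]_p%:E[EFin \o f] < +oo)%E.
(** [fine] turns an infinite norm into 0, so a bound on [nrm] is informative only next to [memL];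
    hence the conjunctions in the lemmas below. *)
Definition nrm p f : R := fine 'N[P]_p%:E[EFin \o f]%E.
(** The space L^(infinity-) of functions with all moments finite, not the bounded functions. It is
    an algebra, unlike a single L^p. *)
Definition Linf f := forall p, 1 <= p -> memL p f.
Definition Ex f : R := \int[P]_x f x.

Lemma memL_meas p f : memL p f -> measurable_fun setT f. Proof. by case. Qed.
Lemma Linf_meas f : Linf f -> measurable_fun setT f.
Proof. by move/(_ 1 (lexx _))/memL_meas. Qed.

Lemma nrm_ge0 p f : 0 <= nrm p f.
Proof. by rewrite fine_ge0// Lnorm_ge0. Qed.

Lemma nrmE p f : memL p f -> 'N[P]_p%:E[EFin \o f]%E = (nrm p f)%:E.
Proof. by case=> _ h; rewrite /nrm fineK// ge0_fin_numE// Lnorm_ge0. Qed.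

Lemma memLP p f C : measurable_fun setT f ->
  ('N[P]_p%:E[EFin \o f] <= C%:E)%E -> memL p f /\ nrm p f <= C.
Proof.
move=> mf h; have m : memL p f by split=> //; rewrite (le_lt_trans h) ?ltry.
by split=> //; rewrite -lee_fin -nrmE.
Qed.

Lemma powR_nrm p f : p != 0 -> memL p f ->
  (\int[P]_x (`|f x| `^ p)%:E = (nrm p f `^ p)%:E)%E.
Proof.
move=> p0 mf; rewrite -poweR_EFin -nrmE// powR_Lnorm//.
Qed.

Lemma memL_integrableX p f : p != 0 -> memL p f ->
  P.-integrable setT (fun x => (`|f x| `^ p)%:E).
Proof.
move=> p0 mf; apply/integrableP; split.
  apply/measurable_EFinP; apply: (@measurableT_comp _ _ _ _ _ _ (@powR R ^~ p)).
    exact: measurable_powR.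
  by apply: measurableT_comp => //; exact: memL_meas mf.
under eq_integral do rewrite /= ger0_norm ?powR_ge0//.
by rewrite powR_nrm// ltry.
Qed.

Lemma memLX p f (C : R) : 0 < p -> measurable_fun setT f ->
  (\int[P]_x (`|f x| `^ p)%:E <= (C `^ p)%:E)%E -> 0 <= C ->
  memL p f /\ nrm p f <= C.
Proof.
move=> p0 mf h C0; apply: memLP => //.
have p1 : p != 0 by rewrite gt_eqF.
have eN : 'N[P]_p%:E[EFin \o f]%E = ('N[P]_p%:E[EFin \o f] `^ p `^ p^-1)%E.
  by rewrite -poweRrM divff// poweRe1// Lnorm_ge0.
have eC : C%:E = (C%:E `^ p `^ p^-1)%E by rewrite -poweRrM divff// poweRe1.
rewrite eN eC; apply: gt0_ler_poweR.
- by rewrite invr_ge0 ltW.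
- by rewrite in_itv/= poweR_ge0 leey.
- by rewrite poweR_EFin in_itv/= lee_fin powR_ge0 leey.
rewrite powR_Lnorm// poweR_EFin; exact: le_trans h.
Qed.

Lemma nrm_powR p f r : 0 < p -> 0 < r -> memL p f ->
  'N[P]_(p / r)%:E[EFin \o (fun x => (`|f x| `^ r)%R)]%E = (nrm p f `^ r)%:E.
Proof.
move=> p0 r0 mf.
have p1 : p != 0 by rewrite gt_eqF.
have r1 : r != 0 by rewrite gt_eqF.
rewrite unlock /Lnorm.
under eq_integral do rewrite /= ger0_norm ?powR_ge0// -powRrM mulrCA divff// mulr1.
by rewrite powR_nrm// poweR_EFin -powRrM invf_div mulrCA divff// mulr1.
Qed.

Lemma measurable_powRn f r : measurable_fun setT f ->
  measurable_fun setT (fun x => `|f x| `^ r).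
Proof.
move=> mf; apply: (@measurableT_comp _ _ _ _ _ _ (@powR R ^~ r)).
  exact: measurable_powR.
exact: measurableT_comp.
Qed.

(** Hoelder's inequality for [|f| ^ r] and [|g| ^ r] with the exponents [p / r] and [q / r]; [r] is
    allowed below 1. *)
Lemma nrmM p q r f g : 0 < p -> 0 < q -> 0 < r -> r^-1 = p^-1 + q^-1 ->
  memL p f -> memL q g ->
  memL r (fun x => f x * g x) /\ nrm r (fun x => f x * g x) <= nrm p f * nrm q g.
Proof.
move=> p0 q0 r0 e mf mg.
apply: memLX => //; last by rewrite mulr_ge0 ?nrm_ge0.
  by apply: measurable_funM; [exact: memL_meas mf|exact: memL_meas mg].
rewrite powRM ?nrm_ge0//.
have := @hoelder _ _ _ P (fun x => `|f x| `^ r) (fun x => `|g x| `^ r) (p / r) (q / r).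
rewrite !nrm_powR// Lnorm1 -EFinM => H; apply: le_trans (H _ _ _ _ _).
- apply: ge0_le_integral => //.
  + apply/measurable_EFinP/measurable_powRn/measurable_funM.
      exact: memL_meas mf.
    exact: memL_meas mg.
  + apply: measurableT_comp => //; apply/measurable_EFinP.
    by apply: measurable_funM; apply: measurable_powRn;
      [exact: memL_meas mf|exact: memL_meas mg].
  + by move=> x _ /=; rewrite normrM powRM// lee_fin ler_norm.
- exact/measurable_powRn/(memL_meas mf).
- exact/measurable_powRn/(memL_meas mg).
- exact: divr_gt0.
- exact: divr_gt0.
- by rewrite !invf_div -mulrDr -e divff// gt_eqF.
Qed.

Lemma probE : (\int[P]_x 1%:E = 1)%E.
Proof. by rewrite integral_cst//= mul1e; exact: probability_setT. Qed.

Lemma memL_bounded p f C : 0 < p -> measurable_fun setT f ->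
  (forall x, `|f x| <= C) -> memL p f /\ nrm p f <= C.
Proof.
move=> p0 mf h.
have C0 : 0 <= C by apply: le_trans (h point).
apply: memLX => //; rewrite -[leRHS]mule1 -probE -ge0_integralZl//; last first.
  by rewrite lee_fin powR_ge0.
apply: ge0_le_integral => //.
- by apply/measurable_EFinP; exact: measurable_powRn.
- by move=> x _; rewrite mule1 lee_fin ge0_ler_powR// ?nnegrE// ltW.
Qed.

Lemma memL_cst p c : 0 < p -> memL p (fun=> c).
Proof. by move=> p0; apply: (memL_bounded (C := `|c|) p0 _ _).1. Qed.

Lemma memL_le p q f : 0 < p -> p <= q -> memL q f ->
  memL p f /\ nrm p f <= nrm q f.
Proof.
move=> p0; rewrite le_eqVlt => /predU1P[<-//|pq] mf.
have q0 : 0 < q by exact: lt_trans pq.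
(* The comparison is Hoelder's inequality against the constant 1 in L^s, where 1/p = 1/q + 1/s. *)
pose s := (p^-1 - q^-1)^-1.
have s0 : 0 < s by rewrite invr_gt0 subr_gt0 ltf_pV2.
have [|m1 n1] := memL_bounded s0 (@measurable_cst _ _ T R setT 1) (C := 1).
  by move=> x; rewrite normr1.
have e : p^-1 = q^-1 + s^-1 by rewrite invrK addrC subrK.
have [] := nrmM q0 s0 p0 e mf m1.
under [X in memL p X]eq_fun do rewrite mulr1.
under [X in nrm p X <= _]eq_fun do rewrite mulr1.
by move=> ? h; split=> //; apply: (le_trans h); rewrite ler_piMr ?nrm_ge0.
Qed.

Lemma nrmD p f g : 1 <= p -> memL p f -> memL p g ->
  memL p (fun x => f x + g x) /\ nrm p (fun x => f x + g x) <= nrm p f + nrm p g.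
Proof.
move=> p1 mf mg; apply: memLP.
  by apply: measurable_funD; [exact: memL_meas mf|exact: memL_meas mg].
rewrite EFinD -!nrmE//; apply: minkowski_EFin => //.
  exact: memL_meas mf.
exact: memL_meas mg.
Qed.

Lemma nrm_ext p f g : (forall x, `|f x| = `|g x|) -> nrm p f = nrm p g.
Proof.
move=> h; rewrite /nrm unlock /Lnorm; apply: (congr1 (fun z => fine (z `^ _)%E)).
by apply: eq_integral => x _ /=; rewrite h.
Qed.

Lemma memL_ext p f g : measurable_fun setT g -> (forall x, `|f x| = `|g x|) ->
  memL p f -> memL p g.
Proof.
move=> mg h [_ m]; split=> //; move: m; rewrite unlock /Lnorm.
by under eq_integral do rewrite /= h.
Qed.

Lemma memL_mono p f g : 0 < p -> measurable_fun setT f -> memL p g ->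
  (forall x, `|f x| <= `|g x|) -> memL p f /\ nrm p f <= nrm p g.
Proof.
move=> p0 mf mg h; apply: memLX => //; last exact: nrm_ge0.
rewrite -powR_nrm ?gt_eqF//; apply: ge0_le_integral => //.
- by apply/measurable_EFinP; exact: measurable_powRn.
- apply/measurable_EFinP; apply: measurable_powRn; exact: memL_meas mg.
- by move=> x _; rewrite lee_fin ge0_ler_powR// ?nnegrE// ltW.
Qed.

Lemma nrmZ p f c : 0 < p -> memL p f ->
  memL p (fun x => c * f x) /\ nrm p (fun x => c * f x) = `|c| * nrm p f.
Proof.
move=> p0 mf.
have ub c' f' : memL p f' -> memL p (fun x => c' * f' x) /\
    nrm p (fun x => c' * f' x) <= `|c'| * nrm p f'.
  move=> mf'; apply: memLX => //; last by rewrite mulr_ge0 ?nrm_ge0.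
    by apply: measurable_funM => //; exact: memL_meas mf'.
  under eq_integral do rewrite normrM powRM// EFinM.
  rewrite ge0_integralZl//; last first.
    by apply/measurable_EFinP; apply: measurable_powRn; exact: memL_meas mf'.
  by rewrite powR_nrm ?gt_eqF// powRM ?nrm_ge0// EFinM.
have [m h] := ub c f mf; split=> //; apply/eqP; rewrite eq_le h/=.
have [->|c0] := eqVneq c 0; first by rewrite normr0 mul0r nrm_ge0.
(* The reverse inequality is the upper bound for [c^-1] applied to [c * f]. *)
have [_] := ub c^-1 _ m.
rewrite (@nrm_ext p (fun x => c^-1 * (c * f x)) f); last first.
  by move=> x; rewrite mulrA mulVf// mul1r.
by rewrite normfV ler_pdivlMl ?normr_gt0.
Qed.

Lemma nrmN p f : nrm p (fun x => - f x) = nrm p f.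
Proof. by apply: nrm_ext => x; rewrite normrN. Qed.

Lemma memLN p f : memL p f -> memL p (fun x => - f x).
Proof.
move=> mf; apply: memL_ext (mf) => [|x]; last by rewrite normrN.
by apply: measurableT_comp => //; exact: memL_meas mf.
Qed.

Lemma nrmB p f g : 1 <= p -> memL p f -> memL p g ->
  memL p (fun x => f x - g x) /\ nrm p (fun x => f x - g x) <= nrm p f + nrm p g.
Proof. by move=> p1 mf mg; have := nrmD p1 mf (memLN mg); rewrite nrmN. Qed.

Lemma ae_nrm p f g : {ae P, forall x, f x = g x} -> memL p f ->
  measurable_fun setT g -> memL p g /\ nrm p g = nrm p f.
Proof.
move=> h mf mg.
have e : 'N[P]_p%:E[EFin \o g]%E = 'N[P]_p%:E[EFin \o f]%E.
  have [->|p0] := eqVneq p 0.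
    by rewrite unlock /Lnorm; under eq_integral do rewrite poweRe0; under [in RHS]eq_integral do rewrite poweRe0.
  rewrite unlock /Lnorm; apply: (congr1 (fun z => z `^ _)%E).
  apply: ae_eq_integral => //=.
  - by apply/measurable_EFinP; exact: measurable_powRn.
  - by apply/measurable_EFinP; apply: measurable_powRn; exact: memL_meas mf.
  - by apply: filterS h => x -> _.
by split; [split=> //; rewrite e; case: mf|rewrite /nrm e].
Qed.

Lemma nrm_eq0 p f : 0 < p -> memL p f -> nrm p f = 0 ->
  {ae P, forall x, f x = 0}.
Proof.
move=> p0 mf h.
have := @Lnorm_eq0_eq0 _ _ _ P (EFin \o f) p%:E _ _ _.
rewrite lte_fin nrmE// h => /(_ _ p0 erefl) H.
have {}H := H ltac:(by apply/measurable_EFinP; exact: memL_meas mf).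
by apply: filterS H => x /(_ I) /= [].
Qed.

Lemma memL1_int f : memL 1 f -> P.-integrable setT (EFin \o f).
Proof.
move=> mf; apply/integrableP; split; first exact/measurable_EFinP/(memL_meas mf).
by rewrite -Lnorm1; case: mf.
Qed.

Lemma Ex_le_nrm p f : 1 <= p -> memL p f -> `|Ex f| <= nrm p f.
Proof.
move=> p1 mf; have [m1 n1] := memL_le ltr01 p1 mf.
apply: le_trans n1; rewrite -lee_fin -nrmE// Lnorm1 /Ex.
rewrite EFin_normr_Rintegral//; last exact: memL1_int.
by apply: le_abse_integral => //; apply/measurable_EFinP; exact: memL_meas mf.
Qed.

Lemma hoelderE p q f g : 0 < p -> 0 < q -> p^-1 + q^-1 = 1 ->
  memL p f -> memL q g ->
  memL 1 (fun x => f x * g x) /\ `|Ex (fun x => f x * g x)| <= nrm p f * nrm q g.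
Proof.
move=> p0 q0 e mf mg; have [|m h] := nrmM p0 q0 ltr01 _ mf mg.
  by rewrite invr1.
by split=> //; apply: (le_trans (Ex_le_nrm (lexx _) m)).
Qed.

Lemma ExD f g : memL 1 f -> memL 1 g -> Ex (fun x => f x + g x) = Ex f + Ex g.
Proof. by move=> mf mg; rewrite /Ex RintegralD//; apply: memL1_int. Qed.

Lemma ExB f g : memL 1 f -> memL 1 g -> Ex (fun x => f x - g x) = Ex f - Ex g.
Proof. by move=> mf mg; rewrite /Ex RintegralB//; apply: memL1_int. Qed.

Lemma ExZ c f : memL 1 f -> Ex (fun x => c * f x) = c * Ex f.
Proof. by move=> mf; rewrite /Ex RintegralZl//; apply: memL1_int. Qed.

Lemma Ex_cst c : Ex (fun=> c) = c.
Proof. rewrite /Ex Rintegral_cst//; have /(congr1 fine)/= := probability_setT P.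
by move=> h; rewrite [X in _ * X]h mulr1. Qed.

Lemma le_Ex f g : memL 1 f -> memL 1 g -> (forall x, f x <= g x) -> Ex f <= Ex g.
Proof.
by move=> mf mg h; apply: le_Rintegral => //; first exact: memL1_int; exact: memL1_int.
Qed.

Lemma Ex_ge0 f : (forall x, 0 <= f x) -> 0 <= Ex f.
Proof. by move=> h; apply: Rintegral_ge0. Qed.

Lemma eq_Ex f g : (forall x, f x = g x) -> Ex f = Ex g.
Proof. by move=> h; congr Ex; exact/funext. Qed.

Lemma ae_Ex f g : {ae P, forall x, f x = g x} ->
  measurable_fun setT f -> measurable_fun setT g -> Ex f = Ex g.
Proof.
move=> h mf mg; rewrite /Ex /Rintegral; congr fine.
apply: ae_eq_integral => //; [exact/measurable_EFinP|exact/measurable_EFinP|].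
by apply: filterS h => x -> _.
Qed.

Lemma nrm_powRE p f : 0 < p -> memL p f -> nrm p f `^ p = Ex (fun x => `|f x| `^ p).
Proof. by move=> p0 mf; rewrite /Ex /Rintegral powR_nrm// gt_eqF. Qed.

Lemma nrm2E f : memL 2 f -> nrm 2 f ^+ 2 = Ex (fun x => f x ^+ 2).
Proof.
move=> mf; rewrite -powR_mulrn ?nrm_ge0// nrm_powRE//; apply: eq_Ex => x.
by rewrite powR_mulrn// real_normK// num_real.
Qed.
End Lp_norms.

(** The discriminant argument of Cauchy-Schwarz. For [b = 0] the polynomial is affine, and a slope
    [a != 0] would let it take the value -1. *)
Lemma discr_le (R : realFieldType) (a b e : R) : 0 <= b ->
  (forall t, 0 <= t ^+ 2 * b + 2 * t * a + e) -> a ^+ 2 <= e * b.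
Proof.
move=> b0 h; have e0 : 0 <= e by have := h 0; rewrite expr0n/= mul0r mulr0 mul0r !add0r.
have [bz|bnz] := eqVneq b 0.
  rewrite bz mulr0; have [->|anz] := eqVneq a 0; first by rewrite expr0n.
  have := h (- (e + 1) / (2 * a)); rewrite bz mulr0 add0r.
  have -> : 2 * (- (e + 1) / (2 * a)) * a + e = -1 by field.
  by rewrite oppr_ge0 ler10.
have b1 : 0 < b by rewrite lt_def bnz.
have := h (- a / b).
have -> : (- a / b) ^+ 2 * b + 2 * (- a / b) * a + e = e - a ^+ 2 / b by field.
by rewrite subr_ge0 ler_pdivrMr.
Qed.

(* Minimising [B u u - 2 * l u]; only an affine structure is needed, so that the
   lemma applies to formal linear combinations. *)
Lemma riesz_seq (R : realType) (V : Type) (v0 : V) (cmb : V -> R -> V -> V)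
    (B : V -> V -> R) (l : V -> R) (C : R) :
  0 <= C -> (forall u v, B u v = B v u) -> (forall u, 0 <= B u u) ->
  (forall u a v w, B (cmb u a v) w = B u w + a * B v w) ->
  (forall u a v, l (cmb u a v) = l u + a * l v) ->
  (forall u, l u ^+ 2 <= C * B u u) ->
  exists v : nat -> V, forall n w, (B (v n) w - l w) ^+ 2 <= 4^-1 ^+ n * B w w.
Proof.
move=> C0 Bs B0 Bl ll lC.
pose J u := B u u - 2 * l u.
have JC u : - C <= J u.
  rewrite /J; have := lC u; have := B0 u; move: (B u u) (l u) => b a b0 h.
  have := sqr_ge0 (b - C); have [|/ltW] := lerP (2 * a) (b + C); first by lra.
  by nra.
have Jinf : has_inf (range J).
  split; first by exists (J v0), v0.
  by exists (- C) => _ [u _ <-].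
have /choice[v vP] : forall n : nat, exists v, J v <= inf (range J) + 4^-1 ^+ n.
  move=> n; have e0 : 0 < 4^-1 ^+ n :> R by rewrite exprn_gt0.
  have [_ [v _ <-] /ltW h] := inf_adherent e0 Jinf.
  by exists v.
(* Comparing the almost minimal [v n] with [cmb (v n) t w] gives 0 <= t^2 B(w,w) + 2 t (B(v n,w) - l
   w) + 4^(-n) for every t. *)
exists v => n w; apply: discr_le => // t.
have : inf (range J) <= J (cmb (v n) t w).
  by apply: ge_inf; [case: Jinf|exists (cmb (v n) t w)].
have := vP n; rewrite /J ll !Bl (Bs (v n)) (Bs w) !Bl (Bs w (v n)).
by move: (B (v n) w) (l w) => ? ?; nra.
Qed.

Section Linf_algebra.
Context {R : realType} {d : measure_display} {T : measurableType d}.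
Variable P : probability T R.
Implicit Types (f g h : T -> R) (p q : R).
Let lt01 p : 1 <= p -> 0 < p :> R. Proof. exact: lt_le_trans. Qed.

Lemma Linf_cst c : Linf P (fun=> c).
Proof. by move=> p /lt01 p0; apply: memL_cst. Qed.

Lemma Linf_bounded f C : measurable_fun setT f -> (forall x, `|f x| <= C) -> Linf P f.
Proof. by move=> mf h p /lt01 p0; apply: (memL_bounded P p0 mf h).1. Qed.

Lemma LinfD f g : Linf P f -> Linf P g -> Linf P (fun x => f x + g x).
Proof. by move=> mf mg p p1; apply: (nrmD p1 (mf p p1) (mg p p1)).1. Qed.

Lemma LinfZ c f : Linf P f -> Linf P (fun x => c * f x).
Proof. by move=> mf p p1; apply: (nrmZ _ (lt01 p1) (mf p p1)).1. Qed.

Lemma LinfN f : Linf P f -> Linf P (fun x => - f x).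
Proof. by move=> mf p p1; apply: memLN (mf p p1). Qed.

Lemma LinfB f g : Linf P f -> Linf P g -> Linf P (fun x => f x - g x).
Proof. by move=> mf mg; apply: LinfD => //; exact: LinfN. Qed.

Lemma nrmM2 p f g : 1 <= p -> memL P (2 * p) f -> memL P (2 * p) g ->
  memL P p (fun x => f x * g x) /\
  nrm P p (fun x => f x * g x) <= nrm P (2 * p) f * nrm P (2 * p) g.
Proof.
move=> /lt01 p0 mf mg.
apply: nrmM => //; rewrite ?mulr_gt0//.
by field; rewrite gt_eqF.
Qed.

Lemma LinfM f g : Linf P f -> Linf P g -> Linf P (fun x => f x * g x).
Proof.
move=> mf mg p p1; have h : 1 <= 2 * p by nra.
exact: (nrmM2 p1 (mf _ h) (mg _ h)).1.
Qed.

Lemma LinfX f n : Linf P f -> Linf P (fun x => f x ^+ n).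
Proof.
move=> mf; elim: n => [|n IH]; first by under eq_fun do rewrite expr0; exact: Linf_cst.
by under eq_fun do rewrite exprS; exact: LinfM.
Qed.

Lemma Linf_sum (J : Type) (s : seq J) (F : J -> T -> R) :
  (forall i, Linf P (F i)) -> Linf P (fun x => \sum_(i <- s) F i x).
Proof.
move=> h; elim: s => [|i s IH].
  by under eq_fun do rewrite big_nil; exact: Linf_cst.
by under eq_fun do rewrite big_cons; exact: LinfD.
Qed.

Lemma Linf1 f : Linf P f -> memL P 1 f. Proof. by apply; rewrite lexx. Qed.
Lemma Linf2 f : Linf P f -> memL P 2 f. Proof. by apply; rewrite ler1n. Qed.

Lemma Ex_sum (J : Type) (s : seq J) (F : J -> T -> R) :
  (forall i, memL P 1 (F i)) ->
  memL P 1 (fun x => \sum_(i <- s) F i x) /\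
  Ex P (fun x => \sum_(i <- s) F i x) = \sum_(i <- s) Ex P (F i).
Proof.
move=> h; elim: s => [|i s [m IH]].
  under [X in memL P 1 X]eq_fun do rewrite big_nil.
  under [X in Ex P X]eq_fun do rewrite big_nil.
  by rewrite big_nil Ex_cst; split => //; exact: memL_cst.
under [X in memL P 1 X]eq_fun do rewrite big_cons.
under [X in Ex P X]eq_fun do rewrite big_cons.
by rewrite big_cons ExD// IH; split=> //; exact: (nrmD _ _ _).1.
Qed.

Lemma memLM22 f g : memL P 2 f -> memL P 2 g ->
  memL P 1 (fun x => f x * g x) /\
  `|Ex P (fun x => f x * g x)| <= nrm P 2 f * nrm P 2 g.
Proof. by move=> mf mg; apply: hoelderE => //; lra. Qed.
End Linf_algebra.

Lemma measurable_limn_einf {R : realType} {d} {T : measurableType d}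
    (f : nat -> T -> \bar R) : (forall n, measurable_fun setT (f n)) ->
  measurable_fun setT (fun x => limn_einf (f ^~ x)).
Proof.
move=> mf; rewrite (_ : (fun x => _) =
    (fun x => - limn_esup (fun n => - f n x))%E); last first.
  apply/funext => x; rewrite -[RHS]limn_einfN; congr limn_einf.
  by apply/funext => n /=; rewrite oppeK.
apply: measurableT_comp => //; apply: measurable_fun_limn_esup => n.
exact: measurableT_comp.
Qed.

Section complete.
Context {R : realType} {d : measure_display} {T : measurableType d}.
Variable P : probability T R.

(** Riesz-Fischer: the increments are summable in L^1, so the sequence converges almost everywhere,
    and Fatou's lemma turns the Cauchy rate into a rate of convergence. *)
Lemma L2_complete (f : nat -> T -> R) : (forall n, memL P 2 (f n)) ->
  (forall n m, nrm P 2 (fun x => f n x - f m x) <= 2^-1 ^+ n + 2^-1 ^+ m) ->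
  exists2 g, memL P 2 g &
    forall n, nrm P 2 (fun x => f n x - g x) <= 2 * 2^-1 ^+ n.
Proof.
move=> mf hf.
have mfn n : measurable_fun setT (f n) by exact: memL_meas (mf n).
have mB n m : memL P 2 (fun x => f n x - f m x).
  by apply: (nrmB _ (mf n) (mf m)).1; rewrite ler1n.
pose D k x : \bar R := (`|f k.+1 x - f k x|)%:E.
have mD k : measurable_fun setT (D k).
  by apply/measurable_EFinP; apply: measurableT_comp => //; exact: measurable_funB.
have D0 k x : (0 <= D k x)%E by rewrite lee_fin.
have fG : {ae P, forall x, (\sum_(0 <= k <oo) D k x < +oo)%E}.
  have : (\int[P]_x (\sum_(0 <= k <oo) D k x) < +oo)%E.
    rewrite integral_nneseries//.
    apply: (@le_lt_trans _ _ (\sum_(0 <= k <oo) (2 * (1 / 2 ^+ k))%:E)%E).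
      apply: lee_nneseries => [k _ _|k _]; first exact: integral_ge0.
      have m1 : memL P 1 (fun x => f k.+1 x - f k x).
        by apply: (memL_le _ _ (mB k.+1 k)).1 => //; rewrite ler1n.
      have := nrmE m1; rewrite Lnorm1 /D => ->; rewrite lee_fin.
      apply: (le_trans (memL_le _ _ (mB k.+1 k)).2) => //; first by rewrite ler1n.
      apply: (le_trans (hf _ _)); rewrite -exprVn exprS.
      have : 0 <= 2^-1 ^+ k :> R by rewrite exprn_ge0.
      by lra.
    have -> : (\sum_(0 <= k <oo) (2 * (1 / 2 ^+ k))%:E = 4%:E :> \bar R)%E.
      apply/cvg_lim => //.
      have -> : (fun n => (\sum_(0 <= k < n) (2 * (1 / 2 ^+ k))%:E)%E) =
          (EFin \o (fun n => 4 - 4 * (2^-1 : R) ^+ n)).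
        apply/funext; elim=> [|n IH]; first by rewrite big_geq//= expr0 mulr1 subrr.
        rewrite big_nat_recr//= IH -EFinD; congr EFin.
        by rewrite exprS -exprVn; field.
      apply/cvg_EFin; first by near=> n.
      rewrite -[X in _ --> X]subr0; apply: cvgB; first exact: cvg_cst.
      rewrite -[X in _ --> X](mulr0 4); apply: cvgMr; apply: cvg_expr.
      by rewrite ger0_norm ?invr_ge0// invf_lt1 ?ltr1n.
    exact: ltry.
  move=> h.
  have iG : P.-integrable setT (fun x => (\sum_(0 <= k <oo) D k x)%E).
    apply/integrableP; split; first exact: ge0_emeasurable_sum.
    by under eq_integral do rewrite gee0_abs ?nneseries_ge0//.
  have := integrable_ae measurableT iG.
  by apply: filterS => x /(_ I); rewrite ge0_fin_numE// nneseries_ge0.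
(* A [limn_esup] is measurable on the whole space, and it is the limit wherever the series of
   increments converges. *)
pose g x := fine (limn_esup (fun n => (f n x)%:E)).
have mg : measurable_fun setT g.
  apply: measurableT_comp => //; apply: measurable_fun_limn_esup => n.
  exact/measurable_EFinP.
have cg : {ae P, forall x, f n x @[n --> \oo] --> g x}.
  apply: filterS fG => x hx.
  have cf : cvgn (f ^~ x).
    have -> : f ^~ x = (fun n => f 0%N x + series (fun k => f k.+1 x - f k x) n).
      by apply/funext => n; rewrite /series/= telescope_sumr// addrC subrK.
    apply: is_cvgD; first exact: is_cvg_cst.
    apply: normed_cvg; apply: nondecreasing_is_cvgn.
      by apply: nondecreasing_series => n _ _ /=.
    exists (fine (\sum_(0 <= k <oo) D k x)%E) => _ [n _ <-].
    rewrite -lee_fin fineK; last by rewrite ge0_fin_numE// nneseries_ge0.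
    rewrite /series/= -sumEFin; exact: nneseries_lim_ge.
  have cE : (f n x)%:E @[n --> \oo] --> (limn (f ^~ x))%:E.
    by apply/cvg_EFin; [near=> n|].
  by rewrite /g (cvg_limn_einf_sup cE).2.
have main n : memL P 2 (fun x => f n x - g x) /\
    nrm P 2 (fun x => f n x - g x) <= 2 * 2^-1 ^+ n.
  have h0 : 0 <= 2 * 2^-1 ^+ n :> R by rewrite mulr_ge0 ?exprn_ge0.
  apply: memLX => //; first exact: measurable_funB.
  rewrite (_ : (\int[P]_x _)%E =
      (\int[P]_x limn_einf (fun m => (`|f n x - f m x| `^ 2)%:E))%E); last first.
    apply: ae_eq_integral => //.
    - by apply/measurable_EFinP; apply: measurable_powRn; exact: measurable_funB.
    - apply: measurable_limn_einf => m.
      by apply/measurable_EFinP; apply: measurable_powRn; exact: measurable_funB.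
    - apply: filterS cg => x cx _; apply/esym.
      apply: (cvg_limn_einf_sup _).1; apply/cvg_EFin; first by near=> m.
      under eq_fun do rewrite powR_mulrn//; rewrite powR_mulrn//.
      under eq_fun do rewrite expr2; rewrite expr2.
      by apply: cvgM; apply: cvg_norm; apply: cvgB => //; exact: cvg_cst.
  apply: le_trans (fatou _ _ _ _) _ => //.
  - by move=> m; apply/measurable_EFinP; apply: measurable_powRn; exact: measurable_funB.
  - rewrite limn_einf_lim; apply: lime_le; first exact: is_cvg_einfs.
    near=> m; apply: (@le_trans _ _ (\int[P]_x (`|f n x - f m x| `^ 2)%:E)%E).
      by apply: ereal_inf_lbound; exists m => //=.
    rewrite powR_nrm// lee_fin ge0_ler_powR ?nnegrE ?nrm_ge0//.
    apply: (le_trans (hf _ _)); have : 2^-1 ^+ m <= 2^-1 ^+ n :> R.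
      rewrite ler_wiXn2l ?invr_ge0// ?invf_le1 ?ler1n//.
      by near: m; exact: nbhs_infty_ge.
    by lra.
exists g; last by move=> n; case: (main n).
have h := (nrmB (ler1n _ 2) (mf 0%N) (main 0%N).1).1; apply: memL_ext h => //.
by move=> x; rewrite opprB addrC subrK.
Unshelve. all: by end_near.
Qed.
End complete.

Lemma conjugate_le2 (R : realFieldType) (p q : R) :
  2 <= p -> 0 < q -> p^-1 + q^-1 = 1 -> 1 <= q <= 2.
Proof.
move=> p2 q0 pq; have p0 : 0 < p by lra.
have h1 : 0 < p^-1 by rewrite invr_gt0.
have h2 : p^-1 <= 2^-1 by rewrite lef_pV2 ?posrE.
have [h3 h4] : q^-1 <= 1 /\ 2^-1 <= q^-1 by split; lra.
have q1 : 0 < q^-1 by rewrite invr_gt0.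
by apply/andP; split; rewrite -lef_pV2 ?posrE// invr1.
Qed.

(** * Duality and representation on a dense span *)

Section representation.
Context {R : realType} {d : measure_display} {T : measurableType d}.
Variable P : probability T R.
Variables (I : Type) (e : I -> T -> R).
Hypothesis eL : forall i, Linf P (e i).
Implicit Types (phi : seq (R * I)) (F : T -> R) (p q : R).

(** Combinations are kept as formal lists so that [fval l] makes sense for any symbol [l],
    compatible or not with the linear relations between the [e i]. Compatibility is a consequence of
    the norm bound in [representation]. *)
Definition fev phi : T -> R := fun x => \sum_(c <- phi) c.1 * e c.2 x.
Definition fval (l : I -> R) phi : R := \sum_(c <- phi) c.1 * l c.2.
Definition fcomb phi (a : R) psi := phi ++ [seq (a * c.1, c.2) | c <- psi].

Lemma fev_comb phi a psi x : fev (fcomb phi a psi) x = fev phi x + a * fev psi x.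
Proof.
rewrite /fev big_cat big_map/= mulr_sumr; congr (_ + _).
by apply: eq_bigr => c _; rewrite mulrA.
Qed.

Lemma fval_comb l phi a psi : fval l (fcomb phi a psi) = fval l phi + a * fval l psi.
Proof.
rewrite /fval big_cat big_map/= mulr_sumr; congr (_ + _).
by apply: eq_bigr => c _; rewrite mulrA.
Qed.

Lemma Linf_fev phi : Linf P (fev phi).
Proof. by apply: Linf_sum => c; exact: LinfZ. Qed.

Lemma Ex_fev F phi : memL P 2 F ->
  Ex P (fun x => F x * fev phi x) = fval (fun i => Ex P (fun x => F x * e i x)) phi.
Proof.
move=> mF; have m1 i : memL P 1 (fun x => F x * e i x).
  by apply: (memLM22 mF _).1; exact: Linf2.
rewrite /fval; under eq_bigr do rewrite -ExZ//.
rewrite -(Ex_sum _ _).2; last by move=> c; apply: (nrmZ _ _ (m1 _)).1.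
by apply: eq_Ex => x; rewrite mulr_sumr; apply: eq_bigr => c _; rewrite mulrCA.
Qed.

Hypothesis dens : forall F (eps : R), memL P 2 F -> 0 < eps ->
  exists phi, nrm P 2 (fun x => F x - fev phi x) <= eps.

(** The difference is orthogonal to a dense span, hence to itself up to an arbitrarily small
    error. *)
Lemma sym_inj F G : memL P 2 F -> memL P 2 G ->
  (forall i, Ex P (fun x => F x * e i x) = Ex P (fun x => G x * e i x)) ->
  {ae P, forall x, F x = G x}.
Proof.
move=> mF mG h; pose H x := F x - G x.
have mH : memL P 2 H by apply: (nrmB _ mF mG).1; rewrite ler1n.
have H0 phi : Ex P (fun x => H x * fev phi x) = 0.
  rewrite Ex_fev// /fval big1// => c _.
  under [X in _ * X]eq_Ex do rewrite mulrBl.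
  by rewrite ExB ?h ?subrr ?mulr0//; apply: (memLM22 _ (Linf2 (eL _))).1.
have : nrm P 2 H = 0.
  apply/eqP; rewrite eq_le nrm_ge0 andbT; apply/ler_addgt0Pr => eps e0.
  rewrite add0r; have [phi hphi] := dens mH e0.
  have [->|nz] := eqVneq (nrm P 2 H) 0; first exact: ltW.
  have n0 : 0 < nrm P 2 H by rewrite lt_def nz nrm_ge0.
  rewrite -(ler_pM2l n0) -expr2 nrm2E//.
  have mB : memL P 2 (fun x => H x - fev phi x).
    by apply: (nrmB _ mH _).1; [rewrite ler1n|exact/Linf2/Linf_fev].
  have -> : Ex P (fun x => H x ^+ 2) = Ex P (fun x => H x * (H x - fev phi x)).
    under [RHS]eq_Ex do rewrite mulrBr.
    rewrite ExB ?H0 ?subr0//; first exact: (memLM22 mH mH).1.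
    exact: (memLM22 mH (Linf2 (Linf_fev _))).1.
  apply: le_trans (ler_norm _) _; apply: le_trans (memLM22 mH mB).2 _.
  by rewrite ler_wpM2l// nrm_ge0.
move/(nrm_eq0 _ mH) => /(_ _) H1; have {H1} := H1 ltac:(by []).
by apply: filterS => x /eqP; rewrite subr_eq0 => /eqP.
Qed.

(* The test functions [sgn F |F|^(p-1)] cut off at [|F| <= M] are bounded, hence
   L^2-limits of the [fev phi]. *)
Lemma dual_nrm F p q (C : R) : 2 <= p -> 0 < q -> p^-1 + q^-1 = 1 -> memL P 2 F -> 0 <= C ->
  (forall phi, `|Ex P (fun x => F x * fev phi x)| <= C * nrm P q (fev phi)) ->
  memL P p F /\ nrm P p F <= C.
Proof.
move=> p2 q0 pq mF C0 hC.
have p0 : 0 < p by lra.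
have mf := memL_meas mF.
have /andP[q1 q2] := conjugate_le2 p2 q0 pq.
(* As q <= 2, an L^2 approximation of the bounded [h] by combinations controls both sides of the
   assumed bound. *)
have hb (h : T -> R) (B : R) : measurable_fun setT h -> (forall x, `|h x| <= B) ->
    `|Ex P (fun x => F x * h x)| <= C * nrm P q h.
  move=> mh hB; apply/ler_addgt0Pr => eps e0.
  have mh2 : memL P 2 h by apply: Linf2; exact: Linf_bounded hB.
  have mhq : memL P q h by apply: (Linf_bounded P mh hB).
  pose D := nrm P 2 F + C + 1.
  have D0 : 0 < D by rewrite ltr_wpDl// addr_ge0// nrm_ge0.
  have [phi hphi] := dens mh2 (divr_gt0 e0 D0).
  have Lphi : memL P 2 (fev phi) by exact/Linf2/Linf_fev.
  have mB : memL P 2 (fun x => h x - fev phi x) by apply: (nrmB _ mh2 Lphi).1; rewrite ler1n.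
  have -> : Ex P (fun x => F x * h x) =
     Ex P (fun x => F x * fev phi x) + Ex P (fun x => F x * (h x - fev phi x)).
    rewrite -ExD; [|exact: (memLM22 mF Lphi).1|exact: (memLM22 mF mB).1].
    by apply: eq_Ex => x; ring.
  apply: (le_trans (ler_normD _ _)).
  have h1 := (memLM22 mF mB).2.
  have h2 : nrm P q (fev phi) <= nrm P q h + nrm P 2 (fun x => h x - fev phi x).
    have mBq := memL_le q0 q2 mB.
    have -> : nrm P q (fev phi) = nrm P q (fun x => h x - (h x - fev phi x)).
      by apply: nrm_ext => x; rewrite opprB addrC subrK.
    by apply: (le_trans (nrmB q1 mhq mBq.1).2); rewrite lerD2l mBq.2.
  have h3 : C * nrm P q (fev phi) <= C * (nrm P q h + eps / D).
    by rewrite ler_wpM2l// (le_trans h2)// lerD2l.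
  have h4 : nrm P 2 F * nrm P 2 (fun x => h x - fev phi x) <= nrm P 2 F * (eps / D).
    by rewrite ler_wpM2l// nrm_ge0.
  have h5 : (nrm P 2 F + C) * (eps / D) <= eps.
    rewrite mulrA ler_pdivrMr// mulrC ler_wpM2l//; first exact: ltW.
    by rewrite lerDl.
  have := hC phi; lra.
pose E (M : R) := (fun x => `|F x|) @^-1` `]-oo, M].
have mE M : measurable (E M).
  by rewrite -[E M]setTI; apply: (measurableT_comp _ mf).
pose B (M : R) x : R := \1_(E M) x.
have BE M x : B M x = (`|F x| <= M)%R%:R.
  rewrite /B indicE; congr (nat_of_bool _)%:R.
  by apply/idP/idP; rewrite inE /E/= in_itv.
have mb M : measurable_fun setT (B M) by exact: measurable_indic.
pose h M x := F x * `|F x| `^ (p - 2) * B M x.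
have mh M : measurable_fun setT (h M).
  by apply: measurable_funM => //; apply: measurable_funM => //; exact: measurable_powRn.
have powE x : `|F x| * `|F x| `^ (p - 2) = `|F x| `^ (p - 1).
  by rewrite -(@mulr_powRB1 _ _ (p - 1))//; [congr (_ * _ `^ _); ring|lra].
pose a M := Ex P (fun x => `|F x| `^ p * B M x).
have hM M : 0 <= M -> forall x, `|h M x| <= M `^ (p - 1).
  move=> M0 x; rewrite /h BE !normrM (ger0_norm (powR_ge0 _ _)) powE.
  have [hx|hx] := leP `|F x| M; last by rewrite normr0 mulr0 powR_ge0.
  by rewrite normr1 mulr1 ge0_ler_powR ?nnegrE//; lra.
have ha M : 0 <= M -> Ex P (fun x => F x * h M x) = a M.
  move=> M0; apply: eq_Ex => x; rewrite /h !mulrA; congr (_ * _).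
  rewrite -expr2 -real_normK ?num_real// expr2 -mulrA powE mulr_powRB1//.
have hq M : 0 <= M -> nrm P q (h M) `^ q = a M.
  move=> M0; rewrite nrm_powRE//; last exact: (Linf_bounded P (mh M) (hM M M0)).
  apply: eq_Ex => x; rewrite /h BE !normrM (ger0_norm (powR_ge0 _ _)) powE.
  case: (_ <= M); last by rewrite normr0 !mulr0 powR0// gt_eqF.
  rewrite normr1 !mulr1 -powRrM; congr (_ `^ _).
  have : q^-1 = 1 - p^-1 by lra.
  move=> /(congr1 GRing.inv); rewrite invrK => ->; field; rewrite ?gt_eqF//; lra.
have aC M : 0 <= M -> a M <= C `^ p.
  move=> M0; have a0 : 0 <= a M by apply: Ex_ge0 => x; rewrite mulr_ge0 ?powR_ge0// BE ler0n.
  (* The test function satisfies E(F h) = |h|_q^q = [a M], whence [a M] <= C ([a M])^(1/q). The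
     truncation makes [a M] finite and permits the division. *)
  have := hb _ _ (mh M) (hM M M0); rewrite ha// ger0_norm// => h1.
  have [->|anz] := eqVneq (a M) 0; first exact: powR_ge0.
  have apos : 0 < a M by rewrite lt_def anz.
  have e1 : nrm P q (h M) = a M `^ q^-1.
    by rewrite -(hq M M0) -powRrM divff ?gt_eqF// powRr1// nrm_ge0.
  have e2 : a M `^ p^-1 <= C.
    have : a M = a M `^ p^-1 * a M `^ q^-1.
      by rewrite -powRD ?pq ?oner_eq0// powRr1.
    by move=> Ea; move: h1; rewrite e1 {1}Ea ler_pM2r// powR_gt0.
  rewrite -[a M]powRr1// -(@mulVf _ p) ?gt_eqF// powRrM ge0_ler_powR ?nnegrE ?powR_ge0//.
  exact: ltW.
apply: memLX => //.
pose G n x : \bar R := (`|F x| `^ p * B n%:R x)%:E.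
have mG n : measurable_fun setT (G n).
  by apply/measurable_EFinP; apply: measurable_funM => //; exact: measurable_powRn.
have G0 n x : setT x -> (0 <= G n x)%E.
  by move=> _; rewrite lee_fin mulr_ge0 ?powR_ge0// BE ler0n.
have Gh x : setT x -> {homo G ^~ x : n m / (n <= m)%N >-> (n <= m)%E}.
  move=> _ n m nm; rewrite lee_fin ler_wpM2l ?powR_ge0// !BE ler_nat.
  by case: leP => //= hx; rewrite (le_trans hx)// ler_nat.
have limG x : limn (G ^~ x) = (`|F x| `^ p)%:E.
  apply/cvg_lim => //; apply: cvg_near_cst; near=> n.
  rewrite /G BE (_ : _ <= _) ?mulr1//; near: n; exact: nbhs_infty_ger.
have := @cvg_monotone_convergence _ _ _ P _ measurableT _ mG G0 Gh.
under eq_integral do rewrite limG.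
move=> cI; rewrite -(cvg_lim _ cI)//; apply: lime_le; first by apply/cvg_ex; eexists; exact: cI.
near=> n.
have maM : memL P 1 (fun x => `|F x| `^ p * B n%:R x).
  apply: (@Linf1 _ _ _ P); apply: (@Linf_bounded _ _ _ P _ (n%:R `^ p)).
    by apply: measurable_funM => //; exact: measurable_powRn.
  move=> x; rewrite BE normrM (ger0_norm (powR_ge0 _ _)).
  have [hx|hx] := leP `|F x| n%:R; last by rewrite normr0 mulr0 powR_ge0.
  by rewrite normr1 mulr1 ge0_ler_powR ?nnegrE//; lra.
rewrite -[X in (X <= _)%E]fineK; last exact: (integrable_fin_num measurableT (memL1_int maM)).
by rewrite lee_fin aC.
Unshelve. all: by end_near.
Qed.

(** As q <= 2, the form is bounded for the L^2 norm as well, so the almost minimisers of [riesz_seq]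
    are Cauchy in L^2. Their limit has the prescribed symbols, and [dual_nrm] upgrades it to L^p.
    All operators below are built by this lemma. *)
Lemma representation p q (C : R) (l : I -> R) :
  2 <= p -> 0 < q -> p^-1 + q^-1 = 1 -> 0 <= C ->
  (forall phi, `|fval l phi| <= C * nrm P q (fev phi)) ->
  exists V, [/\ memL P p V, nrm P p V <= C &
    forall i, Ex P (fun x => V x * e i x) = l i].
Proof.
move=> p2 q0 pq C0 hC.
have /andP[_ q2] := conjugate_le2 p2 q0 pq.
pose B phi psi := Ex P (fun x => fev phi x * fev psi x).
have L2 phi : memL P 2 (fev phi) by exact/Linf2/Linf_fev.
have Bnrm phi : B phi phi = nrm P 2 (fev phi) ^+ 2.
  by rewrite nrm2E//; apply: eq_Ex => x; rewrite expr2.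
have [|||||v vP] := @riesz_seq _ _ [::] fcomb B (fval l) (C ^+ 2) (sqr_ge0 _).
- by move=> u v; apply: eq_Ex => x; rewrite mulrC.
- by move=> u; rewrite Bnrm sqr_ge0.
- move=> u a v w; rewrite /B.
  under eq_Ex do rewrite fev_comb mulrDl -mulrA.
  rewrite ExD ?ExZ//; first exact: (memLM22 _ _).1.
    exact: (memLM22 _ _).1.
  by apply: (nrmZ _ _ _).1 => //; exact: (memLM22 _ _).1.
- exact: fval_comb.
- move=> u; rewrite Bnrm -exprMn -real_normK ?num_real//.
  rewrite ler_sqr ?nnegrE ?mulr_ge0 ?nrm_ge0//.
  apply: (le_trans (hC u)); rewrite ler_wpM2l//; exact: (memL_le _ q2 _).2.
have h2 n w : `|B (v n) w - fval l w| <= 2^-1 ^+ n * nrm P 2 (fev w).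
  rewrite -ler_sqr ?nnegrE ?mulr_ge0 ?exprn_ge0 ?nrm_ge0// real_normK ?num_real//.
  apply: (le_trans (vP n w)); rewrite Bnrm exprMn -exprM mulnC exprM.
  by rewrite ler_wpM2r ?sqr_ge0// lerXn2r ?nnegrE ?exprn_ge0//; lra.
have [|V mV hV] := @L2_complete _ _ _ P (fun n => fev (v n)) (fun n => L2 (v n)).
  move=> n m; pose w := fcomb (v n) (-1) (v m).
  have ew x : fev w x = fev (v n) x - fev (v m) x by rewrite fev_comb mulN1r.
  rewrite (@nrm_ext _ _ _ P 2 _ (fev w)); last by move=> x; rewrite ew.
  have [->|nz] := eqVneq (nrm P 2 (fev w)) 0; first by rewrite addr_ge0 ?exprn_ge0.
  have n0 : 0 < nrm P 2 (fev w) by rewrite lt_def nz nrm_ge0.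
  rewrite -(ler_pM2r n0) -expr2 -Bnrm.
  have -> : B w w = (B (v n) w - fval l w) - (B (v m) w - fval l w).
    rewrite opprB addrA subrK /B -ExB; [|exact: (memLM22 _ _).1|exact: (memLM22 _ _).1].
    by apply: eq_Ex => x; rewrite -mulrBl -ew.
  by apply: le_trans (ler_norm _) _; apply: (le_trans (ler_normB _ _)); rewrite mulrDl lerD.
have Vl phi : Ex P (fun x => V x * fev phi x) = fval l phi.
  apply/eqP; rewrite -subr_eq0 -normr_eq0 eq_le normr_ge0 andbT.
  have bnd n : `|Ex P (fun x => V x * fev phi x) - fval l phi| <=
      3 * nrm P 2 (fev phi) * 2^-1 ^+ n.
    have -> : Ex P (fun x => V x * fev phi x) - fval l phi =
        (B (v n) phi - fval l phi) - Ex P (fun x => (fev (v n) x - V x) * fev phi x).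
      under [X in _ = _ - X]eq_Ex do rewrite mulrBl.
      rewrite ExB; [|exact: (memLM22 _ _).1|exact: (memLM22 _ _).1].
      by rewrite -/(B _ _); ring.
    apply: (le_trans (ler_normB _ _)).
    have mB : memL P 2 (fun x => fev (v n) x - V x) by apply: (nrmB _ _ _).1; rewrite ?ler1n.
    have := (memLM22 mB (L2 phi)).2; have := h2 n phi; have := hV n.
    have := nrm_ge0 P 2 (fev phi); have : 0 <= 2^-1 ^+ n :> R by rewrite exprn_ge0.
    move: (nrm P 2 (fev phi)) (nrm _ _ _) (_ ^+ n) `|_| `|_| => *; nra.
  apply/ler_addgt0Pr => eps e0; rewrite add0r.
  have : (3 * nrm P 2 (fev phi) * 2^-1 ^+ n) @[n --> \oo] --> (3 * nrm P 2 (fev phi) * 0).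
    apply: cvgMr; apply: cvg_expr; by rewrite ger0_norm ?invr_ge0// invf_lt1 ?ltr1n.
  rewrite mulr0 => /cvgr0Pnorm_lt /(_ _ e0) [N _ /(_ N (leqnn _)) hN].
  by apply: (le_trans (bnd N)); apply: le_trans (ltW hN); exact: ler_norm.
have [mp np] := dual_nrm p2 q0 pq mV C0 (fun phi => ltac:(rewrite Vl; exact: hC)).
exists V; split=> // i.
have := Vl [:: (1, i)]; rewrite /fval big_seq1 mul1r => <-.
by apply: eq_Ex => x; rewrite /fev big_seq1 mul1r.
Qed.
End representation.

Section dominated.
Context {R : realType} {d : measure_display} {T : measurableType d}.
Variable P : probability T R.

Lemma dominated_nrm (p : R) (f : nat -> T -> R) (g h : T -> R) : 1 <= p ->
  (forall n, measurable_fun setT (f n)) -> measurable_fun setT g ->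
  memL P p h -> (forall n x, `|f n x| <= h x) ->
  (forall x, f n x @[n --> \oo] --> g x) ->
  nrm P p (fun x => f n x - g x) @[n --> \oo] --> (0 : R).
Proof.
move=> p1 mf mg mh fh fg.
have p0 : 0 < p by exact: lt_le_trans p1.
have gh x : `|g x| <= h x.
  rewrite -(cvg_lim _ (cvg_norm (fg x)))//.
  by apply: limr_le; [apply/cvg_ex; exists `|g x|; exact: cvg_norm|near=> n].
have h0 x : 0 <= h x by exact: le_trans (gh x).
have mn n : memL P p (fun x => f n x - g x).
  apply: (nrmB p1 _ _).1; apply: (memL_mono p0 _ mh _).1 => // x; by rewrite (ger0_norm (h0 x)).
have mh2 : memL P p (fun x => 2 * h x) by exact: (nrmZ 2 p0 mh).1.
have cI : (\int[P]_x (`|f n x - g x| `^ p)%:E)%E @[n --> \oo] --> (\int[P]_x (0 : \bar R))%E.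
  apply: (@dominated_cvg _ _ _ P setT measurableT _ (cst 0%E) (fun x => (`|2 * h x| `^ p)%:E)) => //.
  - by move=> n; apply/measurable_EFinP; apply: measurable_powRn; exact: measurable_funB.
  - move=> x _; apply/cvg_EFin; first by near=> n.
    have : `|f n x - g x| @[n --> \oo] --> (0 : R).
      rewrite -(normr0 R) -(subrr (g x)); apply: cvg_norm; apply: cvgB => //; exact: cvg_cst.
    move=> /cvgr0Pnorm_lt c0; apply/cvgr0Pnorm_lt => eps e0.
    have : 0 < eps `^ p^-1 by rewrite powR_gt0.
    move=> /c0; apply: filterS => n /=; rewrite normr_id => hn.
    rewrite ger0_norm ?powR_ge0//.
    have -> : eps = (eps `^ p^-1) `^ p by rewrite -powRrM mulVf ?gt_eqF// powRr1 ?ltW.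
    by rewrite gt0_ltr_powR// nnegrE ?powR_ge0.
  - by apply: memL_integrableX => //; rewrite gt_eqF.
  - move=> n x _; rewrite gee0_abs ?lee_fin ?powR_ge0// ge0_ler_powR ?nnegrE//; first exact: ltW.
    rewrite (ger0_norm (mulr_ge0 _ (h0 x)))//; apply: (le_trans (ler_normB _ _)).
    by rewrite mulr_natl mulr2n lerD.
rewrite integral0 in cI.
apply/cvgr0Pnorm_lt => eps e0.
have ep0 : 0 < eps `^ p by rewrite powR_gt0.
have := cI; under eq_fun do rewrite powR_nrm ?gt_eqF//.
move=> /fine_cvgP[_] /= /cvgr0Pnorm_lt /(_ _ ep0); apply: filterS => n /=.
rewrite ger0_norm ?powR_ge0// ger0_norm ?nrm_ge0// => hn.
rewrite ltNge; apply/negP => hle; move: hn; rewrite ltNge => /negP; apply.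
by rewrite ge0_ler_powR ?nnegrE ?nrm_ge0//; exact: ltW.
Unshelve. all: by end_near.
Qed.
End dominated.

(** Bounded trigonometric expressions recover the unbounded variable. Moments and the generated
    sigma-algebra are read off from characteristic functions in this way. *)
Lemma cvg_sin_lin (R : realType) (t : R) :
  n.+1%:R * sin (n.+1%:R^-1 * t) @[n --> \oo] --> t.
Proof.
have [->|t0] := eqVneq t 0.
  apply: cvg_near_cst; near=> n; by rewrite mulr0 sin0 mulr0.
have hd : is_derive (0 : R) (1 : R) sin (cos 0) by exact: is_derive_sin.
have dc := @ex_derive _ _ _ _ _ _ _ hd.
have : h^-1 *: (sin (h *: 1 + 0) - sin 0) @[h --> (0 : R)^'] --> (1 : R).
  have h1 : 'D_1 sin (0 : R) = 1 by rewrite (@derive_val _ _ _ _ _ _ _ hd) cos0.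
  by rewrite -[X in _ --> X]h1; exact: dc.
move=> /cvgr_dnbhsP H; have {H} := H (fun n => n.+1%:R^-1 * t).
have H0 : (forall n, n.+1%:R^-1 * t != 0) /\ n.+1%:R^-1 * t @[n --> \oo] --> (0 : R).
  split.
    by move=> n; rewrite mulf_neq0// invr_eq0 pnatr_eq0.
  by rewrite -[X in _ --> X](mul0r t); apply: cvgMl; exact: cvg_harmonic.
move=> /(_ H0) H.
rewrite (_ : (fun n : nat => n.+1%:R * sin (n.+1%:R^-1 * t)) =
  (fun n => ((n.+1%:R^-1 * t)^-1 *: (sin ((n.+1%:R^-1 * t) *: 1 + 0) - sin 0)) * t)).
  by rewrite -[X in _ --> X]mul1r; apply: cvgMl; exact: H.
apply/funext => n; rewrite sin0 subr0 addr0 /GRing.scale/= mulr1 invfM invrK.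
by rewrite mulrAC -(mulrA _ t^-1) mulVf// mulr1.
Unshelve. all: by end_near.
Qed.

Lemma cvg_clamp (R : realType) (u : nat -> R) (l M : R) : u n @[n --> \oo] --> l ->
  Num.max (- M) (Num.min M (u n)) @[n --> \oo] --> Num.max (- M) (Num.min M l).
Proof.
move=> /cvgrPdist_le h; apply/cvgrPdist_le => eps /h; apply: filterS => n.
apply: le_trans.
have lip a b : a <= b -> `|Num.max (- M) (Num.min M b) - Num.max (- M) (Num.min M a)| <= `|b - a|.
  move=> ab; rewrite (ger0_norm (_ : 0 <= b - a)) ?subr_ge0// ler_norml !maxEle !minEle.
  have [?|?] := lerP M b; have [?|?] := lerP M a; have [?|?] := lerP (- M) M;
  have [?|?] := lerP (- M) a; have [?|?] := lerP (- M) b; lra.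
have [/lip//|/ltW/lip h'] := leP (u n) l.
by rewrite distrC (distrC l).
Qed.

(** * A functional monotone class theorem *)

Section bounded_class.
Context {R : realType} {d : measure_display} {T : measurableType d}.
Variable C : (T -> R) -> Prop.
Hypothesis C_cst : forall c, C (fun=> c).
Hypothesis C_add : forall f g, C f -> C g -> C (fun x => f x + g x).
Hypothesis C_mul : forall f g, C f -> C g -> C (fun x => f x * g x).
Hypothesis C_bnd : forall f, C f -> exists M : R, forall x, `|f x| <= M.
Hypothesis C_lim : forall (f : nat -> T -> R) g (M : R), (forall n, C (f n)) ->
  (forall n x, `|f n x| <= M) -> (forall x, f n x @[n --> \oo] --> (g x : R)) -> C g.

Let C_ext f g : (forall x, f x = g x) -> C f -> C g.
Proof. by move=> /funext ->. Qed.

Let C_scale a f : C f -> C (fun x => a * f x).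
Proof. by move=> h; apply: C_mul. Qed.

Let C_sub f g : C f -> C g -> C (fun x => f x - g x).
Proof.
move=> hf hg; apply: C_ext (C_add hf (C_scale (-1) hg)) => x.
by rewrite mulN1r.
Qed.

(* [|t|] is the increasing limit of the polynomials [p 0 = 0],
   [p n.+1 = p n + (t ^+ 2 - p n ^+ 2) / 2] on [-1, 1]. *)
Let absp (t : R) := fix p n : R := if n is m.+1 then p m + (t ^+ 2 - p m ^+ 2) / 2 else 0.

Let absp_bnd t n : `|t| <= 1 ->
  0 <= absp t n <= `|t| /\ `|t| - absp t n <= (1 - `|t| / 2) ^+ n.
Proof.
move=> t1; elim: n => [|n [/andP[h1 h2] h3]] /=.
  by rewrite lexx normr_ge0 subr0 expr0.
rewrite -(real_normK (num_real t)); move: (normr_ge0 t) t1 h1 h2 h3.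
move: (absp t n) `|t| => a u u0 u1 h1 h2 h3.
have e : u - (a + (u ^+ 2 - a ^+ 2) / 2) = (u - a) * (1 - (u + a) / 2) by field.
split.
  apply/andP; split; first by nra.
  by rewrite -subr_ge0 e mulr_ge0 ?subr_ge0//; lra.
rewrite e exprSr; apply: ler_pM => //; [by rewrite subr_ge0|by lra|by lra].
Qed.

Let C_abs f : C f -> C (fun x => `|f x|).
Proof.
move=> hf; have [M hM] := C_bnd hf.
pose K := `|M| + 1; have K0 : 0 < K by rewrite ltr_wpDl.
have fK x : `|K^-1 * f x| <= 1.
  rewrite normrM normfV (gtr0_norm K0) ler_pdivrMl// mulr1.
  by apply: (le_trans (hM x)); apply: (le_trans (ler_norm _)); rewrite lerDl.
have hg : C (fun x => K^-1 * f x) by exact: C_scale.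
have hp n : C (fun x => absp (K^-1 * f x) n).
  elim: n => [|n IH] /=; first exact: C_cst.
  apply: C_add => //; apply: C_ext (C_scale 2^-1 (C_sub (C_mul hg hg) (C_mul IH IH))) => x.
  by rewrite mulrC !expr2.
have hl : C (fun x => `|K^-1 * f x|).
  apply: (C_lim (M := 1) hp).
    move=> n x; have [/andP[h1 h2] _] := absp_bnd n (fK x).
    by rewrite ger0_norm// (le_trans h2).
  move=> x; have [z|nz] := eqVneq (K^-1 * f x) 0.
    rewrite z normr0; apply: cvg_near_cst; near=> n.
    have [/andP[]] := absp_bnd n (fK x); rewrite z normr0 => h1 h2 _.
    by apply/eqP; rewrite eq_le h1 h2.
  apply/cvgrPdist_le => eps e0.
  have : (1 - `|K^-1 * f x| / 2) ^+ n @[n --> \oo] --> (0 : R).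
    have := fK x; have : 0 < `|K^-1 * f x| by rewrite normr_gt0.
    move: `|_| => u u0 u1; apply: cvg_expr; rewrite ger0_norm; lra.
  move=> /cvgr0Pnorm_le /(_ _ e0); apply: filterS => n hn.
  have [/andP[h1 h2] h3] := absp_bnd n (fK x).
  rewrite ger0_norm ?subr_ge0//; apply: (le_trans h3).
  by apply: le_trans hn; exact: ler_norm.
apply: C_ext (C_scale K hl) => x.
by rewrite normrM normfV (gtr0_norm K0) mulrA divff ?gt_eqF// mul1r.
Unshelve. all: by end_near.
Qed.

Let C_max f g : C f -> C g -> C (fun x => Num.max (f x) (g x)).
Proof.
move=> hf hg; apply: C_ext (C_scale 2^-1 (C_add (C_add hf hg) (C_abs (C_sub hf hg)))) => x.
by rewrite maxr_absE mulrC.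
Qed.

Let C_min f g : C f -> C g -> C (fun x => Num.min (f x) (g x)).
Proof.
move=> hf hg; apply: C_ext (C_scale 2^-1 (C_sub (C_add hf hg) (C_abs (C_sub hf hg)))) => x.
by rewrite minr_absE mulrC.
Qed.

Definition Csets : set (set T) := [set E | C (\1_E : T -> R)].

(** The indicator is the increasing limit of min(1, n (c - f)^+). *)
Let C_lt f c : C f -> Csets [set x | f x < c].
Proof.
move=> hf; pose g x := Num.max (c - f x) 0.
have hg : C g by apply: C_max => //; apply: C_sub.
apply: (C_lim (M := 1) (f := fun n x => Num.min 1 (n%:R * g x))).
- by move=> n; apply: C_min => //; exact: C_scale.
- move=> n x; rewrite ger0_norm; first by rewrite ge_min lexx.
  by rewrite le_min ler01 mulr_ge0 ?ler0n// /g le_max lexx orbT.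
- move=> x; rewrite indicE; have [h|h] := ltP (f x) c.
    rewrite mem_set//; apply: cvg_near_cst; near=> n.
    have h' : 0 < c - f x by rewrite subr_gt0.
    rewrite /g max_l ?ltW//; apply/min_idPl; rewrite -ler_pdivrMr//.
    by near: n; exact: nbhs_infty_ger.
  rewrite memNset; last by apply/negP; rewrite -leNgt.
  apply: cvg_near_cst; near=> n.
  by rewrite /g max_r ?subr_le0// mulr0 min_r// ler01.
Unshelve. all: by end_near.
Qed.

Lemma Csets_sigma : sigma_algebra setT Csets.
Proof.
have SC A : Csets A -> Csets (~` A).
  move=> hA; apply: C_ext (C_sub (C_cst 1) hA) => x.
  by rewrite !indicE in_setC; case: (x \in A); rewrite ?subrr ?subr0.
split; first by apply: C_ext (C_cst 0) => x; rewrite indicE in_set0.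
- by move=> A hA; rewrite setTD; exact: SC.
(* The finite products decrease to the indicator of the complement of the union. *)
- move=> F hF; pose G n x := \prod_(i < n) (1 - \1_(F i) x) : R.
  have hG n : C (G n).
    elim: n => [|n IH]; first by apply: C_ext (C_cst 1) => x; rewrite /G big_ord0.
    by apply: C_ext (C_mul IH (C_sub (C_cst 1) (hF n))) => x; rewrite /G big_ord_recr.
  have G01 n x : 0 <= G n x <= 1.
    have h i : (0 : R) <= (1 : R) - (\1_(F i) x : R) <= (1 : R).
      by rewrite indicE; case: (x \in F i) => /=; lra.
    rewrite /G; elim: n => [|n /andP[h1 h2]]; first by rewrite big_ord0; lra.
    by rewrite big_ord_recr/=; have /andP[h3 h4] := h n; apply/andP; split; nra.
  have : C (\1_(~` \bigcup_k F k) : T -> R).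
    apply: (C_lim (M := 1) hG).
      by move=> n x; have /andP[h1 h2] := G01 n x; rewrite ger0_norm.
    move=> x; apply: cvg_near_cst; rewrite indicE in_setC.
    have [|nx] := boolP (x \in _).
      rewrite inE => -[k _ Fk]; near=> n.
      have kn : (k < n)%N by near: n; exact: nbhs_infty_gt.
      rewrite /G (bigD1 (Ordinal kn))//= indicE mem_set// subrr mul0r//.
    near=> n; rewrite /G big1// => i _; rewrite indicE memNset ?subr0// => Fx.
    by move: nx; rewrite notin_setE; apply; exists i.
  by move/SC; rewrite setCK.
Unshelve. all: by end_near.
Qed.

Let C_clamp f (M : R) : C f -> C (fun x => Num.max (- M) (Num.min M (f x))).
Proof. by move=> hf; apply: C_max => //; exact: C_min. Qed.

(** Truncations of [X i] are limits of truncations of n sin(X i / n), so [Csets] contains the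
    generating sets and with them all measurable sets. A bounded function, rescaled into [0, 1], is
    then a uniform limit of staircases, each a sum of indicators of its level sets. *)
Lemma bounded_class (J : Type) (X : J -> T -> R) :
  (forall i (t : R), C (fun x => sin (t * X i x))) ->
  (forall S : set (set T), sigma_algebra setT S ->
    (forall i (c : R), S [set x | X i x < c]) -> measurable `<=` S) ->
  forall (f : T -> R) (M : R), measurable_fun setT f -> (forall x, `|f x| <= M) -> C f.
Proof.
move=> hX gen.
have mS : measurable `<=` Csets.
  apply: gen; first exact: Csets_sigma.
  (* Truncating at a level above |c| does not change the set where [X i] is below [c]. *)
  move=> i c; pose M := `|c| + 1.
  have M0 : 0 <= M by rewrite addr_ge0.
  have hc : C (fun x => Num.max (- M) (Num.min M (X i x))).
    apply: (C_lim (M := M) (f := fun n x => Num.max (- M) (Num.min M (n.+1%:R * sin (n.+1%:R^-1 * X i x))))).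
    - by move=> n; apply: C_clamp; exact: C_scale.
    - move=> n x; rewrite ler_norml le_max lexx/= ge_max ge_min lexx/= andbT; lra.
    - move=> x; apply: cvg_clamp; exact: cvg_sin_lin.
  have -> : [set x | X i x < c] = [set x | Num.max (- M) (Num.min M (X i x)) < c].
    apply/seteqP; split=> x /=; rewrite gt_max gt_min => h.
      rewrite h orbT andbT /M; have := ler_norm (- c); rewrite normrN; lra.
    case/andP: h => _ /orP[|//]; rewrite /M; have := ler_norm c; lra.
  exact: C_lt.
move=> f M mf fM.
have M0 : 0 <= M by exact: le_trans (fM point).
pose g x := (f x + M) / (2 * M + 1).
have g01 x : 0 <= g x <= 1.
  have := fM x; rewrite ler_norml => /andP[h1 h2].
  by rewrite /g; apply/andP; split; [rewrite divr_ge0//; lra|rewrite ler_pdivrMr; lra].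
have mg : measurable_fun setT g.
  by apply: measurable_funM => //; exact: measurable_funD.
pose E n k := [set x | k.+1%:R <= n.+1%:R * g x].
pose S n m x : R := \sum_(k < m) \1_(E n k) x.
have SE n m x : S n m x = \sum_(k < m) (k.+1%:R <= n.+1%:R * g x)%R%:R.
  apply: eq_bigr => k _; rewrite indicE; congr (nat_of_bool _)%:R.
  by apply/idP/idP; rewrite inE.
have count n m x : [/\ 0 <= S n m x <= m%:R, S n m x <= n.+1%:R * g x &
    S n m x = m%:R \/ n.+1%:R * g x - 1 <= S n m x].
  rewrite SE; have /andP[a0 _] := g01 x; have {a0} : 0 <= n.+1%:R * g x by rewrite mulr_ge0.
  move: (n.+1%:R * g x) => a a0.
  elim: m => [|m [/andP[h1 h2] h3 h4]]; first by rewrite big_ord0; split; [lra|lra|left].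
  rewrite big_ord_recr/=; move: (\sum_(_ < _) _) h1 h2 h3 h4 => s h1 h2 h3 h4.
  rewrite -natr1; have [h|h] := lerP (m%:R + 1) a; rewrite ?mulr0n ?addr0 ?mulr1n.
    by case: h4 => h4; split; [lra|lra|left; lra|lra|lra|left; lra].
  by case: h4 => h4; split; [lra|lra|right; lra|lra|lra|right; lra].
have hg : C g.
  apply: (C_lim (M := 1) (f := fun n x => n.+1%:R^-1 * S n n.+1 x)).
  - move=> n; apply: C_scale; rewrite /S.
    move: n.+1 => m0; elim: m0 => [|m IH].
      by apply: C_ext (C_cst 0) => x; rewrite big_ord0.
    apply: (@C_ext (fun x => \sum_(k < m) \1_(E n k) x + \1_(E n m) x)).
      by move=> x; rewrite big_ord_recr.
    apply: C_add => //=.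
    apply: mS; rewrite /E.
    have := measurable_funM (@measurable_cst _ _ T R setT n.+1%:R) mg.
    move=> /(_ measurableT [set` `[m.+1%:R, +oo[ ] (measurable_itv _)).
    by rewrite setTI; congr (measurable _); apply/seteqP; split=> x /=; rewrite in_itv/= andbT.
  - move=> n x; have [/andP[h1 h2] h3 h4] := count n n.+1 x; rewrite ger0_norm ?mulr_ge0//.
    by rewrite ler_pdivrMl// mulr1.
  - move=> x; apply/cvgrPdist_le => eps e0.
    near=> n; have [/andP[h1 h2] h3 h4] := count n n.+1 x.
    have /andP[_ g1] := g01 x.
    have h5 : n.+1%:R * g x <= n.+1%:R by rewrite ler_piMr.
    have h6 : n.+1%:R * g x - S n n.+1 x <= 1 by case: h4 => h4; lra.
    have n0 : 0 < n.+1%:R :> R by rewrite ltr0n.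
    have -> : g x - n.+1%:R^-1 * S n n.+1 x = n.+1%:R^-1 * (n.+1%:R * g x - S n n.+1 x).
      by rewrite mulrBr mulrA mulVf ?mul1r// gt_eqF.
    rewrite ger0_norm; last by rewrite mulr_ge0// subr_ge0.
    apply: (@le_trans _ _ n.+1%:R^-1); first by rewrite ler_piMr.
    by apply: ltW; near: n; exact: (near_infty_natSinv_lt (PosNum e0)).
apply: C_ext (C_add (C_scale (2 * M + 1) hg) (C_cst (- M))) => x.
by rewrite /g mulrC divfK ?addrK// gt_eqF//; lra.
Unshelve. all: by end_near.
Qed.
End bounded_class.

(** * Measure-preserving maps and product spaces *)

Section measure_preserving.
Context {R : realType} {d1 d2 : measure_display}.
Context {T1 : measurableType d1} {T2 : measurableType d2}.
Variables (P1 : probability T1 R) (P2 : probability T2 R).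

Definition mpres (f : T1 -> T2) := measurable_fun setT f /\
  forall A, measurable A -> P1 (f @^-1` A) = P2 A.

Variable f : T1 -> T2.
Hypothesis fP : mpres f.

Lemma mpres_integral (h : T2 -> \bar R) : measurable_fun setT h ->
  (forall x, 0 <= h x)%E -> (\int[P1]_x h (f x) = \int[P2]_x h x)%E.
Proof.
have := @ge0_integral_pushforward _ _ _ _ _ _ fP.1 P1 setT h measurableT.
move=> H mh h0; have := H mh (fun x _ => h0 x); rewrite preimage_setT => <-.
apply: eq_measure_integral; first exact: fP.1.
by move=> mf A mA _; exact: fP.2.
Qed.

Lemma mpres_memL p (h : T2 -> R) : memL P2 p h ->
  memL P1 p (fun x => h (f x)) /\ nrm P1 p (fun x => h (f x)) = nrm P2 p h.
Proof.
move=> mh; have mm := memL_meas mh.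
have e : 'N[P1]_p%:E[EFin \o (fun x => h (f x))]%E = 'N[P2]_p%:E[EFin \o h]%E.
  rewrite unlock /Lnorm; apply: (congr1 (fun z => z `^ _)%E).
  rewrite -(@mpres_integral (fun x => `|(EFin \o h) x| `^ p)%E)//.
    under eq_fun do rewrite poweR_EFin.
    by apply/measurable_EFinP; exact: measurable_powRn.
  by move=> x; exact: poweR_ge0.
split; last by rewrite /nrm e.
split; last by rewrite e; case: mh.
by apply: measurableT_comp => //; exact: fP.1.
Qed.

Lemma mpres_Linf (h : T2 -> R) : Linf P2 h -> Linf P1 (fun x => h (f x)).
Proof. by move=> hh p p1; apply: (mpres_memL (hh p p1)).1. Qed.

Lemma mpres_Ex (h : T2 -> R) : measurable_fun setT h ->
  Ex P1 (fun x => h (f x)) = Ex P2 h.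
Proof.
move=> mh; rewrite /Ex /Rintegral; congr fine.
have mh' : measurable_fun setT (EFin \o h) by exact/measurable_EFinP.
rewrite [LHS]integralE [RHS]integralE.
have -> : (\int[P1]_x ((fun x => (h (f x))%:E)^\+ x) = \int[P2]_x ((EFin \o h)^\+ x))%E.
  rewrite -(mpres_integral (measurable_funepos mh')); last by move=> x; exact: funepos_ge0.
  by apply: eq_integral => x _; rewrite unlock.
have -> : (\int[P1]_x ((fun x => (h (f x))%:E)^\- x) = \int[P2]_x ((EFin \o h)^\- x))%E.
  rewrite -(mpres_integral (measurable_funeneg mh')); last by move=> x; exact: funeneg_ge0.
  by apply: eq_integral => x _; rewrite unlock.
by [].
Qed.

Lemma mpres_ae (A : T2 -> Prop) : {ae P2, forall x, A x} -> {ae P1, forall x, A (f x)}.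
Proof.
move=> [N [mN N0 sub]]; exists (f @^-1` N); split.
- by rewrite -[X in measurable X]setTI; exact: fP.1.
- by rewrite fP.2.
- by move=> x /= h; apply: sub.
Qed.
End measure_preserving.

Section fubini.
Context {R : realType} {d1 d2 : measure_display}.
Context {T1 : measurableType d1} {T2 : measurableType d2}.
Variables (P1 : probability T1 R) (P2 : probability T2 R).
Let PP : probability (T1 * T2)%type R := (P1 \x P2)%E.

Lemma Ex_fubini f : memL PP 1 f ->
  Ex PP f = Ex P1 (fun x => Ex P2 (fun y => f (x, y))).
Proof.
move=> /memL1_int fi.
rewrite /Ex {1}/Rintegral -integral12_prod_meas1// /Rintegral; congr fine.
have iF := integrable_fubini_F fi.
apply: ae_eq_integral => //.
- exact: measurable_int iF.
- apply/measurable_EFinP; apply: measurableT_comp => //; exact: measurable_int iF.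
- have := integrable_ae measurableT iF; apply: filterS => x /(_ I) h _.
  by rewrite /fubini_F/= fineK.
Qed.

Lemma tonelli (f : T1 * T2 -> R) : measurable_fun setT f -> (forall z, 0 <= f z) ->
  (\int[PP]_z (f z)%:E = \int[P1]_x \int[P2]_y (f (x, y))%:E)%E.
Proof.
move=> mf f0; rewrite fubini_tonelli1//; exact/measurable_EFinP.
Qed.

Lemma mpres_fst : mpres PP P1 fst.
Proof.
split=> // A mA; rewrite (_ : _ @^-1` _ = A `*` setT); last first.
  by apply/seteqP; split=> -[x y] //= [].
rewrite [LHS]product_measure1E//.
by have /= -> := probability_setT P2; rewrite mule1.
Qed.

Lemma mpres_snd : mpres PP P2 snd.
Proof.
split=> // A mA; rewrite (_ : _ @^-1` _ = setT `*` A); last first.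
  by apply/seteqP; split=> -[x y] //= [].
rewrite [LHS]product_measure1E//.
by have /= -> := probability_setT P1; rewrite mul1e.
Qed.

Lemma Ex_prod f g : memL P1 2 f -> memL P2 2 g ->
  Ex PP (fun z => f z.1 * g z.2) = Ex P1 f * Ex P2 g.
Proof.
move=> mf mg.
have m1 := (mpres_memL mpres_fst mf).1.
have m2 := (mpres_memL mpres_snd mg).1.
rewrite Ex_fubini; last exact: (memLM22 m1 m2).1.
have mg1 : memL P2 1 g by apply: (memL_le _ _ mg).1; rewrite ?ler1n.
have mf1 : memL P1 1 f by apply: (memL_le _ _ mf).1; rewrite ?ler1n.
under eq_Ex do rewrite /= ExZ// mulrC.
by rewrite ExZ// mulrC.
Qed.
End fubini.

Lemma measurable_sin (R : realType) : measurable_fun setT (@sin R).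
Proof. apply: continuous_measurable_fun; exact: continuous_sin. Qed.
Lemma measurable_cos (R : realType) : measurable_fun setT (@cos R).
Proof. apply: continuous_measurable_fun; exact: continuous_cos. Qed.

(** * Gaussian spaces *)

(* The law of [gX i] is N(0, gcov i i).  Linear combinations of the variables are
   indexed through [glin]; those of the points, through [gmix], so that rotations
   act on the square of the space and not only on its L^2. *)
Record gspace (R : realType) := Gspace {
  gd : measure_display;
  gT : measurableType gd;
  gP : probability gT R;
  gI : Type;
  gi0 : gI;
  gX : gI -> gT -> R;
  glin : R -> gI -> R -> gI -> gI;
  gmix : R -> gT -> R -> gT -> gT;
  gcov : gI -> gI -> R;
  gXlin : forall a i b j x, gX (glin a i b j) x = a * gX i x + b * gX j x;
  gXmix : forall i a x b y, gX i (gmix a x b y) = a * gX i x + b * gX i y;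
  gcovC : forall i j, gcov i j = gcov j i;
  gcovDl : forall a i b j k, gcov (glin a i b j) k = a * gcov i k + b * gcov j k;
  gsep : forall x y, (forall i, gX i x = gX i y) -> x = y;
  gmeas : forall i, measurable_fun setT (gX i);
  ggen : forall S : set (set gT), sigma_algebra setT S ->
    (forall i c, S [set x | gX i x < c]) -> measurable `<=` S;
  gcos : forall i t, Ex gP (fun x => cos (t * gX i x)) = expR (- (t ^+ 2 * gcov i i / 2));
  gsin : forall i t, Ex gP (fun x => sin (t * gX i x)) = 0
}.

Notation gvar i := (gcov i i).

Section trig.
Context {R : realType} (G : gspace R).
Local Notation T := (gT G).
Local Notation X := (@gX R G).
Implicit Types (e f g : T -> R).

Inductive trig : (T -> R) -> Prop :=
| trig_cst c : trig (fun=> c)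
| trig_cos i : trig (fun x => cos (X i x))
| trig_sin i : trig (fun x => sin (X i x))
| trig_add e f : trig e -> trig f -> trig (fun x => e x + f x)
| trig_scale c e : trig e -> trig (fun x => c * e x).

(** Product-to-sum formulas: sums and differences of variables are again variables, through
    [glin]. *)
Lemma trig_mul e f : trig e -> trig f -> trig (fun x => e x * f x).
Proof.
have ext e' f' : (forall x, e' x = f' x) -> trig e' -> trig f' by move=> /funext ->.
have cc i j : trig (fun x => cos (X i x + X j x)).
  by apply: ext (trig_cos (glin 1 i 1 j)) => x; rewrite gXlin !mul1r.
have sc i j : trig (fun x => sin (X i x + X j x)).
  by apply: ext (trig_sin (glin 1 i 1 j)) => x; rewrite gXlin !mul1r.
have cs i j : trig (fun x => cos (X i x - X j x)).
  by apply: ext (trig_cos (glin 1 i (-1) j)) => x; rewrite gXlin mul1r mulN1r.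
have ss i j : trig (fun x => sin (X i x - X j x)).
  by apply: ext (trig_sin (glin 1 i (-1) j)) => x; rewrite gXlin mul1r mulN1r.
have base g : (exists i, g = (fun x => cos (X i x)) \/ g = (fun x => sin (X i x))) ->
    trig f -> trig (fun x => g x * f x).
  move=> gE; elim=> {f} [c|j|j|h k _ h1 _ h2|c h _ h1].
  - apply: ext (trig_scale c (_ : trig g)) => [x|]; first by rewrite mulrC.
    by case: gE => i [->|->]; constructor.
  - case: gE => i [->|->].
      apply: ext (trig_scale 2^-1 (trig_add (cc i j) (cs i j))) => x.
      by rewrite cosD cosB; field.
    apply: ext (trig_scale 2^-1 (trig_add (sc i j) (ss i j))) => x.
    by rewrite sinD sinB; field.
  - case: gE => i [->|->].
      apply: ext (trig_scale 2^-1 (trig_add (sc i j) (trig_scale (-1) (ss i j)))) => x.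
      by rewrite sinD sinB; field.
    apply: ext (trig_scale 2^-1 (trig_add (cs i j) (trig_scale (-1) (cc i j)))) => x.
    by rewrite cosB cosD; field.
  - by apply: ext (trig_add h1 h2) => x; rewrite mulrDr.
  - by apply: ext (trig_scale c h1) => x; rewrite mulrCA.
elim=> {e} [c|i|i|h k _ h1 _ h2|c h _ h1] tf.
- exact: trig_scale.
- by apply: (base (fun x => cos (X i x))) => //; exists i; left.
- by apply: (base (fun x => sin (X i x))) => //; exists i; right.
- by apply: ext (trig_add (h1 tf) (h2 tf)) => x; rewrite mulrDl.
- by apply: ext (trig_scale c (h1 tf)) => x; rewrite mulrA.
Qed.

Lemma trig_meas e : trig e -> measurable_fun setT e.
Proof.
elim=> {e} [c|i|i|h k _ h1 _ h2|c h _ h1].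
- exact: measurable_cst.
- by apply: measurableT_comp; [exact: measurable_cos|exact: gmeas].
- by apply: measurableT_comp; [exact: measurable_sin|exact: gmeas].
- exact: measurable_funD.
- exact: measurable_funM.
Qed.

Lemma trig_bnd e : trig e -> exists2 M : R, 0 <= M & forall x, `|e x| <= M.
Proof.
elim=> {e} [c|i|i|h k _ [M M0 h1] _ [N N0 h2]|c h _ [M M0 h1]].
- by exists `|c|.
- by exists 1 => // x; rewrite ler_norml cos_geN1 cos_le1.
- by exists 1 => // x; rewrite ler_norml sin_geN1 sin_le1.
- by exists (M + N); [exact: addr_ge0|move=> x; apply: (le_trans (ler_normD _ _)); exact: lerD].
- by exists (`|c| * M) => [|x]; rewrite ?mulr_ge0// normrM ler_wpM2l.
Qed.

(** The [+ 1] keeps the denominator positive when [B = 0]. *)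
Lemma half_le (B eps : R) : 0 <= B -> 0 < eps -> B * (eps / (2 * (B + 1))) <= eps / 2.
Proof.
move=> B0 e0; have B1 : 0 < B + 1 by lra.
have -> : B * (eps / (2 * (B + 1))) = eps / 2 * (B / (B + 1)) by field; rewrite gt_eqF.
rewrite ler_piMr//; first by rewrite divr_ge0// ltW.
by rewrite ler_pdivrMr//; lra.
Qed.

Lemma gen_meas d' (T' : measurableType d') (phi : T' -> T) :
  (forall i, measurable_fun setT (fun x => X i (phi x))) -> measurable_fun setT phi.
Proof.
move=> h _ A mA; rewrite setTI.
apply: (@ggen _ G [set A | measurable (phi @^-1` A)]) => //.
  split => /=; first by rewrite preimage_set0.
  - by move=> B mB; rewrite setTD preimage_setC; exact: measurableC.
  - by move=> F mF; rewrite preimage_bigcup; exact: bigcup_measurable.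
move=> i c /=; have := h i measurableT [set` `]-oo, c[] (measurable_itv _).
by rewrite setTI; congr measurable; apply/seteqP; split=> x /=; rewrite in_itv.
Qed.

Section two_measures.
Context {d' : measure_display} {T' : measurableType d'} (Q : probability T' R).
Variable phi : T' -> T.
Hypothesis mphi : measurable_fun setT phi.

(** One trigonometric polynomial approximates [f] at once for the Gaussian measure and for the image
    of [Q] under [phi]: the functions with this property form a class to which [bounded_class]
    applies. The simultaneity is what allows the two laws to be compared. *)
Lemma trig_dense (p : R) f M : 1 <= p -> measurable_fun setT f ->
  (forall x, `|f x| <= M) -> forall eps : R, 0 < eps -> exists2 e, trig e &
    nrm (gP G) p (fun x => f x - e x) <= eps /\
    nrm Q p (fun x => f (phi x) - e (phi x)) <= eps.
Proof.
move=> p1 mf fM.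
have p0 : 0 < p by exact: lt_le_trans p1.
pose C g := (measurable_fun setT g /\ exists M : R, forall x, `|g x| <= M) /\
  forall eps : R, 0 < eps -> exists2 e, trig e &
    nrm (gP G) p (fun x => g x - e x) <= eps /\
    nrm Q p (fun x => g (phi x) - e (phi x)) <= eps.
suff : C f by case.
have mc g : measurable_fun setT g -> measurable_fun setT (fun x => g (phi x)).
  by move=> mg; exact: measurableT_comp.
have Lb g B : measurable_fun setT g -> (forall x, `|g x| <= B) ->
    memL (gP G) p g /\ memL Q p (fun x => g (phi x)).
  move=> mg hg; split; first exact: (memL_bounded _ p0 mg hg).1.
  exact: (memL_bounded _ p0 (mc _ mg) (fun x => hg (phi x))).1.
have Lt e : trig e -> memL (gP G) p e /\ memL Q p (fun x => e (phi x)).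
  by move=> te; have [B _ hB] := trig_bnd te; apply: Lb hB; exact: trig_meas.
have Ct g : trig g -> C g.
  move=> tg; split; first by split; [exact: trig_meas|have [B _ hB] := trig_bnd tg; exists B].
  move=> eps e0; exists g => //.
  have z d0 (T0 : measurableType d0) (Q0 : probability T0 R) (u : T0 -> R) :
      nrm Q0 p (fun x => u x - u x) <= eps.
    apply: ltW; apply: le_lt_trans e0.
    under [X in nrm _ _ X]eq_fun do rewrite subrr.
    by apply: (memL_bounded _ p0 _ _).2 => // x; rewrite normr0.
  by split; exact: z.
apply: (@bounded_class _ _ _ C _ _ _ _ _ _ X) mf fM.
- by move=> c; apply: Ct; exact: trig_cst.
- move=> g h [[mg [Mg bg]] hg] [[mh [Mh bh]] hh]; split.
    split; first exact: measurable_funD.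
    by exists (Mg + Mh) => x; apply: (le_trans (ler_normD _ _)); exact: lerD.
  move=> eps e0; have e2 : 0 < eps / 2 by rewrite divr_gt0.
  have [e te [e3 e4]] := hg _ e2; have [k tk [k3 k4]] := hh _ e2.
  exists (fun x => e x + k x); first exact: trig_add.
  have [g1 g2] := Lb _ _ mg bg; have [h1 h2] := Lb _ _ mh bh.
  have [e5 e6] := Lt _ te; have [k5 k6] := Lt _ tk.
  split.
    rewrite (_ : (fun x => _) = (fun x => (g x - e x) + (h x - k x))); last first.
      by apply/funext => x; ring.
    apply: (le_trans (nrmD p1 (nrmB p1 g1 e5).1 (nrmB p1 h1 k5).1).2); lra.
  rewrite (_ : (fun x => _) = (fun x => (g (phi x) - e (phi x)) + (h (phi x) - k (phi x)))); last first.
    by apply/funext => x; ring.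
  apply: (le_trans (nrmD p1 (nrmB p1 g2 e6).1 (nrmB p1 h2 k6).1).2); lra.
- move=> g h [[mg [Mg bg]] hg] [[mh [Mh bh]] hh]; split.
    split; first exact: measurable_funM.
    by exists (Mg * Mh) => x; rewrite normrM ler_pM.
  move=> eps e0.
  have Mg0 : 0 <= Mg by exact: le_trans (bg point).
  have e2 : 0 < eps / (2 * (Mg + 1)) by rewrite divr_gt0 ?mulr_gt0 ?ltr_wpDl.
  have [k tk [k3 k4]] := hh _ e2.
  have [B B0 bB] := trig_bnd tk.
  have e2' : 0 < eps / (2 * (B + 1)) by rewrite divr_gt0 ?mulr_gt0 ?ltr_wpDl.
  have [e te [e3 e4]] := hg _ e2'.
  exists (fun x => e x * k x); first exact: trig_mul.
  have aux d0 (T0 : measurableType d0) (Q0 : probability T0 R) (g' e' h' k' : T0 -> R) :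
    memL Q0 p g' -> memL Q0 p e' -> memL Q0 p h' -> memL Q0 p k' ->
    (forall x, `|g' x| <= Mg) -> (forall x, `|k' x| <= B) ->
    nrm Q0 p (fun x => g' x - e' x) <= eps / (2 * (B + 1)) ->
    nrm Q0 p (fun x => h' x - k' x) <= eps / (2 * (Mg + 1)) ->
    nrm Q0 p (fun x => g' x * h' x - e' x * k' x) <= eps.
    move=> mg' me' mh' mk' bg' bk' ne nk.
    rewrite (_ : (fun x => _) = (fun x => g' x * (h' x - k' x) + k' x * (g' x - e' x))); last first.
      by apply/funext => x; ring.
    have L1 := nrmB p1 mh' mk'; have L2 := nrmB p1 mg' me'.
    have H1 : memL Q0 p (fun x => g' x * (h' x - k' x)) /\
        nrm Q0 p (fun x => g' x * (h' x - k' x)) <= Mg * nrm Q0 p (fun x => h' x - k' x).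
      have [m1 n1] := nrmZ Mg p0 L1.1.
      rewrite -(ger0_norm Mg0) -n1; apply: memL_mono m1 _ => //.
        by apply: measurable_funM; [exact: memL_meas mg'|exact: memL_meas L1.1].
      by move=> x; rewrite !normrM ler_wpM2r// (ger0_norm Mg0).
    have H2 : memL Q0 p (fun x => k' x * (g' x - e' x)) /\
        nrm Q0 p (fun x => k' x * (g' x - e' x)) <= B * nrm Q0 p (fun x => g' x - e' x).
      have [m1 n1] := nrmZ B p0 L2.1.
      rewrite -(ger0_norm B0) -n1; apply: memL_mono m1 _ => //.
        by apply: measurable_funM; [exact: memL_meas mk'|exact: memL_meas L2.1].
      by move=> x; rewrite !normrM ler_wpM2r// (ger0_norm B0).
    apply: (le_trans (nrmD p1 H1.1 H2.1).2).
    have h1 : Mg * nrm Q0 p (fun x => h' x - k' x) <= eps / 2.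
      apply: (le_trans (ler_wpM2l Mg0 nk)).
      exact: half_le.
    have h2 : B * nrm Q0 p (fun x => g' x - e' x) <= eps / 2.
      apply: (le_trans (ler_wpM2l B0 ne)).
      exact: half_le.
    move: H1.2 H2.2 h1 h2; lra.
  have [g1 g2] := Lb _ _ mg bg; have [h1 h2] := Lb _ _ mh bh.
  have [e5 e6] := Lt _ te; have [k5 k6] := Lt _ tk.
  by split; apply: aux.
- by move=> g [[]].
- move=> u g B Cu bu cu.
  have mg : measurable_fun setT g.
    apply: (measurable_fun_cvg (h := u)) => [n|x _]; first by case: (Cu n) => -[].
    exact: cu.
  have bg x : `|g x| <= B.
    rewrite -(cvg_lim _ (cvg_norm (cu x)))//.
    by apply: limr_le; [apply/cvg_ex; exists `|g x|; exact: cvg_norm|near=> n].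
  split; first by split=> //; exists B.
  move=> eps e0; have e2 : 0 < eps / 2 by rewrite divr_gt0.
  have mu n : measurable_fun setT (u n) by case: (Cu n) => -[].
  have d1 := dominated_nrm p1 mu mg (memL_cst (gP G) B p0) bu cu.
  have d2 := dominated_nrm p1 (fun n => mc _ (mu n)) (mc _ mg) (memL_cst Q B p0)
    (fun n x => bu n (phi x)) (fun x => cu (phi x)).
  near \oo => n.
  have n1 : nrm (gP G) p (fun x => u n x - g x) <= eps / 2.
    rewrite -[leLHS]ger0_norm ?nrm_ge0//; near: n.
    by move/cvgr0Pnorm_le : d1; exact.
  have n2 : nrm Q p (fun x => u n (phi x) - g (phi x)) <= eps / 2.
    rewrite -[leLHS]ger0_norm ?nrm_ge0//; near: n.
    by move/cvgr0Pnorm_le : d2; exact.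
  have [e te [e3 e4]] := (Cu n).2 _ e2; exists e => //.
  have [g1 g2] := Lb _ _ mg bg; have [h1 h2] := Lb _ _ (mu n) (bu n).
  have [e5 e6] := Lt _ te.
  split.
    rewrite (_ : (fun x => _) = (fun x => (u n x - e x) - (u n x - g x))); last first.
      by apply/funext => x; ring.
    apply: (le_trans (nrmB p1 (nrmB p1 h1 e5).1 (nrmB p1 h1 g1).1).2); lra.
  rewrite (_ : (fun x => _) = (fun x => (u n (phi x) - e (phi x)) - (u n (phi x) - g (phi x)))); last first.
    by apply/funext => x; ring.
  apply: (le_trans (nrmB p1 (nrmB p1 h2 e6).1 (nrmB p1 h2 g2).1).2); lra.
- move=> i t; apply: Ct.
  rewrite (_ : (fun x => _) = (fun x => sin (X (glin t i 0 i) x))); first exact: trig_sin.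
  by apply/funext => x; rewrite gXlin mul0r addr0.
- exact: ggen.
Unshelve. all: by end_near.
Qed.

(** Equal characteristic functions give equal means of trigonometric polynomials; [trig_dense]
    carries the equality over to indicators. *)
Lemma law_unique : (forall i, Ex Q (fun x => cos (X i (phi x))) = expR (- (gvar i / 2))) ->
  (forall i, Ex Q (fun x => sin (X i (phi x))) = 0) -> mpres Q (gP G) phi.
Proof.
move=> hc hs.
have eqt e : trig e -> Ex Q (fun x => e (phi x)) = Ex (gP G) e.
  have m1 e' : trig e' -> memL (gP G) 1 e' /\ memL Q 1 (fun x => e' (phi x)).
    move=> te; have [B _ hB] := trig_bnd te; have me := trig_meas te; split.
      by apply: (memL_bounded _ ltr01 me hB).1.
    by apply: (memL_bounded _ ltr01 (measurableT_comp me mphi) (fun x => hB (phi x))).1.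
  elim=> {e} [c|i|i|h k th h1 tk h2|c h th h1].
  - by rewrite !Ex_cst.
  - rewrite hc; have := gcos i 1; rewrite expr1n mul1r => <-.
    by apply: eq_Ex => x; rewrite mul1r.
  - rewrite hs; have := gsin i 1 => <-.
    by apply: eq_Ex => x; rewrite mul1r.
  - by have [? ?] := m1 _ th; have [? ?] := m1 _ tk; rewrite !ExD// h1 h2.
  - by have [? ?] := m1 _ th; rewrite !ExZ// h1.
split=> // A mA.
have mA' : measurable (phi @^-1` A) by rewrite -[X in measurable X]setTI; exact: mphi.
pose f : T -> R := \1_A.
have mf : measurable_fun setT f by exact: measurable_indic.
have bf x : `|f x| <= 1 by rewrite /f indicE; case: (x \in A); rewrite ?normr1 ?normr0.
have e1 : Ex (gP G) f = fine (gP G A).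
  by rewrite /Ex /Rintegral /f integral_indic// setIT.
have e2 : Ex Q (fun x => f (phi x)) = fine (Q (phi @^-1` A)).
  rewrite /Ex /Rintegral (_ : (fun x => _) = (fun x => (\1_(phi @^-1` A) x)%:E)).
    by rewrite integral_indic// setIT.
  by apply/funext => x; rewrite /f !indicE.
suff : Ex (gP G) f = Ex Q (fun x => f (phi x)).
  rewrite e1 e2 => h; rewrite -[LHS]fineK ?fin_num_measure// -[RHS]fineK ?fin_num_measure//.
  by rewrite h.
apply/eqP; rewrite -subr_eq0 -normr_eq0 eq_le normr_ge0 andbT.
apply/ler_addgt0Pr => eps e0; rewrite add0r.
have [e te [n1 n2]] := trig_dense (lexx 1) mf bf (divr_gt0 e0 (ltr0n _ 2)).
have [B _ hB] := trig_bnd te; have me := trig_meas te.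
have L1 := (memL_bounded (gP G) ltr01 me hB).1.
have L2 := (memL_bounded Q ltr01 (measurableT_comp me mphi) (fun x => hB (phi x))).1.
have L3 := (memL_bounded (gP G) ltr01 mf bf).1.
have L4 := (memL_bounded Q ltr01 (measurableT_comp mf mphi) (fun x => bf (phi x))).1.
have -> : Ex (gP G) f - Ex Q (fun x => f (phi x)) =
  Ex (gP G) (fun x => f x - e x) - Ex Q (fun x => f (phi x) - e (phi x)).
  by rewrite (ExB L3 L1) (ExB L4 L2) (eqt _ te); ring.
apply: (le_trans (ler_normB _ _)).
have := Ex_le_nrm (lexx 1) (nrmB (lexx 1) L3 L1).1.
have := Ex_le_nrm (lexx 1) (nrmB (lexx 1) L4 L2).1.
by move: n1 n2; lra.
Qed.
End two_measures.
End trig.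

Lemma cvg_powR (R : realType) (v : nat -> R) (l p : R) : 0 < p ->
  v n @[n --> \oo] --> l -> `|v n| `^ p @[n --> \oo] --> `|l| `^ p.
Proof.
move=> p0 vl; have [l0|l0] := eqVneq l 0.
  rewrite l0 normr0 powR0 ?gt_eqF//; apply/cvgr0Pnorm_lt => eps e0.
  have : 0 < eps `^ p^-1 by rewrite powR_gt0.
  rewrite l0 in vl; move: vl => /cvgr0Pnorm_lt h /h; apply: filterS => n /= hn.
  rewrite ger0_norm ?powR_ge0//.
  have -> : eps = (eps `^ p^-1) `^ p by rewrite -powRrM mulVf ?gt_eqF// powRr1 ?ltW.
  by rewrite gt0_ltr_powR// nnegrE ?powR_ge0.
have lp : 0 < `|l| by rewrite normr_gt0.
have c : {for `|l|, continuous (@powR R ^~ p)}.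
  apply: differentiable_continuous; apply/derivable1_diffP.
  by apply: derivable_powR; rewrite in_itv/= andbT.
exact: (cvg_comp _ _ (cvg_norm vl) c).
Qed.

Section fatou.
Context {R : realType} {d : measure_display} {T : measurableType d}.
Variable P : probability T R.

Lemma nrm_fatou p (u : nat -> T -> R) g (C : R) : 0 < p -> 0 <= C ->
  (forall n, memL P p (u n)) -> (forall n, nrm P p (u n) <= C) ->
  (forall x, u n x @[n --> \oo] --> (g x : R)) -> memL P p g /\ nrm P p g <= C.
Proof.
move=> p0 C0 mu nu cu.
have mg : measurable_fun setT g.
  apply: (measurable_fun_cvg (h := u)) => [n|x _]; [exact: memL_meas (mu n)|exact: cu].
apply: memLX => //.
rewrite (_ : (\int[P]_x _)%E =
    (\int[P]_x limn_einf (fun m => (`|u m x| `^ p)%:E))%E); last first.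
  apply: eq_integral => x _; apply/esym; apply: (cvg_limn_einf_sup _).1.
  apply/cvg_EFin; first by near=> m.
  exact: cvg_powR.
apply: le_trans (fatou _ _ _ _) _ => //.
- by move=> m; apply/measurable_EFinP; exact: measurable_powRn (memL_meas (mu m)).
- rewrite limn_einf_lim; apply: lime_le; first exact: is_cvg_einfs.
  near=> m; apply: (@le_trans _ _ (\int[P]_x (`|u m x| `^ p)%:E)%E).
    by apply: ereal_inf_lbound; exists m => //=.
  rewrite powR_nrm ?gt_eqF// lee_fin ge0_ler_powR ?nnegrE ?nrm_ge0//; exact: ltW.
Unshelve. all: by end_near.
Qed.

Lemma nrmXn p (f : T -> R) n : 1 <= p -> (0 < n)%N -> memL P (n%:R * p) f ->
  memL P p (fun x => f x ^+ n) /\ nrm P p (fun x => f x ^+ n) <= nrm P (n%:R * p) f ^+ n.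
Proof.
move=> p1 n0 mf; have p0 : 0 < p by exact: lt_le_trans p1.
have np : 0 < n%:R * p by rewrite mulr_gt0// ltr0n.
apply: memLX => //; [|  |by rewrite exprn_ge0 ?nrm_ge0].
  by apply: measurable_funX; exact: memL_meas mf.
rewrite -powR_mulrn ?nrm_ge0// -powRrM -powR_nrm ?gt_eqF//.
by under eq_integral do rewrite normrX -powR_mulrn// -powRrM.
Qed.
End fatou.

Section conditional.
Context {R : realType} {d1 d2 : measure_display}.
Context {T1 : measurableType d1} {T2 : measurableType d2}.
Variables (P1 : probability T1 R) (P2 : probability T2 R).
Let PP : probability (T1 * T2)%type R := (P1 \x P2)%E.

Lemma memL_tonelli p (f : T1 * T2 -> R) (C : R) : 0 < p -> measurable_fun setT f ->
  0 <= C -> (\int[P1]_x \int[P2]_y (`|f (x, y)| `^ p)%:E <= (C `^ p)%:E)%E ->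
  memL PP p f /\ nrm PP p f <= C.
Proof.
move=> p0 mf C0 h; apply: memLX => //.
by rewrite (tonelli P1 P2 (f := fun z => `|f z| `^ p))//; exact: measurable_powRn.
Qed.

Lemma nrm_tonelli p (f : T1 * T2 -> R) : 0 < p -> memL PP p f ->
  (\int[P1]_x \int[P2]_y (`|f (x, y)| `^ p)%:E = (nrm PP p f `^ p)%:E)%E.
Proof.
move=> p0 mf; rewrite -powR_nrm ?gt_eqF//.
rewrite (tonelli P1 P2 (f := fun z => `|f z| `^ p))//.
exact: measurable_powRn (memL_meas mf).
Qed.

Lemma Ex_pow_le p (f : T2 -> R) : 1 <= p -> memL P2 1 f ->
  ((`|Ex P2 f| `^ p)%:E <= \int[P2]_y (`|f y| `^ p)%:E)%E.
Proof.
move=> p1 m1; have p0 : 0 < p by exact: lt_le_trans p1.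
have [hy|] := eqVneq (\int[P2]_y (`|f y| `^ p)%:E)%E +oo%E; first by rewrite hy leey.
rewrite -ltey => hlt; have mp : memL P2 p f.
  split; first exact: memL_meas m1.
  rewrite unlock /Lnorm; apply: poweR_lty.
  exact: hlt.
rewrite powR_nrm ?gt_eqF// lee_fin ge0_ler_powR ?nnegrE ?nrm_ge0//; first exact: ltW.
exact: Ex_le_nrm.
Qed.

(** Conditional expectation contracts L^p: Jensen's inequality on each slice, then Tonelli. Preceded
    by a rotation, it becomes the contractivity of the Ornstein-Uhlenbeck semigroup. *)
Lemma cond_nrm p (f : T1 * T2 -> R) : 1 <= p -> memL PP p f ->
  (forall x, memL P2 1 (fun y => f (x, y))) ->
  memL P1 p (fun x => Ex P2 (fun y => f (x, y))) /\
  nrm P1 p (fun x => Ex P2 (fun y => f (x, y))) <= nrm PP p f.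
Proof.
move=> p1 mf m1; have p0 : 0 < p by exact: lt_le_trans p1.
have mE : measurable_fun setT (fun x => Ex P2 (fun y => f (x, y))).
  have f1 : memL PP 1 f by apply: (memL_le _ p1 mf).1.
  have := measurable_int _ (integrable_fubini_F (memL1_int f1)).
  by move=> mF; apply: measurableT_comp => //; exact: mF.
apply: memLX => //; last exact: nrm_ge0.
rewrite -nrm_tonelli//; apply: ge0_le_integral => //.
- by apply/measurable_EFinP; exact: measurable_powRn.
- apply: (@measurable_fun_fubini_tonelli_F _ _ _ _ _ P2 (fun z => (`|f z| `^ p)%:E)) => //.
  by apply/measurable_EFinP; exact: measurable_powRn (memL_meas mf).
- by move=> x _; exact: Ex_pow_le.
Qed.

Lemma nrm_prod p (f : T1 -> R) (g : T2 -> R) : 0 < p -> memL P1 p f -> memL P2 p g ->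
  memL PP p (fun z => f z.1 * g z.2) /\
  nrm PP p (fun z => f z.1 * g z.2) <= nrm P1 p f * nrm P2 p g.
Proof.
move=> p0 mf mg.
have mm : measurable_fun setT (fun z : T1 * T2 => f z.1 * g z.2).
  by apply: measurable_funM; apply: measurableT_comp => //;
    [exact: memL_meas mf|exact: memL_meas mg].
apply: memL_tonelli => //; first by rewrite mulr_ge0 ?nrm_ge0.
under eq_integral => x _.
  under eq_integral do rewrite /= normrM powRM// EFinM.
  rewrite ge0_integralZl//; last first.
    by apply/measurable_EFinP; exact: measurable_powRn (memL_meas mg).
  rewrite powR_nrm ?gt_eqF// muleC.
  over.
rewrite ge0_integralZl//; last 2 first.
- by apply/measurable_EFinP; exact: measurable_powRn (memL_meas mf).
- by rewrite lee_fin powR_ge0.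
by rewrite powR_nrm ?gt_eqF// -EFinM powRM ?nrm_ge0// mulrC.
Qed.
End conditional.

(** * The square of a Gaussian space, rotations, Gaussian moments *)

Section square.
Context {R : realType} (G : gspace R).
Local Notation T := (gT G).
Local Notation P := (gP G).
Local Notation X := (@gX R G).
Let sT : measurableType _ := (T * T)%type.
Let sP : probability sT R := (P \x P)%E.
Let sX (l : gI G * gI G) (z : sT) := X l.1 z.1 + X l.2 z.2.

Lemma sin_Linf i t : Linf P (fun x => sin (t * X i x)).
Proof.
apply: (Linf_bounded P (C := 1)) => [|x]; last by rewrite ler_norml sin_geN1 sin_le1.
apply: measurableT_comp; first exact: measurable_sin.
by apply: measurable_funM => //; exact: gmeas.
Qed.

Lemma cos_Linf i t : Linf P (fun x => cos (t * X i x)).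
Proof.
apply: (Linf_bounded P (C := 1)) => [|x]; last by rewrite ler_norml cos_geN1 cos_le1.
apply: measurableT_comp; first exact: measurable_cos.
by apply: measurable_funM => //; exact: gmeas.
Qed.

Lemma sq_cos l t : Ex sP (fun z => cos (t * sX l z)) =
  expR (- (t ^+ 2 * (gvar l.1 + gvar l.2) / 2)).
Proof.
under eq_Ex do rewrite /sX mulrDr cosD.
have c i := Linf2 (cos_Linf i t); have s i := Linf2 (sin_Linf i t).
have f1 i := (mpres_memL (mpres_fst P P) (c i)).1.
have f2 i := (mpres_memL (mpres_fst P P) (s i)).1.
have f3 i := (mpres_memL (mpres_snd P P) (c i)).1.
have f4 i := (mpres_memL (mpres_snd P P) (s i)).1.
rewrite ExB; [|exact: (memLM22 (f1 _) (f3 _)).1|exact: (memLM22 (f2 _) (f4 _)).1].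
rewrite (Ex_prod (c l.1) (c l.2)) (Ex_prod (s l.1) (s l.2)) !gcos !gsin mul0r subr0.
by rewrite -expRD; congr expR; field.
Qed.

Lemma sq_sin l t : Ex sP (fun z => sin (t * sX l z)) = 0.
Proof.
under eq_Ex do rewrite /sX mulrDr sinD.
have c i := Linf2 (cos_Linf i t); have s i := Linf2 (sin_Linf i t).
have f1 i := (mpres_memL (mpres_fst P P) (c i)).1.
have f2 i := (mpres_memL (mpres_fst P P) (s i)).1.
have f3 i := (mpres_memL (mpres_snd P P) (c i)).1.
have f4 i := (mpres_memL (mpres_snd P P) (s i)).1.
rewrite ExD; [|exact: (memLM22 (f2 _) (f3 _)).1|exact: (memLM22 (f1 _) (f4 _)).1].
by rewrite (Ex_prod (c l.1) (s l.2)) (Ex_prod (s l.1) (c l.2)) !gsin mul0r mulr0 addr0.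
Qed.

Lemma sq_meas l : measurable_fun setT (sX l).
Proof. by apply: measurable_funD; apply: measurableT_comp => //; exact: gmeas. Qed.

(** Each coordinate is reached through the indices whose other component is [glin 0 i 0 i], the null
    variable. *)
Lemma sq_gen (S : set (set sT)) : sigma_algebra setT S ->
  (forall l c, S [set z | sX l z < c]) -> measurable `<=` S.
Proof.
move=> [S0 SC SU] hS; rewrite measurable_prod_measurableType.
have ST : S setT by rewrite -(setD0 setT); exact: SC.
have SC' A : S A -> S (~` A) by rewrite -setTD; exact: SC.
have SI A B : S A -> S B -> S (A `&` B).
  move=> hA hB; rewrite -(setCK (A `&` B)) setCI; apply/SC'.
  rewrite -bigcup2E; apply: SU => -[|[|k]] //=; exact: SC'.
have sub phi : (forall i c, S [set z | X i (phi z) < c]) ->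
    forall A : set T, measurable A -> S (phi @^-1` A).
  move=> h A mA; apply: (@ggen _ G [set A | S (phi @^-1` A)]) mA => //.
  split => /=; first by rewrite preimage_set0.
  - by move=> B mB; rewrite setTD preimage_setC; exact: SC'.
  - by move=> F mF; rewrite preimage_bigcup; exact: SU.
have h1 := sub fst; have h2 := sub snd.
apply: smallest_sub => //.
move=> _ [A mA [B mB <-]].
rewrite (_ : A `*` B = fst @^-1` A `&` snd @^-1` B); last by apply/seteqP; split=> -[].
apply: SI; [apply: h1|apply: h2] => // i c.
  have := hS (i, glin 0 i 0 i) c; congr S; apply/seteqP; split=> z /=;
  by rewrite /sX gXlin !mul0r addr0 addr0.
have := hS (glin 0 i 0 i, i) c; congr S; apply/seteqP; split=> z /=;
by rewrite /sX gXlin !mul0r addr0 add0r.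
Qed.

Lemma sq_lin a (i : gI G * gI G) b j z :
  sX (glin a i.1 b j.1, glin a i.2 b j.2) z = a * sX i z + b * sX j z.
Proof. by rewrite /sX/= !gXlin; ring. Qed.

Lemma sq_mix i a (x : sT) b y :
  sX i (gmix a x.1 b y.1, gmix a x.2 b y.2) = a * sX i x + b * sX i y.
Proof. by rewrite /sX/= !gXmix; ring. Qed.

Lemma sq_covC (i j : gI G * gI G) :
  gcov i.1 j.1 + gcov i.2 j.2 = gcov j.1 i.1 + gcov j.2 i.2.
Proof. by congr (_ + _); exact: gcovC. Qed.

Lemma sq_covDl a (i : gI G * gI G) b j k :
  gcov (glin a i.1 b j.1) k.1 + gcov (glin a i.2 b j.2) k.2 =
  a * (gcov i.1 k.1 + gcov i.2 k.2) + b * (gcov j.1 k.1 + gcov j.2 k.2).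
Proof. by rewrite !gcovDl; ring. Qed.

Lemma sq_sep (x y : sT) : (forall i, sX i x = sX i y) -> x = y.
Proof.
case: x y => [x1 x2] [y1 y2] h; congr pair; apply: gsep => i.
  by have := h (i, glin 0 i 0 i); rewrite /sX/= !gXlin !mul0r !addr0.
by have := h (glin 0 i 0 i, i); rewrite /sX/= !gXlin !mul0r !addr0 !add0r.
Qed.

Definition gsq : gspace R := @Gspace R _ sT sP (gI G * gI G)%type (gi0 G, gi0 G) sX
  (fun a i b j => (glin a i.1 b j.1, glin a i.2 b j.2))
  (fun a x b y => (gmix a x.1 b y.1, gmix a x.2 b y.2))
  (fun i j => gcov i.1 j.1 + gcov i.2 j.2)
  sq_lin sq_mix sq_covC sq_covDl sq_sep sq_meas sq_gen sq_cos sq_sin.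

Definition rot (c s : R) (z : gT gsq) : gT gsq := (gmix c z.1 s z.2, gmix (- s) z.1 c z.2).
(** The transposed action on indices: a variable composed with a rotation is again a variable, of
    the same variance if c^2 + s^2 = 1. *)
Definition rotI (c s : R) (l : gI gsq) : gI gsq :=
  (glin c l.1 (- s) l.2, glin s l.1 c l.2).

Lemma gX_rot c s l z : gX l (rot c s z) = gX (rotI c s l) z.
Proof. by rewrite /= /sX /rot /rotI/= !gXmix !gXlin; ring. Qed.

Lemma gcovDr (i j k : gI G) a b : gcov k (glin a i b j) = a * gcov k i + b * gcov k j.
Proof. by rewrite gcovC gcovDl (gcovC i) (gcovC j). Qed.

Lemma gcov_rotI c s (l : gI gsq) : c ^+ 2 + s ^+ 2 = 1 -> gvar (rotI c s l) = gvar l.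
Proof.
move=> cs; rewrite /= !gcovDl !gcovDr (gcovC l.2 l.1).
have -> : s ^+ 2 = 1 - c ^+ 2 -> forall a b m : R,
  c * (c * a + - s * m) + - s * (c * m + - s * b) + (s * (s * a + c * m) + c * (s * m + c * b)) = a + b.
- by move=> e a b m; ring: e.
- by [].
- by rewrite -cs addrAC subrr add0r.
Qed.

Lemma rot_meas c s : measurable_fun setT (rot c s).
Proof.
apply: gen_meas => l; under eq_fun do rewrite gX_rot; exact: gmeas.
Qed.

Lemma rot_mpres c s : c ^+ 2 + s ^+ 2 = 1 -> mpres (gP gsq) (gP gsq) (rot c s).
Proof.
move=> cs; apply: law_unique; first exact: rot_meas.
- move=> l; under eq_Ex do rewrite gX_rot -[gX _ _]mul1r.
  by rewrite gcos expr1n mul1r gcov_rotI.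
- by move=> l; under eq_Ex do rewrite gX_rot -[gX _ _]mul1r; rewrite gsin.
Qed.

(* Since [X' * Y' = (Y ^+ 2 - X ^+ 2) / 2] for the pair (X', Y') obtained from an
   independent copy by a rotation of angle pi / 4, [X ^+ 2] lies in L^p as soon as
   [X] does, and |X ^+ 2 - E (X ^+ 2)|_p <= 2 |X|_p ^+ 2. *)
Lemma gauss_L2 i : memL P 2 (X i) /\ nrm P 2 (X i) ^+ 2 <= gcov i i.
Proof.
have q0 : 0 <= gvar i.
  have := gcos i 1; rewrite expr1n mul1r => h.
  have : Ex P (fun x => cos (1 * X i x)) <= Ex P (fun=> 1).
    apply: le_Ex; [exact/Linf1/cos_Linf|exact/Linf1/Linf_cst|].
    by move=> x; exact: cos_le1.
  by rewrite h Ex_cst -[leRHS](@expR0 R) ler_expR oppr_le0; lra.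
have [m n] : memL P 2 (X i) /\ nrm P 2 (X i) <= Num.sqrt (gvar i).
  apply: memLX => //; [exact: gmeas|].
  (* [u n] is 2 (n+1)^2 (1 - cos(X/(n+1))). It tends to X^2, and its mean, given by the
     characteristic function, is at most the variance because 1 - e^(-x) <= x; Fatou's lemma
     concludes. *)
  pose u n x := 4 * (n.+1%:R * sin (n.+1%:R^-1 * (X i x / 2))) ^+ 2.
  have cu x : u n x @[n --> \oo] --> X i x ^+ 2.
    have -> : X i x ^+ 2 = 4 * (X i x / 2) ^+ 2 by field.
    rewrite /u; under eq_fun do rewrite expr2; rewrite expr2.
    by apply: cvgMr; apply: cvgM; exact: cvg_sin_lin.
  have uE n x : u n x = n.+1%:R ^+ 2 * (2 * (1 - cos (n.+1%:R^-1 * X i x))).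
    rewrite /u (_ : n.+1%:R^-1 * X i x = (n.+1%:R^-1 * (X i x / 2)) *+ 2); last first.
      by rewrite -mulrnAr -(mulr_natr (X i x / 2)) divfK.
    by rewrite mulr2n cosD -!expr2 cos2sin2; ring.
  have Eu n : Ex P (u n) <= gvar i.
    rewrite (eq_Ex _ (uE n)); have L := Linf1 (cos_Linf i n.+1%:R^-1).
    have L1 := Linf1 (Linf_cst P 1).
    have LB := (nrmB (lexx 1) L1 L).1.
    rewrite !ExZ//; last by apply: (nrmZ _ _ LB).1.
    rewrite ExB// Ex_cst gcos; set x := _ ^+ 2 * gvar i / 2.
    have := expR_ge1Dx (- x); have : n.+1%:R ^+ 2 * (2 * x) = gvar i.
      have : n.+1%:R != 0 :> R by rewrite pnatr_eq0.
      by rewrite /x; move: n.+1%:R => a a0; field.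
    move=> <- h; rewrite ler_wpM2l ?sqr_ge0// ler_wpM2l//; lra.
  have u0 n x : 0 <= u n x by rewrite mulr_ge0 ?sqr_ge0.
  have mu n : measurable_fun setT (u n).
    by apply: measurable_funM => //; apply: measurable_funX; apply: measurable_funM => //;
      apply: measurableT_comp; [exact: measurable_sin|apply: measurable_funM => //;
        apply: measurable_funM => //; exact: gmeas].
  rewrite powR_mulrn ?sqrtr_ge0// sqr_sqrtr//.
  rewrite (_ : (\int[P]_x _)%E = (\int[P]_x limn_einf (fun n => (u n x)%:E))%E); last first.
    apply: eq_integral => x _; apply/esym; apply: (cvg_limn_einf_sup _).1.
    apply/cvg_EFin; first by near=> n.
    by rewrite powR_mulrn// real_normK ?num_real//; exact: cu.
  apply: le_trans (fatou _ _ _ _) _ => //.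
  - by move=> n; apply/measurable_EFinP.
  - by move=> n x _; rewrite lee_fin.
  - rewrite limn_einf_lim; apply: lime_le; first exact: is_cvg_einfs.
    near=> n; apply: (@le_trans _ _ (\int[P]_x (u n x)%:E)%E).
      by apply: ereal_inf_lbound; exists n => //=.
    rewrite -[leLHS]fineK; first by rewrite lee_fin; exact: Eu.
    apply: integrable_fin_num => //; apply: memL1_int.
    apply: (Linf1 (P := P)); rewrite (funext (uE n)); apply: LinfZ; apply: LinfZ.
    apply: LinfB; [exact: Linf_cst|exact: cos_Linf].
split=> //; rewrite -[leRHS]sqr_sqrtr// ler_sqr ?nnegrE ?nrm_ge0 ?sqrtr_ge0//.
Unshelve. all: by end_near.
Qed.

Lemma gvar_ge0 (i : gI G) : 0 <= gvar i.
Proof. by apply: le_trans (gauss_L2 i).2; exact: sqr_ge0. Qed.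

Lemma nrm_sqr p (f : T -> R) : 0 < p -> measurable_fun setT f ->
  memL P p (fun x => f x ^+ 2) ->
  memL P (2 * p) f /\ nrm P (2 * p) f ^+ 2 <= nrm P p (fun x => f x ^+ 2).
Proof.
move=> p0 mf m2; set a := nrm P p _; have a0 : 0 <= a by exact: nrm_ge0.
have [|||m n] := @memLX _ _ _ P (2 * p) f (Num.sqrt a) _ mf.
- by rewrite mulr_gt0.
- rewrite powRrM powR_mulrn ?sqrtr_ge0// sqr_sqrtr// -powR_nrm ?gt_eqF//.
  apply: ge0_le_integral => //.
  + by apply/measurable_EFinP; exact: measurable_powRn.
  + by apply/measurable_EFinP; exact: measurable_powRn (memL_meas m2).
  + by move=> x _; rewrite powRrM powR_mulrn// -normrX.
- exact: sqrtr_ge0.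
split=> //; rewrite -[leRHS]sqr_sqrtr// ler_sqr ?nnegrE ?nrm_ge0 ?sqrtr_ge0//.
Qed.

Lemma gauss_double p i : 1 <= p -> memL P (2 * p) (X i) ->
  memL P (2 * (2 * p)) (X i) /\
  nrm P (2 * (2 * p)) (X i) ^+ 2 <= 2 * nrm P (2 * p) (X i) ^+ 2 + gvar i.
Proof.
move=> p1 m; have p0 : 0 < 2 * p by lra.
have p2 : 1 <= 2 * p by lra.
have [m2 n2] := gauss_L2 i.
pose r : R := Num.sqrt 2^-1.
have r2 : r ^+ 2 = 2^-1 by rewrite sqr_sqrtr// invr_ge0.
have rr : r ^+ 2 + r ^+ 2 = 1 by rewrite r2; lra.
have [mA nA] := nrm_prod (f := X i) (g := X i) p0 m m.
have [mB nB] := mpres_memL (rot_mpres rr) mA.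
have eB z : X i (rot r r z).1 * X i (rot r r z).2 = 2^-1 * (X i z.2 ^+ 2 - X i z.1 ^+ 2).
  by rewrite /rot/= !gXmix -r2; ring.
pose D (z : sT) := X i z.1 ^+ 2 - X i z.2 ^+ 2.
have [mD nD] : memL sP (2 * p) D /\ nrm sP (2 * p) D <= 2 * nrm P (2 * p) (X i) ^+ 2.
  have [h1 h2] := nrmZ (-2) p0 mB.
  have e : D = (fun z => -2 * (X i (rot r r z).1 * X i (rot r r z).2)).
    by apply/funext => z; rewrite eB /D; field.
  rewrite e; split=> //; rewrite h2 nB normrN ger0_norm// ler_wpM2l//.
have s1 : memL P 1 (fun x => X i x ^+ 2).
  under eq_fun do rewrite expr2; exact: (memLM22 m2 m2).1.
pose q := Ex P (fun x => X i x ^+ 2).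
have q0 : 0 <= q by apply: Ex_ge0 => x; exact: sqr_ge0.
have qv : q <= gvar i by rewrite /q -nrm2E.
(* Integrating out the second coordinate leaves X^2 minus its mean, at no cost in norm. *)
have [|mC nC] := @cond_nrm _ _ _ _ _ P P _ D p2 mD.
  by move=> x; rewrite /D/=; exact: (nrmB (lexx 1) (memL_cst P (X i x ^+ 2) ltr01) s1).1.
have eC : (fun x => Ex P (fun y => D (x, y))) = (fun x => X i x ^+ 2 - q).
  by apply/funext => x; rewrite /D/= ExB ?Ex_cst//; exact: memL_cst.
rewrite eC in mC nC.
have mq := memL_cst P q p0.
have [m4 n4] := nrmD p2 mC mq.
have e4 : (fun x => X i x ^+ 2 - q + q) = (fun x => X i x ^+ 2).
  by apply/funext => x; rewrite subrK.
rewrite e4 in m4 n4.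
have [m5 n5] := nrm_sqr p0 (gmeas i) m4; split=> //.
apply: (le_trans n5); apply: (le_trans n4).
have : nrm P (2 * p) (fun=> q) <= q.
  by apply: (memL_bounded P p0 _ _).2 => // x; rewrite ger0_norm.
move: nC nD qv; lra.
Qed.

(** The recursion a -> 2 a + 1 given by [gauss_double], started at 1. *)
Lemma gauss_pow2 m i : memL P (2 ^+ m.+1) (X i) /\
  nrm P (2 ^+ m.+1) (X i) ^+ 2 <= (2 ^+ m.+1 - 1) * gvar i.
Proof.
elim: m => [|m [h1 h2]].
  by rewrite expr1; have [h1 h2] := gauss_L2 i; split=> //; lra.
have [||m1 n1] := @gauss_double (2 ^+ m) i.
- by rewrite exprn_ege1// ler1n.
- by rewrite -exprS.
rewrite -!exprS in m1 n1 *; split=> //; apply: (le_trans n1).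
by move: h2; rewrite (exprS 2 m.+1); move: (2 ^+ m.+1) (_ ^+ 2) (gcov i i) => a b c; lra.
Qed.

(** The least 2^(m+1) above p is at most 4 p. The growth like the square root of p is what makes
    exponentials of [X i] integrable. *)
Lemma gauss_nrm p i : 1 <= p ->
  memL P p (X i) /\ nrm P p (X i) <= Num.sqrt (4 * p * gvar i).
Proof.
move=> p1; have p0 : 0 < p by exact: lt_le_trans p1.
have q0 := gvar_ge0 i.
have [m [h1 h2]] : exists m : nat, p <= 2 ^+ m.+1 /\ 2 ^+ m.+1 <= 4 * p.
  have e : exists n : nat, p <= 2 ^+ n.+1.
    exists (Num.truncn p); apply: ltW; apply: (lt_le_trans (truncnS_gt _)).
    by rewrite -natrX ler_nat ltnW// ltn_expl.
  have [n pn minn] := ex_minnP e; exists n; split=> //.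
  case: n pn minn => [|n] pn minn; first by lra.
  have : ~~ (p <= 2 ^+ n.+1) by apply/negP => /minn; rewrite ltnn.
  by rewrite -ltNge (exprS 2 n.+1); move: (2 ^+ n.+1) => a; lra.
have [m1 n1] := gauss_pow2 m i; have [m2 n2] := memL_le p0 h1 m1.
split=> //; apply: (le_trans n2).
rewrite -[leLHS]ger0_norm ?nrm_ge0// -sqrtr_sqr; apply: ler_wsqrtr.
by apply: (le_trans n1); rewrite ler_wpM2r//; lra.
Qed.

Lemma Linf_gX i : Linf P (X i).
Proof. by move=> p p1; exact: (gauss_nrm i p1).1. Qed.

Lemma Linf_gXX i n : Linf P (fun x => X i x ^+ n).
Proof. exact: LinfX (Linf_gX i). Qed.

Lemma fact_expn (n : nat) : (n%:R ^+ n : R) <= n`!%:R * expR n%:R.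
Proof.
case: n => [|n]; first by rewrite expr0 fact0 expR0 mulr1.
have nf : 0 < n.+1`!%:R :> R by rewrite ltr0n fact_gt0.
rewrite -ler_pdivrMl// mulrC; apply: le_trans (expR_ge1Dxn n _) => //.
by rewrite lerDr.
Qed.

(** By the moment bound and n^n <= n! e^n, the n-th term of the exponential series has L^p norm at
    most (b / sqrt n)^n, hence at most 2^(-n) once n > 4 b^2. Fatou's lemma passes from partial sums
    to the sum. *)
Lemma exp_gX_memL p i : 1 <= p -> memL P p (fun x => expR `|X i x|).
Proof.
move=> p1; have p0 : 0 < p by exact: lt_le_trans p1.
pose t n x : R := exp_coeff `|X i x| n.
pose s n x := series (exp_coeff `|X i x|) n.
pose q := 4 * p * gvar i; have q0 : 0 <= q by rewrite !mulr_ge0 ?gvar_ge0//; lra.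
pose b := expR 1 * Num.sqrt q.
have b0 : 0 <= b by rewrite mulr_ge0 ?expR_ge0 ?sqrtr_ge0.
have tb n : (0 < n)%N -> memL P p (t n) /\ nrm P p (t n) <= (b / Num.sqrt n%:R) ^+ n.
  move=> n0; have nR : 0 < n%:R :> R by rewrite ltr0n.
  have np : 1 <= n%:R * p.
    have : 1 <= n%:R :> R by rewrite ler1n.
    by nra.
  have [m1 n1] := gauss_nrm i np.
  have [m2 n2] := nrmXn p1 n0 m1.
  have e x : `|t n x| = `|n`!%:R^-1 * X i x ^+ n|.
    rewrite /t /exp_coeff/= normrM normrX normr_id normfV [RHS]normrM mulrC.
    by rewrite normfV normrX.
  have [m3 n3] := nrmZ n`!%:R^-1 p0 m2.
  have mt : measurable_fun setT (t n).
    apply: measurable_funM => //; apply: measurable_funX.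
    by apply: measurableT_comp => //; exact: gmeas.
  split; first exact: memL_ext m3.
  rewrite (nrm_ext _ _ e) n3 normfV normr_nat.
  have nf : 0 < n`!%:R :> R by rewrite ltr0n fact_gt0.
  rewrite ler_pdivrMl//; apply: (le_trans n2).
  have e2 : Num.sqrt (4 * (n%:R * p) * gvar i) = Num.sqrt q * Num.sqrt n%:R.
    by rewrite -sqrtrM//; congr Num.sqrt; rewrite /q; ring.
  apply: (@le_trans _ _ ((Num.sqrt q * Num.sqrt n%:R) ^+ n)).
    by rewrite lerXn2r ?nnegrE ?nrm_ge0 ?mulr_ge0 ?sqrtr_ge0// -e2.
  have sn : 0 < Num.sqrt n%:R :> R by rewrite sqrtr_gt0.
  have -> : Num.sqrt q * Num.sqrt n%:R = n%:R * (Num.sqrt q / Num.sqrt n%:R).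
    rewrite -{2}(@sqr_sqrtr _ n%:R)//; field; rewrite gt_eqF//.
  rewrite exprMn /b -mulrA (exprMn n (expR 1)) mulrA.
  rewrite ler_wpM2r ?exprn_ge0 ?divr_ge0 ?sqrtr_ge0//.
  by rewrite -expRM_natr mul1r; exact: fact_expn.
have mt0 n : memL P p (t n).
  case: n => [|n]; last exact: (tb n.+1 isT).1.
  rewrite /t /exp_coeff/=; under eq_fun do rewrite expr0; exact: memL_cst.
have [N hN] : exists N : nat, forall n, (N < n)%N -> nrm P p (t n) <= 2^-1 ^+ n.
  exists (Num.truncn (4 * b ^+ 2)) => n hn.
  have n0 : (0 < n)%N by exact: leq_ltn_trans hn.
  have hn2 : 4 * b ^+ 2 < n%:R.
    by apply: (lt_le_trans (truncnS_gt _)); rewrite ler_nat.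
  apply: (le_trans (tb n n0).2); rewrite lerXn2r ?nnegrE ?divr_ge0 ?sqrtr_ge0//.
  have sn : 0 < Num.sqrt n%:R :> R by rewrite sqrtr_gt0 ltr0n.
  rewrite ler_pdivrMr//; have : 2 * b <= Num.sqrt n%:R.
    rewrite -[leLHS]ger0_norm ?mulr_ge0// -sqrtr_sqr; apply: ler_wsqrtr.
    have -> : (2 * b) ^+ 2 = 4 * b ^+ 2 by ring.
    exact: ltW.
  by lra.
pose C := \sum_(k < N.+1) nrm P p (t k) + 1.
have sC n : memL P p (s n) /\ nrm P p (s n) <= \sum_(k < n) nrm P p (t k).
  elim: n => [|n [m1 n1]].
    rewrite /s /series/= big_ord0; under eq_fun do rewrite big_geq//; split; first exact: memL_cst.
    by apply: (memL_bounded P p0 _ _).2 => // x; rewrite normr0.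
  have e : s n.+1 = (fun x => s n x + t n x).
    by apply/funext => x; rewrite /s /series/= big_nat_recr.
  rewrite e big_ord_recr/=; have [m2 n2] := nrmD p1 m1 (mt0 n).
  by split=> //; apply: (le_trans n2); rewrite lerD2r.
have sumC n : \sum_(k < n) nrm P p (t k) <= C.
  have C1 m : \sum_(k < N.+1 + m) nrm P p (t k) <=
      \sum_(k < N.+1) nrm P p (t k) + (1 - 2^-1 ^+ m).
    elim: m => [|m IH]; first by rewrite addn0 expr0 subrr addr0.
    rewrite addnS big_ord_recr/=; apply: (le_trans (lerD IH (hN _ _))).
      by rewrite leq_addr.
    have : 2^-1 ^+ (N.+1 + m) <= 2^-1 ^+ m.+1 :> R.
      by rewrite ler_wiXn2l ?invr_ge0// ?invf_le1 ?ler1n// addSn ltnS leq_addl.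
    by rewrite exprS; set c := 2^-1 ^+ m; lra.
  apply: (@le_trans _ _ (\sum_(k < N.+1 + n) nrm P p (t k))).
    rewrite addnC big_split_ord/= lerDl; apply: sumr_ge0 => k _; exact: nrm_ge0.
  apply: (le_trans (C1 n)); rewrite /C lerD2l gerBl; exact: exprn_ge0.
have C0 : 0 <= C by rewrite addr_ge0// sumr_ge0// => k _; exact: nrm_ge0.
apply: (nrm_fatou p0 C0 (fun n => (sC n).1) (fun n => le_trans (sC n).2 (sumC n)) _).1.
by move=> x; exact: (is_cvg_series_exp_coeff `|X i x|).
Qed.

End square.

(** * Hermite polynomials and the chaos decomposition *)

Section hermite.
Context {R : realType}.
Implicit Types (q x y c : R).

(* The monic Hermite polynomials of N(0, q). *)
Fixpoint he q n x : R :=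
  if n is m.+1 then x * he q m x - m%:R * q * (if m is k.+1 then he q k x else 0)
  else 1.

Lemma he0 q x : he q 0 x = 1. Proof. by []. Qed.
Lemma he1 q x : he q 1 x = x. Proof. by rewrite /= mulr1 !mulr0 subr0. Qed.
Lemma heS q n x : he q n.+1 x = x * he q n x - n%:R * q * he q n.-1 x.
Proof. by case: n => [|n]//=; rewrite !mul0r. Qed.

Lemma he_ind2 (K : nat -> Prop) : K 0%N -> (forall n, K n -> K n.-1 -> K n.+1) -> forall n, K n.
Proof.
move=> K0 KS n; suff : K n /\ K n.-1 by case.
by elim: n => [|n [h1 h2]]; split=> //; exact: KS.
Qed.

Lemma he_scale q c n x : he (c ^+ 2 * q) n (c * x) = c ^+ n * he q n x.
Proof.
elim/he_ind2: n => [|n h1 h2]; first by rewrite !he0 expr0 mul1r.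
rewrite !heS h1 h2; case: n {h1 h2} => [|n]/=; first by rewrite expr0 expr1; ring.
rewrite !exprS; ring.
Qed.

(** The generating functions exp(t x - t^2 q / 2) multiply. In terms of coefficients: u_n = he_n /
    n! satisfies (n+1) u_(n+1) = z u_n - q u_(n-1), and the Cauchy product of two such sequences
    satisfies the same recurrence with [z] and [q] added. *)
Lemma he_add q1 q2 n x y : he (q1 + q2) n (x + y) =
  \sum_(k < n.+1) 'C(n, k)%:R * (he q1 (n - k) x * he q2 k y).
Proof.
pose a n := he q1 n x / n`!%:R; pose b n := he q2 n y / n`!%:R.
(* The shift, extended by 0 so that the recurrence also covers index 0. *)
pose sh (u : nat -> R) n := if n is m.+1 then u m else 0.
have rec q z (u := fun n => he q n z / n`!%:R) m :
    m.+1%:R * u m.+1 = z * u m - q * sh u m.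
  rewrite /u heS factS; have mf k : k`!%:R != 0 :> R by rewrite pnatr_eq0 -lt0n fact_gt0.
  case: m => [|m]; first by rewrite /sh fact0 muln1 !mul0r !divr1 mul1r mulr0 !subr0.
  have m1 : m.+1%:R != 0 :> R by rewrite pnatr_eq0.
  have m2 : m.+2%:R != 0 :> R by rewrite pnatr_eq0.
  have F (a' b' c h1 h0 : R) : a' != 0 -> b' != 0 -> c != 0 ->
      a' * ((z * h1 - b' * q * h0) / (a' * (b' * c))) = z * (h1 / (b' * c)) - q * (h0 / c).
    by move=> a0 b0 c0; field; rewrite a0 b0 c0.
  by rewrite /sh factS !natrM; apply: F; rewrite ?mf.
pose cv (u v : nat -> R) n := \sum_(k < n.+1) u (n - k)%N * v k.
have cvC u v m : cv u v m = cv v u m.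
  rewrite /cv (reindex_inj rev_ord_inj)/=; apply: eq_bigr => k _.
  by rewrite mulrC subSS subKn// -ltnS.
have cvsh u v m : cv (sh u) v m = sh (cv u v) m.
  rewrite /cv big_ord_recr/= subnn mul0r addr0; case: m => [|m]; first by rewrite big_ord0.
  by apply: eq_bigr => k _; rewrite subSn// -ltnS.
have half (u v : nat -> R) (z q : R) (m : nat) : (forall m, m.+1%:R * u m.+1 = z * u m - q * sh u m) ->
    \sum_(k < m.+2) (m.+1 - k)%N%:R * (u (m.+1 - k)%N * v k) = z * cv u v m - q * sh (cv u v) m.
  move=> hu; rewrite big_ord_recr/= subnn mul0r addr0 -cvsh /cv !mulr_sumr -sumrB.
  apply: eq_bigr => k _; have km : (k <= m)%N by rewrite -ltnS.
  by rewrite mulrA subSn// hu; ring.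
have gam m : m.+1%:R * cv a b m.+1 = (x + y) * cv a b m - (q1 + q2) * sh (cv a b) m.
  have -> : m.+1%:R * cv a b m.+1 =
    \sum_(k < m.+2) (m.+1 - k)%N%:R * (a (m.+1 - k)%N * b k) +
    \sum_(k < m.+2) (m.+1 - k)%N%:R * (b (m.+1 - k)%N * a k).
    rewrite [X in _ + X](reindex_inj rev_ord_inj)/= -big_split/= /cv mulr_sumr.
    apply: eq_bigr => k _; have km : (k <= m.+1)%N by rewrite -ltnS.
    rewrite subSS subKn// (mulrC (b _)) -mulrDl -natrD subnK//.
  rewrite (half a b x q1) ?(half b a y q2); try by move=> ?; exact: rec.
  rewrite (cvC b a); case: m => [|m]/=; first by ring.
  by rewrite (cvC b a); ring.
have fin m : he (q1 + q2) m (x + y) = m`!%:R * cv a b m.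
  elim/he_ind2: m => [|m h1 h2].
    by rewrite /cv big_ord_recl big_ord0 /a /b/= !fact0; field.
  rewrite heS h1 h2 factS natrM.
  have -> : m.+1%:R * m`!%:R * cv a b m.+1 = m`!%:R * (m.+1%:R * cv a b m.+1).
    by rewrite [RHS]mulrCA mulrA.
  rewrite gam; case: m {h1 h2} => [|m]/=.
    by rewrite fact0; ring.
  by rewrite factS natrM; ring.
rewrite fin /cv mulr_sumr; apply: eq_bigr => k _; have kn : (k <= n)%N by rewrite -ltnS.
have mf i : i`!%:R != 0 :> R by rewrite pnatr_eq0 -lt0n fact_gt0.
rewrite /a /b -(bin_fact kn) !natrM; field; by rewrite !mf.
Qed.
End hermite.

Arguments he : simpl never.

Lemma is_derive_mul (R : realType) (u v : R -> R) (t du dv : R) :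
  is_derive t 1 u du -> is_derive t 1 v dv ->
  is_derive t 1 (fun t => u t * v t) (du * v t + u t * dv).
Proof.
move=> uD vD; have := is_deriveM uD vD.
by rewrite /GRing.scale/= addrC (mulrC (v t)).
Qed.

Lemma is_derive_ext (R : realType) (u v : R -> R) (t du dv : R) :
  is_derive t 1 u du -> (forall x, v x = u x) -> dv = du -> is_derive t 1 v dv.
Proof. by move=> D /funext -> ->. Qed.

(** * Differentiation under the expectation *)

Section jets.
Context {R : realType} {d : measure_display} {T : measurableType d}.
Variable P : probability T R.
Implicit Types (f df g dg : R -> T -> R).

(** Pairs of a family and its [t]-derivative, where the family is a finite sum of terms u(t) h(x).
    The class is closed under sums, products and Hermite polynomials, and on it derivative and
    expectation commute by linearity alone, with no domination argument. *)
Inductive jet : (R -> T -> R) -> (R -> T -> R) -> Prop :=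
| jet_nil : jet (fun _ _ => 0) (fun _ _ => 0)
| jet_cons (u du : R -> R) (h : T -> R) f df : (forall t : R, is_derive t 1 u (du t)) -> Linf P h ->
    jet f df -> jet (fun t x => u t * h x + f t x) (fun t x => du t * h x + df t x).

Lemma jet_ext f df g dg : jet f df -> (forall t x, g t x = f t x) ->
  (forall t x, dg t x = df t x) -> jet g dg.
Proof.
move=> j e1 e2; have -> : g = f by apply/funext => t; apply/funext => x.
by have -> : dg = df by apply/funext => t; apply/funext => x.
Qed.

Lemma jet_term (u du : R -> R) (h : T -> R) : (forall t : R, is_derive t 1 u (du t)) ->
  Linf P h -> jet (fun t x => u t * h x) (fun t x => du t * h x).
Proof.
by move=> uD hL; apply: (jet_ext (jet_cons uD hL jet_nil)) => t x; rewrite addr0.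
Qed.

Lemma jet_cst (h : T -> R) : Linf P h -> jet (fun _ x => h x) (fun _ _ => 0).
Proof.
by move=> hL; apply: (jet_ext (@jet_term (cst 1) (cst 0) h _ hL)) => t x; rewrite /= ?mul1r ?mul0r.
Qed.

Lemma jetD f df g dg : jet f df -> jet g dg ->
  jet (fun t x => f t x + g t x) (fun t x => df t x + dg t x).
Proof.
move=> jf jg; elim: jf => [|u du h f' df' uD hL jf IH].
  by apply: (jet_ext jg) => t x; rewrite add0r.
by apply: (jet_ext (jet_cons uD hL IH)) => t x; rewrite addrA.
Qed.

Lemma jetM f df g dg : jet f df -> jet g dg ->
  jet (fun t x => f t x * g t x) (fun t x => df t x * g t x + f t x * dg t x).
Proof.
move=> jf jg; elim: jf => [|u du h f' df' uD hL jf IH].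
  by apply: (jet_ext jet_nil) => t x; rewrite ?mul0r ?addr0.
have jt : jet (fun t x => u t * h x * g t x) (fun t x => du t * h x * g t x + u t * h x * dg t x).
  elim: jg => [|v dv k g' dg' vD kL jg IH2].
    by apply: (jet_ext jet_nil) => t x; rewrite ?mulr0 ?addr0.
  have uvD (t : R) : is_derive t 1 (fun t => u t * v t) (du t * v t + u t * dv t).
    exact: is_derive_mul.
  by apply: (jet_ext (jet_cons uvD (LinfM hL kL) IH2)) => t x; ring.
by apply: (jet_ext (jetD jt IH)) => t x; ring.
Qed.

Lemma jet_Linf f df : jet f df -> forall t, Linf P (f t) /\ Linf P (df t).
Proof.
elim=> {f df} [|u du h f df uD hL _ IH] t; first by split; exact: (Linf_cst P 0).
by have [h1 h2] := IH t; split; apply: LinfD => //; exact: LinfZ.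
Qed.

Lemma jet_Ex f df (F : T -> R) : memL P 2 F -> jet f df -> forall t : R,
  is_derive t 1 (fun t => Ex P (fun x => F x * f t x)) (Ex P (fun x => F x * df t x)).
Proof.
move=> mF; elim=> {f df} [|u du h f df uD hL jf IH] t.
  under [X in is_derive _ _ X]funext => s do under eq_Ex do rewrite mulr0.
  by under [X in is_derive _ _ _ X]eq_Ex do rewrite mulr0; rewrite Ex_cst; exact: is_derive_cst.
have m1 : memL P 1 (fun x => F x * h x) by apply: (memLM22 mF (Linf2 hL)).1.
have m2 s : memL P 1 (fun x => F x * f s x) by apply: (memLM22 mF (Linf2 (jet_Linf jf s).1)).1.
have m3 s : memL P 1 (fun x => F x * df s x) by apply: (memLM22 mF (Linf2 (jet_Linf jf s).2)).1.
have e1 : (fun t => Ex P (fun x => F x * (u t * h x + f t x))) =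
    (fun t => u t * Ex P (fun x => F x * h x) + Ex P (fun x => F x * f t x)).
  apply/funext => s; rewrite -ExZ// -ExD//; first by apply: eq_Ex => x; ring.
  exact: (nrmZ _ _ m1).1.
rewrite e1.
have -> : Ex P (fun x => F x * (du t * h x + df t x)) =
    du t * Ex P (fun x => F x * h x) + Ex P (fun x => F x * df t x).
  rewrite -ExZ// -ExD//; first by apply: eq_Ex => x; ring.
  exact: (nrmZ _ _ m1).1.
apply: is_deriveD; rewrite -[X in is_derive _ _ _ X]addr0 -(mulr0 (u t)).
exact: is_derive_mul (uD t) (is_derive_cst _ _ _).
Qed.

(** In the variance variable Hermite polynomials solve the backward heat equation: the derivative of
    he_n in [q] is - C(n,2) he_(n-2). *)
Lemma jet_he (q dq : R -> R) f df n : (forall t : R, is_derive t 1 q (dq t)) -> jet f df ->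
  jet (fun t x => he (q t) n (f t x))
      (fun t x => n%:R * he (q t) n.-1 (f t x) * df t x
         - 'C(n, 2)%:R * he (q t) n.-2 (f t x) * dq t).
Proof.
move=> qD jf; elim/he_ind2: n => [|n h1 h2].
  apply: (jet_ext (jet_cst (Linf_cst P 1))) => t x //=.
  by rewrite !mul0r subr0.
have jq : jet (fun t _ => - n%:R * q t) (fun t _ => - n%:R * dq t).
  have qD' (t : R) : is_derive t 1 (fun t => - n%:R * q t) (- n%:R * dq t).
    exact: is_deriveZ.
  by apply: (jet_ext (jet_term qD' (Linf_cst P 1))) => t x; rewrite mulr1.
apply: (jet_ext (jetD (jetM jf h1) (jetM jq h2))) => t x; first by rewrite heS; ring.
have cE m : 'C(m.+1, 2)%:R = (m%:R + 1) * m%:R / 2 :> R.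
  have := congr1 (fun k : nat => k%:R : R) (mul_bin_diag m.+1 1); rewrite /= bin1 !natrM.
  by rewrite -natr1; lra.
case: n {h1 h2 jq} => [|[|n]].
- by rewrite /= !he0 (bin_small (n := 0))// (bin_small (n := 1))//; ring.
- by rewrite /= !he0 he1 binn (bin_small (n := 1))// (bin_small (n := 0))//; ring.
by rewrite !cE (heS _ n.+1) (heS _ n)/= -!natr1; field.
Qed.
End jets.

(** * Hermite functionals: density, means and Mehler averages *)

Section chaos.
Context {R : realType} (G : gspace R).
Local Notation T := (gT G).
Local Notation P := (gP G).
Local Notation X := (@gX R G).
Local Notation Q := (gP (gsq G)).

Lemma Linf_he (d : measure_display) (T' : measurableType d) (P' : probability T' R)
  (q : R) n (f : T' -> R) : Linf P' f -> Linf P' (fun x => he q n (f x)).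
Proof.
move=> fL; elim/he_ind2: n => [|n h1 h2]; first exact: (Linf_cst P' 1).
under eq_fun do rewrite heS; apply: LinfB; first exact: LinfM.
exact: LinfZ.
Qed.

(** The Hermite polynomial of degree [l.1] in the variable [l.2], normalised by its variance. For
    fixed degree these functionals span the Wiener chaos of that order. *)
Definition ge (l : nat * gI G) (x : T) : R := he (gvar l.2) l.1 (X l.2 x).

Lemma Linf_ge l : Linf P (ge l).
Proof. exact: Linf_he (Linf_gX l.2). Qed.

Lemma pow_span i n : exists phi, forall x, fev ge phi x = X i x ^+ n.
Proof.
suff [phi h] : exists phi : seq (R * nat), forall x,
    \sum_(c <- phi) c.1 * he (gvar i) c.2 (X i x) = X i x ^+ n.
  by exists [seq (c.1, (c.2, i)) | c <- phi] => x; rewrite /fev big_map -h.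
elim: n => [|n [phi h]].
  by exists [:: (1, 0%N)] => x; rewrite big_seq1 he0 mulr1 expr0.
exists ([seq (c.1, c.2.+1) | c <- phi] ++
   [seq (c.1 * (c.2%:R * gvar i), c.2.-1) | c <- phi]) => x.
rewrite big_cat/= !big_map/= -big_split/= exprS -h mulr_sumr.
by apply: eq_bigr => c _; rewrite heS; ring.
Qed.

Definition apx p (f : T -> R) := forall eps : R, 0 < eps ->
  exists phi, nrm P p (fun x => f x - fev ge phi x) <= eps.

Lemma apx_lin p f g a : 1 <= p -> memL P p f -> memL P p g -> apx p f -> apx p g ->
  apx p (fun x => f x + a * g x).
Proof.
move=> p1 mf mg hf hg eps e0; have p0 : 0 < p by exact: lt_le_trans p1.
have L phi : memL P p (fev ge phi) by apply: Linf_fev => //; exact: Linf_ge.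
have e2 : 0 < eps / (2 * (`|a| + 1)) by rewrite divr_gt0// mulr_gt0// ltr_wpDl.
have [phi h1] := hf _ (divr_gt0 e0 (ltr0n R 2)); have [psi h2] := hg _ e2.
exists (fcomb phi a psi); have [m1 _] := nrmB p1 mf (L phi); have [m2 _] := nrmB p1 mg (L psi).
have [m3 n3] := nrmZ a p0 m2; have [_ n4] := nrmD p1 m1 m3.
rewrite (nrm_ext P p (g := fun x => f x - fev ge phi x + a * (g x - fev ge psi x))); last first.
  by move=> x; rewrite fev_comb; congr `|_|; ring.
apply: (le_trans n4); rewrite n3; have := half_le (normr_ge0 a) e0.
have : `|a| * nrm P p (fun x => g x - fev ge psi x) <= `|a| * (eps / (2 * (`|a| + 1))).
  by rewrite ler_wpM2l.
lra.
Qed.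

(** The partial sums are polynomials in one variable [X i], dominated by exp |X i|, which lies in
    every L^p. *)
Lemma apx_series p i (a : nat -> R) (f : T -> R) : 1 <= p -> measurable_fun setT f ->
  (forall k, `|a k| <= k`!%:R^-1) ->
  (forall x, (\sum_(0 <= k < n) a k * X i x ^+ k) @[n --> \oo] --> (f x : R)) -> apx p f.
Proof.
move=> p1 mf ha cf eps e0; pose s n x := \sum_(0 <= k < n) a k * X i x ^+ k.
have cs n : exists phi, forall x, fev ge phi x = s n x.
  elim: n => [|n [phi h]]; first by exists [::] => x; rewrite /s big_geq// /fev big_nil.
  have [psi h2] := pow_span i n; exists (fcomb phi (a n) psi) => x.
  by rewrite fev_comb h h2 /s big_nat_recr.
have ms n : measurable_fun setT (s n).
  have [phi h] := cs n; rewrite -(funext h); apply: (Linf_meas (P := P)).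
  by apply: Linf_fev; exact: Linf_ge.
have sb n x : `|s n x| <= expR `|X i x|.
  apply: (@le_trans _ _ (series (exp_coeff `|X i x|) n)).
    rewrite /s /series/=; apply: (le_trans (ler_norm_sum _ _ _)).
    by apply: ler_sum => k _; rewrite normrM normrX /exp_coeff/= mulrC ler_wpM2l ?exprn_ge0.
  apply: nondecreasing_cvgn_le; last exact: is_cvg_series_exp_coeff.
  by apply/nondecreasing_seqP => k; rewrite /series/= big_nat_recr//= lerDl exp_coeff_ge0.
have /cvgr0Pnorm_lt /(_ _ e0) [N _ /(_ N (leqnn _)) h] :=
  dominated_nrm p1 ms mf (exp_gX_memL i p1) sb cf.
have [phi hphi] := cs N; exists phi; apply: le_trans (ltW h).
apply: le_trans (ler_norm _); rewrite le_eqVlt; apply/orP; left; apply/eqP.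
by apply: nrm_ext => x; rewrite hphi distrC.
Qed.

Lemma apx_trig p e : 1 <= p -> trig e -> apx p e.
Proof.
move=> p1; have p0 : 0 < p by exact: lt_le_trans p1.
have c0 : apx p (fun=> 0).
  move=> eps e0; exists [::]; apply: le_trans (ltW e0).
  rewrite (nrm_ext P p (g := fun=> 0)); last by move=> x; rewrite /fev big_nil subr0.
  by apply: (memL_bounded P p0 _ _).2 => // x; rewrite normr0.
have m0 : memL P p (fun=> 0 : R) by exact: memL_cst.
have mt f : trig f -> memL P p f.
  by move=> tf; have [M _ hM] := trig_bnd tf; apply: (memL_bounded P p0 (trig_meas tf) hM).1.
elim=> {e} [c|i|i|f g tf hf tg hg|c f tf hf].
- move=> eps e0; exists [:: (c, (0%N, gi0 G))]; apply: le_trans (ltW e0).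
  rewrite (nrm_ext P p (g := fun=> 0)); last first.
    by move=> x; rewrite /fev big_seq1 /ge he0 mulr1 subrr.
  by apply: (memL_bounded P p0 _ _).2 => // x; rewrite normr0.
- apply: (@apx_series p i (fun n => (~~ odd n)%:R * (-1) ^+ n./2 / n`!%:R)) => //.
  + exact: trig_meas (trig_cos i).
  + move=> k; rewrite !normrM normrX normrN1 expr1n mulr1 normfV !normr_nat.
    by case: (odd k); rewrite ?mul1r// mul0r invr_ge0.
  + move=> x; rewrite cos.unlock.
    have := @is_cvg_series_cos_coeff R (X i x); apply: cvg_trans.
    apply: near_eq_cvg; near=> n; rewrite /series/=; apply: eq_bigr => k _.
    by rewrite /cos_coeff/= -exprnP; ring.
- apply: (@apx_series p i (fun n => (odd n)%:R * (-1) ^+ n.-1./2 / n`!%:R)) => //.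
  + exact: trig_meas (trig_sin i).
  + move=> k; rewrite !normrM normrX normrN1 expr1n mulr1 normfV !normr_nat.
    by case: (odd k); rewrite ?mul1r// mul0r invr_ge0.
  + move=> x; rewrite sin.unlock.
    have := @is_cvg_series_sin_coeff R (X i x); apply: cvg_trans.
    apply: near_eq_cvg; near=> n; rewrite /series/=; apply: eq_bigr => k _.
    by rewrite /sin_coeff/=; ring.
- have -> : (fun x => f x + g x) = (fun x => f x + 1 * g x) by apply/funext => x; rewrite mul1r.
  by apply: apx_lin => //; exact: mt.
- have -> : (fun x => c * f x) = (fun x => 0 + c * f x) by apply/funext => x; rewrite add0r.
  by apply: apx_lin => //; exact: mt.
Unshelve. all: by end_near.
Qed.

Lemma apx_trans p f g eps : 1 <= p -> memL P p f -> memL P p g -> apx p g ->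
  nrm P p (fun x => f x - g x) <= eps / 2 -> 0 < eps ->
  exists phi, nrm P p (fun x => f x - fev ge phi x) <= eps.
Proof.
move=> p1 mf mg hg h e0; have [phi h2] := hg _ (divr_gt0 e0 (ltr0n R 2)).
have L : memL P p (fev ge phi) by apply: Linf_fev => //; exact: Linf_ge.
exists phi; rewrite (nrm_ext P p (g := fun x => (f x - g x) + (g x - fev ge phi x))); last first.
  by move=> x; congr `|_|; ring.
have [_ n] := nrmD p1 (nrmB p1 mf mg).1 (nrmB p1 mg L).1.
by apply: (le_trans n); lra.
Qed.

(** Truncation reduces to bounded functionals, [trig_dense] to trigonometric polynomials, and these
    are sums of power series in single variables, treated by [apx_series]. *)
Lemma chaos_dense p F : 1 <= p -> memL P p F -> apx p F.
Proof.
move=> p1 mF; have p0 : 0 < p by exact: lt_le_trans p1.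
have bnd (f : T -> R) (M : R) : measurable_fun setT f -> (forall x, `|f x| <= M) -> apx p f.
  move=> mf hf eps e0; have mpf : memL P p f by apply: (memL_bounded P p0 mf hf).1.
  have [e te [h _]] := trig_dense P (phi := idfun) (@measurable_id _ _ setT) p1 mf hf (divr_gt0 e0 (ltr0n R 2)).
  apply: apx_trans mpf _ _ h e0 => //; last exact: apx_trig.
  by have [N _ hN] := trig_bnd te; apply: (memL_bounded P p0 (trig_meas te) hN).1.
pose f n x := Num.max (- n%:R) (Num.min n%:R (F x)).
have mF' := memL_meas mF.
have mf n : measurable_fun setT (f n).
  by apply: measurable_maxr => //; apply: measurable_minr.
have fb n x : `|f n x| <= n%:R.
  rewrite /f ler_norml le_max ge_max ge_min !lexx/= andbT.
  by rewrite (@le_trans _ _ 0)// oppr_le0.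
have ff n x : `|f n x| <= `|F x|.
  rewrite /f; have := ler0n R n; move: n%:R (F x) => a b a0.
  have e1 : - `|b| <= a by rewrite (@le_trans _ _ 0)// oppr_le0.
  have e2 : - `|b| <= b by have := ler_norm (- b); rewrite normrN; lra.
  have e3 : - a <= `|b| by rewrite (@le_trans _ _ 0)// oppr_le0.
  have e4 := ler_norm b.
  by rewrite ler_norml le_max le_min ge_max ge_min e1 e2 e3 e4 !orbT.
have cf x : f n x @[n --> \oo] --> F x.
  apply: cvg_near_cst; near=> n.
  have : `|F x| <= n%:R by near: n; exact: nbhs_infty_ger.
  by rewrite ler_norml => /andP[h1 h2]; rewrite /f min_r// max_r.
have mab : memL P p (fun x => `|F x|).
  by apply: memL_ext (mF) => [|x]; rewrite ?normr_id//; exact: measurableT_comp.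
move=> eps e0.
have /cvgr0Pnorm_lt /(_ _ (divr_gt0 e0 (ltr0n R 2))) [N _ /(_ N (leqnn _)) h] :=
  dominated_nrm p1 mf mF' mab ff cf.
apply: (apx_trans (g := f N)) => //.
- by apply: (memL_bounded P p0 (mf N) (fb N)).1.
- exact: bnd (fb N).
- apply: le_trans (ltW h); apply: le_trans (ler_norm _).
  rewrite le_eqVlt; apply/orP; left; apply/eqP.
  by apply: nrm_ext => x; rewrite distrC.
Unshelve. all: by end_near.
Qed.

Lemma cvg_nrm1_Ex (f : nat -> T -> R) g : (forall n, memL P 1 (f n)) -> memL P 1 g ->
  nrm P 1 (fun x => f n x - g x) @[n --> \oo] --> (0 : R) ->
  Ex P (f n) @[n --> \oo] --> Ex P g.
Proof.
move=> mf mg h; apply/subr_cvg0; apply/norm_cvg0P.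
apply: (@squeeze_cvgr _ _ _ _ (cst 0) (fun n => nrm P 1 (fun x => f n x - g x))) => //.
  near=> n; rewrite normr_ge0/= -ExB//; apply: Ex_le_nrm => //.
  exact: (nrmB (lexx 1) (mf n) mg).1.
exact: cvg_cst.
Unshelve. all: by end_near.
Qed.

Lemma norm_sin_le (t : R) : `|sin t| <= `|t|.
Proof.
wlog t0 : t / 0 <= t.
  move=> h; have [/h//|t0] := leP 0 t.
  by rewrite -normrN -sinN -(normrN t); apply: h; rewrite oppr_ge0 ltW.
have [->|tn] := eqVneq t 0; first by rewrite sin0.
have tp : 0 < t by rewrite lt_def tn.
have [|c _] := @MVT R sin cos 0 t tp.
  by apply: continuous_subspaceT; exact: continuous_sin.
rewrite sin0 !subr0 => ->; rewrite normrM -[leRHS]mul1r ler_wpM2r//.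
by rewrite ler_norml cos_geN1 cos_le1.
Qed.

Lemma Ex_gX i : Ex P (X i) = 0.
Proof.
pose f n x := n.+1%:R * sin (n.+1%:R^-1 * X i x).
have m1 : memL P 1 (X i) by exact/Linf1/Linf_gX.
have mf n : memL P 1 (f n) by exact/Linf1/LinfZ/sin_Linf.
have fb n x : `|f n x| <= `|X i x|.
  rewrite normrM; apply: (@le_trans _ _ (`|n.+1%:R| * `|n.+1%:R^-1 * X i x|)).
    by rewrite ler_wpM2l// norm_sin_le.
  by rewrite -normrM mulrA mulfV ?mul1r// pnatr_eq0.
have h := dominated_nrm (lexx 1) (fun n => memL_meas (mf n)) (memL_meas m1)
  (memL_ext (g := fun x => `|X i x|) _ _ m1) fb (fun x => @cvg_sin_lin R (X i x)).
have := cvg_nrm1_Ex mf m1 (h _ _).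
have -> : (fun n => Ex P (f n)) = cst 0.
  apply/funext => n; rewrite /f ExZ ?gsin ?mulr0//; exact/Linf1/sin_Linf.
move=> /(_ _ _) /cvg_lim => <-//; first by rewrite lim_cst.
- by apply: measurableT_comp => //; exact: gmeas.
- by move=> x; rewrite normr_id.
Qed.

(** The approximation used in [gauss_L2] is now dominated by X^2, so the means converge; both are
    squeezed to the variance. *)
Lemma Ex_gX2 i : Ex P (fun x => X i x ^+ 2) = gvar i.
Proof.
pose f n x := 4 * (n.+1%:R * sin (n.+1%:R^-1 * (X i x / 2))) ^+ 2.
have m1 : memL P 1 (fun x => X i x ^+ 2) by exact/Linf1/Linf_gXX.
have fE n x : f n x = n.+1%:R ^+ 2 * (2 * (1 - cos (n.+1%:R^-1 * X i x))).
  rewrite /f (_ : n.+1%:R^-1 * X i x = (n.+1%:R^-1 * (X i x / 2)) *+ 2); last first.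
    by rewrite -mulrnAr -(mulr_natr (X i x / 2)) divfK.
  by rewrite mulr2n cosD -!expr2 cos2sin2; ring.
have LB n : Linf P (fun x => 1 - cos (n.+1%:R^-1 * X i x)).
  by apply: LinfB; [exact: Linf_cst|exact: cos_Linf].
have mf n : memL P 1 (f n).
  by rewrite (funext (fE n)); apply: (Linf1 (P := P)); do 2 apply: LinfZ.
have fb n x : `|f n x| <= X i x ^+ 2.
  rewrite ger0_norm; last by rewrite /f mulr_ge0 ?sqr_ge0.
  rewrite /f exprMn.
  have := norm_sin_le (n.+1%:R^-1 * (X i x / 2)).
  rewrite -(@real_normK _ (X i x)) ?num_real//.
  rewrite -(@real_normK _ (sin _)) ?num_real// !normrM normfV (normfV 2) !normr_nat.
  set a := `|sin _|; set b := `|X i x|; have a0 : 0 <= a := normr_ge0 _; have b0 : 0 <= b := normr_ge0 _.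
  have np : 0 < n.+1%:R :> R by rewrite ltr0n.
  move: (n.+1%:R) np => c c0; rewrite ler_pdivlMl// => h.
  have : (c * a) ^+ 2 <= (b / 2) ^+ 2 by rewrite ler_sqr ?nnegrE ?mulr_ge0 ?divr_ge0// ltW.
  by rewrite exprMn expr_div_n; lra.
have cf x : f n x @[n --> \oo] --> X i x ^+ 2.
  have -> : X i x ^+ 2 = 4 * (X i x / 2) ^+ 2 by field.
  rewrite /f; under eq_fun do rewrite expr2; rewrite expr2.
  by apply: cvgMr; apply: cvgM; exact: cvg_sin_lin.
have h := dominated_nrm (lexx 1) (fun n => memL_meas (mf n)) (memL_meas m1) m1 fb cf.
have c1 := cvg_nrm1_Ex mf m1 h.
pose a n : R := n.+1%:R^-1 ^+ 2 * gvar i / 2.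
have q0 := gvar_ge0 i.
have a0 n : 0 <= a n by rewrite /a divr_ge0 ?mulr_ge0 ?sqr_ge0.
have aE n : n.+1%:R ^+ 2 * (2 * a n) = gvar i.
  have : n.+1%:R != 0 :> R by rewrite pnatr_eq0.
  by rewrite /a; move: n.+1%:R => b b0; field.
have Ef n : Ex P (f n) = n.+1%:R ^+ 2 * (2 * (1 - expR (- a n))).
  rewrite (eq_Ex _ (fE n)) !ExZ//; last 2 first.
  - exact: (Linf1 (LB n)).
  - exact: (Linf1 (LinfZ 2 (LB n))).
  by rewrite ExB ?Ex_cst ?gcos//; [exact/Linf1/Linf_cst|exact/Linf1/cos_Linf].
have c2 : Ex P (f n) @[n --> \oo] --> gvar i.
  apply: (@squeeze_cvgr _ _ _ _ (fun n => gvar i - gvar i * a n) (cst (gvar i))).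
  - near=> n; rewrite Ef /cst -(aE n).
    have h1 := expR_ge1Dx (- a n); have h2 := expR_ge1Dx (a n).
    have h3 : expR (- a n) * expR (a n) = 1 by rewrite -expRD addNr expR0.
    have h4 := expR_gt0 (- a n).
    have h5 : expR (- a n) * (1 + a n) <= 1 by rewrite -[leRHS]h3 ler_wpM2l// ltW.
    have c0 : 0 <= n.+1%:R ^+ 2 :> R by rewrite sqr_ge0.
    have := a0 n; move: (a n) (expR _) (n.+1%:R ^+ 2) h1 h4 h5 c0 => x y z *.
    apply/andP; split; last by rewrite ler_wpM2l//; lra.
    rewrite -mulrA -mulrBr ler_wpM2l//.
    by nra.
  - rewrite -[X in _ --> X]subr0 -(mulr0 (gvar i)); apply: cvgB; first exact: cvg_cst.
    apply: cvgMr; have h1 : (@harmonic R n * @harmonic R n * (gvar i / 2)) @[n --> \oo] --> (0 : R).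
      have h2 : (@harmonic R n * @harmonic R n * (gvar i / 2)) @[n --> \oo] --> (0 * 0 * (gvar i / 2) : R).
        by apply: cvgM; [apply: cvgM; exact: cvg_harmonic|exact: cvg_cst].
      by rewrite !mul0r in h2.
    apply: cvg_trans h1; apply: near_eq_cvg; near=> n.
    by rewrite /a /harmonic/= expr2 !mulrA.
  - exact: cvg_cst.
by rewrite -(cvg_lim _ c1)// (cvg_lim _ c2).
Unshelve. all: by end_near.
Qed.

Lemma Ex_gXX i j : Ex P (fun x => X i x * X j x) = gcov i j.
Proof.
have := Ex_gX2 (glin 1 i 1 j); rewrite gcovDl !gcovDr (gcovC j i).
have e x : X (glin 1 i 1 j) x ^+ 2 = X i x ^+ 2 + X j x ^+ 2 + 2 * (X i x * X j x).
  by rewrite gXlin; ring.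
have m1 k : memL P 1 (fun x => X k x ^+ 2) by exact/Linf1/Linf_gXX.
have m2 : memL P 1 (fun x => X i x * X j x) by apply/Linf1/LinfM; exact: Linf_gX.
rewrite (eq_Ex _ e) ExD; [|exact: (nrmD _ _ _).1|exact: (nrmZ _ _ _).1].
by rewrite ExD// ExZ// !Ex_gX2; lra.
Qed.

Lemma fst_Linf (F : T -> R) : Linf P F -> Linf Q (fun z => F z.1).
Proof. exact: (@mpres_Linf _ _ _ _ _ Q P fst (mpres_fst P P)). Qed.
Lemma snd_Linf (F : T -> R) : Linf P F -> Linf Q (fun z => F z.2).
Proof. exact: (@mpres_Linf _ _ _ _ _ Q P snd (mpres_snd P P)). Qed.

Lemma rot1_mpres (c s : R) : c ^+ 2 + s ^+ 2 = 1 ->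
  mpres Q P (fun z : gT (gsq G) => (rot c s z).1).
Proof.
move=> cs; have [m h] := rot_mpres G cs; have [m' h'] := mpres_fst P P.
split; first exact: measurableT_comp.
move=> A mA; have mB : measurable (fst @^-1` A : set (T * T)).
  by rewrite -[X in measurable X]setTI; exact: m'.
by rewrite -(h' A mA) -(h _ mB).
Qed.

(** Expand he_n(c X + s Y) by [he_add]. By rotation invariance and induction, the mean M satisfies M
    = (c^n + s^n) M, and c^n + s^n < 1 for n >= 3. The rotation (3/5, 4/5) is a rational choice; for
    n = 2 the factor is 1, so this degree is computed directly. *)
Lemma he_mean n i : (0 < n)%N -> Ex P (fun x => he (gvar i) n (X i x)) = 0.
Proof.
elim/ltn_ind: n => n IH n0.
have L k : Linf P (fun x => he (gvar i) k (X i x)) by exact/Linf_he/Linf_gX.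
case: n n0 IH L => [|[|[|n]]]// _ IH L.
- by under eq_Ex do rewrite he1; exact: Ex_gX.
- rewrite (eq_Ex P (g := fun x => X i x ^+ 2 - gvar i)); last first.
    by move=> x; rewrite heS he1 /= he0; ring.
  rewrite ExB ?Ex_cst ?Ex_gX2 ?subrr//; [exact/Linf1/Linf_gXX|exact/Linf1/Linf_cst].
set m := n.+3; pose c : R := 3 / 5; pose s : R := 4 / 5.
have cs : c ^+ 2 + s ^+ 2 = 1 by rewrite /c /s; lra.
pose M k := Ex P (fun x => he (gvar i) k (X i x)).
have E : M m = \sum_(k < m.+1) 'C(m, k)%:R * (c ^+ (m - k) * s ^+ k) * (M (m - k)%N * M k).
  rewrite {1}/M -(mpres_Ex (rot1_mpres cs)); last exact: Linf_meas (L m).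
  have hE z : he (gvar i) m (X i (rot c s z).1) = \sum_(k < m.+1)
      'C(m, k)%:R * (c ^+ (m - k) * s ^+ k) *
      (he (gvar i) (m - k) (X i z.1) * he (gvar i) k (X i z.2)).
    rewrite /rot/= gXmix (_ : he (gvar i) m = he (c ^+ 2 * gvar i + s ^+ 2 * gvar i) m); last first.
      by rewrite -mulrDl cs mul1r.
    rewrite he_add; apply: eq_bigr => k _.
    by rewrite !he_scale; ring.
  rewrite (eq_Ex _ hE).
  have LL (k : 'I_m.+1) : memL Q 1 (fun z => he (gvar i) (m - k) (X i z.1) * he (gvar i) k (X i z.2)).
    exact/Linf1/(LinfM (fst_Linf (L _)) (snd_Linf (L _))).
  rewrite (Ex_sum _ _).2; last by move=> k; exact: (nrmZ _ _ (LL k)).1.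
  apply: eq_bigr => k _; rewrite ExZ//; congr (_ * _).
  by apply: (Ex_prod (P1 := P) (P2 := P)); exact: Linf2.
have M0 : M 0%N = 1 by rewrite /M; under eq_Ex do rewrite he0; exact: Ex_cst.
move: E; rewrite big_ord_recl big_ord_recr/= big1 => [|k _]; last first.
  by rewrite [M (bump 0 k)]IH// ?mulr0//= /bump leq0n add1n ltnS.
rewrite subn0 subnn M0 bin0 expr0 /bump leq0n add1n binn expr0 add0r !mul1r !mulr1 => E.
have : M m * (1 - c ^+ m - s ^+ m) = 0 by move: E; lra.
move/eqP; rewrite mulf_eq0 => /orP[/eqP//|/eqP h]; exfalso; move: h.
have h1 : c ^+ m <= c ^+ 3 by rewrite ler_wiXn2l// /c; lra.
have h2 : s ^+ m <= s ^+ 3 by rewrite ler_wiXn2l// /s; lra.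
have h3 : c ^+ 3 + s ^+ 3 = 91 / 125 by rewrite /c /s; field.
by lra.
Qed.

(** For n >= 2, t -> E he_(n+1)(X_b + t X_b') vanishes identically. Its derivative at 0 is (n+1)
    E(he_n(X_b) X_b') minus a multiple of the mean of he_(n-1)(X_b), which is 0. *)
Lemma he_mean1 n b b' : n != 1%N -> Ex P (fun x => he (gvar b) n (X b x) * X b' x) = 0.
Proof.
case: n => [|[|n]]// _; first by under eq_Ex do rewrite he0 mul1r; exact: Ex_gX.
pose q (t : R) := gvar b + 2 * gcov b b' * t + gvar b' * t ^+ 2.
pose f (t : R) x := X b x + t * X b' x.
have ge1 t x : he (q t) n.+3 (f t x) = ge (n.+3, glin 1 b t b') x.
  rewrite /ge/= /f gXlin mul1r; congr (he _ _ _).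
  by rewrite /q gcovDl !gcovDr (gcovC b' b); ring.
have qD (t : R) : is_derive t 1 q (2 * gcov b b' + gvar b' * (2 * t)).
  rewrite /q; have := is_derive_id t (1 : R) => hid.
  have h1 : is_derive t 1 (fun t : R => 2 * gcov b b' * t) (2 * gcov b b').
    have := is_derive_mul (is_derive_cst (2 * gcov b b') t 1) hid.
    by rewrite mul0r add0r mulr1.
  have h2 : is_derive t 1 (fun t : R => gvar b' * t ^+ 2) (gvar b' * (2 * t)).
    have h3 := is_derive_mul hid hid.
    have := is_derive_mul (is_derive_cst (gvar b') t 1) h3.
    by move=> D; apply: (is_derive_ext D) => [x|]; rewrite /= ?expr2//; ring.
  have := is_deriveD (is_deriveD (is_derive_cst (gvar b) t 1) h1) h2.
  by rewrite add0r.
have jf : jet P f (fun _ x => X b' x).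
  have hid (t : R) : is_derive t 1 (fun t : R => t) 1 by exact: is_derive_id.
  have := jetD (jet_cst (Linf_gX b)) (jet_term hid (Linf_gX b')).
  by move=> j; apply: (jet_ext j) => t x; rewrite ?add0r ?mul1r.
have := jet_Ex (memL_cst P 1 (ltr0n R 2)) (jet_he n.+3 qD jf) 0.
have -> : (fun t => Ex P (fun x => 1 * he (q t) n.+3 (f t x))) = cst 0.
  by apply/funext => t; under eq_Ex do rewrite mul1r ge1; exact: he_mean.
move=> D; have := derive_val (is_derive := D); rewrite derive_cst => /esym.
rewrite /f /q/=; under eq_Ex do rewrite !mul0r addr0 expr0n/= !mulr0 !addr0 mul1r.
have L k : Linf P (fun x => he (gvar b) k (X b x)) by exact/Linf_he/Linf_gX.
have m1 : memL P 1 (fun x => he (gvar b) n.+2 (X b x) * X b' x).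
  exact/Linf1/(LinfM (L _) (Linf_gX _)).
rewrite (eq_Ex P (g := fun x => n.+3%:R * (he (gvar b) n.+2 (X b x) * X b' x) -
  ('C(n.+3, 2)%:R * (2 * gcov b b')) * he (gvar b) n.+1 (X b x))); last by move=> x; ring.
rewrite ExB; [|exact: (nrmZ _ _ m1).1|exact: (nrmZ _ _ (Linf1 (L _))).1].
rewrite !ExZ//; last exact: Linf1.
by rewrite he_mean// mulr0 subr0 => /eqP; rewrite mulf_eq0 pnatr_eq0/= => /eqP.
Qed.

(** Only the term of degree 0 in [y] survives: he_n of a Gaussian sum, with the matching variance,
    is a martingale. In [mehler1] the weight [X b'] selects the term of degree 1 instead. *)
Lemma mehler0 (q A : R) n b : Ex P (fun y => he (q + gvar b) n (A + X b y)) = he q n A.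
Proof.
under eq_Ex do rewrite he_add.
have L (k : 'I_n.+1) : memL P 1 (fun y => he q (n - k) A * he (gvar b) k (X b y)).
  exact/Linf1/LinfZ/Linf_he/Linf_gX.
rewrite (Ex_sum _ _).2; last by move=> k; exact: (nrmZ _ _ (L k)).1.
rewrite big_ord_recl big1 => [|k _].
  rewrite ExZ; last exact: (L ord0).
  rewrite /= ?bin0 ?mul1r ?subn0 ?addr0.
  by under eq_Ex do rewrite he0 mulr1; exact: Ex_cst.
rewrite ExZ// ExZ ?he_mean ?mulr0//; exact/Linf1/Linf_he/Linf_gX.
Qed.

Lemma mehler1 (q A : R) n b b' : Ex P (fun y => he (q + gvar b) n (A + X b y) * X b' y) =
  n%:R * gcov b b' * he q n.-1 A.
Proof.
under eq_Ex do rewrite he_add mulr_suml.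
have L k : memL P 1 (fun y => he (gvar b) k (X b y) * X b' y).
  by apply/Linf1/LinfM; [exact/Linf_he/Linf_gX|exact: Linf_gX].
have e (k : 'I_n.+1) y : 'C(n, k)%:R * (he q (n - k) A * he (gvar b) k (X b y)) * X b' y =
  'C(n, k)%:R * he q (n - k) A * (he (gvar b) k (X b y) * X b' y) by ring.
rewrite (Ex_sum _ _).2 => [|k]; last by under eq_fun do rewrite e; exact: (nrmZ _ _ (L k)).1.
under eq_bigr => k _ do (rewrite (eq_Ex P (e k)) ExZ; last exact: L).
case: n e => [|n] e; first by rewrite big_ord1 he_mean1// mulr0 !mul0r.
rewrite big_ord_recl big_ord_recl/= he_mean1// mulr0 add0r big1 => [|k _]; last first.
  by rewrite he_mean1// mulr0.
rewrite addr0 /bump/= bin1 subn1/=; under [X in _ * X]eq_Ex do rewrite he1.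
by rewrite Ex_gXX; ring.
Qed.
End chaos.
Arguments ge {R G} l x.

(** * Singular integrals on the half-line *)

Section integrals.
Context {R : realType}.
Notation mu := (@lebesgue_measure R).
Implicit Types (f F G : R -> R) (a b : nat -> R).

Lemma cont_itv (f : R -> R) (x y : R) : (forall z, x <= z <= y -> {for z, continuous f}) ->
  {within `[x, y], continuous f}.
Proof.
by move=> h; apply: continuous_in_subspaceT => z; rewrite inE/= in_itv/=; exact: h.
Qed.

Lemma cont_itv_meas (f : R -> R) (x y : R) : (forall z, x <= z <= y -> {for z, continuous f}) ->
  measurable_fun `[x, y] f.
Proof. by move=> h; apply: subspace_continuous_measurable_fun => //; exact: cont_itv. Qed.

Lemma is_derive_LR (F f : R -> R) (x y : R) : (forall z, x <= z <= y -> is_derive z 1 F (f z)) -> x <= y ->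
  derivable_oo_LRcontinuous F x y.
Proof.
move=> h xy; have c z : x <= z <= y -> {for z, continuous F}.
  move=> hz; apply: differentiable_continuous; apply/derivable1_diffP.
  by have := h z hz => D; exact: ex_derive.
split.
- move=> z; rewrite in_itv/= => /andP[h1 h2].
  by have D := h z (introT andP (conj (ltW h1) (ltW h2))); exact: ex_derive.
- by apply: cvg_at_right_filter; apply: c; rewrite lexx.
- by apply: cvg_at_left_filter; apply: c; rewrite xy lexx.
Qed.

Lemma int_itv (F f : R -> R) (x y : R) : x < y -> (forall z, x <= z <= y -> is_derive z 1 F (f z)) ->
  (forall z, x <= z <= y -> {for z, continuous f}) ->
  (\int[mu]_(z in `[x, y]) (f z)%:E = (F y - F x)%:E)%E.
Proof.
move=> xy D c; rewrite (continuous_FTC2 (F := F) xy (cont_itv c))//.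
  exact: is_derive_LR D (ltW xy).
move=> z; rewrite in_itv/= => /andP[h1 h2].
have Dz := D z (introT andP (conj (ltW h1) (ltW h2))).
by rewrite derive1E; exact: derive_val.
Qed.

Lemma int_union (A : nat -> set R) f : {homo A : n m / (n <= m)%N >-> (n <= m)%O} ->
  (forall i, measurable (A i)) -> (forall i, measurable_fun (A i) f) ->
  (forall i x, A i x -> 0 <= f x) ->
  (\int[mu]_(x in A i) (f x)%:E)%E @[i --> \oo] --> (\int[mu]_(x in \bigcup_i A i) (f x)%:E)%E.
Proof.
move=> hA mA mf f0; apply: ge0_nondecreasing_set_cvg_integral => // i.
by apply/measurable_EFinP; exact: mf.
Qed.

Lemma int_union_le (A : nat -> set R) f (C : R) : {homo A : n m / (n <= m)%N >-> (n <= m)%O} ->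
  (forall i, measurable (A i)) -> (forall i, measurable_fun (A i) f) ->
  (forall i x, A i x -> 0 <= f x) ->
  (forall i, (\int[mu]_(x in A i) (f x)%:E <= C%:E)%E) ->
  (\int[mu]_(x in \bigcup_i A i) (f x)%:E <= C%:E)%E.
Proof.
move=> hA mA mf f0 h; have c := int_union hA mA mf f0.
by rewrite -(cvg_lim _ c)//; apply: lime_le; [apply/cvg_ex; eexists; exact: c|exact: nearW].
Qed.

Lemma itv_homo a b : {homo a : n m / (n <= m)%N >-> m <= n} -> {homo b : n m / (n <= m)%N >-> n <= m} ->
  {homo (fun i => `[a i, b i]%classic) : n m / (n <= m)%N >-> (n <= m)%O}.
Proof.
move=> ha hb n m nm; apply/subsetPset => x; rewrite /= !in_itv/= => /andP[h1 h2].
by rewrite (le_trans (ha _ _ nm) h1) (le_trans h2 (hb _ _ nm)).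
Qed.

(** Both integrals are improper: the change of variables is made on each compact interval of an
    exhaustion and passes to the limit by monotone convergence, as the integrands are
    nonnegative. *)
Lemma int_subst F dF G a b :
  {homo a : n m / (n <= m)%N >-> m <= n} -> {homo b : n m / (n <= m)%N >-> n <= m} ->
  (forall i, a i < b i) ->
  (forall i x, a i <= x <= b i -> [/\ is_derive x 1 F (dF x), {for x, continuous dF} & 0 <= dF x]) ->
  (forall i, {in `[a i, b i] &, {homo F : x y / x < y}}) ->
  (forall i y, F (a i) <= y <= F (b i) -> {for y, continuous G} /\ 0 <= G y) ->
  (\int[mu]_(x in \bigcup_i `[F (a i), F (b i)]%classic) (G x)%:E =
   \int[mu]_(x in \bigcup_i `[a i, b i]%classic) (G (F x) * dF x)%:E)%E.
Proof.
move=> ha hb ab hF Fh hG.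
have in1 i : a i \in `[a i, b i] by rewrite in_itv/= lexx ltW.
have in2 i : b i \in `[a i, b i] by rewrite in_itv/= lexx ltW.
have Fle i : {in `[a i, b i] &, {homo F : x y / x <= y}}.
  move=> x y xi yi; rewrite le_eqVlt => /predU1P[->//|xy]; apply: ltW; exact: Fh xi yi xy.
have sub i j : (i <= j)%N -> {subset `[a i, b i] <= `[a j, b j]}.
  move=> ij x; rewrite !in_itv/= => /andP[h1 h2].
  by rewrite (le_trans (ha _ _ ij) h1) (le_trans h2 (hb _ _ ij)).
have hA1 := itv_homo ha hb.
have hA2 : {homo (fun i => `[F (a i), F (b i)]%classic) : n m / (n <= m)%N >-> (n <= m)%O}.
  apply: itv_homo => n m nm.
    by apply: (Fle m); rewrite ?in1 ?(sub n m nm) ?in1//; exact: ha.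
  by apply: (Fle m); rewrite ?in2 ?(sub n m nm) ?in2//; exact: hb.
have cF i x : a i <= x <= b i -> {for x, continuous F}.
  move=> hx; apply: differentiable_continuous; apply/derivable1_diffP.
  by have [D _ _] := hF i x hx; exact: ex_derive.
have Fin i x : a i <= x <= b i -> F (a i) <= F x <= F (b i).
  move=> hx; have xi : x \in `[a i, b i] by rewrite in_itv.
  by move/andP: hx => [h1 h2]; rewrite !(Fle i)//.
have m1 i x : a i <= x <= b i -> {for x, continuous (fun x => G (F x) * dF x)}.
  move=> hx; have [_ cd _] := hF i x hx; apply: continuousM => //.
  by apply: continuous_comp; [exact: cF hx|exact: (hG i _ (Fin i x hx)).1].
have l1 := int_union hA1 (fun i => ltac:(exact: measurable_itv)) (fun i => cont_itv_meas (m1 i)) _.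
have l2 := int_union hA2 (fun i => ltac:(exact: measurable_itv))
  (fun i => cont_itv_meas (fun y hy => (hG i y hy).1)) _.
have {}l1 := l1 _; have {}l2 := l2 _.
rewrite -(cvg_lim _ (l1 _))//; last first.
  move=> i x; rewrite /= in_itv/= => hx; have [_ _ d0] := hF i x hx.
  by rewrite mulr_ge0//; exact: (hG i _ (Fin i x hx)).2.
rewrite -(cvg_lim _ (l2 _))//; last by move=> i x; rewrite /= in_itv/= => hx; exact: (hG i x hx).2.
congr (limn _); apply/funext => i.
have dE x : a i <= x <= b i -> derive1 F x = dF x.
  by move=> hx; have [D _ _] := hF i x hx; rewrite derive1E; exact: derive_val.
have nE x : a i < x < b i -> \forall y \near x, derive1 F y = dF y.
  move=> hx; have : \forall y \near x, y \in `]a i, b i[.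
    by apply: near_in_itvoo; rewrite in_itv.
  by apply: filterS => y; rewrite in_itv/= => /andP[h1 h2]; apply: dE; rewrite !ltW.
rewrite (@integration_by_substitution_increasing R F G (a i) (b i) (ltW (ab i)) (Fh i)).
- by apply: eq_integral => x; rewrite inE/= in_itv/= => hx; rewrite fctE dE.
- move=> x; rewrite in_itv/= => hx.
  have hx' : a i <= x <= b i by case/andP: hx => /ltW -> /ltW ->.
  have [_ cd _] := hF i x hx'; rewrite /prop_for /continuous_at (dE x hx').
  by apply: cvg_trans cd; apply: near_eq_cvg; apply: filterS (nE x hx) => y ->.
- apply/cvg_ex; exists (dF (a i)).
  have [_ cd _] := hF i (a i) ltac:(by rewrite lexx ltW).
  apply: cvg_trans (cvg_at_right_filter cd); apply: near_eq_cvg; near=> y.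
  by apply/esym/dE; apply/andP; split; near: y; [exact: nbhs_right_ge|exact: nbhs_right_le].
- apply/cvg_ex; exists (dF (b i)).
  have [_ cd _] := hF i (b i) ltac:(by rewrite lexx ltW).
  apply: cvg_trans (cvg_at_left_filter cd); apply: near_eq_cvg; near=> y.
  by apply/esym/dE; apply/andP; split; near: y; [exact: nbhs_left_ge|exact: nbhs_left_le].
- by apply: is_derive_LR (ltW (ab i)) => z hz; have [] := hF i z hz.
- by apply: cont_itv => y hy; exact: (hG i y hy).1.
Unshelve. all: by end_near.
Qed.

(** The shift by 2 keeps the left end strictly below the right end already for [i = 0]. *)
Lemma bigcup_pos : \bigcup_i `[i.+2%:R^-1, (i.+2%:R : R)]%classic = `]0, +oo[%classic.
Proof.
apply/seteqP; split => x /=; rewrite in_itv/= ?andbT.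
  by move=> [i _]; rewrite /= in_itv/= => /andP[h _]; apply: lt_le_trans h; rewrite invr_gt0.
move=> x0; have [n hn] : exists n : nat, x <= n%:R /\ x^-1 <= n%:R.
  exists (maxn (Num.truncn x).+1 (Num.truncn x^-1).+1); split; apply: ltW;
  by apply: (lt_le_trans (truncnS_gt _)); rewrite ler_nat leq_max leqnn ?orbT.
exists n => //=; rewrite in_itv/=; have n2 : n%:R <= n.+2%:R :> R by rewrite ler_nat ltnW// ltnW.
rewrite (le_trans hn.1 n2) andbT -[leRHS]invrK lef_pV2 ?posrE ?invr_gt0//.
exact: le_trans hn.2 n2.
Qed.

Lemma inv_homo : {homo (fun i : nat => (i.+2%:R^-1 : R)) : n m / (n <= m)%N >-> m <= n}.
Proof. by move=> n m nm; rewrite lef_pV2 ?posrE// ler_nat !ltnS. Qed.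

Lemma nat_homo : {homo (fun i : nat => (i.+2%:R : R)) : n m / (n <= m)%N >-> n <= m}.
Proof. by move=> n m nm; rewrite ler_nat !ltnS. Qed.

Lemma inv_lt (i : nat) : i.+2%:R^-1 < i.+2%:R :> R.
Proof.
have h : 1 < i.+2%:R :> R by rewrite ltr1n.
by apply: (lt_trans _ h); rewrite invf_lt1// (lt_trans _ h).
Qed.

Lemma int_scale G (c : R) : 0 < c -> (forall y : R, 0 < y -> {for y, continuous G} /\ 0 <= G y) ->
  (\int[mu]_(x in `]0%R, +oo[) (G x)%:E = \int[mu]_(x in `]0%R, +oo[) (G (c * x) * c)%:E)%E.
Proof.
move=> c0 hG; have i0 (i : nat) : 0 < i.+2%:R^-1 :> R by rewrite invr_gt0.
rewrite -{2}bigcup_pos -(int_subst (F := fun x => c * x) (dF := fun=> c) inv_homo nat_homo inv_lt).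
- congr (integral _ _ _); apply/seteqP; split => x /=; rewrite in_itv/= ?andbT.
    move=> x0; have : `]0, +oo[%classic (c^-1 * x) by rewrite /= in_itv/= andbT mulr_gt0 ?invr_gt0.
    rewrite -bigcup_pos => -[i _]; rewrite /= in_itv/= => /andP[h1 h2]; exists i => //=.
    rewrite ler_pdivlMl// in h1; rewrite ler_pdivrMl// in h2.
    by rewrite in_itv/=; apply/andP.
  move=> [i _]; rewrite /= in_itv/= => /andP[h1 _]; apply: lt_le_trans h1; exact: mulr_gt0.
- move=> i x _; split; [|exact: cst_continuous|exact: ltW].
  by apply: (is_derive_ext (is_deriveM (is_derive_cst c x 1) (is_derive_id x 1))) => // ;
    rewrite /GRing.scale/= mulr1 mulr0 addr0.
- by move=> i x y _ _ xy; rewrite ltr_pM2l.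
- move=> i y /andP[h _]; apply: hG; apply: lt_le_trans h; exact: mulr_gt0.
Qed.

Lemma cont_powR (s z : R) : 0 < z -> {for z, continuous (@powR R ^~ s)}.
Proof.
move=> z0; apply: differentiable_continuous; apply/derivable1_diffP.
by apply: derivable_powR; rewrite in_itv/= z0.
Qed.

Lemma int_pow01 (s : R) : 0 < s -> (\int[mu]_(x in `]0%R, 1%R]) (x `^ (s - 1))%:E <= (s^-1)%:E)%E.
Proof.
move=> s0; have i0 (i : nat) : 0 < i.+2%:R^-1 :> R by rewrite invr_gt0.
have i1 (i : nat) : i.+2%:R^-1 < 1 :> R by rewrite invf_lt1// ltr1n.
have -> : `]0%R, 1%R]%classic = \bigcup_i `[i.+2%:R^-1, (1 : R)]%classic.
  apply/seteqP; split => x /=; rewrite in_itv/=.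
    move=> /andP[x0 x1]; have : `]0, +oo[%classic x by rewrite /= in_itv/= andbT.
    by rewrite -bigcup_pos => -[i _]; rewrite /= in_itv/= => /andP[h1 h2]; exists i => //=;
      rewrite in_itv/= h1 x1.
  by move=> [i _]; rewrite /= in_itv/= => /andP[h1 ->]; rewrite (lt_le_trans (i0 i) h1).
have pos (i : nat) (z : R) : i.+2%:R^-1 <= z <= 1 -> 0 < z by move=> /andP[h _]; exact: lt_le_trans h.
apply: int_union_le => //.
- by apply: (@itv_homo (fun i => i.+2%:R^-1) (fun=> 1)) => //; exact: inv_homo.
- by move=> i; apply: cont_itv_meas => z /pos; exact: cont_powR.
- by move=> i x _; exact: powR_ge0.
- move=> i.
  have D (z : R) : i.+2%:R^-1 <= z <= 1 -> is_derive z 1 (fun x => s^-1 * x `^ s) (z `^ (s - 1)).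
    move=> /pos z0; have h := is_derive1_powR s z0.
    apply: (is_derive_ext (is_derive_mul (is_derive_cst s^-1 z 1) h)) => //=.
    by rewrite mul0r add0r mulrA mulVf ?gt_eqF// mul1r.
  rewrite (int_itv (i1 i) D); last by move=> z /pos; exact: cont_powR.
  by rewrite lee_fin powR1 mulr1 gerBl mulr_ge0 ?powR_ge0// invr_ge0 ltW.
Qed.

Lemma int_pow1y (s : R) : 0 < s -> (\int[mu]_(x in `[1%R, +oo[) (x `^ (- s - 1))%:E <= (s^-1)%:E)%E.
Proof.
move=> s0; have i1 (i : nat) : 1 < i.+2%:R :> R by rewrite ltr1n.
have -> : `[1%R, +oo[%classic = \bigcup_i `[(1 : R), i.+2%:R]%classic.
  apply/seteqP; split => x /=; rewrite in_itv/= ?andbT.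
    move=> x1; have : `]0, +oo[%classic x by rewrite /= in_itv/= andbT (lt_le_trans _ x1).
    by rewrite -bigcup_pos => -[i _]; rewrite /= in_itv/= => /andP[h1 h2]; exists i => //=;
      rewrite in_itv/= h2 x1.
  by move=> [i _]; rewrite /= in_itv/= => /andP[].
have pos (i : nat) (z : R) : 1 <= z <= i.+2%:R -> 0 < z by move=> /andP[h _]; exact: lt_le_trans h.
apply: int_union_le => //.
- by apply: (@itv_homo (fun=> 1) (fun i => i.+2%:R)) => //; exact: nat_homo.
- by move=> i; apply: cont_itv_meas => z /pos; exact: cont_powR.
- by move=> i x _; exact: powR_ge0.
- move=> i.
  have D (z : R) : 1 <= z <= i.+2%:R -> is_derive z 1 (fun x => - s^-1 * x `^ (- s)) (z `^ (- s - 1)).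
    move=> /pos z0; have h := is_derive1_powR (- s) z0.
    apply: (is_derive_ext (is_derive_mul (is_derive_cst (- s^-1) z 1) h)) => //=.
    by rewrite mul0r add0r mulrA mulrNN mulVf ?gt_eqF// mul1r.
  rewrite (int_itv (i1 i) D); last by move=> z /pos; exact: cont_powR.
  rewrite lee_fin powR1 mulr1 opprK mulNr addrC gerBl mulr_ge0 ?powR_ge0// invr_ge0 ltW//.
Qed.

Lemma int_pos_lty f (s r C : R) : 0 < s -> 0 < r ->
  measurable_fun (`]0%R, +oo[ : set R) f ->
  (forall x, 0 < x -> x <= 1 -> `|f x| <= C * x `^ (s - 1)) ->
  (forall x, 1 <= x -> `|f x| <= C * x `^ (- r - 1)) ->
  mu.-integrable `]0%R, +oo[ (EFin \o f).
Proof.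
move=> s0 r0 mf h1 h2; apply/integrableP; split; first exact/measurable_EFinP.
have C0 : 0 <= C.
  by have := h2 1 (lexx _); rewrite powR1 mulr1; apply: le_trans.
have U : `]0%R, +oo[%classic = `]0%R, 1%R[ `|` `[1%R, +oo[ :> set R.
  apply/seteqP; split => x /=; rewrite !in_itv/= ?andbT.
    by move=> ->; have [] := ltP x 1; [left|right].
  by case=> [/andP[->]//|]; apply: lt_le_trans.
have mU : measurable_fun (`]0%R, 1%R[ `|` `[1%R, +oo[ : set R) (fun x => `|(f x)%:E|%E).
  by rewrite -U; apply: measurableT_comp => //; exact/measurable_EFinP.
rewrite U ge0_integral_setU//=; last first.
  rewrite disj_set2E; apply/eqP/seteqP; split => // x [] /=; rewrite !in_itv/= andbT.
  by move=> /andP[_ h] /(lt_le_trans h); rewrite ltxx.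
have p1 (A : set R) (c : R) : measurable A -> A `<=` `]0%R, +oo[ ->
    (forall x, A x -> `|f x| <= C * x `^ c) ->
    (\int[mu]_(x in A) (x `^ c)%:E < +oo)%E -> (\int[mu]_(x in A) `|(f x)%:E| < +oo)%E.
  move=> mA sA hA fin; have mp : measurable_fun A (fun x => (x `^ c)%:E).
    apply/measurable_EFinP; apply: (measurable_funS (E := setT)) => //; exact: measurable_powR.
  apply: (@le_lt_trans _ _ (\int[mu]_(x in A) (C%:E * (x `^ c)%:E))%E).
    apply: ge0_le_integral => //.
    - by apply: measurableT_comp => //; apply/measurable_EFinP; exact: measurable_funS mf.
    - by apply: measurable_funeM.
  rewrite ge0_integralZl//; last by move=> x _; rewrite lee_fin powR_ge0.
  have : (0 <= \int[mu]_(x in A) (x `^ c)%:E)%E by apply: integral_ge0 => x _; rewrite lee_fin powR_ge0.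
  by move: fin; case: (integral _ _ _) => // y _ _; rewrite -EFinM ltry.
apply: lte_add_pinfty.
- apply: (p1 _ (s - 1)) => //.
  + by move=> x /=; rewrite !in_itv/= andbT => /andP[].
  + by move=> x /=; rewrite in_itv/= => /andP[x0 /ltW]; exact: h1.
  + apply: le_lt_trans (ltry s^-1); apply: le_trans (int_pow01 s0).
    apply: ge0_subset_integral => //.
    * apply/measurable_EFinP; apply: (measurable_funS (E := setT)) => //; exact: measurable_powR.
    * by move=> x _; rewrite lee_fin powR_ge0.
    * by move=> x /=; rewrite !in_itv/= => /andP[-> /ltW].
- apply: (p1 _ (- r - 1)) => //.
  + by move=> x /=; rewrite !in_itv/= !andbT; apply: lt_le_trans.
  + by move=> x /=; rewrite in_itv/= andbT; exact: h2.
  + by apply: le_lt_trans (int_pow1y r0) _; exact: ltry.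
Qed.

Lemma intZ (D : set R) (c : R) f : measurable D -> mu.-integrable D (EFin \o f) ->
  mu.-integrable D (EFin \o (fun t => c * f t)).
Proof. by move=> mD fi; exact: integrableZl fi. Qed.

(** The mechanism of subordination: a bound on a finite combination, valid for each value of the
    parameter, integrates to a bound for the combination of the integrated symbols. *)
Lemma Rint_comb (J : Type) (phi : seq (R * J)) (D : set R) (g : J -> R -> R) (B : R -> R) :
  measurable D -> (forall j, mu.-integrable D (EFin \o g j)) -> mu.-integrable D (EFin \o B) ->
  (forall x, D x -> `|\sum_(c <- phi) c.1 * g c.2 x| <= B x) ->
  `|\sum_(c <- phi) c.1 * \int[mu]_(x in D) g c.2 x| <= \int[mu]_(x in D) B x.
Proof.
move=> mD gi Bi h.
have [e i] : \sum_(c <- phi) c.1 * \int[mu]_(x in D) g c.2 x =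
    \int[mu]_(x in D) (\sum_(c <- phi) c.1 * g c.2 x) /\
    mu.-integrable D (EFin \o (fun x => \sum_(c <- phi) c.1 * g c.2 x)).
  elim: (phi) => [|c psi [IH1 IH2]].
    under [X in _ /\ mu.-integrable _ (_ \o X)]eq_fun do rewrite big_nil.
    rewrite big_nil; split; last exact: integrable0.
    by rewrite /Rintegral; under eq_integral do rewrite big_nil; rewrite integral0.
  under [X in _ /\ mu.-integrable _ (_ \o X)]eq_fun do rewrite big_cons.
  have ci : mu.-integrable D (EFin \o (fun x => c.1 * g c.2 x)).
    exact: integrableZl (gi _).
  split; last exact: integrableD ci IH2.
  under eq_Rintegral do rewrite big_cons.
  by rewrite RintegralD// RintegralZl// big_cons IH1.
rewrite e; apply: le_trans (le_normr_Rintegral _ _) _ => //.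
by apply: le_Rintegral => //; exact: integrable_norm.
Qed.
End integrals.

(** * Integral formulas for powers *)

Section laplace.
Context {R : realType}.
Notation mu := (@lebesgue_measure R).
Notation D := (`]0%R, +oo[%classic : set R).
Implicit Types (r s t : R).

Lemma pow_le_exp s : exists2 C : R, 0 <= C & forall t : R, 1 <= t -> t `^ s <= C * expR t.
Proof.
have [n hn] : exists n : nat, s <= n.+1%:R.
  by exists (Num.truncn s); apply/ltW/truncnS_gt.
exists n.+1`!%:R => // t t1.
apply: (@le_trans _ _ (t `^ n.+1%:R)); first exact: ler_powR.
have t0 : 0 <= t by exact: le_trans t1.
rewrite powR_mulrn// -ler_pdivrMl ?ltr0n ?fact_gt0//.
by have := expR_ge1Dxn n t0; rewrite mulrC; lra.
Qed.

Lemma meas_pow (s : R) (A : set R) : measurable_fun A (fun t : R => t `^ s).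
Proof. by apply: (measurable_funS (E := setT)) => //; exact: measurable_powR. Qed.

Lemma meas_exp (c : R) (A : set R) : measurable_fun A (fun t : R => expR (c * t)).
Proof.
apply: (measurable_funS (E := setT)) => //.
by apply: measurableT_comp; [exact: measurable_expR|exact: measurable_funM].
Qed.

Lemma lap_int s (m : R) : 0 < s -> 1 <= m ->
  mu.-integrable D (EFin \o (fun t : R => t `^ (s - 1) * expR (- m * t))).
Proof.
move=> s0 m1; have [C C0 hC] := pow_le_exp (s + 1).
apply: (@int_pos_lty _ _ s 1 (Num.max 1 C)) => //.
- by apply: measurable_funM; [exact: meas_pow|exact: meas_exp].
- move=> t t0 t1; rewrite ger0_norm ?mulr_ge0 ?powR_ge0 ?expR_ge0//.
  rewrite mulrC ler_wpM2r ?powR_ge0//; apply: (@le_trans _ _ 1); last by rewrite le_max lexx.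
  by rewrite -[leRHS]expR0 ler_expR mulNr oppr_le0 mulr_ge0 ?ltW//; lra.
- move=> t t1; have t0 : 0 < t by lra.
  rewrite ger0_norm ?mulr_ge0 ?powR_ge0 ?expR_ge0//.
  have e1 : t `^ (s - 1) = t `^ (s + 1) * t `^ (- 1 - 1).
    by rewrite -powRD ?(gt_eqF t0) ?implybT//; congr (_ `^ _); ring.
  apply: (@le_trans _ _ (C * t `^ (- 1 - 1))); last first.
    by rewrite ler_wpM2r ?powR_ge0// le_max lexx orbT.
  rewrite e1 mulrAC ler_wpM2r ?powR_ge0//.
  apply: (@le_trans _ _ (C * expR t * expR (- m * t))); first by rewrite ler_wpM2r ?expR_ge0 ?hC.
  rewrite -mulrA -expRD -[leRHS]mulr1 ler_wpM2l// -[leRHS]expR0 ler_expR.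
  by nra.
Qed.

Lemma Rint_gt0 (f : R -> R) (c : R) : 0 < c -> mu.-integrable D (EFin \o f) ->
  (forall t : R, 0 < t -> 0 <= f t) -> (forall t : R, 1 <= t -> t <= 2 -> c <= f t) ->
  0 < \int[mu]_(t in D) f t.
Proof.
move=> c0 fi f0 fc; have sub : (`[1%R, 2%R]%classic : set R) `<=` D.
  by move=> x /=; rewrite !in_itv/= andbT => /andP[h _]; exact: lt_le_trans h.
have mf : measurable_fun D (EFin \o f) by case/integrableP: fi.
apply: (lt_le_trans c0); rewrite -lee_fin /Rintegral fineK; last exact: integrable_fin_num.
apply: (@le_trans _ _ (\int[mu]_(t in `[1%R, 2%R]) c%:E)%E).
  rewrite integral_cst//= lebesgue_measure_itv/= lte_fin ltr1n/= -EFinB -EFinM lee_fin.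
  by rewrite (_ : 2 - 1 = 1 :> R) ?mulr1//; lra.
apply: (@le_trans _ _ (\int[mu]_(t in `[1%R, 2%R]) (f t)%:E)%E).
  apply: ge0_le_integral => //.
  - by move=> x _; rewrite lee_fin ltW.
  - exact: measurable_funS mf.
  - by move=> t; rewrite /= in_itv/= => /andP[t1 t2]; rewrite lee_fin fc.
apply: ge0_subset_integral => //.
by move=> x; rewrite /= in_itv/= andbT => x0; rewrite lee_fin f0.
Qed.

Lemma powR_scale (m x a : R) : 0 < m -> 0 <= x ->
  (m^-1 * x) `^ a / m = m `^ (- a - 1) * x `^ a.
Proof.
move=> m0 x0; have mi : 0 <= m^-1 by rewrite invr_ge0 ltW.
rewrite powRM// mulrAC; congr (_ * _).
rewrite -powR_inv1 ?ltW// -powRrM mulN1r -powRD ?(gt_eqF m0) ?implybT//.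
Qed.

(** The Gamma function for s > 0; the factor [- 1] is the [- m] of [lapE] at m = 1. It normalises
    the negative powers of 1 - L. *)
Definition gam s : R := \int[mu]_(t in D) (t `^ (s - 1) * expR (- 1 * t)).

Lemma gam_gt0 s : 0 < s -> 0 < gam s.
Proof.
move=> s0; have c0 : 0 < expR (- 2) / 2 :> R by rewrite divr_gt0 ?expR_gt0.
apply: (Rint_gt0 c0) => [|t t0|t t1 t2]; first exact: lap_int.
  by rewrite mulr_ge0 ?powR_ge0 ?expR_ge0.
have t0 : 0 < t by lra.
rewrite mulrC; apply: ler_pM; rewrite ?expR_ge0 ?invr_ge0 ?ler_expR//; last by lra.
rewrite powRD ?(gt_eqF t0) ?implybT// powR_inv1 ?(ltW t0)//.
rewrite -[leLHS]mul1r; apply: ler_pM; rewrite ?invr_ge0//.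
  apply: (@le_trans _ _ (1 `^ s)); first by rewrite powR1.
  by rewrite ge0_ler_powR ?nnegrE// ltW.
by rewrite lef_pV2 ?posrE.
Qed.

Lemma fine_scale (G H : R -> R) (c k : R) : 0 < c -> (forall y : R, 0 < y -> {for y, continuous G} /\ 0 <= G y) ->
  mu.-integrable D (EFin \o H) -> (forall x : R, 0 < x -> G (c * x) * c = k * H x) ->
  \int[mu]_(x in D) G x = k * \int[mu]_(x in D) H x.
Proof.
move=> c0 hG iH e; rewrite -RintegralZl//.
rewrite /Rintegral (int_scale c0 hG); congr fine; apply: eq_integral => x.
by rewrite inE/= in_itv/= andbT => x0; rewrite e.
Qed.

Lemma lapE s (m : R) : 0 < s -> 1 <= m ->
  \int[mu]_(t in D) (t `^ (s - 1) * expR (- m * t)) = m `^ (- s) * gam s.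
Proof.
move=> s0 m1; have m0 : 0 < m by exact: lt_le_trans m1.
have mi0 : 0 < m^-1 by rewrite invr_gt0.
apply: (@fine_scale _ _ m^-1) => //.
- move=> y y0; split; last by rewrite mulr_ge0 ?powR_ge0 ?expR_ge0.
  apply: continuousM; first exact: cont_powR.
  by apply: continuous_comp; [apply: continuousM; [exact: cst_continuous|]|exact: continuous_expR].
- exact: lap_int.
- move=> x x0; have -> : - m * (m^-1 * x) = - 1 * x by rewrite mulrA !mulNr mulfV ?gt_eqF.
  rewrite mulrAC powR_scale ?ltW// -mulrA; congr (_ `^ _ * _); ring.
Qed.

Lemma hol_int (r m : R) : 0 < r -> r < 1 -> 0 <= m ->
  mu.-integrable D (EFin \o (fun t : R => t `^ (- r - 1) * (1 - expR (- m * t)))).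
Proof.
move=> r0 r1 m0; have e0 (t : R) : 0 < t -> 0 <= 1 - expR (- m * t) <= 1.
  move=> t0; have := expR_gt0 (- m * t); have : expR (- m * t) <= 1.
    by rewrite -[leRHS]expR0 ler_expR; nra.
  by lra.
apply: (@int_pos_lty _ _ (1 - r) r (Num.max 1 m)); rewrite ?subr_gt0//.
- apply: measurable_funM; first exact: meas_pow.
  by apply: measurable_funB => //; exact: meas_exp.
- move=> t t0 _; have /andP[h1 h2] := e0 t t0.
  rewrite ger0_norm ?mulr_ge0 ?powR_ge0//.
  have -> : t `^ (1 - r - 1) = t * t `^ (- r - 1).
    rewrite -{2}(powRr1 (ltW t0)) -powRD ?(gt_eqF t0) ?implybT//.
    by congr (_ `^ _); ring.
  rewrite [leLHS]mulrC mulrA ler_wpM2r ?powR_ge0//.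
  apply: (@le_trans _ _ (m * t)); last by rewrite ler_wpM2r ?(ltW t0)// le_max lexx orbT.
  by have := expR_ge1Dx (- m * t); lra.
- move=> t t1; have t0 : 0 < t by lra.
  have /andP[h1 h2] := e0 t t0.
  rewrite ger0_norm ?mulr_ge0 ?powR_ge0// mulrC ler_wpM2r ?powR_ge0//.
  by apply: (le_trans h2); rewrite le_max lexx.
Qed.

(** The constant of the companion formula for positive powers. The subtraction of the exponential
    makes the integral converge at 0, which requires r < 1. *)
Definition hol r : R := \int[mu]_(t in D) (t `^ (- r - 1) * (1 - expR (- 1 * t))).

Lemma hol_gt0 r : 0 < r -> r < 1 -> 0 < hol r.
Proof.
move=> r0 r1.
have e1 : expR (- 1 * 1) < 1 :> R by rewrite -[ltRHS]expR0 ltr_expR; lra.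
have c0 : 0 < 2 `^ (- r - 1) * (1 - expR (- 1 * 1)) :> R by rewrite mulr_gt0 ?powR_gt0// subr_gt0.
have e0 (t : R) : 0 < t -> 0 <= 1 - expR (- 1 * t).
  by move=> t0; rewrite subr_ge0 -[leRHS]expR0 ler_expR; nra.
apply: (Rint_gt0 c0) => [|t t0|t t1 t2]; first exact: hol_int.
  by rewrite mulr_ge0 ?powR_ge0 ?e0.
have t0 : 0 < t by lra.
have h1 : 2 `^ (- r - 1) <= t `^ (- r - 1).
  have -> : - r - 1 = - (r + 1) by ring.
  by rewrite !powRN lef_pV2 ?posrE ?powR_gt0// ge0_ler_powR ?nnegrE//; lra.
have h2 : 1 - expR (- 1 * 1) <= 1 - expR (- 1 * t) by rewrite lerB// ler_expR; lra.
by apply: ler_pM => //; rewrite ?powR_ge0// subr_ge0 ltW.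
Qed.

Lemma holE (r m : R) : 0 < r -> r < 1 -> 1 <= m ->
  \int[mu]_(t in D) (t `^ (- r - 1) * (1 - expR (- m * t))) = m `^ r * hol r.
Proof.
move=> r0 r1 m1; have m0 : 0 < m by exact: lt_le_trans m1.
have mi0 : 0 < m^-1 by rewrite invr_gt0.
apply: (@fine_scale _ _ m^-1) => //.
- move=> y y0; split.
    apply: continuousM; first exact: cont_powR.
    apply: continuousB; first exact: cst_continuous.
    by apply: continuous_comp; [apply: continuousM; [exact: cst_continuous|]|exact: continuous_expR].
  by rewrite mulr_ge0 ?powR_ge0// subr_ge0 -[leRHS]expR0 ler_expR; nra.
- exact: hol_int.
- move=> x x0; have -> : - m * (m^-1 * x) = - 1 * x by rewrite mulrA !mulNr mulfV ?gt_eqF.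
  rewrite mulrAC powR_scale ?ltW// -mulrA; congr (_ `^ _ * _); ring.
Qed.
End laplace.

(** * The Ornstein-Uhlenbeck semigroup and Bessel potentials *)

Section semigroup.
Context {R : realType} (G : gspace R).
Local Notation T := (gT G).
Local Notation P := (gP G).
Local Notation X := (@gX R G).
Local Notation Q := (gP (gsq G)).
Local Notation I := (nat * gI G)%type.
Implicit Types (F V : T -> R) (phi : seq (R * I)) (p q : R).

(** The symbols of [F]; they stand in for its chaos expansion and determine it in L^2 by
    [sym_uniq]. *)
Definition sym F (l : I) : R := Ex P (fun x => F x * ge l x).
(** A multiplier depending on the degree only, that is, a function of L. *)
Definition fmul (a : nat -> R) phi : seq (R * I) := [seq (c.1 * a c.2.1, c.2) | c <- phi].

Lemma fval_fmul (s : I -> R) a phi : fval s (fmul a phi) = \sum_(c <- phi) c.1 * (a c.2.1 * s c.2).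
Proof. by rewrite /fval big_map; apply: eq_bigr => c _; rewrite mulrA. Qed.

Lemma fev_fmul a phi x : fev ge (fmul a phi) x = \sum_(c <- phi) c.1 * (a c.2.1 * ge c.2 x).
Proof. by rewrite /fev big_map; apply: eq_bigr => c _; rewrite mulrA. Qed.

Lemma Ex_sym F phi : memL P 2 F -> Ex P (fun x => F x * fev ge phi x) = fval (sym F) phi.
Proof. by move=> mF; rewrite Ex_fev//; exact: Linf_ge. Qed.

Lemma Linf_fevg phi : Linf P (fev ge phi).
Proof. by apply: Linf_fev; exact: Linf_ge. Qed.

Lemma ge_mehler (c s : R) (l : I) x : c ^+ 2 + s ^+ 2 = 1 ->
  Ex P (fun y => ge l (rot c s ((x, y) : gT (gsq G))).1) = c ^+ l.1 * ge l x.
Proof.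
move=> cs; rewrite /ge /rot/= -he_scale -(mehler0 _ _ _ (glin s l.2 0 l.2)).
apply: eq_Ex => y; rewrite gXmix gXlin mul0r addr0; congr (he _ _ _).
by rewrite gcovDl !gcovDr -{1}[gvar l.2]mul1r -cs; ring.
Qed.

Lemma fev_rot_Linf (c s : R) phi : c ^+ 2 + s ^+ 2 = 1 ->
  Linf Q (fun z => fev ge phi (rot c s z).1).
Proof. by move=> cs; exact: mpres_Linf (rot1_mpres G cs) _ (Linf_fevg phi). Qed.

Lemma ge_slice (c s : R) (l : I) x : Linf P (fun y => ge l (rot c s ((x, y) : gT (gsq G))).1).
Proof.
apply: Linf_he => /=; under eq_fun do rewrite gXmix.
by apply: LinfD; [exact: Linf_cst|apply: LinfZ; exact: Linf_gX].
Qed.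

Lemma fev_mehler (c s : R) phi x : c ^+ 2 + s ^+ 2 = 1 ->
  Ex P (fun y => fev ge phi (rot c s ((x, y) : gT (gsq G))).1) = fev ge (fmul (fun n => c ^+ n) phi) x.
Proof.
move=> cs; rewrite fev_fmul /fev (Ex_sum _ _).2; last first.
  by move=> k; apply: (Linf1 (P := P)); apply: LinfZ; exact: ge_slice.
apply: eq_bigr => k _; rewrite ExZ; last exact/Linf1/ge_slice.
by rewrite ge_mehler.
Qed.

Lemma fev_slice (c s : R) phi x : Linf P (fun y => fev ge phi (rot c s ((x, y) : gT (gsq G))).1).
Proof. by apply: Linf_sum => k; apply: LinfZ; exact: ge_slice. Qed.

(** By Mehler's formula the multiplier c^n is a rotation, which preserves the measure, followed by a
    conditional expectation. *)
Lemma fmul_nrm p (c s : R) phi : 1 <= p -> c ^+ 2 + s ^+ 2 = 1 ->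
  nrm P p (fev ge (fmul (fun n => c ^+ n) phi)) <= nrm P p (fev ge phi).
Proof.
move=> p1 cs; have m : memL P p (fev ge phi) by exact: Linf_fevg.
have [m1 n1] := mpres_memL (rot1_mpres G cs) m.
have [_] := cond_nrm (P1 := P) (P2 := P) p1 m1 (fun x => Linf1 (fev_slice c s phi x)).
rewrite n1; under [X in nrm P p X]eq_fun do rewrite fev_mehler//.
by [].
Qed.

Lemma mehler_sym F (c s : R) phi : memL P 2 F -> c ^+ 2 + s ^+ 2 = 1 ->
  Ex Q (fun z => F z.1 * fev ge phi (rot c s z).1) = fval (sym F) (fmul (fun n => c ^+ n) phi).
Proof.
move=> mF cs; have m1 : memL Q 2 (fun z => F z.1) by exact: (mpres_memL (mpres_fst P P) mF).1.
have m2 : memL Q 2 (fun z => fev ge phi (rot c s z).1) by exact/Linf2/fev_rot_Linf.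
have m3 := (memLM22 m1 m2).1.
rewrite (Ex_fubini (P1 := P) (P2 := P) m3) -Ex_sym//; apply: eq_Ex => x.
rewrite -(fev_mehler phi x cs); apply: (ExZ (F x)); exact/Linf1/fev_slice.
Qed.

Lemma cs35 : (3 / 5 : R) ^+ 2 + (4 / 5) ^+ 2 = 1. Proof. by field. Qed.

(** Pairing one functional with the rotated other gives E(ge l ge k) times c^k or c^l, according to
    which of them is rotated; measure invariance identifies the two values, and 0 < c < 1 makes the
    powers different. *)
Lemma ge_orth (l k : I) : l.1 != k.1 -> Ex P (fun x => ge l x * ge k x) = 0.
Proof.
move=> lk; pose c : R := 3 / 5; pose s : R := 4 / 5.
have cs : c ^+ 2 + s ^+ 2 = 1 := cs35.
have cs' : c ^+ 2 + (- s) ^+ 2 = 1 by rewrite sqrrN.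
have A i j r : c ^+ 2 + r ^+ 2 = 1 ->
    Ex Q (fun z => ge i z.1 * ge j (rot c r z).1) = c ^+ j.1 * Ex P (fun x => ge i x * ge j x).
  move=> cr; have := mehler_sym [:: (1, j)] (Linf2 (Linf_ge i)) cr.
  rewrite fval_fmul big_seq1 mul1r /sym => <-; apply: eq_Ex => z.
  by rewrite /fev big_seq1 mul1r.
have E : Ex Q (fun z => ge l z.1 * ge k (rot c s z).1) = Ex Q (fun z => ge k z.1 * ge l (rot c (- s) z).1).
  rewrite -(mpres_Ex (rot_mpres G cs')); last first.
    apply: (Linf_meas (P := Q)); apply: LinfM; first exact/fst_Linf/Linf_ge.
    exact: mpres_Linf (rot1_mpres G cs) _ (Linf_ge k).
  apply: eq_Ex => z; rewrite mulrC; congr (_ * _); rewrite /ge /rot/=; congr (he _ _ _).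
  rewrite !gXmix; have -> : c * (c * X k.2 z.1 + - s * X k.2 z.2) + s * (- - s * X k.2 z.1 + c * X k.2 z.2)
    = (c ^+ 2 + s ^+ 2) * X k.2 z.1 by ring.
  by rewrite cs mul1r.
move: E; rewrite !A//; under [X in _ = _ * X]eq_Ex do rewrite mulrC.
move=> /eqP; rewrite -subr_eq0 -mulrBl mulf_eq0 => /orP[|/eqP//].
rewrite subr_eq0 => /eqP h; exfalso; move: lk; wlog : l k h / (l.1 < k.1)%N.
  by move=> w; rewrite neq_ltn => /orP[hl|hl]; [apply: (w l k)|apply: (w k l)] => //;
    rewrite neq_ltn hl ?orbT.
move=> hl _; have : c ^+ k.1 < c ^+ l.1 by rewrite ltr_iXn2l// /c; lra.
by rewrite h ltxx.
Qed.

Definition conj_exp p q := 0 < q /\ p^-1 + q^-1 = 1.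

Lemma conj_ge1 p q : 2 <= p -> conj_exp p q -> 1 <= q <= 2.
Proof. by move=> p2 [q0 pq]; exact: conjugate_le2 p2 q0 pq. Qed.

Lemma sym_bound p q F phi : 2 <= p -> conj_exp p q -> memL P p F ->
  `|fval (sym F) phi| <= nrm P p F * nrm P q (fev ge phi).
Proof.
move=> p2 pq mF; have p0 : 0 < p by lra.
have /andP[q1 _] := conj_ge1 p2 pq.
rewrite -Ex_sym; last exact: (memL_le _ p2 mF).1.
by apply: (hoelderE p0 pq.1 pq.2 mF _).2; exact: Linf_fevg.
Qed.

Lemma sym_uniq F V : memL P 2 F -> memL P 2 V -> (forall l, sym F l = sym V l) ->
  {ae P, forall x, F x = V x}.
Proof.
move=> mF mV h; apply: (sym_inj (e := ge)) h => //; first exact: Linf_ge.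
by move=> H eps mH e0; apply: chaos_dense => //; rewrite ler1n.
Qed.

Lemma repr p q (C : R) (s : I -> R) : 2 <= p -> conj_exp p q -> 0 <= C ->
  (forall phi, `|fval s phi| <= C * nrm P q (fev ge phi)) ->
  exists V, [/\ memL P p V, nrm P p V <= C & forall l, sym V l = s l].
Proof.
move=> p2 [q0 pq] C0 h; apply: (representation (e := ge)) h => //; first exact: Linf_ge.
by move=> H eps mH e0; apply: chaos_dense => //; rewrite ler1n.
Qed.

Lemma conj_exists p : 2 <= p -> conj_exp p (p / (p - 1)).
Proof.
move=> p2; split; first by rewrite divr_gt0//; lra.
by field; apply/andP; split; rewrite gt_eqF//; lra.
Qed.

Lemma exp_cs (t : R) : 0 < t -> exists2 s : R, 0 < s & expR (- t) ^+ 2 + s ^+ 2 = 1.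
Proof.
move=> t0; have h : 0 < 1 - expR (- t) ^+ 2.
  rewrite subr_gt0 -(expr1n _ 2) ltrXn2r// ?nnegrE ?expR_ge0//.
  by rewrite -[ltRHS]expR0 ltr_expR; lra.
exists (Num.sqrt (1 - expR (- t) ^+ 2)); first by rewrite sqrtr_gt0.
by rewrite sqr_sqrtr ?ltW//; ring.
Qed.

Lemma expXn (t : R) n : expR (- t) ^+ n = expR (- n%:R * t).
Proof. by rewrite -expRM_natl; congr expR; rewrite mulrN mulNr. Qed.

(* [pot a V F] says that F = (1 - L)^(- a / 2) V. *)
Definition jm (a : R) (n : nat) : R := (n.+1%:R) `^ (- (a / 2)).
Definition pot a V F := forall l, sym F l = jm a l.1 * sym V l.

Lemma jm0 n : jm 0 n = 1.
Proof. by rewrite /jm mul0r oppr0 powRr0. Qed.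

Lemma jmD a b n : jm (a + b) n = jm a n * jm b n.
Proof.
rewrite /jm -powRD; first by congr (_ `^ _); field.
by rewrite (_ : n.+1%:R == 0 = false) ?implybT// gt_eqF.
Qed.

Lemma potD a b V W F : pot a V F -> pot b W V -> pot (a + b) W F.
Proof. by move=> h1 h2 l; rewrite h1 h2 jmD mulrA. Qed.

(** Subordination: (n+1)^(-s) is the integral of t^(s-1) e^(-t) e^(-n t) divided by Gamma(s), and
    the multipliers e^(-n t) are contractions. For [a = 0] the multiplier is 1. *)
Lemma jm_bound (a : R) p q V phi : 0 <= a -> 2 <= p -> conj_exp p q -> memL P p V ->
  `|fval (fun l => jm a l.1 * sym V l) phi| <= nrm P p V * nrm P q (fev ge phi).
Proof.
rewrite le_eqVlt => /predU1P[<-|a0] p2 pq mV.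
  by under [fval _]funext => f do rewrite /fval; under eq_bigr do rewrite jm0 mul1r; exact: sym_bound.
have s0 : 0 < a / 2 by rewrite divr_gt0.
have g0 := gam_gt0 s0; set s := a / 2 in s0 g0 *.
have /andP[q1 _] := conj_ge1 p2 pq.
pose g (l : I) (t : R) := sym V l * ((gam s)^-1 * (t `^ (s - 1) * expR (- l.1.+1%:R * t))).
pose B t := nrm P p V * nrm P q (fev ge phi) * ((gam s)^-1 * (t `^ (s - 1) * expR (- 1 * t))).
have n1 n : 1 <= n.+1%:R :> R by rewrite ler1n.
have ig l : lebesgue_measure.-integrable `]0, +oo[ (EFin \o g l).
  by apply: intZ => //; apply: intZ => //; exact: lap_int.
have iB : lebesgue_measure.-integrable `]0, +oo[ (EFin \o B).
  by apply: intZ => //; apply: intZ => //; exact: lap_int.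
have := @Rint_comb R I phi `]0, +oo[%classic g B (measurable_itv _) ig iB.
have eg l : \int[lebesgue_measure]_(t in `]0, +oo[) g l t = jm a l.1 * sym V l.
  rewrite RintegralZl//; last by apply: intZ => //; exact: lap_int.
  rewrite RintegralZl//; last exact: lap_int.
  rewrite lapE// /jm -/s; rewrite mulrC; congr (_ * _).
  by rewrite mulrCA mulVf ?mulr1// gt_eqF.
have eB : \int[lebesgue_measure]_(t in `]0, +oo[) B t = nrm P p V * nrm P q (fev ge phi).
  rewrite RintegralZl//; last by apply: intZ => //; exact: lap_int.
  rewrite RintegralZl//; last exact: lap_int.
  by rewrite lapE// powR1 mul1r mulVf ?mulr1// gt_eqF.
rewrite eB; under eq_bigr do rewrite eg; apply.
move=> t; rewrite /= in_itv/= andbT => t0.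
have -> : \sum_(c <- phi) c.1 * g c.2 t =
    (gam s)^-1 * (t `^ (s - 1) * expR (- 1 * t)) * fval (sym V) (fmul (fun n => expR (- t) ^+ n) phi).
  rewrite fval_fmul mulr_sumr; apply: eq_bigr => c _; rewrite /g.
  have -> : expR (- c.2.1.+1%:R * t) = expR (- 1 * t) * expR (- t) ^+ c.2.1.
    by rewrite expXn -expRD; congr expR; rewrite -natr1; ring.
  by ring.
have w0 : 0 <= (gam s)^-1 * (t `^ (s - 1) * expR (- 1 * t)).
  by rewrite mulr_ge0 ?invr_ge0 ?(ltW g0)// mulr_ge0 ?powR_ge0 ?expR_ge0.
rewrite normrM (ger0_norm w0) /B mulrC ler_wpM2r//.
apply: (le_trans (sym_bound _ p2 pq mV)); rewrite ler_wpM2l ?nrm_ge0//.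
by have [r _ cr] := exp_cs t0; exact: fmul_nrm cr.
Qed.

Lemma bessel_ex (a : R) p V : 0 <= a -> 2 <= p -> memL P p V ->
  exists F, [/\ memL P p F, nrm P p F <= nrm P p V & pot a V F].
Proof.
move=> a0 p2 mV; apply: (repr p2 (conj_exists p2) (nrm_ge0 _ _ _)) => phi.
exact: jm_bound (conj_exists p2) mV.
Qed.

Lemma memL_sym p F V : 2 <= p -> memL P 2 F -> memL P p V -> (forall l, sym F l = sym V l) ->
  memL P p F /\ nrm P p F = nrm P p V.
Proof.
move=> p2 mF mV h; have p0 : 0 < p by lra.
have m2 := (memL_le (ltr0n R 2) p2 mV).1.
by apply: ae_nrm => //; [exact: sym_uniq|exact: memL_meas mF].
Qed.

(** The functionals obtained for different p have the same symbols, hence agree almost everywhere,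
    so the one found for p = 2 serves all p. *)
Lemma Linf_sym (s : I -> R) :
  (forall p, 2 <= p -> exists V, memL P p V /\ forall l, sym V l = s l) ->
  exists V, Linf P V /\ forall l, sym V l = s l.
Proof.
move=> h; have [V [mV hV]] := h 2 (lexx _); exists V; split=> // p p1.
have p0 : 0 < p by lra.
have [p2|p2] := leP 2 p; last by apply: (memL_le p0 (ltW p2) mV).1.
have [W [mW hW]] := h p p2; apply: (memL_sym p2 mV mW _).1 => l.
by rewrite hV hW.
Qed.

Lemma bessel_Linf (a : R) V : 0 <= a -> Linf P V -> exists F, Linf P F /\ pot a V F.
Proof.
move=> a0 LV; apply: Linf_sym => p p2; have p1 : 1 <= p by lra.
by have [F [m _ h]] := bessel_ex a0 p2 (LV p p1); exists F.
Qed.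

(** The space of order [a] in the intersection over p, with one [V] common to all p; this uniformity
    is legitimate by [Linf_sym]. *)
Definition Dsp (a : R) F := Linf P F /\ exists V, Linf P V /\ pot a V F.

Lemma Dsp0 F : Linf P F -> Dsp 0 F.
Proof. by move=> LF; split=> //; exists F; split=> // l; rewrite jm0 mul1r. Qed.

Lemma Dsp_le a b F : a <= b -> Dsp b F -> Dsp a F.
Proof.
move=> ab [LF [V [LV h]]]; split=> //.
have [W [LW hW]] := bessel_Linf (a := b - a) (ltac:(rewrite subr_ge0//)) LV.
exists W; split=> // l; rewrite h hW mulrA -jmD; congr (jm _ _ * _); ring.
Qed.

Lemma symD F V a l : memL P 2 F -> memL P 2 V ->
  sym (fun x => F x + a * V x) l = sym F l + a * sym V l.
Proof.
move=> mF mV; have L := Linf2 (Linf_ge l).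
rewrite /sym -ExZ; last exact: (memLM22 mV L).1.
rewrite -ExD; last 2 first.
- exact: (memLM22 mF L).1.
- exact: (nrmZ _ _ (memLM22 mV L).1).1.
by apply: eq_Ex => x; ring.
Qed.

Lemma Dsp_lin a b F V : Dsp a F -> Dsp a V -> Dsp a (fun x => F x + b * V x).
Proof.
move=> [LF [F' [LF' hF]]] [LV [V' [LV' hV]]]; split; first exact: LinfD (LinfZ _ LV).
exists (fun x => F' x + b * V' x); split; first exact: LinfD (LinfZ _ LV').
by move=> l; rewrite !symD ?hF ?hV; [ring|exact: Linf2..].
Qed.

Lemma sym_ae F V : measurable_fun setT F -> measurable_fun setT V ->
  {ae P, forall x, F x = V x} -> forall l, sym F l = sym V l.
Proof.
move=> mF mV h l; apply: ae_Ex; first by apply: filterS h => x ->.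
- by apply: measurable_funM => //; exact: Linf_meas (Linf_ge l).
- by apply: measurable_funM => //; exact: Linf_meas (Linf_ge l).
Qed.

Lemma Linf_ae F V : {ae P, forall x, F x = V x} -> Linf P F -> measurable_fun setT V -> Linf P V.
Proof. by move=> h LF mV p p1; apply: (ae_nrm h (LF p p1) mV).1. Qed.

Lemma Dsp_ae a F V : {ae P, forall x, F x = V x} -> measurable_fun setT V -> Dsp a F -> Dsp a V.
Proof.
move=> h mV [LF [F' [LF' hF]]]; split; first exact: Linf_ae h LF mV.
exists F'; split=> // l; rewrite -hF; apply/esym/sym_ae => //; exact: Linf_meas LF.
Qed.
End semigroup.

Section transfer.
Context {R : realType} (G : gspace R).
Local Notation P := (gP G).
Local Notation Q := (gP (gsq G)).

(** Averaging he_n(X_i(x) + X_j(y)) over [y] leaves he_n(X_i(x)), so only the first component of the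
    index is seen. *)
Lemma ge_fst (F : gT G -> R) (l : nat * gI (gsq G)) : memL P 2 F ->
  sym (G := gsq G) (fun z => F z.1) l = sym F (l.1, l.2.1).
Proof.
move=> mF; have m1 : memL Q 2 (fun z => F z.1) by exact: (mpres_memL (mpres_fst P P) mF).1.
rewrite /sym (Ex_fubini (P1 := P) (P2 := P) (memLM22 m1 (Linf2 (Linf_ge l))).1).
apply: eq_Ex => x /=; rewrite ExZ; last first.
  apply/Linf1/Linf_he; apply: (LinfD (Linf_cst P (gX l.2.1 x))); exact: Linf_gX.
by congr (_ * _); rewrite /ge/= mehler0.
Qed.

Lemma pot_fst a (V F : gT G -> R) : memL P 2 F -> memL P 2 V -> pot a V F ->
  pot (G := gsq G) a (fun z => V z.1) (fun z => F z.1).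
Proof. by move=> mF mV h l; rewrite !ge_fst// h. Qed.

Lemma Dsp_fst a (F : gT G -> R) : Dsp a F -> Dsp (G := gsq G) a (fun z => F z.1).
Proof.
move=> [LF [V [LV h]]]; split; first exact: fst_Linf.
exists (fun z => V z.1); split; first exact: fst_Linf.
by apply: pot_fst h; exact: Linf2.
Qed.
End transfer.

(** * Derivatives along rotations *)

Lemma mvt_bound (R : realType) (f df : R -> R) (B s t : R) :
  (forall x : R, is_derive x 1 f (df x)) ->
  (forall x, Num.min s t <= x <= Num.max s t -> `|df x| <= B) ->
  `|f t - f s| <= B * `|t - s|.
Proof.
move=> D; wlog st : s t / s <= t.
  move=> h; case/orP: (le_total s t) => [/h//|ts]; rewrite minC maxC distrC (distrC t).
  exact: h.
rewrite min_l// max_r// => hB.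
have c : {within `[s, t], continuous f}.
  apply: continuous_subspaceT => x; apply: differentiable_continuous.
  by apply/derivable1_diffP; have := D x => ?; exact: ex_derive.
have [x xst ->] := MVT_segment st (fun x _ => D x) c.
by rewrite normrM ler_wpM2r// hB//; move: xst; rewrite in_itv.
Qed.

Section rotation.
Context {R : realType} (G : gspace R).
Local Notation S := (gsq G).
Local Notation T := (gT S).
Local Notation Q := (gP S).
Local Notation X := (@gX R S).
Local Notation I := (nat * gI S)%type.
Implicit Types (H U W : T -> R) (phi : seq (R * I)) (p q : R).

Definition rotate (t : R) (z : T) : T := rot (cos t) (sin t) z.
(** A quarter turn on indices: [X (gJ l)] is the derivative at angle 0 of [X l] along the
    rotations. *)
Definition gJ (l : gI S) : gI S := (glin (- 1) l.2 0 l.2, l.1).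
(* The derivative at 0 of [t |-> ge l (rotate t z)]. *)
Definition rge (l : I) (z : T) : R := l.1%:R * he (gvar l.2) l.1.-1 (X l.2 z) * X (gJ l.2) z.

Lemma cs1 (t : R) : cos t ^+ 2 + sin t ^+ 2 = 1. Proof. exact: cos2Dsin2. Qed.

Lemma rotate_mpres t : mpres Q Q (rotate t).
Proof. exact: rot_mpres (cs1 t). Qed.

Lemma gX_rotate (l : gI S) t z : X l (rotate t z) = cos t * X l z + sin t * X (gJ l) z.
Proof. by rewrite /rotate /rot /= !gXmix gXlin; ring. Qed.

Lemma gX_gJ2 (l : gI S) z : X (gJ (gJ l)) z = - X l z.
Proof. by rewrite /= !gXlin; ring. Qed.

Lemma gJ_rotI (c s : R) (l : gI S) z : X (gJ (rotI c s l)) z = X (rotI c s (gJ l)) z.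
Proof. by rewrite /= !gXlin; ring. Qed.

Lemma rotateD s t z : rotate s (rotate t z) = rotate (s + t) z.
Proof.
apply: (gsep (g := S)) => l; rewrite !gX_rotate gX_gJ2 cosD sinD; ring.
Qed.

Lemma rotate0 z : rotate 0 z = z.
Proof. by apply: (gsep (g := S)) => l; rewrite gX_rotate cos0 sin0; ring. Qed.

Definition frot (t : R) phi : seq (R * I) :=
  [seq (c.1, (c.2.1, rotI (cos t) (sin t) c.2.2)) | c <- phi].

Lemma ge_rotI t (l : I) z : ge (l.1, rotI (cos t) (sin t) l.2) z = ge l (rotate t z).
Proof. by rewrite /ge /rotate gX_rot -(gcov_rotI l.2 (cs1 t)). Qed.

Lemma rge_rotI t (l : I) z : rge (l.1, rotI (cos t) (sin t) l.2) z = rge l (rotate t z).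
Proof.
by rewrite /rge /rotate gX_rot (gX_rot _ _ (gJ l.2)) -gJ_rotI -(gcov_rotI l.2 (cs1 t)).
Qed.

Lemma fev_frot t phi z : fev ge (frot t phi) z = fev ge phi (rotate t z).
Proof. by rewrite /fev big_map; apply: eq_bigr => c _; rewrite -ge_rotI. Qed.

Lemma fev_frotr t phi z : fev rge (frot t phi) z = fev rge phi (rotate t z).
Proof. by rewrite /fev big_map; apply: eq_bigr => c _; rewrite -rge_rotI. Qed.

Lemma Linf_rge l : Linf Q (rge l).
Proof. by apply: LinfM; [apply: LinfZ; exact/Linf_he/Linf_gX|exact: Linf_gX]. Qed.

Lemma Linf_rotate H t : Linf Q H -> Linf Q (fun z => H (rotate t z)).
Proof. by move=> LH; exact: mpres_Linf (rotate_mpres t) _ LH. Qed.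

Lemma rotate_nrm p H t : memL Q p H ->
  memL Q p (fun z => H (rotate t z)) /\ nrm Q p (fun z => H (rotate t z)) = nrm Q p H.
Proof. exact: mpres_memL (rotate_mpres t) _ _. Qed.

Lemma Ex_rotate H W t : memL Q 2 H -> memL Q 2 W ->
  Ex Q (fun z => H (rotate t z) * W z) = Ex Q (fun z => H z * W (rotate (- t) z)).
Proof.
move=> mH mW; have [m1 _] := rotate_nrm (- t) mW.
have mm : measurable_fun setT (fun z => H z * W (rotate (- t) z)).
  by apply: measurable_funM; [exact: memL_meas mH|exact: memL_meas m1].
rewrite -(mpres_Ex (rotate_mpres t) mm); apply: eq_Ex => z.
by rewrite rotateD addNr rotate0.
Qed.

Lemma jet_rge l : jet Q (fun t z => ge l (rotate t z)) (fun t z => rge l (rotate t z)).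
Proof.
have j1 := jet_term (@is_derive_cos R) (Linf_gX l.2).
have j2 := jet_term (@is_derive_sin R) (Linf_gX (gJ l.2)).
have q0 (t : R) : is_derive t 1 (fun=> gvar l.2) 0 by exact: is_derive_cst.
apply: (jet_ext (jet_he l.1 q0 (jetD j1 j2))) => t z.
  by rewrite /ge gX_rotate.
by rewrite /rge !gX_rotate gX_gJ2; ring.
Qed.

Lemma jet_fev phi : jet Q (fun t z => fev ge phi (rotate t z)) (fun t z => fev rge phi (rotate t z)).
Proof.
elim: phi => [|c phi IH].
  by apply: (jet_ext (jet_nil Q)) => t z; rewrite /fev big_nil.
have j := jetM (jet_cst (Linf_cst Q c.1)) (jet_rge c.2).
by apply: (jet_ext (jetD j IH)) => t z; rewrite /fev big_cons// mul0r add0r.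
Qed.

(** Measure invariance moves the rotation onto the Hermite side, where the dependence on [t] is a
    jet; so a merely square-integrable [H] is differentiable in this weak sense. *)
Lemma der_rotate H phi (t : R) : memL Q 2 H ->
  is_derive t 1 (fun t => Ex Q (fun z => H (rotate t z) * fev ge phi z))
    (- Ex Q (fun z => H z * fev rge phi (rotate (- t) z))).
Proof.
move=> mH; have D := jet_Ex mH (jet_fev phi) (- t).
have N : is_derive t 1 (-%R : R -> R) (- 1).
  have := is_deriveN (is_derive_id t (1 : R)); exact.
apply: (is_derive_ext (is_derive1_comp D N)) => [s|]; last by rewrite mulrN1.
by rewrite /= Ex_rotate//; exact/Linf2/Linf_fevg.
Qed.

(* The group [rotate] preserves [Q], so its generator is skew-symmetric. *)
Definition wder H U := forall l, sym (G := S) U l = - Ex Q (fun z => H z * rge l z).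

Lemma wder_fev H U phi : memL Q 2 H -> memL Q 2 U -> wder H U ->
  Ex Q (fun z => U z * fev ge phi z) = - Ex Q (fun z => H z * fev rge phi z).
Proof.
move=> mH mU h; rewrite Ex_sym// (Ex_fev (e := rge) Linf_rge)// /fval -sumrN.
by apply: eq_bigr => c _; rewrite h mulrN.
Qed.

Lemma wder_is_derive H U phi (t : R) : memL Q 2 H -> memL Q 2 U -> wder H U ->
  is_derive t 1 (fun t => Ex Q (fun z => H (rotate t z) * fev ge phi z))
    (Ex Q (fun z => U (rotate t z) * fev ge phi z)).
Proof.
move=> mH mU h; apply: is_derive_ext (der_rotate phi t mH) _ _ => //.
rewrite Ex_rotate//; last exact/Linf2/Linf_fevg.
under [in RHS]eq_Ex do rewrite -fev_frotr.
under eq_Ex do rewrite -fev_frot.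
exact: wder_fev.
Qed.

Lemma dual p q (C : R) H : 2 <= p -> conj_exp p q -> memL Q 2 H -> 0 <= C ->
  (forall phi, `|Ex Q (fun z => H z * fev ge phi z)| <= C * nrm Q q (fev ge phi)) ->
  memL Q p H /\ nrm Q p H <= C.
Proof.
move=> p2 [q0 pq] mH C0 h; apply: (dual_nrm (e := ge)) h => //; first exact: Linf_ge.
by move=> F eps mF e0; apply: chaos_dense => //; rewrite ler1n.
Qed.

(* Both estimates come from the mean value theorem for [t |-> E (H (rotate t z) * phi z)]. *)
Lemma wder_taylor p H U (t B : R) : 2 <= p -> memL Q p H -> memL Q p U -> wder H U -> 0 <= B ->
  forall (c : R), (forall s, Num.min 0 t <= s <= Num.max 0 t -> nrm Q p (fun z => U (rotate s z) - c * U z) <= B) ->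
  nrm Q p (fun z => H (rotate t z) - H z - (c * t) * U z) <= B * `|t|.
Proof.
move=> p2 mH mU h B0 c hB; have p1 : 1 <= p by lra. have p0 : 0 < p by lra.
have pq := conj_exists p2; set q := p / (p - 1) in pq.
have H2 := (memL_le (ltr0n R 2) p2 mH).1; have U2 := (memL_le (ltr0n R 2) p2 mU).1.
have [R2 _] := rotate_nrm t H2; have p12 : 1 <= 2 :> R by rewrite ler1n.
have m1 := (nrmB p12 R2 H2).1; have m2 := (nrmZ (c * t) (ltr0n R 2) U2).1.
apply: (dual p2 pq (nrmB p12 m1 m2).1 _ _).2; first by rewrite mulr_ge0.
move=> phi; have L2 := Linf2 (Linf_fevg phi).
pose f (s : R) := Ex Q (fun z => H (rotate s z) * fev ge phi z) - c * Ex Q (fun z => U z * fev ge phi z) * s.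
pose df (s : R) := Ex Q (fun z => U (rotate s z) * fev ge phi z) - c * Ex Q (fun z => U z * fev ge phi z).
have Df (s : R) : is_derive s 1 f (df s).
  have D2 := is_derive_mul (is_derive_cst (c * Ex Q (fun z => U z * fev ge phi z)) s 1) (is_derive_id s (1 : R)).
  apply: (is_derive_ext (is_deriveB (wder_is_derive phi s H2 U2 h) D2)) => //=.
  by rewrite mul0r add0r mulr1.
have E2 V : memL Q 2 V -> memL Q 1 (fun z => V z * fev ge phi z).
  by move=> mV; exact: (memLM22 mV L2).1.
have -> : Ex Q (fun z => (H (rotate t z) - H z - c * t * U z) * fev ge phi z) = f t - f 0.
  rewrite /f mulr0 subr0; under [X in _ = _ - _ - X]eq_Ex do rewrite rotate0.
  have -> : (fun z => (H (rotate t z) - H z - c * t * U z) * fev ge phi z) =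
    (fun z => (H (rotate t z) * fev ge phi z - H z * fev ge phi z) - c * t * (U z * fev ge phi z)).
    by apply/funext => z; ring.
  rewrite ExB; last 2 first.
  - exact: (nrmB (lexx 1) (E2 _ R2) (E2 _ H2)).1.
  - exact: (nrmZ _ _ (E2 _ U2)).1.
  rewrite (ExB (E2 _ R2) (E2 _ H2)) (ExZ (c * t) (E2 _ U2)); ring.
have := @mvt_bound R f df (B * nrm Q q (fev ge phi)) 0 t Df _.
rewrite subr0 mulrAC; apply=> s hs; rewrite /df -(ExZ c (E2 _ U2)).
have [RU nRU] := rotate_nrm s U2; have [RUp _] := rotate_nrm s mU.
rewrite -ExB; [|exact: E2|exact: (nrmZ _ _ (E2 _ U2)).1].
rewrite (eq_Ex Q (g := fun z => (U (rotate s z) - c * U z) * fev ge phi z)); last by move=> z; ring.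
have mD := (nrmB p1 RUp (nrmZ c p0 mU).1).1.
have /andP[q1 _] := conj_ge1 p2 pq.
apply: le_trans (hoelderE p0 pq.1 pq.2 mD (Linf_fevg phi q1)).2 _.
by rewrite ler_wpM2r ?nrm_ge0 ?hB.
Qed.

Lemma wder_lip p H U (t : R) : 2 <= p -> memL Q p H -> memL Q p U -> wder H U ->
  nrm Q p (fun z => H (rotate t z) - H z) <= nrm Q p U * `|t|.
Proof.
move=> p2 mH mU h.
rewrite (nrm_ext Q p (g := fun z => H (rotate t z) - H z - 0 * t * U z)); last first.
  by move=> z; rewrite !mul0r subr0.
apply: wder_taylor => // [|s _]; first exact: nrm_ge0.
rewrite (nrm_ext Q p (g := fun z => U (rotate s z))) ?(rotate_nrm s mU).2//.
by move=> z; rewrite mul0r subr0.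
Qed.

Lemma fev_wder phi : wder (fev ge phi) (fev rge phi).
Proof.
move=> l; apply/eqP; rewrite -subr_eq0 opprK; apply/eqP.
have L1 := Linf2 (Linf_fevg phi).
have D1 := der_rotate [:: (1, l)] 0 L1.
have D2 := jet_Ex (Linf2 (Linf_ge l)) (jet_fev phi) 0.
have e : (fun t => Ex Q (fun z => fev ge phi (rotate t z) * fev ge [:: (1, l)] z)) =
   (fun t => Ex Q (fun z => ge l z * fev ge phi (rotate t z))).
  by apply/funext => t; apply: eq_Ex => z; rewrite /fev big_seq1 mul1r mulrC.
rewrite e in D1; have := derive_val (is_derive := D1); have := derive_val (is_derive := D2).
move=> -> /eqP; rewrite -subr_eq0 opprK oppr0 => /eqP e2; rewrite -[RHS]e2; congr (_ + _).
  by apply: eq_Ex => z; rewrite rotate0 mulrC.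
by apply: eq_Ex => z; rewrite rotate0 /fev big_seq1 mul1r.
Qed.

Lemma Linf_fevr phi : Linf Q (fev rge phi).
Proof. by apply: Linf_fev; exact: Linf_rge. Qed.

(** Finite Hermite combinations are Lipschitz along rotations by [wder_lip]; density and the
    isometry of rotations give the rest. *)
Lemma rotate_cont p U (eps : R) : 2 <= p -> memL Q p U -> 0 < eps ->
  exists2 dl : R, 0 < dl & forall t, `|t| <= dl -> nrm Q p (fun z => U (rotate t z) - U z) <= eps.
Proof.
move=> p2 mU e0; have p1 : 1 <= p by lra.
have [phi hphi] := chaos_dense p1 mU (divr_gt0 e0 (ltr0n R 3)).
set M := nrm Q p (fev rge phi); have M0 : 0 <= M by exact: nrm_ge0.
exists (eps / 3 / (M + 1)); first by rewrite !divr_gt0// ltr_wpDl.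
move=> t ht; have Lp := Linf_fevg phi p1; have mB := (nrmB p1 mU Lp).1.
have [m1 n1] := rotate_nrm t mB.
have h2 := wder_lip t p2 Lp (Linf_fevr phi p1) (fev_wder phi).
have mD := (nrmB p1 (rotate_nrm t Lp).1 Lp).1.
rewrite (nrm_ext Q p (g := fun z => (U (rotate t z) - fev ge phi (rotate t z)) +
   (fev ge phi (rotate t z) - fev ge phi z) - (U z - fev ge phi z))); last first.
  by move=> z; congr `|_|; ring.
have [m3 n3] := nrmD p1 m1 mD; have [_ n4] := nrmB p1 m3 mB.
apply: (le_trans n4); have : M * `|t| <= eps / 3.
  apply: (@le_trans _ _ ((M + 1) * (eps / 3 / (M + 1)))); first by apply: ler_pM => //; lra.
  by rewrite mulrC divfK// gt_eqF// ltr_wpDl.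
rewrite n1 in n3; move: n3 hphi h2; rewrite -/M; lra.
Qed.

(** Differentiability at angle 0 in the norm of L^p. It is equivalent to [wder]: the weak form is
    read off symbols, the strong form gives convergence of difference quotients and so passes
    through products. *)
Definition sder p H U := forall eps : R, 0 < eps -> exists2 dl : R, 0 < dl &
  forall t, `|t| <= dl -> nrm Q p (fun z => H (rotate t z) - H z - t * U z) <= eps * `|t|.

Lemma wder_sder p H U : 2 <= p -> memL Q p H -> memL Q p U -> wder H U -> sder p H U.
Proof.
move=> p2 mH mU h eps e0; have [dl d0 hd] := rotate_cont p2 mU e0.
exists dl => // t ht.
rewrite (nrm_ext Q p (g := fun z => H (rotate t z) - H z - 1 * t * U z)); last first.
  by move=> z; rewrite mul1r.
apply: wder_taylor => // [|s hs]; first exact: ltW.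
under [X in nrm Q p X]eq_fun do rewrite mul1r; apply: hd; apply: le_trans ht.
move: hs; case: (leP 0 t) => t0 /andP[h1 h2].
  by rewrite !ger0_norm.
by rewrite !ler0_norm ?lerN2//; exact: ltW.
Qed.

Lemma sder_pair H U W (a : R) : memL Q 2 H -> memL Q 2 U -> memL Q 2 W -> sder 2 H U ->
  is_derive (0 : R) 1 (fun t => Ex Q (fun z => H (rotate t z) * W z)) a ->
  Ex Q (fun z => U z * W z) = a.
Proof.
move=> mH mU La h; have p12 : 1 <= 2 :> R by rewrite ler1n.
set f := (X in is_derive _ _ X _) => D.
have key eps : 0 < eps -> exists2 dl : R, 0 < dl & forall t, `|t| <= dl ->
    `|f t - f 0 - t * Ex Q (fun z => U z * W z)| <= eps * `|t|.
  move=> e0; set N := nrm Q 2 W; have N0 : 0 <= N by exact: nrm_ge0.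
  have [dl d0 hd] := h (eps / (N + 1)) (ltac:(by rewrite divr_gt0// ltr_wpDl)).
  exists dl => // t /hd ht; have [m1 _] := rotate_nrm t mH.
  have m2 := (nrmB p12 m1 mH).1; have m3 := (nrmZ t (ltr0n R 2) mU).1.
  have -> : f t - f 0 - t * Ex Q (fun z => U z * W z) =
      Ex Q (fun z => (H (rotate t z) - H z - t * U z) * W z).
    have E2 V : memL Q 2 V -> memL Q 1 (fun z => V z * W z).
      by move=> mV; exact: (memLM22 mV La).1.
    rewrite /f; under [X in _ - X - _]eq_Ex do rewrite rotate0.
    rewrite -(ExB (E2 _ m1) (E2 _ mH)) -(ExZ t (E2 _ mU)) -ExB; last 2 first.
    - exact: (nrmB (lexx 1) (E2 _ m1) (E2 _ mH)).1.
    - exact: (nrmZ _ _ (E2 _ mU)).1.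
    by apply: eq_Ex => z; ring.
  apply: le_trans (memLM22 (nrmB p12 m2 m3).1 La).2 _.
  apply: (@le_trans _ _ (eps / (N + 1) * `|t| * N)); first by rewrite ler_wpM2r.
  have : eps / (N + 1) * N <= eps.
    by rewrite mulrAC ler_pdivrMr ?ltr_wpDl// ler_wpM2l ?(ltW e0)// lerDl.
  by move=> hh; rewrite mulrAC ler_wpM2r.
apply/eqP; rewrite -subr_eq0 -normr_eq0 eq_le normr_ge0 andbT.
apply/ler_addgt0Pr => eps e0; rewrite add0r.
have [dl d0 hd] := key _ (divr_gt0 e0 (ltr0n R 2)).
have /cvg_ex [b hb] : derivable f 0 1 by exact: ex_derive.
have ba : b = a by rewrite -(derive_val (is_derive := D)) /derive; exact/esym/cvg_lim.
rewrite ba in hb; move/cvgrPdist_le : hb => /(_ _ (divr_gt0 e0 (ltr0n R 2))).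
move=> /nbhs_ballP [r /= r0 hr].
pose t := Num.min dl (r / 2).
have t0 : 0 < t by rewrite lt_min d0 divr_gt0.
have tr : t < r by rewrite gt_min; apply/orP; right; lra.
have := hr t; rewrite /ball/= sub0r normrN gtr0_norm// => /(_ tr); rewrite gt_eqF// => /(_ isT).
have := hd t; rewrite gtr0_norm// ge_min lexx => /(_ isT).
rewrite /GRing.scale/= mulr1 addr0.
set x := Ex Q (fun z => U z * W z) => h1 h2.
have e1 : f t - f 0 = t * (t^-1 * (f t - f 0)) by rewrite mulrA divff ?mul1r// gt_eqF.
rewrite e1 -mulrBr normrM gtr0_norm// mulrC ler_pM2r// in h1.
move: h1 h2; rewrite !ler_norml => /andP[a1 a2] /andP[a3 a4].
by apply/andP; split; lra.
Qed.

Lemma sder_wder H U : memL Q 2 H -> memL Q 2 U -> sder 2 H U -> wder H U.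
Proof.
move=> mH mU h l; pose phi := [:: (1 : R, l)].
have fE z : fev ge phi z = ge l z by rewrite /fev big_seq1 mul1r.
have rE z : fev rge phi z = rge l z by rewrite /fev big_seq1 mul1r.
rewrite /sym -(eq_Ex Q (f := fun z => U z * fev ge phi z)); last by move=> z; rewrite fE.
rewrite (sder_pair mH mU (Linf2 (Linf_fevg phi)) h (der_rotate phi 0 mH)).
by congr (- _); apply: eq_Ex => z; rewrite oppr0 rotate0 rE.
Qed.
End rotation.
Arguments rge {R G} l z.

(** * The gradient seen on the square space *)

Section first_order.
Context {R : realType} (G : gspace R).
Local Notation S := (gsq G).
Local Notation P := (gP G).
Local Notation Q := (gP S).
Local Notation X := (@gX R G).
Local Notation I := (nat * gI S)%type.
Implicit Types (F V : gT G -> R) (u : seq (R * I)) (p q : R).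

(** Hermite in the first coordinate and linear in the second: the scalar stand-in for the H-valued
    test functional, with the direction [j] replaced by the independent Gaussian [X j]. *)
Definition ge1 (l : I) (z : gT S) : R :=
  l.1%:R * he (gvar l.2.1) l.1.-1 (X l.2.1 z.1) * X l.2.2 z.2.
(* The divergence of [n * he (n - 1) (X i)] in the direction [j], for [l = (n, (i, j))]:
   thus [dsym F] are the symbols of the gradient of [F]. *)
Definition dge (l : I) (x : gT G) : R :=
  l.1%:R * (X l.2.2 x * he (gvar l.2.1) l.1.-1 (X l.2.1 x)
    - l.1.-1%:R * gcov l.2.1 l.2.2 * he (gvar l.2.1) l.1.-2 (X l.2.1 x)).
Definition dsym F (l : I) : R := Ex P (fun x => F x * dge l x).

Lemma Linf_dge l : Linf P (dge l).
Proof.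
apply: LinfZ; apply: LinfB.
  by apply: LinfM; [exact: Linf_gX|exact/Linf_he/Linf_gX].
by apply: LinfZ; exact/Linf_he/Linf_gX.
Qed.

Lemma Linf_aff (a b : R) (i : gI G) : Linf P (fun y => a + b * X i y).
Proof. by apply: (LinfD (Linf_cst P a)); apply: LinfZ; exact: Linf_gX. Qed.

Lemma Linf_ge1 l : Linf Q (ge1 l).
Proof.
apply: LinfM; last exact/snd_Linf/Linf_gX.
apply: LinfZ; apply: (fst_Linf (F := fun x => he (gvar l.2.1) l.1.-1 (X l.2.1 x))).
exact/Linf_he/Linf_gX.
Qed.

Lemma Linf_fe1 u : Linf Q (fev ge1 u).
Proof. by apply: Linf_fev; exact: Linf_ge1. Qed.

Lemma ge1_rot (c s : R) (l : I) (z : gT S) : ge1 l (rot c s z) =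
  l.1%:R * he (gvar l.2.1) l.1.-1 (c * X l.2.1 z.1 + s * X l.2.1 z.2) *
    (- s * X l.2.2 z.1 + c * X l.2.2 z.2).
Proof. by rewrite /ge1 /rot/= !gXmix. Qed.

Lemma ge1_slice_Linf (c s : R) (l : I) x : Linf P (fun y => ge1 l (rot c s ((x, y) : gT S))).
Proof.
under eq_fun do rewrite ge1_rot/=.
by apply: LinfM; [apply: LinfZ; apply: Linf_he|]; exact: Linf_aff.
Qed.

(** [mehler0] averages the term with [X b x] and [mehler1] the term with [X b y]; together they
    reproduce the divergence [dge]. *)
Lemma ge1_slice (c s : R) (l : I) x : c ^+ 2 + s ^+ 2 = 1 ->
  Ex P (fun y => ge1 l (rot c (- s) ((x, y) : gT S))) = c ^+ l.1.-1 * s * dge l x.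
Proof.
move=> cs; case: l => n [a b]; rewrite /dge/=.
pose k := glin (- s) a 0 a; pose A := c * X a x; pose q := c ^+ 2 * gvar a.
have kE y : X k y = - s * X a y by rewrite gXlin mul0r addr0.
have qE : gvar a = q + gvar k by rewrite /q /k gcovDl !gcovDr -{1}[gvar a]mul1r -cs; ring.
have m0 := mehler0 q A n.-1 k; have m1 := mehler1 q A n.-1 k b.
have e y : ge1 (n, (a, b)) (rot c (- s) ((x, y) : gT S)) =
    (n%:R * s * X b x) * he (q + gvar k) n.-1 (A + X k y) +
    (n%:R * c) * (he (q + gvar k) n.-1 (A + X k y) * X b y).
  by rewrite ge1_rot/= -qE kE /A opprK; ring.
have LA : Linf P (fun y => A + X k y) by apply: (LinfD (Linf_cst P A)); exact: Linf_gX.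
have L0 : memL P 1 (fun y => he (q + gvar k) n.-1 (A + X k y)) by exact/Linf1/Linf_he.
have L1 : memL P 1 (fun y => he (q + gvar k) n.-1 (A + X k y) * X b y).
  by apply/Linf1/LinfM; [exact: Linf_he|exact: Linf_gX].
rewrite (eq_Ex P e) (ExD (nrmZ _ ltr01 L0).1 (nrmZ _ ltr01 L1).1) (ExZ _ L0) (ExZ _ L1) m0 m1.
rewrite /q /A !he_scale /k gcovDl mul0r addr0.
by case: n {m0 m1 e L0 L1} => [|[|n]]/=; rewrite ?exprS; ring.
Qed.

Lemma gXS_slice (i : gI S) x : Linf P (fun y => gX i ((x, y) : gT S)).
Proof. exact: (LinfD (Linf_cst P (X i.1 x)) (Linf_gX i.2)). Qed.

Lemma rge_slice_Linf (l : I) x : Linf P (fun y => rge l ((x, y) : gT S)).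
Proof.
by apply: LinfM; [apply: LinfZ; apply: Linf_he|]; exact: gXS_slice.
Qed.

Lemma rge_slice (l : I) x : Ex P (fun y => rge l ((x, y) : gT S)) = - dge l x.
Proof.
case: l => n [a b]; rewrite /dge/=.
have m0 := mehler0 (gvar a) (X a x) n.-1 b; have m1 := mehler1 (gvar a) (X a x) n.-1 b a.
have e y : rge (n, (a, b)) ((x, y) : gT S) =
    (- n%:R * X b x) * he (gvar a + gvar b) n.-1 (X a x + X b y) +
    n%:R * (he (gvar a + gvar b) n.-1 (X a x + X b y) * X a y).
  by rewrite /rge/= gXlin; ring.
have LA : Linf P (fun y => X a x + X b y) by apply: (LinfD (Linf_cst P _)); exact: Linf_gX.
have L0 : memL P 1 (fun y => he (gvar a + gvar b) n.-1 (X a x + X b y)) by exact/Linf1/Linf_he.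
have L1 : memL P 1 (fun y => he (gvar a + gvar b) n.-1 (X a x + X b y) * X a y).
  by apply/Linf1/LinfM; [exact: Linf_he|exact: Linf_gX].
rewrite (eq_Ex P e) (ExD (nrmZ _ ltr01 L0).1 (nrmZ _ ltr01 L1).1) (ExZ _ L0) (ExZ _ L1) m0 m1.
by rewrite (gcovC b a); ring.
Qed.

Lemma fst2 F : memL P 2 F -> memL Q 2 (fun z => F z.1).
Proof. by move=> mF; exact: (mpres_memL (mpres_fst P P) mF).1. Qed.

Lemma rge_dsym F l : memL P 2 F -> Ex Q (fun z => F z.1 * rge l z) = - dsym F l.
Proof.
move=> mF; have m := (memLM22 (fst2 mF) (Linf2 (Linf_rge l))).1.
rewrite (Ex_fubini (P1 := P) (P2 := P) m) /dsym -mulN1r -ExZ; last first.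
  exact: (memLM22 mF (Linf2 (Linf_dge l))).1.
apply: eq_Ex => x; rewrite mulrCA mulN1r -rge_slice; apply: (ExZ (F x)).
exact/Linf1/rge_slice_Linf.
Qed.

(** The weight c^(n-1) s, for c and s the cosine and sine of an angle, is the one that Meyer's
    kernel [kk] integrates to (n+1)^(-1/2). *)
Lemma ge1_dsym F (c s : R) l : memL P 2 F -> c ^+ 2 + s ^+ 2 = 1 ->
  Ex Q (fun z => F (rot c s z).1 * ge1 l z) = c ^+ l.1.-1 * s * dsym F l.
Proof.
move=> mF cs; have cs' : c ^+ 2 + (- s) ^+ 2 = 1 by rewrite sqrrN.
have m1 := (mpres_memL (rot1_mpres G cs) mF).1.
have m2 : memL Q 2 (fun z => ge1 l (rot c (- s) z)).
  exact: (mpres_memL (rot_mpres G cs') (Linf2 (Linf_ge1 l))).1.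
have mm := memL_meas (memLM22 m1 (Linf2 (Linf_ge1 l))).1.
rewrite -(mpres_Ex (rot_mpres G cs') mm).
have e z : F (rot c s (rot c (- s) z)).1 * ge1 l (rot c (- s) z) = F z.1 * ge1 l (rot c (- s) z).
  congr (F _ * _); apply: gsep => i; rewrite /rot/= !gXmix.
  have -> : c * (c * X i z.1 + - s * X i z.2) + s * (- - s * X i z.1 + c * X i z.2)
    = (c ^+ 2 + s ^+ 2) * X i z.1 by ring.
  by rewrite cs mul1r.
rewrite (eq_Ex Q e) (Ex_fubini (P1 := P) (P2 := P) (memLM22 (fst2 mF) m2).1).
rewrite /dsym -ExZ; last exact: (memLM22 mF (Linf2 (Linf_dge l))).1.
apply: eq_Ex => x; rewrite mulrCA -ge1_slice//; apply: (ExZ (F x)).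
exact/Linf1/ge1_slice_Linf.
Qed.

Lemma wder_dsym F U : memL P 2 F -> wder (fun z => F z.1) U <-> forall l, sym (G := S) U l = dsym F l.
Proof.
by move=> mF; split=> h l; have := h l; rewrite rge_dsym// ?opprK// => <-; rewrite ?opprK.
Qed.

(** The product of the constants 2 sqrt p and 2 sqrt p' of [gauss_nrm] at p and at its conjugate
    exponent p'. *)
Definition C1 (p : R) : R := 4 * Num.sqrt p * Num.sqrt (p / (p - 1)).

(** For fixed [x], the slice of [fev ge1 u] is the projection of the slice of [fev ge u] onto the
    first chaos in [y], hence a Gaussian [X k]. Its variance is E(v X k) <= |v|_p |X k|_p', and the
    norms of a Gaussian are comparable to its standard deviation. *)
Lemma fe1_nrm p u : 1 < p -> nrm Q p (fev ge1 u) <= C1 p * nrm Q p (fev ge u).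
Proof.
move=> p1; have p1' := ltW p1; have p0 : 0 < p by lra.
pose p' := p / (p - 1); have pm : 0 < p - 1 by lra.
have p'1 : 1 <= p' by rewrite /p' ler_pdivlMr//; lra.
have p'0 : 0 < p' by lra.
have pp : p^-1 + p'^-1 = 1 by rewrite /p'; field; rewrite !gt_eqF.
have C10 : 0 <= C1 p by rewrite !mulr_ge0 ?sqrtr_ge0.
pose v x y := fev ge u ((x, y) : gT S); pose w x y := fev ge1 u ((x, y) : gT S).
have wX x : exists k, forall y, w x y = X k y.
  rewrite /w; elim: (u) => [|c u' [k hk]].
    by exists (glin 0 (gi0 G) 0 (gi0 G)) => y; rewrite gXlin !mul0r addr0 /fev big_nil.
  exists (glin (c.1 * (c.2.1%:R * he (gvar c.2.2.1) c.2.1.-1 (X c.2.2.1 x))) c.2.2.2 1 k) => y.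
  by rewrite gXlin mul1r -hk /fev big_cons /ge1/= !mulrA.
have Lv x : Linf P (v x).
  by apply: Linf_sum => c; apply: LinfZ; apply: Linf_he; exact: gXS_slice.
have Le1 x (c : I) : Linf P (fun y => ge1 c ((x, y) : gT S)) by exact: (LinfZ (c.1%:R * he (gvar c.2.1) c.1.-1 (X c.2.1 x)) (Linf_gX c.2.2)).
have Lge x (c : I) : Linf P (fun y => ge c ((x, y) : gT S)).
  by apply: Linf_he; exact: gXS_slice.
have slice x : nrm P p (w x) <= C1 p * nrm P p (v x).
  have [k hk] := wX x; have wk : w x = X k by apply/funext.
  have E1 : Ex P (fun y => v x y * X k y) = Ex P (fun y => w x y * X k y).
    rewrite /v /w /fev; under eq_Ex do rewrite mulr_suml; under [RHS]eq_Ex do rewrite mulr_suml.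
    have m1 (c : R * I) : memL P 1 (fun y => ge c.2 ((x, y) : gT S) * X k y).
      by apply/Linf1/LinfM => //; exact: Linf_gX.
    have m2 (c : R * I) : memL P 1 (fun y => ge1 c.2 ((x, y) : gT S) * X k y).
      by apply/Linf1/LinfM => //; exact: Linf_gX.
    have mm1 (c : R * I) : memL P 1 (fun y => c.1 * ge c.2 ((x, y) : gT S) * X k y).
      by under eq_fun do rewrite -mulrA; exact: (nrmZ _ _ (m1 c)).1.
    have mm2 (c : R * I) : memL P 1 (fun y => c.1 * ge1 c.2 ((x, y) : gT S) * X k y).
      by under eq_fun do rewrite -mulrA; exact: (nrmZ _ _ (m2 c)).1.
    rewrite (Ex_sum _ mm1).2 (Ex_sum _ mm2).2; apply: eq_bigr => c _.
    under eq_Ex do rewrite -mulrA; under [RHS]eq_Ex do rewrite -mulrA.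
    rewrite (ExZ _ (m1 c)) (ExZ _ (m2 c)); congr (_ * _).
    rewrite /ge/= mehler1 /ge1/=; under [RHS]eq_Ex do rewrite -mulrA.
    rewrite ExZ; last by apply/Linf1/LinfM; exact: Linf_gX.
    by rewrite Ex_gXX; ring.
  rewrite wk in E1 *; have E2 : Ex P (fun y => X k y * X k y) = gvar k by exact: Ex_gXX.
  have [mk nk] := gauss_nrm k p1'; have [mk' nk'] := gauss_nrm k p'1.
  have h1 : gvar k <= nrm P p (v x) * nrm P p' (X k).
    rewrite -E2 -E1; apply: le_trans (ler_norm _) _.
    exact: (hoelderE p0 p'0 pp (Lv x p p1') mk').2.
  have q0 := gvar_ge0 k; set g := gvar k in h1 nk nk' q0 *.
  have s4 : Num.sqrt 4 = 2 :> R.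
    by rewrite (_ : 4 = 2 ^+ 2 :> R) ?sqrtr_sqr ?ger0_norm//; ring.
  have sq r : 0 <= r -> Num.sqrt (4 * r * g) = 2 * Num.sqrt r * Num.sqrt g.
    by move=> r0; rewrite !sqrtrM ?mulr_ge0// s4.
  rewrite sq ?(ltW p0)// in nk; rewrite sq ?(ltW p'0)// in nk'.
  apply: (le_trans nk); rewrite /C1 -/p'.
  have gs : Num.sqrt g ^+ 2 = g by rewrite sqr_sqrtr.
  have h2 : Num.sqrt g <= 2 * Num.sqrt p' * nrm P p (v x).
    have [->|gn] := eqVneq (Num.sqrt g) 0; first by rewrite !mulr_ge0 ?sqrtr_ge0 ?nrm_ge0.
    have g0 : 0 < Num.sqrt g by rewrite lt_def gn sqrtr_ge0.
    rewrite -(ler_pM2r g0) -expr2 gs; apply: (le_trans h1).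
    apply: (@le_trans _ _ (nrm P p (v x) * (2 * Num.sqrt p' * Num.sqrt g))).
      by rewrite ler_wpM2l ?nrm_ge0.
    by rewrite le_eqVlt; apply/orP; left; apply/eqP; ring.
  apply: (@le_trans _ _ (2 * Num.sqrt p * (2 * Num.sqrt p' * nrm P p (v x)))).
    by rewrite ler_wpM2l ?mulr_ge0 ?sqrtr_ge0.
  by rewrite le_eqVlt; apply/orP; left; apply/eqP; ring.
have mv : memL Q p (fev ge u) by exact: Linf_fevg.
apply: (memL_tonelli (P1 := P) (P2 := P) p0 (memL_meas (Linf_fe1 u p1')) _ _).2.
  by rewrite mulr_ge0 ?nrm_ge0.
have mw x : memL P p (w x) by have [k /funext ->] := wX x; exact: Linf_gX.
apply: (@le_trans _ _ (\int[P]_x ((C1 p `^ p)%:E * \int[P]_y (`|v x y| `^ p)%:E))%E).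
  apply: ge0_le_integral => //.
  - by move=> x _; apply: integral_ge0 => y _; rewrite lee_fin powR_ge0.
  - apply: (@measurable_fun_fubini_tonelli_F _ _ _ _ _ P (fun z : gT S => (`|fev ge1 u z| `^ p)%:E)) => //.
    by apply/measurable_EFinP; exact: measurable_powRn (memL_meas (Linf_fe1 u p1')).
  - apply: measurable_funeM.
    apply: (@measurable_fun_fubini_tonelli_F _ _ _ _ _ P (fun z : gT S => (`|fev ge u z| `^ p)%:E)) => //.
    by apply/measurable_EFinP; exact: measurable_powRn (memL_meas mv).
  - move=> x _; rewrite (powR_nrm _ (mw x)) ?gt_eqF//.
    rewrite (powR_nrm _ (Lv x p p1')) ?gt_eqF// -EFinM lee_fin -powRM ?nrm_ge0//.
    by rewrite ge0_ler_powR ?nnegrE ?mulr_ge0 ?nrm_ge0 ?(ltW p0).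
rewrite ge0_integralZl//; last 3 first.
- apply: (@measurable_fun_fubini_tonelli_F _ _ _ _ _ P (fun z : gT S => (`|fev ge u z| `^ p)%:E)) => //.
  by apply/measurable_EFinP; exact: measurable_powRn (memL_meas mv).
- by move=> x _; apply: integral_ge0 => y _; rewrite lee_fin powR_ge0.
- by rewrite lee_fin powR_ge0.
by rewrite (nrm_tonelli p0 mv) -EFinM powRM ?nrm_ge0.
Qed.

Lemma dsym_sum F (c s : R) u : memL P 2 F -> c ^+ 2 + s ^+ 2 = 1 ->
  Ex Q (fun z => F (rot c s z).1 * fev ge1 u z) = \sum_(k <- u) k.1 * (c ^+ k.2.1.-1 * s * dsym F k.2).
Proof.
move=> mF cs; have m1 := (mpres_memL (rot1_mpres G cs) mF).1.
rewrite (Ex_fev (e := ge1) Linf_ge1)// /fval; apply: eq_bigr => k _.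
by rewrite ge1_dsym.
Qed.

Lemma dsym_bound p q F (c s : R) u : 2 <= p -> conj_exp p q -> memL P p F -> c ^+ 2 + s ^+ 2 = 1 ->
  `|\sum_(k <- u) k.1 * (c ^+ k.2.1.-1 * s * dsym F k.2)| <= nrm P p F * nrm Q q (fev ge1 u).
Proof.
move=> p2 pq mF cs; have p0 : 0 < p by lra.
rewrite -dsym_sum//; last exact: (memL_le (ltr0n R 2) p2 mF).1.
have [m1 n1] := mpres_memL (rot1_mpres G cs) mF.
have /andP[q1 _] := conj_ge1 p2 pq.
by have := (hoelderE p0 pq.1 pq.2 m1 (Linf_fe1 u q1)).2; rewrite n1.
Qed.
End first_order.
Arguments ge1 {R G} l z.
Arguments dge {R G} l x.

(** * Hoelder continuity along rotations *)

Section hoelder.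
Context {R : realType} (G : gspace R).
Local Notation S := (gsq G).
Local Notation P := (gP G).
Local Notation Q := (gP S).
Local Notation I := (nat * gI S)%type.
Implicit Types (F V : gT G -> R) (u : seq (R * I)) (p q : R).

Lemma frot_nrm p t u : 1 <= p -> nrm Q p (fev ge (frot t u)) = nrm Q p (fev ge u).
Proof.
move=> p1; rewrite (nrm_ext Q p (g := fun z => fev ge u (rotate t z))); last first.
  by move=> z; rewrite fev_frot.
exact: (rotate_nrm t (Linf_fevg u p1)).2.
Qed.

Lemma dsym0 F (l : gI S) : dsym F (0%N, l) = 0.
Proof.
rewrite /dsym /dge/=; under eq_Ex do rewrite !mul0r mulr0; exact: Ex_cst.
Qed.

(** The cotangent of the Mehler angle at time [t]: the price of one derivative of the semigroup. *)
Lemma exp_le_sqrt (t : R) : 0 < t -> exists s : R, [/\ 0 < s, expR (- t) ^+ 2 + s ^+ 2 = 1 &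
  expR (- t) / s <= t `^ (- 2^-1)].
Proof.
move=> t0; have [s s0 cs] := exp_cs t0; exists s; split=> //.
set c := expR (- t) in cs *; have c0 : 0 < c by exact: expR_gt0.
have h : c ^+ 2 * (1 + t) <= 1.
  have e : c ^+ 2 = expR (- (2 * t)) by rewrite /c -expRM_natl; congr expR; ring.
  have := expR_ge1Dx (2 * t); have : expR (- (2 * t)) * expR (2 * t) = 1 by rewrite -expRD addNr expR0.
  have := expR_gt0 (- (2 * t)); rewrite e; move: (expR (2 * t)) (expR _) => a b *; nra.
have r0 : 0 < t `^ 2^-1 by rewrite powR_gt0.
have r2 : t `^ 2^-1 ^+ 2 = t by rewrite -powR_mulrn ?powR_ge0// -powRrM mulVf// powRr1// ltW.
rewrite powRN ler_pdivrMr// mulrC ler_pdivlMr// -ler_sqr ?nnegrE ?mulr_ge0 ?(ltW c0) ?(ltW r0) ?(ltW s0)//.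
by rewrite exprMn r2; lra.
Qed.

Lemma min_powR (x s : R) : 0 <= x -> 0 <= s -> s <= 1 -> Num.min 1 x <= x `^ s.
Proof.
move=> x0 s0 s1; case: (leP 1 x) => hx.
  apply: (@le_trans _ _ (1 `^ s)); first by rewrite powR1.
  by rewrite ge0_ler_powR ?nnegrE.
have [->|xn] := eqVneq x 0; first exact: powR_ge0.
have xp : 0 < x by rewrite lt_def xn.
by rewrite -{1}(powRr1 x0) ger_powR// ?xp ltW.
Qed.

(** The increment along a rotation of the semigroup applied to [V]. It is at most twice the norm,
    and also at most |th| times the derivative, which costs t^(-1/2); the minimum is kept so that
    [min_powR] can interpolate. *)
Lemma heat_diff p q V (t th : R) u : 2 <= p -> conj_exp p q -> 1 < q -> memL P p V -> 0 < t ->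
  `|\sum_(k <- u) k.1 * (expR (- t) ^+ k.2.1 *
     (sym (G := S) (fun z => V z.1) (k.2.1, rotI (cos (- th)) (sin (- th)) k.2.2)
      - sym (G := S) (fun z => V z.1) k.2))| <=
  (2 + C1 q) * nrm P p V * nrm Q q (fev ge u) * Num.min 1 (`|th| * t `^ (- 2^-1)).
Proof.
move=> p2 pq q1 mV t0; have q1' := ltW q1.
have [s [s0 cs hs]] := exp_le_sqrt t0; set c := expR (- t) in cs hs *.
have c0 : 0 < c by exact: expR_gt0.
have V2 := (memL_le (ltr0n R 2) p2 mV).1; have p0 : 0 < p by lra.
have [mH nH] := mpres_memL (mpres_fst P P) mV.
have H2 := fst2 V2; pose H z := V (z : gT S).1.
pose ut := fmul (fun n => c ^+ n) u.
have L1 := Linf2 (Linf_fevg ut).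
have nu : nrm Q q (fev ge ut) <= nrm Q q (fev ge u) by exact: fmul_nrm cs.
have C0 : 0 <= C1 q by rewrite /C1 !mulr_ge0 ?sqrtr_ge0.
set K := nrm P p V * nrm Q q (fev ge u); have K0 : 0 <= K by rewrite mulr_ge0 ?nrm_ge0.
have -> : \sum_(k <- u) k.1 * (c ^+ k.2.1 * (sym (G := S) H (k.2.1, rotI (cos (- th)) (sin (- th)) k.2.2)
      - sym (G := S) H k.2)) =
    Ex Q (fun z => H (rotate th z) * fev ge ut z) - Ex Q (fun z => H (rotate 0 z) * fev ge ut z).
  rewrite !Ex_rotate//; under eq_Ex do rewrite -fev_frot.
  under [X in _ = _ - X]eq_Ex do rewrite oppr0 rotate0.
  rewrite !Ex_sym// /fval /frot /ut /fmul !big_map -sumrB.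
  by apply: eq_bigr => k _ /=; ring.
have -> : (2 + C1 q) * nrm P p V * nrm Q q (fev ge u) = (2 + C1 q) * K by rewrite /K mulrA.
have b1 : `|Ex Q (fun z => H (rotate th z) * fev ge ut z) - Ex Q (fun z => H (rotate 0 z) * fev ge ut z)| <= 2 * K.
  have B r : `|Ex Q (fun z => H (rotate r z) * fev ge ut z)| <= K.
    have [mr nr] := rotate_nrm r mH.
    apply: le_trans (hoelderE p0 pq.1 pq.2 mr (Linf_fevg ut q1')).2 _.
    by rewrite nr nH ler_wpM2l ?nrm_ge0.
  by apply: (le_trans (ler_normB _ _)); have := B th; have := B 0; lra.
have b2 : `|Ex Q (fun z => H (rotate th z) * fev ge ut z) - Ex Q (fun z => H (rotate 0 z) * fev ge ut z)| <=
    C1 q * K * (`|th| * t `^ (- 2^-1)).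
  rewrite (mulrC `|th|) mulrA -[in leRHS](subr0 th).
  apply: (mvt_bound (f := fun t => Ex Q (fun z => H (rotate t z) * fev ge ut z))
     (fun x => der_rotate ut x H2)) => x _.
  rewrite normrN; under eq_Ex do rewrite -fev_frotr.
  rewrite (Ex_fev (e := rge) (@Linf_rge _ G))// /fval.
  (* Writing c^n as (c/s) c^(n-1) s exposes the weights of [dsym_bound]; the term of degree 0
     vanishes by [dsym0]. *)
  have -> : \sum_(k <- frot (- x) ut) k.1 * Ex Q (fun z => H z * rge k.2 z) =
     - (c / s) * \sum_(k <- frot (- x) u) k.1 * (c ^+ k.2.1.-1 * s * dsym V k.2).
    rewrite mulr_sumr !big_map; apply: eq_bigr => k _ /=.
    rewrite rge_dsym//; case: (k.2.1) => [|n]/=; first by rewrite dsym0; ring.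
    by rewrite exprS; field; rewrite gt_eqF.
  rewrite normrM normrN (ger0_norm (divr_ge0 (ltW c0) (ltW s0))).
  have h1 := dsym_bound (frot (- x) u) p2 pq mV cs.
  have h2 := fe1_nrm (frot (- x) u) q1; rewrite frot_nrm// in h2.
  apply: (@le_trans _ _ (t `^ (- 2^-1) * (nrm P p V * (C1 q * nrm Q q (fev ge u))))).
    apply: ler_pM => //; first by rewrite divr_ge0 ?ltW.
    by apply: (le_trans h1); rewrite ler_wpM2l ?nrm_ge0.
  by rewrite le_eqVlt; apply/orP; left; apply/eqP; rewrite /K; ring.
have w0 : 0 <= `|th| * t `^ (- 2^-1) by rewrite mulr_ge0 ?powR_ge0.
have CK := mulr_ge0 C0 K0; case: (leP 1 _) => hx.
  by rewrite mulr1; apply: (le_trans b1); lra.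
by apply: (le_trans b2); rewrite ler_wpM2r//; lra.
Qed.

(** Subordination applied to [heat_diff], with min(1, x) <= x^r. The integrand t^((s-r)/2 - 1)
    e^(-t) is integrable at 0 because r < s: this is the loss in the order. *)
Lemma hold_of_pot (s r p : R) : 2 <= p -> 0 < r -> r < s -> r <= 1 ->
  exists2 C : R, 0 <= C & forall V F, memL P p V -> memL P p F -> pot s V F ->
  forall th : R, nrm Q p (fun z => F (rotate th z).1 - F z.1) <= C * nrm P p V * `|th| `^ r.
Proof.
move=> p2 r0 rs r1; have p0 : 0 < p by lra. have p1 : 1 <= p by lra.
have pq := conj_exists p2; set q := p / (p - 1) in pq.
have q1 : 1 < q by rewrite /q ltr_pdivlMr; lra.
have s0 : 0 < s / 2 by lra.
have e0 : 0 < (s - r) / 2 by lra.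
have C0 : 0 <= C1 q by rewrite /C1 !mulr_ge0 ?sqrtr_ge0.
exists ((gam (s / 2))^-1 * (2 + C1 q) * gam ((s - r) / 2)).
  by rewrite !mulr_ge0 ?invr_ge0 ?(ltW (gam_gt0 _))//; lra.
move=> V F mV mF h th.
have V2 := (memL_le (ltr0n R 2) p2 mV).1; have F2 := (memL_le (ltr0n R 2) p2 mF).1.
have hQ := pot_fst F2 V2 h.
have g0 := gam_gt0 s0; have g1 := gam_gt0 e0.
have p12 : 1 <= 2 :> R by rewrite ler1n.
have mR2 := (rotate_nrm th (fst2 F2)).1.
apply: (dual p2 pq (nrmB p12 mR2 (fst2 F2)).1 _ _).2.
  by rewrite !mulr_ge0 ?nrm_ge0 ?powR_ge0 ?invr_ge0 ?(ltW g0) ?(ltW g1)//; lra.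
move=> u; have L2 := Linf2 (Linf_fevg u).
pose sV := sym (G := S) (fun z => V z.1).
pose D (l : I) := sV (l.1, rotI (cos (- th)) (sin (- th)) l.2) - sV l.
have -> : Ex Q (fun z => (F (rotate th z).1 - F z.1) * fev ge u z) =
    \sum_(k <- u) k.1 * (jm s k.2.1 * D k.2).
  under eq_Ex do rewrite mulrBl.
  rewrite ExB; [|exact: (memLM22 mR2 L2).1|exact: (memLM22 (fst2 F2) L2).1].
  rewrite (Ex_rotate th (fst2 F2) L2); under eq_Ex do rewrite -fev_frot.
  rewrite !(Ex_sym _ (fst2 F2)) /fval /frot big_map -sumrB; apply: eq_bigr => k _ /=.
  by rewrite !hQ /D /sV/=; ring.
set K := (2 + C1 q) * nrm P p V * nrm Q q (fev ge u).
have K0 : 0 <= K by rewrite !mulr_ge0 ?nrm_ge0//; lra.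
pose g (l : I) (t : R) := D l * ((gam (s / 2))^-1 * (t `^ (s / 2 - 1) * expR (- l.1.+1%:R * t))).
pose B (t : R) := (gam (s / 2))^-1 * K * `|th| `^ r * (t `^ ((s - r) / 2 - 1) * expR (- 1 * t)).
have n1 n : 1 <= n.+1%:R :> R by rewrite ler1n.
have ig l : lebesgue_measure.-integrable `]0, +oo[ (EFin \o g l).
  by apply: intZ => //; apply: intZ => //; exact: lap_int.
have iB : lebesgue_measure.-integrable `]0, +oo[ (EFin \o B).
  by apply: intZ => //; exact: lap_int.
have := @Rint_comb R I u `]0, +oo[%classic g B (measurable_itv _) ig iB.
have eg l : \int[lebesgue_measure]_(t in `]0, +oo[) g l t = jm s l.1 * D l.
  rewrite RintegralZl//; last by apply: intZ => //; exact: lap_int.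
  rewrite RintegralZl//; last exact: lap_int.
  rewrite lapE// /jm; rewrite mulrC; congr (_ * _).
  by rewrite mulrCA mulVf ?mulr1// gt_eqF.
have eB : \int[lebesgue_measure]_(t in `]0, +oo[) B t =
    (gam (s / 2))^-1 * K * `|th| `^ r * gam ((s - r) / 2).
  by rewrite RintegralZl//; exact: lap_int.
rewrite eB; under eq_bigr do rewrite eg.
move=> H; apply: (le_trans (H _)); last first.
  by rewrite le_eqVlt; apply/orP; left; apply/eqP; rewrite /K; ring.
move=> t; rewrite /= in_itv/= andbT => t0.
have -> : \sum_(c <- u) c.1 * g c.2 t = (gam (s / 2))^-1 * (t `^ (s / 2 - 1) * expR (- 1 * t)) *
    \sum_(k <- u) k.1 * (expR (- t) ^+ k.2.1 * D k.2).
  rewrite mulr_sumr; apply: eq_bigr => c _; rewrite /g.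
  have -> : expR (- c.2.1.+1%:R * t) = expR (- 1 * t) * expR (- t) ^+ c.2.1.
    by rewrite expXn -expRD; congr expR; rewrite -natr1; ring.
  by ring.
have w0 : 0 <= (gam (s / 2))^-1 * (t `^ (s / 2 - 1) * expR (- 1 * t)).
  by rewrite !mulr_ge0 ?powR_ge0 ?expR_ge0 ?invr_ge0 ?(ltW g0).
rewrite normrM (ger0_norm w0).
have h1 := heat_diff th u p2 pq q1 mV t0; rewrite -/K in h1.
have x0 : 0 <= `|th| * t `^ (- 2^-1) by rewrite mulr_ge0 ?powR_ge0.
have h2 := min_powR x0 (ltW r0) r1.
rewrite powRM ?powR_ge0// -powRrM in h2.
apply: (@le_trans _ _ ((gam (s / 2))^-1 * (t `^ (s / 2 - 1) * expR (- 1 * t)) *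
    (K * (`|th| `^ r * t `^ (- 2^-1 * r))))).
  by rewrite ler_wpM2l//; apply: (le_trans h1); rewrite ler_wpM2l.
rewrite /B; have -> : t `^ ((s - r) / 2 - 1) = t `^ (s / 2 - 1) * t `^ (- 2^-1 * r).
  rewrite -powRD ?(gt_eqF t0) ?implybT//; congr (_ `^ _); ring.
by rewrite le_eqVlt; apply/orP; left; apply/eqP; rewrite /B; ring.
Qed.

(** As the angle is at most pi/2, sin(th/2) >= th/4, so th^2/8 <= 2 sin(th/2)^2 = 1 - e^(-t) <=
    t. *)
Lemma acos_sqrt (t : R) : 0 < t -> exists th : R,
  [/\ cos th = expR (- t), 0 <= th & th ^+ 2 <= 8 * t].
Proof.
move=> t0; have e0 : 0 < expR (- t) :> R by exact: expR_gt0.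
have e1 : expR (- t) <= 1 :> R by rewrite -[leRHS]expR0 ler_expR; lra.
have em : -1 <= (expR (- t) : R) <= 1 by apply/andP; split => //; lra.
pose th := acos (expR (- t)); have cth : cos th = expR (- t) by rewrite acosK.
have th0 : 0 <= th by apply: acos_ge0.
have thp : th <= pi / 2.
  rewrite leNgt; apply/negP => hp; have tp : th <= pi by exact: acos_lepi.
  have pi0 := @pi_gt0 R.
  have h : (cos th < cos (pi / 2)) = (pi / 2 < th).
    by apply: ltr_cos; rewrite in_itv/= ?th0 ?tp//; apply/andP; split; lra.
  by rewrite cos_pihalf cth hp in h; lra.
exists th; split=> //.
have s1 : th / 4 <= sin (th / 2).
  have [->|thn] := eqVneq th 0; first by rewrite !mul0r sin0.
  have tp : 0 < th / 2 by rewrite divr_gt0// lt_def thn.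
  have [|x] := @MVT R sin cos 0 (th / 2) tp; first by apply: continuous_subspaceT; exact: continuous_sin.
  rewrite in_itv/= sin0 !subr0 => /andP[x0 x1] ->.
  have : 2^-1 <= cos x.
    apply: (@le_trans _ _ (cos (pi / 4))).
      have : cos (pi / 4) ^+ 2 = 2^-1 :> R.
        have := @cos_pihalf R; have -> : pi / 2 = (pi / 4) *+ 2 :> R by rewrite -mulr_natr; field.
        rewrite mulr2n cosD -!expr2 sin2cos2; lra.
      have c0 : 0 <= cos (pi / 4) :> R by apply: cos_ge0_pihalf; have := @pi_gt0 R; lra.
      move=> h; rewrite -ler_sqr ?nnegrE ?invr_ge0// h; lra.
    rewrite leNgt; have pi0 := @pi_gt0 R.
    by rewrite ltr_cos ?in_itv/=; try (apply/andP; split); lra.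
  by move=> h; rewrite (_ : th / 4 = 2^-1 * (th / 2)) ?ler_wpM2r ?(ltW tp)//; field.
have s2 : 1 - cos th = 2 * sin (th / 2) ^+ 2.
  have {1}-> : th = (th / 2) *+ 2 by rewrite -mulr_natr divfK.
  by rewrite mulr2n cosD -!expr2 cos2sin2; ring.
have s3 : (th / 4) ^+ 2 <= sin (th / 2) ^+ 2.
  by rewrite ler_sqr ?nnegrE ?divr_ge0//; apply: le_trans s1; rewrite divr_ge0.
have := expR_ge1Dx (- t); rewrite -cth; move: s3; rewrite expr_div_n; lra.
Qed.

(** Positive powers by the integral of t^(-a-1) (1 - e^(-(n+1) t)) with a = r/2. Its integrand on
    symbols is E - e^(-t) E_t, where E_t pairs [F] with the semigroup at time [t]; E - E_t is a
    pairing with the increment of [F] at an angle of order sqrt t, hence O(t^(s/2)), integrable at 0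
    against t^(-a-1) as r < s. *)
Lemma pot_of_hold p F (s r M : R) : 2 <= p -> memL P p F -> 0 < r -> r < s -> s <= 1 -> 0 <= M ->
  (forall th : R, nrm Q p (fun z => F (rotate th z).1 - F z.1) <= M * `|th| `^ s) ->
  exists V, memL P p V /\ pot r V F.
Proof.
move=> p2 mF r0 rs s1 M0 hM; have p0 : 0 < p by lra. have p1 : 1 <= p by lra.
have pq := conj_exists p2; set q := p / (p - 1) in pq.
have /andP[q1 _] := conj_ge1 p2 pq; have q0 := pq.1.
pose a := r / 2; have a0 : 0 < a by rewrite /a; lra. have a1 : a < 1 by rewrite /a; lra.
have F2 := (memL_le (ltr0n R 2) p2 mF).1.
have h0 := hol_gt0 a0 a1.
(* The first term comes from the increment and th^2 <= 8 t; the second covers large [t] and the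
   discrepancy between E_t and e^(-t) E_t. *)
pose K0 := M * 8 `^ (s / 2) + 3 * nrm P p F.
have K00 : 0 <= K0 by rewrite addr_ge0 ?mulr_ge0 ?powR_ge0 ?nrm_ge0.
pose W (t : R) := t `^ (- a - 1) * Num.min 1 (t `^ (s / 2)).
have iW : lebesgue_measure.-integrable `]0, +oo[ (EFin \o W).
  apply: (@int_pos_lty _ _ (s / 2 - a) a 1) => //; first by rewrite /a; lra.
  - apply: measurable_funM; first exact: meas_pow.
    by apply: measurable_minr => //; exact: meas_pow.
  - move=> t t0 t1; rewrite mul1r ger0_norm; last by rewrite mulr_ge0 ?powR_ge0// le_min ler01 powR_ge0.
    have -> : t `^ (s / 2 - a - 1) = t `^ (- a - 1) * t `^ (s / 2).
      by rewrite -powRD ?(gt_eqF t0) ?implybT//; congr (_ `^ _); ring.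
    by rewrite ler_wpM2l ?powR_ge0// ge_min lexx orbT.
  - move=> t t1; rewrite mul1r ger0_norm; last by rewrite mulr_ge0 ?powR_ge0// le_min ler01 powR_ge0.
    by rewrite ler_piMr ?powR_ge0// ge_min lexx.
pose CW := \int[lebesgue_measure]_(t in `]0, +oo[) W t.
have CW0 : 0 <= CW.
  by apply: Rintegral_ge0 => t _; rewrite mulr_ge0 ?powR_ge0// le_min ler01 powR_ge0.
pose C := (hol a)^-1 * K0 * CW.
have C0 : 0 <= C by rewrite !mulr_ge0 ?invr_ge0 ?(ltW h0).
have [|V [mV _ hV]] := @repr R G p q C (fun l => l.1.+1%:R `^ a * sym F l) p2 pq C0; last first.
  exists V; split=> // l; rewrite hV /jm mulrA powRN -/a mulVf ?mul1r//.
move=> phi; set N := nrm P q (fev ge phi); have N0 : 0 <= N by exact: nrm_ge0.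
have n1 n : 1 <= n.+1%:R :> R by rewrite ler1n.
pose g (l : nat * gI G) (t : R) := sym F l * ((hol a)^-1 * (t `^ (- a - 1) * (1 - expR (- l.1.+1%:R * t)))).
pose B (t : R) := (hol a)^-1 * K0 * N * W t.
have ig l : lebesgue_measure.-integrable `]0, +oo[ (EFin \o g l).
  by apply: intZ => //; apply: intZ => //; apply: hol_int => //; apply: le_trans (n1 _).
have iB : lebesgue_measure.-integrable `]0, +oo[ (EFin \o B) by apply: intZ.
have := @Rint_comb R _ phi `]0, +oo[%classic g B (measurable_itv _) ig iB.
have eg l : \int[lebesgue_measure]_(t in `]0, +oo[) g l t = l.1.+1%:R `^ a * sym F l.
  rewrite RintegralZl//; last by apply: intZ => //; apply: hol_int => //; apply: le_trans (n1 _).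
  rewrite RintegralZl//; last by apply: hol_int => //; apply: le_trans (n1 _).
  rewrite holE// mulrC; congr (_ * _).
  by rewrite mulrCA mulVf ?mulr1// gt_eqF.
have eB : \int[lebesgue_measure]_(t in `]0, +oo[) B t = C * N.
  by rewrite RintegralZl// -/CW /C; ring.
rewrite eB; under eq_bigr do rewrite eg; apply.
move=> t; rewrite /= in_itv/= andbT => t0.
have [th [cth th0 th8]] := acos_sqrt t0.
pose c := expR (- t); have cs : c ^+ 2 + sin th ^+ 2 = 1 by rewrite /c -cth; exact: cs1.
have c0 : 0 < c by exact: expR_gt0.
have c1 : c <= 1 by rewrite -[leRHS]expR0 ler_expR; lra.
pose E := Ex P (fun x => F x * fev ge phi x).
pose Et := fval (sym F) (fmul (fun n => c ^+ n) phi).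
have -> : \sum_(k <- phi) k.1 * g k.2 t = (hol a)^-1 * t `^ (- a - 1) * (E - c * Et).
  rewrite /E Ex_sym// /Et fval_fmul /fval mulrBr !mulr_sumr -sumrB; apply: eq_bigr => k _.
  rewrite /g; have -> : expR (- k.2.1.+1%:R * t) = c * c ^+ k.2.1.
    by rewrite /c expXn -expRD; congr expR; rewrite -natr1; ring.
  by ring.
have w0 : 0 <= (hol a)^-1 * t `^ (- a - 1) by rewrite mulr_ge0 ?powR_ge0 ?invr_ge0 ?(ltW h0).
rewrite normrM (ger0_norm w0).
have Eb : `|E| <= nrm P p F * N by exact: (hoelderE p0 q0 pq.2 mF (Linf_fevg phi q1)).2.
have Etb : `|Et| <= nrm P p F * N.
  apply: (le_trans (sym_bound _ p2 pq mF)); rewrite ler_wpM2l ?nrm_ge0//; exact: fmul_nrm cs.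
have dif : `|E - Et| <= M * (th `^ s) * N.
  have m1 := (mpres_memL (rot1_mpres G cs) (Linf2 (Linf_fevg phi))).1.
  have mf2 := Linf2 (Linf_fevg phi).
  have [mF1 _] := mpres_memL (rot1_mpres G cs) F2.
  have -> : E - Et = Ex Q (fun z => (F (rotate th z).1 - F z.1) * fev ge phi (rotate th z).1).
    rewrite /Et -(mehler_sym phi F2 cs).
    have -> : E = Ex Q (fun z => F (rot c (sin th) z).1 * fev ge phi (rot c (sin th) z).1).
      rewrite (mpres_Ex (f := fun z : gT S => (rot c (sin th) z).1) (rot1_mpres G cs)
        (h := fun x => F x * fev ge phi x))//.
      exact: memL_meas (memLM22 F2 mf2).1.
    rewrite -ExB; [|exact: (memLM22 mF1 m1).1|exact: (memLM22 (fst2 F2) m1).1].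
    by apply: eq_Ex => z; rewrite /rotate cth -mulrBl.
  have [mr _] := rotate_nrm th (mpres_memL (mpres_fst P P) mF).1.
  have mD := (nrmB p1 mr (mpres_memL (mpres_fst P P) mF).1).1.
  have [mq nq] := mpres_memL (rot1_mpres G (cs1 th)) (Linf_fevg phi q1).
  apply: le_trans (hoelderE p0 q0 pq.2 mD mq).2 _; rewrite nq ler_wpM2r//.
  by apply: (le_trans (hM th)); rewrite ger0_norm.
have ths : th `^ s <= 8 `^ (s / 2) * t `^ (s / 2).
  rewrite -powRM ?(ltW t0)//; have -> : th `^ s = (th ^+ 2) `^ (s / 2).
    by rewrite -powR_mulrn// -powRrM; congr (_ `^ _); field.
  by rewrite ge0_ler_powR ?nnegrE ?sqr_ge0 ?mulr_ge0 ?(ltW t0)//; lra.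
have tot : `|E - c * Et| <= K0 * N * Num.min 1 (t `^ (s / 2)).
  have eq1 : E - c * Et = (E - Et) + (1 - c) * Et by ring.
  have n0 := nrm_ge0 P p F.
  case: (leP 1 _) => ht.
    rewrite mulr1 /K0 mulrDl; apply: (le_trans (ler_normB _ _)); rewrite normrM (gtr0_norm c0).
    have : c * `|Et| <= `|Et| by rewrite ler_piMl.
    have : 0 <= M * 8 `^ (s / 2) * N by rewrite !mulr_ge0 ?powR_ge0.
    have : 0 <= nrm P p F * N by rewrite mulr_ge0.
    lra.
  rewrite eq1; apply: (le_trans (ler_normD _ _)); rewrite normrM (ger0_norm (_ : 0 <= 1 - c)) ?subr_ge0//.
  have tt : t <= t `^ (s / 2).
    have t1 : t <= 1.
      rewrite leNgt; apply/negP => t1; move: ht; rewrite ltNge => /negP; apply.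
      apply: (@le_trans _ _ (1 `^ (s / 2))); first by rewrite powR1.
      by rewrite ge0_ler_powR ?nnegrE; lra.
    by rewrite -{1}(powRr1 (ltW t0)) ger_powR//; lra.
  have ct : 1 - c <= t by have := expR_ge1Dx (- t); rewrite -/c; lra.
  have e1 : M * (th `^ s) * N <= M * 8 `^ (s / 2) * N * t `^ (s / 2).
    have -> : M * 8 `^ (s / 2) * N * t `^ (s / 2) = M * N * (8 `^ (s / 2) * t `^ (s / 2)) by ring.
    by rewrite mulrAC ler_wpM2l ?mulr_ge0.
  have e2 : (1 - c) * `|Et| <= t `^ (s / 2) * (nrm P p F * N).
    by apply: ler_pM => //; [rewrite subr_ge0|exact: le_trans tt].
  have : 0 <= 2 * nrm P p F * N * t `^ (s / 2) by rewrite !mulr_ge0 ?powR_ge0.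
  by move: e1 e2 dif; rewrite /K0; lra.
apply: (@le_trans _ _ ((hol a)^-1 * t `^ (- a - 1) * (K0 * N * Num.min 1 (t `^ (s / 2))))).
  by rewrite ler_wpM2l.
by rewrite le_eqVlt; apply/orP; left; apply/eqP; rewrite /B /W; ring.
Qed.
End hoelder.

(** * The conjugate function *)

Section trigonometric_integrals.
Context {R : realType}.
Notation mu := (@lebesgue_measure R).
Notation O := (`]0%R, pi[%classic : set R).
Implicit Types (f g h : R -> R).

Lemma cont_int f (x y : R) : continuous f -> mu.-integrable (`]x, y[%classic : set R) (EFin \o f).
Proof.
move=> cf; apply: (@integrableS _ _ _ mu `[x, y]%classic) => //.
  by move=> z /=; rewrite !in_itv/= => /andP[/ltW -> /ltW ->].
apply: continuous_compact_integrable; first exact: segment_compact.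
exact: continuous_subspaceT.
Qed.

Lemma Rint_oo (F f : R -> R) (x y : R) : x < y -> continuous f ->
  (forall z : R, is_derive z 1 F (f z)) -> \int[mu]_(z in `]x, y[) f z = F y - F x.
Proof.
move=> xy cf D; have := int_itv xy (fun z _ => D z) (fun z _ => cf z).
rewrite (@integral_itv_bndoo _ x y _ true false).
  by rewrite /Rintegral => ->.
by apply/measurable_EFinP; apply: (measurable_funS (E := setT)) => //; exact: continuous_measurable_fun.
Qed.

Lemma is_derive_scale (F f : R -> R) (c x : R) : (forall z : R, is_derive z 1 F (f z)) ->
  is_derive x 1 (fun x => F (c * x)) (c * f (c * x)).
Proof.
move=> D; have D2 : is_derive x 1 (fun x : R => c * x) c.
  by apply: (is_derive_ext (is_derive_mul (is_derive_cst c x 1) (is_derive_id x (1 : R)))) => //=; ring.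
have := is_derive1_comp (D (c * x)) D2; by rewrite mulrC.
Qed.

Lemma cont_cosn (c : R) : continuous (fun x : R => cos (c * x)).
Proof.
move=> x; apply: continuous_comp; last exact: continuous_cos.
by apply: continuousM; [exact: cst_continuous|].
Qed.

Lemma sin_natpi (j : nat) : sin (j%:R * pi) = 0 :> R.
Proof.
elim: j => [|j IH]; first by rewrite mul0r sin0.
by rewrite -natr1 mulrDl mul1r sinDpi IH oppr0.
Qed.

Lemma int_cosn (j : nat) : \int[mu]_(x in O) cos (j%:R * x) = if j == 0%N then pi else 0.
Proof.
case: eqP => [->|/eqP j0].
  under eq_Rintegral do rewrite mul0r cos0.
  rewrite (@Rint_oo id (cst 1)) ?subr0 ?pi_gt0//; first exact: cst_continuous.
have jn : (j%:R : R) != 0 by rewrite pnatr_eq0.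
have D (z : R) : is_derive z 1 (fun x => j%:R^-1 * sin (j%:R * x)) (cos (j%:R * z)).
  have D := is_derive_scale j%:R z (@is_derive_sin R).
  have D2 := is_derive_mul (is_derive_cst (j%:R^-1 : R) z 1) D.
  apply: (is_derive_ext D2) => //=.
  by rewrite mul0r add0r mulrA mulVf// mul1r.
rewrite (Rint_oo (pi_gt0 R) (@cont_cosn _) D).
by rewrite sin_natpi mulr0 mulr0 sin0 mulr0 subr0.
Qed.

Definition cot2 (x : R) : R := cos (x / 2) / sin (x / 2).
Definition LamI g := mu.-integrable O (EFin \o (fun x => cot2 x * (g x - g (- x)))).
(* The value at 0 of the conjugate function of [g], up to sign. *)
Definition Lam g : R := (2 * pi)^-1 * \int[mu]_(x in O) (cot2 x * (g x - g (- x))).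

Lemma LamD a g h : LamI g -> LamI h ->
  LamI (fun x => a * g x + h x) /\ Lam (fun x => a * g x + h x) = a * Lam g + Lam h.
Proof.
move=> ig ih; have e : (fun x => cot2 x * (a * g x + h x - (a * g (- x) + h (- x)))) =
    (fun x => a * (cot2 x * (g x - g (- x))) + cot2 x * (h x - h (- x))).
  by apply/funext => x; ring.
have ia : mu.-integrable O (EFin \o (fun x => a * (cot2 x * (g x - g (- x))))) by exact: intZ.
split; first by rewrite /LamI e; exact: integrableD ia ih.
by rewrite /Lam e RintegralD// RintegralZl//; ring.
Qed.

Lemma Lam_even g : (forall x, g (- x) = g x) -> LamI g /\ Lam g = 0.
Proof.
move=> h; have e : (fun x => cot2 x * (g x - g (- x))) = cst 0.
  by apply/funext => x; rewrite h subrr mulr0.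
split; first by rewrite /LamI e; exact: integrable0.
by rewrite /Lam e /Rintegral integral0 mulr0.
Qed.

Lemma sin_half_gt0 x : O x -> 0 < sin (x / 2).
Proof.
rewrite /= in_itv/= => /andP[h1 h2]; have pi0 := @pi_gt0 R.
by apply: sin_gt0_pi; apply/andP; split; lra.
Qed.

Lemma cot_sin1 x : O x -> cot2 x * sin x = 1 + cos x.
Proof.
move=> /sin_half_gt0 s0; rewrite /cot2.
have -> : sin x = 2 * (sin (x / 2) * cos (x / 2)).
  by have {1}-> : x = x / 2 + x / 2 by [field]; rewrite sinD; ring.
have -> : cos x = cos (x / 2) ^+ 2 - sin (x / 2) ^+ 2.
  by have {1}-> : x = x / 2 + x / 2 by [field]; rewrite cosD; ring.
have e3 := cos2Dsin2 (x / 2); move: (sin (x / 2)) (cos (x / 2)) s0 e3 => s c s0 e3.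
have -> : 1 + (c ^+ 2 - s ^+ 2) = (c ^+ 2 + s ^+ 2) + (c ^+ 2 - s ^+ 2) by rewrite e3.
by field; rewrite gt_eqF.
Qed.

(** The increment in [j] of cot(x/2) sin(j x) is a sum of two cosines; after integration all values
    coincide with the first one, pi. *)
Lemma cot_sin_rec (j : nat) x : O x -> cot2 x * sin (j.+1%:R * x) =
  cot2 x * sin (j%:R * x) + (cos (j.+1%:R * x) + cos (j%:R * x)).
Proof.
move=> Ox; have s0 := sin_half_gt0 Ox.
have e : j.+1%:R * x = j%:R * x + x by rewrite -natr1; ring.
rewrite e sinD cosD; set a := j%:R * x.
have e1 : sin x = 2 * (sin (x / 2) * cos (x / 2)).
  by have {1}-> : x = x / 2 + x / 2 by [field]; rewrite sinD; ring.
have e2 : cos x = cos (x / 2) ^+ 2 - sin (x / 2) ^+ 2.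
  by have {1}-> : x = x / 2 + x / 2 by [field]; rewrite cosD; ring.
have e3 : cos (x / 2) ^+ 2 + sin (x / 2) ^+ 2 = 1 by exact: cos2Dsin2.
rewrite /cot2 e1 e2; move: (sin (x / 2)) (cos (x / 2)) s0 e3 => s c s0 e3.
have sn : s != 0 by rewrite gt_eqF.
move: (sin a) (cos a) => sa ca.
have -> : c / s * sa + (ca * (c ^+ 2 - s ^+ 2) - sa * (2 * (s * c)) + ca) =
  c / s * sa * (c ^+ 2 + s ^+ 2) + (ca * (c ^+ 2 - s ^+ 2) - sa * (2 * (s * c)) + ca * (c ^+ 2 + s ^+ 2)).
  by rewrite e3 !mulr1.
by field.
Qed.

Lemma eq_Oint f g : {in O, forall x, f x = g x} -> mu.-integrable O (EFin \o f) ->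
  mu.-integrable O (EFin \o g) /\ \int[mu]_(x in O) g x = \int[mu]_(x in O) f x.
Proof.
move=> h fi; split.
  by apply: (@eq_integrable _ _ _ mu O _ (EFin \o f) (EFin \o g)) => // x Ox /=; rewrite h.
by apply: eq_Rintegral => x Ox; rewrite h.
Qed.

Lemma cosn_int (j : nat) : mu.-integrable O (EFin \o (fun x => cos (j%:R * x))).
Proof. exact: (@cont_int (fun x => cos (j%:R * x)) 0 pi (@cont_cosn _)). Qed.

Lemma cot_sin_int (j : nat) :
  mu.-integrable O (EFin \o (fun x => cot2 x * sin (j.+1%:R * x))) /\
  \int[mu]_(x in O) (cot2 x * sin (j.+1%:R * x)) = pi.
Proof.
elim: j => [|j [IH1 IH2]].
  have i0 := cosn_int 0; have i1 := cosn_int 1.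
  have i01 : mu.-integrable O (EFin \o (fun x => cos (0%:R * x) + cos (1%:R * x))).
    exact: integrableD i0 i1.
  have [x|h1 h2] := @eq_Oint _ (fun x => cot2 x * sin (1%:R * x)) _ i01.
    by rewrite inE => Ox; rewrite !mul1r mul0r cos0 cot_sin1.
  by split=> //; rewrite h2 RintegralD// !int_cosn/= addr0.
have i0 := cosn_int j.+2; have i1 := cosn_int j.+1.
have i2 : mu.-integrable O (EFin \o (fun x => cos (j.+2%:R * x) + cos (j.+1%:R * x))).
  exact: integrableD i0 i1.
have i3 : mu.-integrable O (EFin \o (fun x => cot2 x * sin (j.+1%:R * x) +
   (cos (j.+2%:R * x) + cos (j.+1%:R * x)))) by exact: integrableD IH1 i2.
have [x|h1 h2] := @eq_Oint _ (fun x => cot2 x * sin (j.+2%:R * x)) _ i3.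
  by rewrite inE => Ox; rewrite [RHS]cot_sin_rec.
by split=> //; rewrite h2 RintegralD// IH2 RintegralD// !int_cosn/= !addr0.
Qed.

(** With [Lam_even] this determines [Lam] on trigonometric polynomials: even functions give 0 and
    every sin(n x), n >= 1, gives 1, the multiplier of the conjugate function. *)
Lemma Lam_sin (j : nat) : LamI (fun x => sin (j.+1%:R * x)) /\ Lam (fun x => sin (j.+1%:R * x)) = 1.
Proof.
have [i e] := cot_sin_int j.
have e2 : (fun x => cot2 x * (sin (j.+1%:R * x) - sin (j.+1%:R * - x))) =
    (fun x => 2 * (cot2 x * sin (j.+1%:R * x))).
  by apply/funext => x; rewrite mulrN sinN opprK; ring.
split; first by rewrite /LamI e2; exact: intZ.
by rewrite /Lam e2 RintegralZl// e mulrA -mulrA mulVf// mulf_neq0// gt_eqF// pi_gt0.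
Qed.

(** Multiplied by 2 sin(j pi / M), which is not 0 for 0 < j < M, the sum telescopes over a full
    period. Equally spaced points thus replace the mean over the circle. *)
Lemma cos_sum0 (M j : nat) (b : R) : (0 < j)%N -> (j < M)%N ->
  \sum_(k < M) cos (b + k%:R * (j%:R * (2 * pi / M%:R))) = 0.
Proof.
move=> j0 jM; have M0 : (0 < M)%N by exact: leq_ltn_trans jM.
have Mn : (M%:R : R) != 0 by rewrite pnatr_eq0 -lt0n.
pose a : R := j%:R * (pi / M%:R).
have sa : 0 < sin a.
  have pi0 := @pi_gt0 R; have MR : 0 < M%:R :> R by rewrite ltr0n.
  apply: sin_gt0_pi; rewrite /a; apply/andP; split.
    by rewrite mulr_gt0 ?ltr0n// divr_gt0.
  by rewrite mulrA ltr_pdivrMr// mulrC ltr_pM2l// ltr_nat.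
apply: (mulfI (x := 2 * sin a)); first by rewrite mulf_neq0// gt_eqF.
rewrite mulr0 mulr_sumr.
have step (k : nat) : 2 * sin a * cos (b + k%:R * (j%:R * (2 * pi / M%:R))) =
    sin (b - a + k.+1%:R * (2 * a)) - sin (b - a + k%:R * (2 * a)).
  have -> : b + k%:R * (j%:R * (2 * pi / M%:R)) = b + k%:R * (2 * a).
    by congr (_ + _); rewrite /a; ring.
  have -> : b - a + k.+1%:R * (2 * a) = b + k%:R * (2 * a) + a by rewrite -natr1; ring.
  have -> : b - a + k%:R * (2 * a) = b + k%:R * (2 * a) - a by ring.
  by rewrite sinB sinD; ring.
under eq_bigr do rewrite step.
rewrite -(big_mkord xpredT (fun k => sin (b - a + k.+1%:R * (2 * a)) - sin (b - a + k%:R * (2 * a)))).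
rewrite telescope_sumr//; have -> : M%:R * (2 * a) = j%:R * (2 * pi) by rewrite /a; field.
have per (n : nat) (x : R) : sin (x + n%:R * (2 * pi)) = sin x.
  elim: n => [|n IH]; first by rewrite mul0r addr0.
  rewrite -natr1 mulrDl mul1r addrA -[RHS]IH.
  by rewrite (mulr_natl pi 2) sinD2pi.
by rewrite per mul0r addr0 subrr.
Qed.

Lemma sin_sum0 (M j : nat) (b : R) : (0 < j)%N -> (j < M)%N ->
  \sum_(k < M) sin (b + k%:R * (j%:R * (2 * pi / M%:R))) = 0.
Proof.
move=> j0 jM; rewrite -[RHS](cos_sum0 (b - pi / 2) j0 jM); apply: eq_bigr => k _.
rewrite -cosBpihalf; congr cos; ring.
Qed.

(* The real and imaginary parts of (x + i y)^(2^m). *)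
Fixpoint sqit (m : nat) (x y : R) : R * R :=
  if m is n.+1 then
    ((sqit n x y).1 ^+ 2 - (sqit n x y).2 ^+ 2, 2 * ((sqit n x y).1 * (sqit n x y).2))
  else (x, y).

Lemma sqit_norm m x y : (sqit m x y).1 ^+ 2 + (sqit m x y).2 ^+ 2 = (x ^+ 2 + y ^+ 2) ^+ (2 ^ m).
Proof.
elim: m => [|m IH]; first by rewrite expn0 expr1.
by rewrite expnS mulnC exprM -IH /=; ring.
Qed.

(** For z = x + i y with [x] small, z^(2^(m+1)) is close to a real number of fixed sign [sg]: -1 for
    the first square, 1 from then on. The induction uses Re(z^(2n)) = 2 (Re z^n)^2 - |z|^(2n). *)
Lemma sqit_ge (m : nat) : exists2 sg : R, sg ^+ 2 = 1 & forall dl : R, 0 < dl -> dl <= 1 -> exists2 C : R, 0 <= C &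
  forall x y : R, (1 - dl) * (x ^+ 2 + y ^+ 2) ^+ (2 ^ m) - C * x ^+ (2 ^ m.+1) <= sg * (sqit m.+1 x y).1.
Proof.
elim: m => [|m [sg sg1 IH]].
  exists (-1) => [|dl d0 d1]; first by rewrite sqrrN expr1n.
  exists 2 => // x y; rewrite expn0 expn1 /= expr1.
  have : 0 <= dl * (x ^+ 2 + y ^+ 2) by rewrite mulr_ge0 ?addr_ge0 ?sqr_ge0// ltW.
  lra.
exists 1 => [|dl d0 d1]; first by rewrite expr1n.
(* The margin 8 absorbs the losses in squaring the inequality and in splitting the cross term. *)
have [e de] : exists e, dl = 8 * e by exists (dl / 8); field.
have e0 : 0 < e by lra.
have [C C0 hC] := IH e e0 ltac:(lra).
exists (2 * C ^+ 2 / e) => [|x y]; first by rewrite divr_ge0 ?mulr_ge0 ?sqr_ge0// ltW.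
have := hC x y; have := sqit_norm m.+1 x y.
have -> : (x ^+ 2 + y ^+ 2) ^+ (2 ^ m.+1) = ((x ^+ 2 + y ^+ 2) ^+ (2 ^ m)) ^+ 2.
  by rewrite [(2 ^ m.+1)%N]expnS mulnC exprM.
have -> : x ^+ (2 ^ m.+2) = (x ^+ (2 ^ m.+1)) ^+ 2 by rewrite [(2 ^ m.+2)%N]expnS mulnC exprM.
have := exprn_ge0 (2 ^ m) (addr_ge0 (sqr_ge0 x) (sqr_ge0 y)).
have -> : (sqit m.+2 x y).1 = (sqit m.+1 x y).1 ^+ 2 - (sqit m.+1 x y).2 ^+ 2 by [].
have : (0 : R) <= x ^+ (2 ^ m.+1) by rewrite expnS exprM exprn_ge0 ?sqr_ge0.
move: (_ ^+ (2 ^ m)) (x ^+ _) (sqit m.+1 x y) => S X [P Q] X0 S0 /= eQ h.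
have -> : Q ^+ 2 = S ^+ 2 - P ^+ 2 by rewrite -eQ; ring.
rewrite mul1r; have e1 : e <= 8^-1 by lra.
have eP : P ^+ 2 = (sg * P) ^+ 2 by rewrite exprMn sg1 mul1r.
have [k|k] := leP 0 ((1 - e) * S - C * X).
  have h2 : ((1 - e) * S - C * X) ^+ 2 <= P ^+ 2 by rewrite eP ler_sqr ?nnegrE// (le_trans k).
  have h3 : 0 <= (e * S - C * X) ^+ 2 / e by rewrite divr_ge0 ?sqr_ge0// ltW.
  have h4 : (e * S - C * X) ^+ 2 / e = e * S ^+ 2 - 2 * (S * (C * X)) + C ^+ 2 / e * X ^+ 2 by field; rewrite gt_eqF.
  have h5 : 0 <= e * (S * (C * X)) by rewrite mulr_ge0 ?mulr_ge0// ltW.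
  have h6 : 0 <= e * S ^+ 2 by rewrite mulr_ge0 ?sqr_ge0// ltW.
  have h7 : ((1 - e) * S - C * X) ^+ 2 = S ^+ 2 - 2 * (e * S ^+ 2) + (e * S) ^+ 2 - 2 * (S * (C * X)) + 2 * (e * (S * (C * X))) + (C * X) ^+ 2 by ring.
  have h8 := sqr_ge0 (e * S); have h9 := sqr_ge0 (C * X).
  have -> : 2 * C ^+ 2 / e * X ^+ 2 = 2 * (C ^+ 2 / e * X ^+ 2) by ring.
  have -> : (1 - dl) * S ^+ 2 = S ^+ 2 - 8 * (e * S ^+ 2) by rewrite de; ring.
  lra.
(* In the other case the modulus is itself controlled by the power of [x]. *)
have k2 : S <= 2 * (C * X).
  have : 0 <= (2^-1 - e) * S by rewrite mulr_ge0//; lra.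
  lra.
have k3 : S ^+ 2 <= 4 * (C * X) ^+ 2.
  have -> : 4 * (C * X) ^+ 2 = (2 * (C * X)) ^+ 2 by ring.
  by rewrite ler_sqr ?nnegrE// !mulr_ge0.
have k4 : 8 * (C * X) ^+ 2 <= 2 * C ^+ 2 / e * X ^+ 2.
  have -> : 2 * C ^+ 2 / e * X ^+ 2 = 2 / e * (C * X) ^+ 2 by field; rewrite gt_eqF.
  apply: ler_wpM2r; first exact: sqr_ge0.
  by rewrite ler_pdivlMr//; lra.
have : 0 <= dl * S ^+ 2 by rewrite mulr_ge0 ?sqr_ge0// ltW.
have := sqr_ge0 P; lra.
Qed.

(** The pointwise form of M. Riesz's inequality for p = 2^(m+1): the error term is the real part of
    an analytic power and disappears on averaging. *)
Lemma conj_pow (m : nat) : exists sg C : R, sg ^+ 2 = 1 /\ 0 <= C /\ forall x y : R, y ^+ (2 ^ m.+1) <= C * x ^+ (2 ^ m.+1) + 2 * sg * (sqit m.+1 x y).1.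
Proof.
have [sg s1 h] := sqit_ge m; have [C C0 hC] := h 2^-1 ltac:(by rewrite invr_gt0) ltac:(lra).
exists sg, (2 * C); split=> //; split=> [|x y]; first by rewrite mulr_ge0.
have := hC x y; have : y ^+ (2 ^ m.+1) <= (x ^+ 2 + y ^+ 2) ^+ (2 ^ m).
  rewrite expnS exprM; apply: lerXn2r; rewrite ?nnegrE ?addr_ge0 ?sqr_ge0//.
  by rewrite lerDr sqr_ge0.
by move: (_ ^+ (2 ^ m)) (x ^+ (2 ^ m.+1)) (y ^+ (2 ^ m.+1)) (sqit _ _ _).1 => a b c d; lra.
Qed.
End trigonometric_integrals.

(** * M. Riesz's theorem for trigonometric polynomials with random coefficients *)

Section conjugate_function.
Context {R : realType} {d : measure_display} {T : measurableType d}.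
Variable P : probability T R.
Notation mu := (@lebesgue_measure R).
Implicit Types (f g u v : R -> T -> R) (A B : T -> R).

Definition md (n : nat) A B (t : R) (x : T) : R := cos (n%:R * t) * A x + sin (n%:R * t) * B x.

Inductive tp : (R -> T -> R) -> Prop :=
| tp_nil : tp (fun _ _ => 0)
| tp_cons n A B f : Linf P A -> Linf P B -> tp f -> tp (fun t x => md n A B t x + f t x).

Lemma tp_ext f g : tp f -> (forall t x, g t x = f t x) -> tp g.
Proof. by move=> h e; have -> : g = f by apply/funext => t; apply/funext => x. Qed.

Lemma tp_Linf f : tp f -> forall t, Linf P (f t).
Proof.
elim=> [|n A B {}f LA LB _ IH] t; first exact: Linf_cst.
by apply: LinfD (IH t); apply: LinfD; apply: LinfZ.
Qed.

Lemma tpD f g : tp f -> tp g -> tp (fun t x => f t x + g t x).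
Proof.
move=> tf tg; elim: tf => [|n A B {}f LA LB _ IH].
  by apply: (tp_ext tg) => t x; rewrite add0r.
by apply: (tp_ext (tp_cons n LA LB IH)) => t x; rewrite addrA.
Qed.

Lemma tp_md n A B : Linf P A -> Linf P B -> tp (md n A B).
Proof. by move=> LA LB; apply: (tp_ext (tp_cons n LA LB tp_nil)) => t x; rewrite addr0. Qed.

Lemma tp_cst A : Linf P A -> tp (fun _ => A).
Proof.
move=> LA; apply: (tp_ext (tp_md 0 LA LA)) => t x.
by rewrite /md mul0r cos0 sin0 mul1r mul0r addr0.
Qed.

Lemma md_mul (j k : nat) A B A' B' : (k <= j)%N -> Linf P A -> Linf P B -> Linf P A' -> Linf P B' ->
  tp (fun t x => md j A B t x * md k A' B' t x).
Proof.
move=> kj LA LB LA' LB'.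
have L1 : Linf P (fun x => 2^-1 * (A x * A' x - B x * B' x)) by apply: LinfZ; apply: LinfB; apply: LinfM.
have L2 : Linf P (fun x => 2^-1 * (A x * B' x + B x * A' x)) by apply: LinfZ; apply: LinfD; apply: LinfM.
have L3 : Linf P (fun x => 2^-1 * (A x * A' x + B x * B' x)) by apply: LinfZ; apply: LinfD; apply: LinfM.
have L4 : Linf P (fun x => 2^-1 * (B x * A' x - A x * B' x)) by apply: LinfZ; apply: LinfB; apply: LinfM.
apply: (tp_ext (tpD (tp_md (j + k) L1 L2) (tp_md (j - k) L3 L4))) => t x.
rewrite /md natrD natrB// [(_ - _) * t]mulrBl [(_ + k%:R) * t]mulrDl cosD sinD cosB sinB; by field.
Qed.

Lemma tpM f g : tp f -> tp g -> tp (fun t x => f t x * g t x).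
Proof.
move=> tf tg; elim: tf => [|n A B {}f LA LB _ IH].
  by apply: (tp_ext tp_nil) => t x; rewrite mul0r.
apply: (tp_ext (tpD (_ : tp (fun t x => md n A B t x * g t x)) IH)) => [|t x]; last by rewrite mulrDl.
clear IH; elim: tg => [|k A' B' {}g LA' LB' _ IH2].
  by apply: (tp_ext tp_nil) => t x; rewrite mulr0.
apply: (tp_ext (tpD (_ : tp (fun t x => md n A B t x * md k A' B' t x)) IH2)) => [|t x]; last by rewrite mulrDr.
have [kn|/ltnW nk] := leqP k n; first exact: md_mul.
by apply: (tp_ext (md_mul nk LA' LB' LA LB)) => t x; rewrite mulrC.
Qed.

Lemma tpZ c f : tp f -> tp (fun t x => c * f t x).
Proof. by move=> tf; apply: tpM tf; apply: tp_cst; exact: Linf_cst. Qed.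

Lemma tp_he q n f : tp f -> tp (fun t x => he q n (f t x)).
Proof.
move=> tf; elim/he_ind2: n => [|n IH1 IH2].
  by apply: (tp_ext (tp_cst (Linf_cst P 1))).
apply: (tp_ext (tpD (tpM tf IH1) (tpZ (- (n%:R * q)) IH2))) => t x.
by rewrite heS mulNr.
Qed.

(* [u + i v] is the sum of the (A - i B) e^(i (n + 1) t): an analytic trigonometric
   polynomial without constant term. *)
Inductive hardy (N : nat) : (R -> T -> R) -> (R -> T -> R) -> Prop :=
| hardy_nil : hardy N (fun _ _ => 0) (fun _ _ => 0)
| hardy_cons n A B u v : (n < N)%N -> Linf P A -> Linf P B -> hardy N u v ->
    hardy N (fun t x => md n.+1 A B t x + u t x) (fun t x => md n.+1 (fun x => - B x) A t x + v t x).

Lemma hardy_ext N f g u v : hardy N f g -> (forall t x, u t x = f t x) -> (forall t x, v t x = g t x) ->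
  hardy N u v.
Proof.
move=> h e1 e2; have -> : u = f by apply/funext => t; apply/funext => x.
by have -> : v = g by apply/funext => t; apply/funext => x.
Qed.

Lemma hardyD N f g u v : hardy N f g -> hardy N u v ->
  hardy N (fun t x => f t x + u t x) (fun t x => g t x + v t x).
Proof.
move=> h1 h2; elim: h1 => [|n A B f' g' nN LA LB _ IH].
  by apply: (hardy_ext h2) => t x; rewrite add0r.
by apply: (hardy_ext (hardy_cons nN LA LB IH)) => t x; rewrite addrA.
Qed.

Lemma hardy_le N M u v : (N <= M)%N -> hardy N u v -> hardy M u v.
Proof.
move=> NM; elim=> [|n A B f' g' nN LA LB _ IH]; first exact: hardy_nil.
by apply: hardy_cons IH => //; exact: leq_trans nN NM.
Qed.

(** Complex multiplication of the two analytic polynomials: the frequencies are positive and add up,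
    so no constant term appears. *)
Lemma hardyM N M f g u v : hardy N f g -> hardy M u v ->
  hardy (N + M) (fun t x => f t x * u t x - g t x * v t x) (fun t x => f t x * v t x + g t x * u t x).
Proof.
move=> h1 h2; elim: h1 => [|n A B f' g' nN LA LB _ IH].
  by apply: (hardy_ext (hardy_nil _)) => t x; ring.
have h3 : hardy (N + M) (fun t x => md n.+1 A B t x * u t x - md n.+1 (fun x => - B x) A t x * v t x)
    (fun t x => md n.+1 A B t x * v t x + md n.+1 (fun x => - B x) A t x * u t x).
  elim: h2 => [|k A' B' u' v' kM LA' LB' _ IH2].
    by apply: (hardy_ext (hardy_nil _)) => t x; ring.
  have L1 : Linf P (fun x => A x * A' x - B x * B' x) by apply: LinfB; apply: LinfM.
  have L2 : Linf P (fun x => A x * B' x + B x * A' x) by apply: LinfD; apply: LinfM.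
  have l : ((n + k.+1) < N + M)%N by rewrite -ltn_subRL; lia.
  apply: (hardy_ext (hardy_cons l L1 L2 IH2)) => t x;
    by rewrite /md -[(n + k.+1).+1]addSn natrD [(_ + k.+1%:R) * t]mulrDl cosD sinD; ring.
by apply: (hardy_ext (hardyD h3 IH)) => t x; ring.
Qed.

Lemma hardy_sqit N m u v : hardy N u v ->
  hardy (2 ^ m * N) (fun t x => (sqit m (u t x) (v t x)).1) (fun t x => (sqit m (u t x) (v t x)).2).
Proof.
move=> h; elim: m => [|m IH]; first by rewrite expn0 mul1n.
by rewrite expnS mul2n -addnn mulnDl; apply: (hardy_ext (hardyM IH IH)) => t x /=; ring.
Qed.

(** All frequencies lie between 1 and N, so K > N equally spaced points integrate them exactly. *)
Lemma hardy_mean N K u v (b : R) x : hardy N u v -> (N < K)%N ->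
  \sum_(k < K) u (b + k%:R * (2 * pi / K%:R)) x = 0.
Proof.
move=> h NK; elim: h => [|n A B u' v' nN LA LB _ IH]; first by rewrite big1.
rewrite big_split/= IH addr0 /md big_split/= -!mulr_suml.
have e (k : nat) : n.+1%:R * (b + k%:R * (2 * pi / K%:R)) =
   n.+1%:R * b + k%:R * (n.+1%:R * (2 * pi / K%:R)) by ring.
under eq_bigr do rewrite e.
rewrite cos_sum0//; last exact: leq_ltn_trans nN NK.
under eq_bigr do rewrite e.
by rewrite sin_sum0// ?mul0r ?addr0//; exact: leq_ltn_trans nN NK.
Qed.

Lemma hardy_Linf N u v : hardy N u v -> forall t, Linf P (u t) /\ Linf P (v t).
Proof.
elim=> [|n A B u' v' nN LA LB _ IH] t; first by split; exact: Linf_cst.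
by split; (apply: LinfD; [apply: LinfD; apply: LinfZ => //; exact: LinfN|by have [] := IH t]).
Qed.

Lemma tp_hardy f : tp f -> exists A0 N u v,
  [/\ Linf P A0, hardy N u v & forall t x, f t x = A0 x + u t x].
Proof.
elim=> [|[|n] A B {}f LA LB _ [A0 [N [u [v [L0 h e]]]]]].
- exists (fun=> 0), 0%N, (fun _ _ => 0), (fun _ _ => 0); split=> [||t x]; [exact: Linf_cst|exact: hardy_nil|].
  by rewrite addr0.
- exists (fun x => A x + A0 x), N, u, v; split=> // [|t x]; first exact: LinfD.
  by rewrite e /md mul0r cos0 sin0; ring.
- have h' := hardy_le (leq_maxl N n.+1) h.
  do 4 eexists; split; [exact: L0|exact: (hardy_cons (leq_maxr N n.+1) LA LB h')|move=> t x].
  by rewrite e; ring.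
Qed.

(** Up to sign, [Lam] of the translate by [s] reads the conjugate polynomial at [s]; by linearity it
    suffices to treat one frequency. *)
Lemma Lam_hardy N u v (s : R) W : Linf P W -> hardy N u v ->
  LamI (fun t => Ex P (fun x => u (t + s) x * W x)) /\
  Lam (fun t => Ex P (fun x => u (t + s) x * W x)) = - Ex P (fun x => v s x * W x).
Proof.
move=> LW; elim=> [|n A B u' v' nN LA LB h [IH1 IH2]].
  have e (t : R) : Ex P (fun x => 0 * W x) = 0.
    by rewrite (eq_Ex P (g := fun=> 0)) ?Ex_cst// => x; rewrite mul0r.
  have -> : (fun t : R => Ex P (fun x => 0 * W x)) = (fun=> 0) by apply/funext => t; exact: e.
  by rewrite (e 0) oppr0; exact: Lam_even.
pose a := Ex P (fun x => A x * W x); pose b := Ex P (fun x => B x * W x).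
have mA : memL P 1 (fun x => A x * W x) by apply: Linf1; exact: LinfM.
have mB : memL P 1 (fun x => B x * W x) by apply: Linf1; exact: LinfM.
have mU t : memL P 1 (fun x => u' t x * W x) by apply: Linf1; apply: LinfM LW; have [] := hardy_Linf h t.
have mV t : memL P 1 (fun x => v' t x * W x) by apply: Linf1; apply: LinfM LW; have [] := hardy_Linf h t.
have E3 c1 c2 F : memL P 1 F -> Ex P (fun x => c1 * (A x * W x) + (c2 * (B x * W x) + F x)) = c1 * a + (c2 * b + Ex P F).
  move=> mF; have [m1 _] := nrmZ c1 ltr01 mA; have [m2 _] := nrmZ c2 ltr01 mB.
  have [m3 _] := nrmD (lexx 1) m2 mF.
  by rewrite ExD// ExD// (ExZ c1 mA) (ExZ c2 mB).
have e1 : (fun t => Ex P (fun x => (md n.+1 A B (t + s) x + u' (t + s) x) * W x)) =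
  (fun t => (- sin (n.+1%:R * s) * a + cos (n.+1%:R * s) * b) * sin (n.+1%:R * t) +
     ((cos (n.+1%:R * s) * a + sin (n.+1%:R * s) * b) * cos (n.+1%:R * t) + Ex P (fun x => u' (t + s) x * W x))).
  apply/funext => t; rewrite (eq_Ex P (g := fun x => cos (n.+1%:R * (t + s)) * (A x * W x) +
    (sin (n.+1%:R * (t + s)) * (B x * W x) + u' (t + s) x * W x))); last by move=> x; rewrite /md; ring.
  by rewrite E3// mulrDr cosD sinD; ring.
have e2 : Ex P (fun x => (md n.+1 (fun x => - B x) A s x + v' s x) * W x) =
    sin (n.+1%:R * s) * a + ((- cos (n.+1%:R * s)) * b + Ex P (fun x => v' s x * W x)).
  rewrite (eq_Ex P (g := fun x => sin (n.+1%:R * s) * (A x * W x) +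
    ((- cos (n.+1%:R * s)) * (B x * W x) + v' s x * W x))); last by move=> x; rewrite /md; ring.
  by rewrite E3.
have [s1 s2] := @Lam_sin R n.
have [c1 c2] : LamI (fun t : R => cos (n.+1%:R * t)) /\ Lam (fun t : R => cos (n.+1%:R * t)) = 0.
  by apply: Lam_even => t; rewrite mulrN cosN.
have [D1 D2] := LamD (cos (n.+1%:R * s) * a + sin (n.+1%:R * s) * b) c1 IH1.
have [D3 D4] := LamD (- sin (n.+1%:R * s) * a + cos (n.+1%:R * s) * b) s1 D1.
by rewrite e1 e2; split=> //; rewrite D4 D2 s2 c2 IH2; ring.
Qed.

Lemma nrm_natX (n : nat) (f : T -> R) : Linf P f ->
  nrm P (2 ^ n.+1)%:R f ^+ (2 ^ n.+1) = Ex P (fun x => f x ^+ (2 ^ n.+1)).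
Proof.
move=> Lf; have p0 : (0 : R) < (2 ^ n.+1)%:R by rewrite ltr0n expn_gt0.
rewrite -powR_mulrn ?nrm_ge0// (nrm_powRE p0); last by apply: Lf; rewrite ler1n expn_gt0.
apply: eq_Ex => x; rewrite powR_mulrn// -normrX ger0_norm//.
by rewrite expnS exprM exprn_ge0// sqr_ge0.
Qed.

(** [conj_pow] is averaged over equally spaced angles: the analytic term has mean zero, so the
    conjugate is bounded in the mean and hence at one angle at least. The angle is not controlled,
    but [C] depends on the exponent only. *)
Lemma conj_fun (m : nat) : exists2 C : R, 0 <= C & forall f (M : R), tp f ->
  (forall t, nrm P (2 ^ m.+1)%:R (f t) <= M) ->
  exists (s : R) (v : T -> R), [/\ Linf P v, nrm P (2 ^ m.+1)%:R v <= C * M &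
    forall W, Linf P W -> LamI (fun t => Ex P (fun x => f (t + s) x * W x)) /\
      Lam (fun t => Ex P (fun x => f (t + s) x * W x)) = - Ex P (fun x => v x * W x)].
Proof.
have [sg [C [sg1 [C0 hC]]]] := @conj_pow R m; set p := (2 ^ m.+1)%N in hC *.
have p1 : (1 : R) <= p%:R by rewrite ler1n expn_gt0.
(* The 2 is the cost of removing the mean [A0]; [1 + C] dominates the p-th root of [C]. *)
exists ((1 + C) * 2) => [|f M tf hM]; first by rewrite mulr_ge0// addr_ge0.
have [A0 [N [u [v [L0 h e]]]]] := tp_hardy tf.
(* The number of angles exceeds both the degree of the polynomial and that of its p-th power. *)
pose K := (2 ^ m.+1 * N + N).+1; pose th (k : nat) : R := 0 + k%:R * (2 * pi / K%:R).
have NK : (N < K)%N by rewrite ltnS leq_addl.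
have K0 : (0 : R) < K%:R by rewrite ltr0n.
have Lu t := (hardy_Linf h t).1; have Lv t := (hardy_Linf h t).2; have Lf := tp_Linf tf.
have M0 : 0 <= M by apply: le_trans (hM 0); exact: nrm_ge0.
have A0M : nrm P p%:R A0 <= M.
  have Ae x : A0 x = K%:R^-1 * \sum_(k < K) f (th k) x.
    apply: (mulfI (lt0r_neq0 K0)); rewrite mulrA mulfV ?gt_eqF// mul1r.
    under eq_bigr do rewrite e.
    by rewrite big_split/= (hardy_mean _ _ h NK) addr0 sumr_const card_ord mulr_natl.
  have Ls (n : nat) : Linf P (fun x => \sum_(k < n) f (th k) x) by apply: Linf_sum => k; exact: Lf.
  have hs (n : nat) : nrm P p%:R (fun x => \sum_(k < n) f (th k) x) <= n%:R * M.
    elim: n => [|n IH].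
      rewrite (nrm_ext P _ (g := fun x => 0 * A0 x)) => [|x]; last by rewrite big_ord0 mul0r.
      by have [_ ->] := nrmZ 0 (lt_le_trans ltr01 p1) (L0 _ p1); rewrite normr0 !mul0r.
    rewrite (nrm_ext P _ (g := fun x => \sum_(k < n) f (th k) x + f (th n) x)) => [|x]; last by rewrite big_ord_recr.
    have [_ /le_trans] := nrmD p1 (Ls n _ p1) (Lf (th n) _ p1); apply.
    by rewrite -natr1 mulrDl mul1r lerD.
  rewrite (nrm_ext P _ (g := fun x => K%:R^-1 * \sum_(k < K) f (th k) x)) => [|x]; last by rewrite Ae.
  have [_ ->] := nrmZ K%:R^-1 (lt_le_trans ltr01 p1) (Ls K _ p1).
  by rewrite gtr0_norm ?invr_gt0// ler_pdivrMl.
have uM t : nrm P p%:R (u t) <= 2 * M.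
  rewrite (nrm_ext P _ (g := fun x => f t x - A0 x)) => [|x]; last by rewrite e addrC addKr.
  by have [_ /le_trans] := nrmB p1 (Lf t _ p1) (L0 _ p1); apply; rewrite mulr_natl mulr2n lerD.
have sumv : \sum_(k < K) nrm P p%:R (v (th k)) ^+ p <= \sum_(k < K) C * nrm P p%:R (u (th k)) ^+ p.
  pose S k x := (sqit m.+1 (u (th k) x) (v (th k) x)).1.
  have LS k : Linf P (S k) by have [] := hardy_Linf (hardy_sqit m.+1 h) (th k).
  have -> : \sum_(k < K) C * nrm P p%:R (u (th k)) ^+ p =
      \sum_(k < K) (C * nrm P p%:R (u (th k)) ^+ p + 2 * sg * Ex P (S k)).
    rewrite big_split/= -!mulr_sumr.
    have [_ <-] := Ex_sum (index_enum 'I_K) (fun k : 'I_K => Linf1 (LS k)).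
    rewrite (eq_Ex P (g := fun=> 0)) ?Ex_cst ?mulr0 ?addr0// => x.
    by apply: (hardy_mean 0 x (hardy_sqit m.+1 h)); rewrite ltnS leq_addr.
  apply: ler_sum => k _; rewrite !nrm_natX//.
  have m1 : memL P 1 (fun x => u (th k) x ^+ p) by apply: Linf1; exact: LinfX.
  have m2 := Linf1 (LS k).
  have [k1 _] := nrmZ C ltr01 m1; have [k2 _] := nrmZ (2 * sg) ltr01 m2.
rewrite -(ExZ C m1) -(ExZ (2 * sg) m2) -ExD//.
  apply: le_Ex => [||x]; [by apply: Linf1; exact: LinfX| |exact: hC].
  by have [] := nrmD (lexx 1) k1 k2.
(* If the bound failed at every angle, the summed inequality would fail strictly. *)
have [k hk] : exists k : 'I_K, nrm P p%:R (v (th k)) <= (1 + C) * 2 * M.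
  apply: contrapT => /forallNP hn; move: sumv; apply/negP; rewrite -ltNge.
  apply: ltr_sum => [|k _]; first by apply/hasP; exists ord0 => //; rewrite mem_index_enum.
  have /negP := hn k; rewrite -ltNge => hk.
  have D0 : 0 <= (1 + C) * 2 * M by rewrite !mulr_ge0// addr_ge0.
  apply: (@le_lt_trans _ _ (((1 + C) * 2 * M) ^+ p)); last first.
    by rewrite ltrXn2r ?nnegrE ?nrm_ge0// -lt0n expn_gt0.
  rewrite -mulrA exprMn; apply: ler_pM; rewrite ?exprn_ge0 ?nrm_ge0//.
    apply: (@le_trans _ _ (1 + C)); first by rewrite lerDr.
    by rewrite ler_eXnr ?expn_gt0// lerDl.
  by rewrite lerXn2r ?nnegrE ?nrm_ge0// mulr_ge0.
exists (th k), (v (th k)); split=> // W LW.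
have [I1 I2] := Lam_hardy (th k) LW h.
have mA : memL P 1 (fun x => A0 x * W x) by apply: Linf1; exact: LinfM.
have eA : (fun t => Ex P (fun x => f (t + th k) x * W x)) =
    (fun t => 1 * Ex P (fun x => u (t + th k) x * W x) + Ex P (fun x => A0 x * W x)).
  apply/funext => t; rewrite mul1r -ExD//; last by apply: Linf1; exact: LinfM.
  by apply: eq_Ex => x; rewrite e; ring.
have [J1 J2] := @Lam_even R (fun=> Ex P (fun x => A0 x * W x)) (fun=> erefl).
have [H1 H2] := LamD 1 I1 J1.
by rewrite eA H2 I2 J2; split=> //; ring.
Qed.
End conjugate_function.

(** * Meyer's inequalities *)

Section meyer_kernel.
Context {R : realType}.
Notation mu := (@lebesgue_measure R).
Notation O := (`]0%R, pi[%classic : set R).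
Implicit Types (x t : R).

(* With [y = - ln (cos x)] the integral of [kk x * (cos x ^+ n * sin x)] becomes a
   Laplace integral, equal to (n + 2)^(-1/2).  For [cos x <= 0], [ln (cos x)] and
   hence [kk x] are 0. *)
Definition kk x : R := (gam 2^-1)^-1 * (cos x * (- ln (cos x)) `^ (- 2^-1)).
(** The constant that matches the singularities at 0: - ln(cos x) behaves like x^2/2, so [kk x]
    behaves like sqrt 2 / ([gam 2^-1] x), while cot(x/2) behaves like 2/x. *)
Definition kap : R := (gam 2^-1)^-1 / Num.sqrt 2.

Lemma kk0 x : cos x <= 0 -> kk x = 0.
Proof. by move=> c0; rewrite /kk ln0// oppr0 powR0 ?mulr0// oppr_eq0 invr_eq0. Qed.

Lemma kk_ge0 x : 0 <= kk x.
Proof.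
have [c0|c0] := leP (cos x) 0; first by rewrite kk0.
by rewrite mulr_ge0 ?invr_ge0 ?mulr_ge0 ?powR_ge0 ?ltW ?gam_gt0.
Qed.

Lemma cos_in01 x : 0 < x -> x < pi / 2 -> 0 < cos x /\ cos x < 1.
Proof.
move=> x0 x1; have pi0 := @pi_gt0 R; split; first by apply: cos_gt0_pihalf; apply/andP; split; lra.
by rewrite -cos0 ltr_cos// in_itv/=; apply/andP; split; lra.
Qed.

Lemma cos_small x : 0 < x -> x < pi -> 0 < cos x -> x < pi / 2.
Proof.
move=> x0 x1; rewrite -[X in X < cos x]cos_pihalf; have pi0 := @pi_gt0 R.
by rewrite ltr_cos// in_itv/=; apply/andP; split; lra.
Qed.

Lemma is_derive_lncos x : 0 < cos x -> is_derive x 1 (fun x => - ln (cos x)) (sin x / cos x).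
Proof.
move=> c0; have D := is_derive1_comp (is_derive1_ln c0) (is_derive_cos x).
have D2 := is_derive_mul (is_derive_cst (-1 : R) x 1) D.
by apply: (is_derive_ext D2) => [z|] /=; ring.
Qed.

(** The substitution y = - ln(cos x), an increasing bijection from (0, pi/2) to the half-line with
    inverse acos(e^(-y)). *)
Lemma kk_subst (G : R -> R) : (forall y : R, 0 < y -> {for y, continuous G} /\ 0 <= G y) ->
  (\int[mu]_(y in `]0%R, +oo[) (G y)%:E =
   \int[mu]_(x in `]0%R, (pi / 2)%R[) (G (- ln (cos x)) * (sin x / cos x))%:E)%E.
Proof.
move=> hG; have pi0 := @pi_gt0 R; pose F x := - ln (cos x).
pose h (y : R) := acos (expR (- y)).
have hh y : 0 < y -> [/\ 0 < h y, h y < pi / 2 & F (h y) = y].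
  move=> y0; have e0 : 0 < expR (- y) :> R by exact: expR_gt0.
  have e1 : expR (- y) < 1 :> R by rewrite -[ltRHS]expR0 ltr_expR; lra.
  have ch : cos (h y) = expR (- y) by rewrite /h acosK// in_itv/=; apply/andP; split; lra.
  have h0 : 0 < h y by apply: acos_gt0; apply/andP; split; lra.
  split=> //; last by rewrite /F ch expRK opprK.
  apply: cos_small => //; last by rewrite ch.
  by apply: acos_ltpi; apply/andP; split; lra.
have Fmono x y : 0 < x -> x < y -> y < pi / 2 -> F x < F y.
  move=> x0 xy y1; have [cy _] := cos_in01 (lt_trans x0 xy) y1.
  have [cx _] := cos_in01 x0 (lt_trans xy y1).
  by rewrite ltrN2 ltr_ln// ltr_cos// in_itv/=; apply/andP; split; lra.
have Fle x y : 0 < x -> 0 < y -> x < pi / 2 -> y < pi / 2 -> F x <= F y -> x <= y.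
  by move=> x0 y0 x1 y1; rewrite leNgt => xy; rewrite leNgt; apply: contra xy => yx; exact: Fmono.
have hmono y z : 0 < y -> 0 < z -> y <= z -> h y <= h z.
  move=> y0 z0 yz; have [a1 a2 a3] := hh y y0; have [b1 b2 b3] := hh z z0.
  by apply: Fle => //; rewrite a3 b3.
have i0 (i : nat) : 0 < i.+2%:R^-1 :> R by rewrite invr_gt0.
have j0 (i : nat) : 0 < i.+2%:R :> R by [].
have inr (i : nat) x : h i.+2%:R^-1 <= x <= h i.+2%:R -> 0 < x /\ x < pi / 2.
  by move=> /andP[h1 h2]; have [a1 _ _] := hh _ (i0 i); have [_ b2 _] := hh _ (j0 i); split; lra.
have Fi (i : nat) : F (h i.+2%:R^-1) = i.+2%:R^-1 by have [] := hh _ (i0 i).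
have Fj (i : nat) : F (h i.+2%:R) = i.+2%:R by have [] := hh _ (j0 i).
have e := @int_subst R F (fun x => sin x / cos x) G (fun i => h i.+2%:R^-1) (fun i => h i.+2%:R).
rewrite -bigcup_pos; under eq_bigcupr do rewrite -[X in `[X, _]]Fi -[X in `[_, X]]Fj.
rewrite e.
- congr (integral _ _ _); apply/seteqP; split => x /=.
    by move=> [i _]; rewrite /= in_itv/= => /inr[h1 h2]; rewrite in_itv/= h1 h2.
  rewrite in_itv/= => /andP[x0 x1]; have [c0 c1] := cos_in01 x0 x1.
  have : `]0, +oo[%classic (F x) by rewrite /= in_itv/= andbT oppr_gt0 ln_lt0// c0 c1.
  rewrite -bigcup_pos => -[i _]; rewrite /= in_itv/= -{1}Fi -{2}Fj => /andP[h1 h2]; exists i => //=.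
  have [a1 a2 _] := hh _ (i0 i); have [b1 b2 _] := hh _ (j0 i).
  by rewrite in_itv/=; apply/andP; split; exact: Fle.
- by move=> n m nm; apply: hmono => //; exact: inv_homo.
- by move=> n m nm; apply: hmono => //; exact: nat_homo.
- move=> i; have [a1 a2 _] := hh _ (i0 i); have [b1 b2 _] := hh _ (j0 i).
  rewrite ltNge; apply/negP => hle; have iv := @inv_lt R i; rewrite -[X in X < _]Fi -[X in _ < X]Fj in iv.
  move: hle iv; rewrite le_eqVlt => /predU1P[->|hlt]; first by rewrite ltxx.
  by rewrite ltNge ltW//; exact: Fmono.
- move=> i x /inr[x0 x1]; have [c0 c1] := cos_in01 x0 x1; split.
  + exact: is_derive_lncos.
  + apply: continuousM; first exact: continuous_sin.
    by apply: continuousV; [rewrite gt_eqF|exact: continuous_cos].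
  + by rewrite divr_ge0 ?ltW// sin_gt0_pi//; apply/andP; split; lra.
- move=> i x y; rewrite !in_itv/= => /inr[x0 x1] /inr[y0 y1] xy; exact: Fmono.
- by move=> i y; rewrite Fi Fj => /andP[h1 _]; apply: hG; exact: lt_le_trans h1.
Qed.

Lemma kk_meas : measurable_fun setT kk.
Proof.
apply: measurable_funM; first exact: measurable_cst.
apply: measurable_funM; first exact: measurable_cos.
apply: (@measurableT_comp _ _ _ _ _ _ (fun t : R => t `^ (- 2^-1))); first by apply: meas_pow.
apply: (measurableT_comp (f := fun x : R => - x)); first exact: oppr_measurable.
by apply: (measurableT_comp (f := @ln R)); [exact: measurable_ln|exact: measurable_cos].
Qed.

Lemma cossin_meas (n : nat) : measurable_fun setT (fun x : R => cos x ^+ n * sin x).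
Proof.
apply: measurable_funM; last exact: measurable_sin.
by apply: measurable_funX; exact: measurable_cos.
Qed.

Lemma kk_int (n : nat) : mu.-integrable O (EFin \o (fun x => kk x * (cos x ^+ n * sin x))) /\
  \int[mu]_(x in O) (kk x * (cos x ^+ n * sin x)) = jm 1 n.+1.
Proof.
have pi0 := @pi_gt0 R; have g0 : 0 < gam 2^-1 :> R by apply: gam_gt0; rewrite invr_gt0.
have half0 : 0 < 2^-1 :> R by rewrite invr_gt0.
have n1 : 1 <= n.+2%:R :> R by rewrite ler1n.
pose G (y : R) := (gam 2^-1)^-1 * (y `^ (2^-1 - 1) * expR (- n.+2%:R * y)).
have hG (y : R) : 0 < y -> {for y, continuous G} /\ 0 <= G y.
  move=> y0; split; last by rewrite !mulr_ge0 ?powR_ge0 ?expR_ge0 ?invr_ge0 ?ltW.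
  apply: continuousM; first exact: cst_continuous.
  apply: continuousM; first exact: cont_powR.
  by apply: continuous_comp; [apply: continuousM; [exact: cst_continuous|]|exact: continuous_expR].
have E : (\int[mu]_(x in O) (kk x * (cos x ^+ n * sin x))%:E = (jm 1 n.+1)%:E)%E.
  transitivity (\int[mu]_(x in `]0%R, (pi / 2)%R[) (G (- ln (cos x)) * (sin x / cos x))%:E)%E.
    rewrite integral_mkcond [RHS]integral_mkcond; apply: eq_integral => x _.
    rewrite !patchE !mem_setE !in_itv/=.
    have [x0|x0] := ltP 0 x => //=; have [x1|x1] := ltP x (pi / 2).
      have [c0 c1] := cos_in01 x0 x1; have -> : x < pi by lra.
      congr EFin; rewrite /kk /G; have -> : - n.+2%:R * - ln (cos x) = n.+2%:R * ln (cos x) by ring.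
      rewrite expRM_natl lnK ?posrE// !exprS; have -> : 2^-1 - 1 = - 2^-1 :> R by field.
      by field; rewrite gt_eqF//= gt_eqF.
    case: ifP => // x2; rewrite kk0 ?mul0r// leNgt; apply/negP => c0.
    by have := cos_small x0 x2 c0; lra.
  have iG : mu.-integrable `]0, +oo[ (EFin \o G) by apply: intZ => //; exact: lap_int.
  rewrite -(kk_subst hG) -[LHS]fineK; last first.
    by apply: integrable_fin_num => //.
  rewrite -[fine _]/(\int[mu]_(y in `]0, +oo[) G y) RintegralZl//; last exact: lap_int.
  rewrite lapE// mulrC -mulrA mulfV ?gt_eqF// mulr1 /jm; congr ((_ `^ _)%:E); by field.
split; last by rewrite /Rintegral E.
apply/integrableP; split.
  apply/measurable_EFinP; apply: (measurable_funS (E := setT)) => //.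
  by apply: measurable_funM; [exact: kk_meas|exact: cossin_meas].
have -> : (\int[mu]_(x in O) `|(EFin \o (fun x => kk x * (cos x ^+ n * sin x))%R) x| =
  \int[mu]_(x in O) (kk x * (cos x ^+ n * sin x))%:E)%E; last by rewrite E ltry.
apply: eq_integral => x; rewrite inE/= in_itv/= => /andP[x0 x1]; rewrite ger0_norm//.
have [c0|c0] := leP (cos x) 0; first by rewrite kk0// mul0r.
apply: mulr_ge0; first exact: kk_ge0.
apply: mulr_ge0; first by rewrite exprn_ge0 ?(ltW c0).
by apply/ltW/sin_gt0_pi; rewrite x0 x1.
Qed.

(** With s = sin(x/2), L = - ln(cos x) and w^2 = (1 - cos x) / L, the kernel is [kap] cos x w / s.
    From 1 - cos x <= L <= (1 - cos x) / cos x follows cos x <= w <= 1, and the difference to [kap]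
    cos(x/2) / s is of order s^2 / s. *)
Lemma kk_bound x : O x -> `|kk x - kap * cot2 x| <= 4 * kap.
Proof.
move=> Ox; have s0 := sin_half_gt0 Ox; move: (Ox); rewrite /= in_itv/= => /andP[x0 x1].
have pi0 := @pi_gt0 R; have g0 : 0 < gam 2^-1 :> R by apply: gam_gt0; rewrite invr_gt0.
have q0 : 0 < Num.sqrt 2 :> R by rewrite sqrtr_gt0.
have k0 : 0 < kap by rewrite divr_gt0// invr_gt0.
have c20 : 0 < cos (x / 2) by apply: cos_gt0_pihalf; apply/andP; split; lra.
have e3 := cos2Dsin2 (x / 2).
have e2 : cos x = cos (x / 2) ^+ 2 - sin (x / 2) ^+ 2.
  by have {1}-> : x = x / 2 + x / 2 by [field]; rewrite cosD; ring.
rewrite /cot2; set s := sin (x / 2) in s0 e2 e3 *; set c := cos (x / 2) in c20 e2 e3 *.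
have s1 : s <= 1 by rewrite -(@ler_sqr R)// ?nnegrE ?(ltW s0)// expr1n -e3 lerDr sqr_ge0.
have c1 : c <= 1 by rewrite -(@ler_sqr R)// ?nnegrE ?(ltW c20)// expr1n -e3 lerDl sqr_ge0.
have cs0 : 0 < c / s by rewrite divr_gt0.
have [cx|cx] := leP (cos x) 0.
  rewrite kk0// sub0r normrN normrM !gtr0_norm// mulrC ler_wpM2r ?(ltW k0)//.
  rewrite ler_pdivrMr//; have : c ^+ 2 <= s ^+ 2 by lra.
  rewrite ler_sqr ?nnegrE ?(ltW s0) ?(ltW c20)//; lra.
have [_ cx1] := cos_in01 x0 (cos_small x0 x1 cx).
pose L := - ln (cos x); pose r := L `^ (- 2^-1).
have L1 : 1 - cos x <= L by have := @le_ln1Dx R (cos x - 1) ltac:(lra); rewrite /L subrKC; lra.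
have L2 : L * cos x <= 1 - cos x.
  have i1 : 0 < (cos x)^-1 by rewrite invr_gt0.
  have := @le_ln1Dx R ((cos x)^-1 - 1) ltac:(lra); rewrite subrKC lnV ?posrE// -/L => h.
  apply: (@le_trans _ _ (((cos x)^-1 - 1) * cos x)); first by rewrite ler_wpM2r ?(ltW cx).
  by rewrite mulrBl mulVf ?gt_eqF// mul1r.
have L0 : 0 < L by lra.
have r0 : 0 < r by rewrite powR_gt0.
have r2 : r ^+ 2 * L = 1.
  rewrite /r -powR_mulrn ?powR_ge0// -powRrM (_ : - 2^-1 * 2%:R = - 1); last by field.
  by rewrite powR_inv1 ?(ltW L0)// mulVf ?gt_eqF.
pose w := Num.sqrt 2 * r * s; have w0 : 0 < w by rewrite !mulr_gt0.
have sy : 2 * s ^+ 2 = 1 - cos x by lra.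
have w2 : w ^+ 2 = r ^+ 2 * (1 - cos x) by rewrite /w !exprMn sqr_sqrtr// -sy; ring.
have w1 : w <= 1.
  rewrite -(@ler_sqr R)// ?nnegrE ?(ltW w0)// expr1n w2 -[leRHS]r2; apply: ler_wpM2l => //; exact: sqr_ge0.
have wc : cos x <= w.
  rewrite -(@ler_sqr R)// ?nnegrE ?(ltW cx) ?(ltW w0)// w2.
  apply: (@le_trans _ _ (cos x)); first by rewrite expr2 ler_piMl ?ltW.
  by rewrite -[leLHS]mul1r -[X in X * _]r2 -mulrA ler_wpM2l ?sqr_ge0.
have -> : kk x = kap * (cos x * w / s).
  rewrite /kk -/L -/r /kap /w; field; by rewrite gt_eqF//= gt_eqF//= gt_eqF.
rewrite -mulrBr normrM gtr0_norm// mulrC ler_wpM2r ?(ltW k0)//.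
rewrite -mulrBl normrM [`|s^-1|]gtr0_norm ?invr_gt0// ler_pdivrMr// ler_norml; apply/andP; split.
  have : (cos x) ^+ 2 <= cos x * w by rewrite expr2 ler_wpM2l ?(ltW cx).
  have : s ^+ 2 <= s by rewrite expr2 ler_piMl ?(ltW s0).
  have : 1 - cos x ^+ 2 <= 2 * (1 - cos x).
    have : 0 <= (1 - cos x) ^+ 2 by exact: sqr_ge0.
    by rewrite sqrrB expr1n mul1r mulr2n; lra.
  lra.
have : cos x * w <= cos x by rewrite ler_piMr ?(ltW cx).
have : c ^+ 2 <= c by rewrite expr2 ler_piMl ?(ltW c20).
have := sqr_ge0 s; lra.
Qed.

(** On odd functions [Lam] is 1/pi times the integral against cot(x/2), whence the factor [pi * kap]
    of the singular part. *)
Lemma kk_split (n : nat) : [/\ LamI (fun x : R => cos x ^+ n * sin x),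
  mu.-integrable O (EFin \o (fun x => (kk x - kap * cot2 x) * (cos x ^+ n * sin x))) &
  jm 1 n.+1 = pi * kap * Lam (fun x => cos x ^+ n * sin x) +
    \int[mu]_(x in O) ((kk x - kap * cot2 x) * (cos x ^+ n * sin x))].
Proof.
have [k1 k2] := kk_int n; have pi0 := @pi_gt0 R.
have i0 : mu.-integrable O (EFin \o (fun x => (1 + cos x) * cos x ^+ n)).
  apply: cont_int => x; apply: (@continuousM _ _ (fun x => 1 + cos x) (fun x => cos x ^+ n)).
    by apply: cvgD; [exact: cvg_cst|exact: continuous_cos].
  by apply: (@continuous_comp _ _ _ cos (fun y => y ^+ n)); [exact: continuous_cos|exact: exprn_continuous].
have [x|i1 _] := @eq_Oint _ _ (fun x => cot2 x * (cos x ^+ n * sin x)) _ i0.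
  by rewrite inE => Ox; rewrite mulrCA mulrA -cot_sin1// mulrC; ring.
have i2 : mu.-integrable O (EFin \o (fun x => 2 * (cot2 x * (cos x ^+ n * sin x)))) by exact: intZ.
have e : (fun x => cot2 x * (cos x ^+ n * sin x - cos (- x) ^+ n * sin (- x))) =
    (fun x => 2 * (cot2 x * (cos x ^+ n * sin x))).
  by apply/funext => x; rewrite cosN sinN; ring.
have i3 : mu.-integrable O (EFin \o (fun x => - kap * (cot2 x * (cos x ^+ n * sin x)))) by exact: intZ.
have e2 : (fun x => (kk x - kap * cot2 x) * (cos x ^+ n * sin x)) =
   (fun x => kk x * (cos x ^+ n * sin x) + - kap * (cot2 x * (cos x ^+ n * sin x))).
  by apply/funext => x; ring.
split; [by rewrite /LamI e|by rewrite e2; exact: integrableD k1 i3|].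
rewrite /Lam e e2 RintegralD// RintegralZl// RintegralZl// k2.
have h (z p k : R) : p != 0 -> p * k * ((2 * p)^-1 * (2 * z)) = k * z by move=> p0; field.
by rewrite h ?gt_eqF//; ring.
Qed.

Lemma Lam_sum (J : Type) (u : seq (R * J)) (h : J -> R -> R) : (forall j, LamI (h j)) ->
  Lam (fun t => \sum_(k <- u) k.1 * h k.2 t) = \sum_(k <- u) k.1 * Lam (h k.2) /\
  LamI (fun t => \sum_(k <- u) k.1 * h k.2 t).
Proof.
move=> hi; elim: (u) => [|k s [IH1 IH2]].
  under eq_fun do rewrite big_nil; rewrite big_nil.
  by have [] := @Lam_even R (fun=> 0) (fun=> erefl).
under eq_fun do rewrite big_cons; rewrite big_cons.
by have [h1 h2] := LamD k.1 (hi k.2) IH2; rewrite h2 IH1.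
Qed.

End meyer_kernel.

(** * The bilinear form of the normalised gradient *)

Section meyer.
Context {R : realType} (G : gspace R).
Notation mu := (@lebesgue_measure R).
Notation O := (`]0%R, pi[%classic : set R).
Local Notation S := (gsq G).
Local Notation P := (gP G).
Local Notation Q := (gP S).
Local Notation I := (nat * gI S)%type.
Implicit Types (F V : gT G -> R) (H W U : gT S -> R) (u : seq (R * I)) (v phi : seq (R * (nat * gI G))) (p q : R).

Lemma tp_sum (J : Type) (s : seq (R * J)) (h : J -> R -> gT S -> R) : (forall j, tp Q (h j)) ->
  tp Q (fun t z => \sum_(k <- s) k.1 * h k.2 t z).
Proof.
move=> hh; elim: s => [|k s IH].
  by apply: (tp_ext (tp_nil Q)) => t z; rewrite big_nil.
by apply: (tp_ext (tpD (tpZ k.1 (hh k.2)) IH)) => t z; rewrite big_cons.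
Qed.

Lemma tp_fst (l : gI G) : tp Q (fun t z => gX l (rotate t z).1).
Proof.
apply: (tp_ext (tp_md 1 (fst_Linf (Linf_gX l)) (snd_Linf (Linf_gX l)))) => t z.
by rewrite /md mul1r /rotate /rot/= gXmix.
Qed.

Lemma tp_snd (l : gI G) : tp Q (fun t z => gX l (rotate t z).2).
Proof.
apply: (tp_ext (tp_md 1 (snd_Linf (Linf_gX l)) (LinfN (fst_Linf (Linf_gX l))))) => t z.
by rewrite /md mul1r /rotate /rot/= gXmix; ring.
Qed.

Lemma tp_fev_fst phi : tp Q (fun t z => fev ge phi (rotate t z).1).
Proof. by apply: (@tp_sum _ phi (fun k t z => ge k (rotate t z).1)) => k; apply: tp_he; exact: tp_fst. Qed.

Lemma tp_fev1 u : tp Q (fun t z => fev ge1 u (rotate t z)).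
Proof.
apply: (@tp_sum _ u (fun k t z => ge1 k (rotate t z))) => k; apply: tpM (tp_snd _).
by apply: tpZ; apply: tp_he; exact: tp_fst.
Qed.

Lemma mpres_rotateE H t : measurable_fun setT H -> Ex Q (fun z => H (rotate t z)) = Ex Q H.
Proof. by move=> mH; apply: mpres_Ex mH; exact: rotate_mpres. Qed.

(** [conj_fun] controls the conjugate at some angle [s]; testing against [W] rotated by [s] brings
    it back to angle 0 by invariance. It covers the exponents 2^(m+1) only: the bound with the
    exponents exchanged comes from moving the rotation onto [W], which changes the sign of [Lam]. *)
Lemma riesz_rot (m : nat) : let p := (2 ^ m.+1)%:R in exists2 C : R, 0 <= C & forall q H W,
  conj_exp p q -> Linf Q H -> Linf Q W ->
  tp Q (fun t z => H (rotate t z)) -> tp Q (fun t z => W (rotate t z)) ->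
  `|Lam (fun t => Ex Q (fun z => H (rotate t z) * W z))| <= C * (nrm Q p H * nrm Q q W) /\
  `|Lam (fun t => Ex Q (fun z => H (rotate t z) * W z))| <= C * (nrm Q q H * nrm Q p W).
Proof.
move=> p; have [C C0 hC] := @conj_fun R _ _ Q m; exists C => // q.
have p2 : 2 <= p by rewrite /p ler_nat expnS leq_pmulr// expn_gt0.
have p1 : 1 <= p by lra.
have key H W : conj_exp p q -> Linf Q H -> Linf Q W -> tp Q (fun t z => H (rotate t z)) ->
    LamI (fun t => Ex Q (fun z => H (rotate t z) * W z)) /\
    `|Lam (fun t => Ex Q (fun z => H (rotate t z) * W z))| <= C * (nrm Q p H * nrm Q q W).
  move=> cpq LH LW tH; have /andP[q1 _] := conj_ge1 p2 cpq.
  have [|s [v [Lv nv hv]]] := hC _ (nrm Q p H) tH.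
    by move=> t; have [_ ->] := rotate_nrm t (LH p p1).
  have [] := hv (fun z => W (rotate s z)) (Linf_rotate s LW).
  have -> : (fun t => Ex Q (fun z => H (rotate (t + s) z) * W (rotate s z))) =
     (fun t => Ex Q (fun z => H (rotate t z) * W z)).
    apply/funext => t; rewrite -(@mpres_rotateE (fun z => H (rotate t z) * W z) s).
      by apply: eq_Ex => z; rewrite rotateD.
    by apply: Linf_meas; apply: LinfM LW; exact: Linf_rotate.
  move=> h1 ->; split=> //; rewrite normrN.
  have [_ /le_trans] := hoelderE (lt_le_trans ltr01 p1) (lt_le_trans ltr01 q1) cpq.2
     (Lv p p1) (Linf_rotate s LW q1); apply.
  have [_ ->] := rotate_nrm s (LW q q1); rewrite mulrA.
  by apply: ler_wpM2r nv; exact: nrm_ge0.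
move=> H W cpq LH LW tH tW; have [i1 b1] := key H W cpq LH LW tH; split=> //.
have [i2 b2] := key W H cpq LW LH tW; rewrite [X in C * X]mulrC.
apply: le_trans b2; rewrite le_eqVlt; apply/orP; left; apply/eqP.
rewrite -[in RHS]normrN; congr (`|_|).
have e t : Ex Q (fun z => H (rotate t z) * W z) = Ex Q (fun z => W (rotate (- t) z) * H z).
  by rewrite Ex_rotate; [apply: eq_Ex => z; rewrite mulrC|exact: Linf2|exact: Linf2].
have eI : \int[mu]_(t in O) (cot2 t * (Ex Q (fun z => H (rotate t z) * W z) - Ex Q (fun z => H (rotate (- t) z) * W z))) =
    -1 * \int[mu]_(t in O) (cot2 t * (Ex Q (fun z => W (rotate t z) * H z) - Ex Q (fun z => W (rotate (- t) z) * H z))).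
  by rewrite -RintegralZl//; apply: eq_Rintegral => t _; rewrite !e opprK; ring.
by rewrite /Lam eI mulN1r mulrN.
Qed.

(** The form of the gradient composed with (1 - L)^(-1/2), on finite combinations. Bounding it in
    both pairs of conjugate exponents handles the operator and its adjoint together. *)
Definition beta v u : R := \sum_(k <- u) k.1 * (jm 1 k.2.1 * dsym (fev ge v) k.2).

(** The bounded part of the kernel: [4 * kap] is its supremum, [pi] the length of the interval, and
    each rotation preserves norms. *)
Lemma beta_bulk p q v u : 1 <= p -> 1 <= q -> p^-1 + q^-1 = 1 ->
  `|\sum_(k <- u) k.1 * (\int[mu]_(x in O) ((kk x - kap * cot2 x) * (cos x ^+ k.2.1.-1 * sin x)) * dsym (fev ge v) k.2)|
  <= 4 * kap * pi * (nrm P p (fev ge v) * nrm Q q (fev ge1 u)).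
Proof.
move=> p1 q1 cpq; have pi0 := @pi_gt0 R; have LV := Linf_fevg v.
pose B x : R := kk x - kap * cot2 x.
pose b : R := 4 * kap * (nrm P p (fev ge v) * nrm Q q (fev ge1 u)).
have i1 (k : I) : mu.-integrable O (EFin \o (fun x => dsym (fev ge v) k * (B x * (cos x ^+ k.1.-1 * sin x)))).
  by apply: intZ => //; have [] := @kk_split R k.1.-1.
have ib : mu.-integrable O (EFin \o (fun=> b)).
  by apply: (@cont_int _ (fun=> b)); exact: cst_continuous.
have := @Rint_comb R _ u O (fun k x => dsym (fev ge v) k * (B x * (cos x ^+ k.1.-1 * sin x))) (fun=> b)
  ltac:(by []) i1 ib.
have -> : \int[mu]_(x in O) b = 4 * kap * pi * (nrm P p (fev ge v) * nrm Q q (fev ge1 u)).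
  by rewrite Rintegral_cst//= lebesgue_measure_itv/= lte_fin pi0 -EFinB subr0/= /b; ring.
rewrite (_ : \sum_(k <- u) _ = \sum_(k <- u) k.1 *
    (\int[mu]_(x in O) (B x * (cos x ^+ k.2.1.-1 * sin x)) * dsym (fev ge v) k.2)); last first.
  apply: eq_bigr => k _; rewrite RintegralZl// 1?[dsym _ _ * _]mulrC//.
  by have [] := @kk_split R k.2.1.-1.
apply=> x Ox; rewrite (_ : \sum_(c <- u) _ =
   B x * \sum_(k <- u) k.1 * (cos x ^+ k.2.1.-1 * sin x * dsym (fev ge v) k.2)); last first.
  by rewrite mulr_sumr; apply: eq_bigr => k _; ring.
rewrite -dsym_sum ?cs1//; last exact: Linf2.
rewrite normrM; apply: ler_pM => //; first exact: kk_bound.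
have L1 : Linf Q (fun z : gT S => fev ge v (rotate x z).1).
  by apply: (Linf_rotate x (H := fun z => fev ge v z.1)); exact: fst_Linf.
have [_ /le_trans] := hoelderE (lt_le_trans ltr01 p1) (lt_le_trans ltr01 q1) cpq (L1 p p1) (Linf_fe1 u q1).
apply; apply: ler_wpM2r; first exact: nrm_ge0.
have [_ ->] := rotate_nrm x (fst_Linf LV p1).
by have [_ ->] := mpres_memL (mpres_fst P P) (LV p p1).
Qed.

(** (n+1)^(-1/2) is the integral of the kernel against cos^(n-1) sin, so the form is an average of
    pairings of the rotated functional with [fev ge1 u]. The cotangent part is bounded by
    [riesz_rot], the rest by [beta_bulk], and [fe1_nrm] returns from [ge1] to [ge]. *)
Lemma beta_bound (m : nat) : let p := (2 ^ m.+1)%:R in exists2 C : R, 0 <= C & forall q v u,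
  conj_exp p q ->
  `|beta v u| <= C * (nrm P p (fev ge v) * nrm Q q (fev ge u)) /\
  `|beta v u| <= C * (nrm P q (fev ge v) * nrm Q p (fev ge u)).
Proof.
move=> p; have [C C0 hC] := riesz_rot m; rewrite -/p in hC.
have p2 : 2 <= p by rewrite /p ler_nat expnS leq_pmulr// expn_gt0.
have p1 : 1 < p by lra.
have pi0 := @pi_gt0 R; have k0 : 0 < kap :> R.
  by rewrite divr_gt0 ?sqrtr_gt0// invr_gt0 gam_gt0// invr_gt0.
pose q' := p / (p - 1); have q'1 : 1 < q' by rewrite ltr_pdivlMr; lra.
pose D := pi * kap * C + 4 * kap * pi; have D0 : 0 <= D.
  by have kg := ltW k0; have pig := ltW pi0; apply: addr_ge0; (do ?[exact: kg|apply: mulr_ge0]).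
have C10 (r : R) : 0 <= C1 r by rewrite !mulr_ge0 ?sqrtr_ge0.
exists (D * (C1 q' + C1 p)) => [|q v u cpq]; first exact: mulr_ge0 D0 (addr_ge0 (C10 _) (C10 _)).
have -> : q = q'.
  have [q0 /(congr1 (fun x => x - p^-1))] := cpq; rewrite addrAC subrr add0r => e.
  have pn : p != 0 by rewrite gt_eqF//; lra.
  have pm : p - 1 != 0 by rewrite gt_eqF//; lra.
  rewrite -[q]invrK e /q'; field; by rewrite ?pn ?pm.
have {}cpq : conj_exp p q' by exact: conj_exists.
have LV := Linf_fevg v; have LW := Linf_fe1 u.
have e : beta v u = pi * kap * Lam (fun t => Ex Q (fun z => fev ge v (rotate t z).1 * fev ge1 u z)) +
    \sum_(k <- u) k.1 * (\int[mu]_(x in O) ((kk x - kap * cot2 x) * (cos x ^+ k.2.1.-1 * sin x)) * dsym (fev ge v) k.2).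
  have -> : (fun t => Ex Q (fun z => fev ge v (rotate t z).1 * fev ge1 u z)) =
      (fun t => \sum_(k <- u) k.1 * (dsym (fev ge v) k.2 * (cos t ^+ k.2.1.-1 * sin t))).
    apply/funext => t; rewrite dsym_sum ?cs1//; last exact: Linf2.
    by apply: eq_bigr => k _; rewrite [_ * dsym _ _]mulrC.
  have hI (k : I) : LamI (fun t => dsym (fev ge v) k * (cos t ^+ k.1.-1 * sin t)) /\
      Lam (fun t => dsym (fev ge v) k * (cos t ^+ k.1.-1 * sin t)) =
      dsym (fev ge v) k * Lam (fun t => cos t ^+ k.1.-1 * sin t).
    have [h1 _ _] := @kk_split R k.1.-1; have [z1 z2] := @Lam_even R (fun=> 0) (fun=> erefl).
    have [h3 h4] := LamD (dsym (fev ge v) k) h1 z1; move: h3 h4.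
    by under eq_fun do rewrite addr0; rewrite z2 addr0.
  have [-> _] := Lam_sum u (fun k => (hI k).1).
  rewrite mulr_sumr -big_split/=; apply: eq_bigr => -[a [n l]] _ /=.
  (* The formula of [kk_split] is indexed by the degree minus one; degree 0 contributes nothing to
     the gradient. *)
  rewrite (hI (n, l)).2/=; case: n => [|n]; first by rewrite dsym0; ring.
  by have [_ _ ->] := @kk_split R n; ring.
have tH : tp Q (fun t z => (fun z : gT S => fev ge v z.1) (rotate t z)) by exact: tp_fev_fst.
have [b1 b2] := hC q' _ _ cpq (fst_Linf LV) LW tH (tp_fev1 u).
have nV r : 1 <= r -> nrm Q r (fun z => fev ge v z.1) = nrm P r (fev ge v).
  by move=> r1; have [_ ->] := mpres_memL (mpres_fst P P) (LV r r1).
rewrite !nV ?(ltW p1) ?(ltW q'1)// in b1 b2.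
have k1 := beta_bulk v u (ltW p1) (ltW q'1) cpq.2.
have k2 := beta_bulk v u (ltW q'1) (ltW p1) (etrans (addrC _ _) cpq.2).
have f1 := fe1_nrm u q'1; have f2 := fe1_nrm u p1.
have fin a c w X : 0 <= X -> nrm Q c (fev ge1 u) <= w * nrm Q c (fev ge u) -> 0 <= w -> w <= C1 q' + C1 p ->
    `|a| <= C * (X * nrm Q c (fev ge1 u)) -> forall b, `|b| <= 4 * kap * pi * (X * nrm Q c (fev ge1 u)) ->
    `|pi * kap * a + b| <= D * (C1 q' + C1 p) * (X * nrm Q c (fev ge u)).
  move=> X0 hw w0 wC ha b hb; apply: (@le_trans _ _ (D * (X * nrm Q c (fev ge1 u)))).
    apply: (le_trans (ler_normD _ _)); rewrite /D [leRHS]mulrDl; apply: lerD => //.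
    rewrite normrM gtr0_norm; last exact: mulr_gt0 pi0 k0.
    by rewrite -[leRHS]mulrA; apply: ler_wpM2l => //; exact: ltW (mulr_gt0 pi0 k0).
  rewrite -mulrA; apply: ler_wpM2l => //; rewrite mulrCA; apply: ler_wpM2l => //.
  by apply: (le_trans hw); apply: ler_wpM2r => //; exact: nrm_ge0.
by rewrite e; split; [apply: (fin _ q' _ _ _ f1 _ _ b1 _ k1)|apply: (fin _ p _ _ _ f2 _ _ b2 _ k2)];
  rewrite ?nrm_ge0 ?C10 ?lerDl ?lerDr ?C10.
Qed.
End meyer.

(** * Meyer's inequality and its adjoint *)

Section multipliers.
Context {R : realType} (G : gspace R).
Local Notation S := (gsq G).
Local Notation P := (gP G).
Local Notation Q := (gP S).
Local Notation I := (nat * gI S)%type.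
Implicit Types (F V : gT G -> R) (H W U : gT S -> R) (l : I) (a : nat -> R).

Lemma der_sym U l : memL Q 2 U ->
  is_derive (0 : R) 1 (fun t => sym (G := S) U (l.1, rotI (cos (- t)) (sin (- t)) l.2)) (- Ex Q (fun z => U z * rge l z)).
Proof.
move=> mU; have D := der_rotate [:: (1 : R, l)] 0 mU.
have fE z : fev ge [:: (1 : R, l)] z = ge l z by rewrite /fev big_seq1 mul1r.
apply: (is_derive_ext D) => [t|].
  rewrite Ex_rotate//; last by apply: Linf2; exact: Linf_fevg.
  by apply: eq_Ex => z; rewrite fE ge_rotI.
by congr (- _); apply: eq_Ex => z; rewrite oppr0 rotate0 /fev big_seq1 mul1r.
Qed.

(** Rotating an index preserves its degree, so a degree multiplier commutes with the derivative
    along rotations. *)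
Lemma rsym_mul a U W : memL Q 2 U -> memL Q 2 W ->
  (forall k, sym (G := S) U k = a k.1 * sym (G := S) W k) ->
  forall l, Ex Q (fun z => U z * rge l z) = a l.1 * Ex Q (fun z => W z * rge l z).
Proof.
move=> mU mW h l; apply/oppr_inj; rewrite -mulrN.
have D1 := der_sym l mU; have D2 := is_derive_mul (is_derive_cst (a l.1) (0 : R) 1) (der_sym l mW).
rewrite mul0r add0r in D2; move: D1; rewrite (_ : (fun t => sym U _) =
  (fun t => cst (a l.1) t * sym (G := S) W (l.1, rotI (cos (- t)) (sin (- t)) l.2))); last first.
  by apply/funext => t; exact: (h (l.1, _)).
by move=> D1; exact: (etrans (esym (derive_val (is_derive := D1))) (derive_val (is_derive := D2))).
Qed.

Lemma dsym_mul a F V : memL P 2 F -> memL P 2 V -> (forall k, sym F k = a k.1 * sym V k) ->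
  forall l, dsym F l = a l.1 * dsym V l.
Proof.
move=> mF mV h l; apply/oppr_inj; rewrite -mulrN -!rge_dsym//.
by apply: rsym_mul => [||k]; [exact: fst2|exact: fst2|rewrite !ge_fst// h].
Qed.

(** The null variable; with it [hat] lifts an index to one that depends on the first coordinate
    only. *)
Definition g0 : gI G := glin 0 (gi0 G) 0 (gi0 G).
Definition hat (k : nat * gI G) : I := (k.1, (k.2, g0)).
(** The pairing of [U] with the gradient of [ge k]: the symbols of the divergence of [U]. *)
Definition rsym U (k : nat * gI G) : R := Ex Q (fun z => U z * rge (hat k) z).

Lemma gX_g0 x : gX g0 x = 0. Proof. by rewrite gXlin !mul0r addr0. Qed.

Lemma ge_hat k z : ge (hat k) z = ge k z.1.
Proof. by rewrite /ge /= gX_g0 addr0 gcovDl !mul0r !addr0. Qed.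

Lemma rge_hat k z : rge (hat k) z = ge1 (k.1, (k.2, k.2)) z.
Proof.
by rewrite /rge /ge1 /= gX_g0 addr0 gcovDl !mul0r !addr0 gXlin gX_g0 mulr0 mul0r addr0 add0r.
Qed.

Lemma ge_dsym k l : Ex Q (fun z => ge l z * rge (hat k) z) = dsym (ge k) l.
Proof.
have := fev_wder [:: (1 : R, hat k)] l.
rewrite /sym (eq_Ex Q (g := fun z => ge l z * rge (hat k) z)); last first.
  by move=> z; rewrite /fev big_seq1 mul1r mulrC.
move=> ->; apply/oppr_inj; rewrite opprK -rge_dsym; last by apply: Linf2; exact: Linf_ge.
by apply: eq_Ex => z; rewrite /fev big_seq1 mul1r ge_hat.
Qed.

Lemma dsym_ge_deg k l : l.1 != k.1 -> dsym (ge k) l = 0.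
Proof.
move=> lk; have m := Linf2 (Linf_ge k).
rewrite (@dsym_mul (fun n => (n == k.1)%:R) (ge k) (ge k)) ?(negPf lk) ?mul0r// => j.
by case: (eqVneq j.1 k.1) => jk; rewrite ?mul1r// mul0r; apply: ge_orth; rewrite eq_sym.
Qed.

(** Divergence is adjoint to gradient, and the pairing vanishes between different degrees, so the
    multiplier may be attached to either index. *)
Lemma rsym_beta u v : \sum_(k <- v) k.1 * (jm 1 k.2.1 * rsym (fev ge u) k.2) = beta v u.
Proof.
have e (k : nat * gI G) : rsym (fev ge u) k = \sum_(j <- u) j.1 * dsym (ge k) j.2.
  rewrite /rsym (eq_Ex Q (g := fun z => rge (hat k) z * fev ge u z)); last by move=> z; rewrite mulrC.
  rewrite Ex_sym; last by apply: Linf2; exact: Linf_rge.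
  by apply: eq_bigr => j _; rewrite -ge_dsym; congr (_ * _); apply: eq_Ex => z; rewrite mulrC.
have e2 (l : I) : dsym (fev ge v) l = \sum_(k <- v) k.1 * dsym (ge k.2) l.
  rewrite /dsym (eq_Ex P (g := fun x => dge l x * fev ge v x)); last by move=> z; rewrite mulrC.
  rewrite (Ex_fev (@Linf_ge R G)); last by apply: Linf2; exact: Linf_dge.
  by apply: eq_bigr => k _; congr (_ * _); apply: eq_Ex => z; rewrite mulrC.
rewrite /beta; under eq_bigr do rewrite e !mulr_sumr.
under [RHS]eq_bigr do rewrite e2 !mulr_sumr.
rewrite exchange_big/=; apply: eq_bigr => j _; apply: eq_bigr => k _.
case: (eqVneq j.2.1 k.2.1) => [->|jk]; first by ring.
by rewrite dsym_ge_deg//; ring.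
Qed.

Lemma pow2_ge p : exists m, p <= (2 ^ m.+1)%:R :> R.
Proof.
exists (Num.truncn p); apply: (le_trans (ltW (truncnS_gt p))).
by rewrite ler_nat ltnW// ltn_expl.
Qed.
End multipliers.

Section form_extension.
Context {R : realType} (G : gspace R).
Local Notation P := (gP G).

(** Density in L^p; the a priori L^q norm of the fixed [E] controls the approximation error and does
    not enter the final constant. *)
Lemma form_ext p (D : R) V E : 2 <= p -> 0 <= D -> memL P p V -> Linf P E ->
  (forall phi, `|Ex P (fun x => fev ge phi x * E x)| <= D * nrm P p (fev ge phi)) ->
  `|Ex P (fun x => V x * E x)| <= D * nrm P p V.
Proof.
move=> p2 D0 mV LE h; have p1 : 1 <= p by lra.
have [q0 cpq] := conj_exists p2; have /andP[q1 _] := conj_ge1 p2 (conj q0 cpq).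
set q := p / (p - 1) in q0 cpq q1; set N := nrm P q E; have N0 : 0 <= N by exact: nrm_ge0.
apply/ler_addgt0Pr => eps e0; have k0 : 0 < N + D + 1 by lra.
have [phi hphi] := chaos_dense p1 mV (divr_gt0 e0 k0).
have mf := Linf_fevg phi p1; have [mB _] := nrmB p1 mV mf.
have -> : Ex P (fun x => V x * E x) = Ex P (fun x => (V x - fev ge phi x) * E x) + Ex P (fun x => fev ge phi x * E x).
  rewrite -ExD; first by apply: eq_Ex => x; ring.
    exact: (hoelderE (lt_le_trans ltr01 p1) q0 cpq mB (LE q q1)).1.
  exact: (hoelderE (lt_le_trans ltr01 p1) q0 cpq mf (LE q q1)).1.
apply: (le_trans (ler_normD _ _)).
have b1 := (hoelderE (lt_le_trans ltr01 p1) q0 cpq mB (LE q q1)).2.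
have b2 : nrm P p (fev ge phi) <= nrm P p V + eps / (N + D + 1).
  rewrite (nrm_ext P p (g := fun x => V x - (V x - fev ge phi x))); last by move=> x; congr (`|_|); ring.
  by apply: (le_trans (nrmB p1 mV mB).2); rewrite lerD2l.
have b3 := le_trans (h phi) (ler_wpM2l D0 b2).
have b4 := ler_wpM2r N0 hphi.
have b5 : eps / (N + D + 1) * (N + D + 1) = eps by rewrite divfK// gt_eqF.
have b6 : 0 < eps / (N + D + 1) by rewrite divr_gt0.
move: b1 b3 b4 b5 b6; rewrite -/N; move: (eps / _) (`|_|) (`|_|) (nrm P p V) (nrm P p _) => e a b v w.
by move=> b1 b3 b4 b5 b6; nra.
Qed.
End form_extension.

Section operators.
Context {R : realType} (G : gspace R).
Local Notation S := (gsq G).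
Local Notation P := (gP G).
Local Notation Q := (gP S).
Local Notation I := (nat * gI S)%type.
Implicit Types (F V : gT G -> R) (H W U : gT S -> R) (l : I) (a : nat -> R) (p q : R).

(** Meyer's inequality: the gradient composed with (1 - L)^(-1/2) is bounded on every L^p. It is
    enough to use exponents 2^(m+1) above the given p. *)
Lemma T_ex V : Linf P V -> exists U, Linf Q U /\ forall l, sym (G := S) U l = jm 1 l.1 * dsym V l.
Proof.
move=> LV; apply: Linf_sym => p p2; have [m pm] := pow2_ge p.
set p' := (2 ^ m.+1)%:R in pm; have p'2 : 2 <= p' by exact: le_trans pm.
have p'1 : 1 <= p' by lra.
have [C C0 hC] := beta_bound G m; rewrite -/p' in hC.
have cpq := conj_exists p'2; set q := p' / (p' - 1) in cpq.
have [|u|U [mU _ hU]] := @repr R S p' q (C * nrm P p' V) (fun l => jm 1 l.1 * dsym V l) p'2 cpq.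
- by rewrite mulr_ge0// nrm_ge0.
- pose E x : R := \sum_(k <- u) k.1 * (jm 1 k.2.1 * dge k.2 x).
  have LE : Linf P E by apply: Linf_sum => k; apply: LinfZ; apply: LinfZ; exact: Linf_dge.
  have eE F : Linf P F -> Ex P (fun x => F x * E x) = fval (fun l => jm 1 l.1 * dsym F l) u.
    move=> LF; rewrite (eq_Ex P (g := fun x => \sum_(k <- u) (k.1 * jm 1 k.2.1) * (F x * dge k.2 x))); last first.
      by move=> x; rewrite /E mulr_sumr; apply: eq_bigr => k _; ring.
    have m1 (k : R * I) : memL P 1 (fun x => F x * dge k.2 x) by apply: Linf1; apply: LinfM => //; exact: Linf_dge.
    have [_ ->] := Ex_sum u (fun k => (nrmZ (k.1 * jm 1 k.2.1) ltr01 (m1 k)).1).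
    by rewrite /fval; apply: eq_bigr => k _; rewrite (ExZ _ (m1 k)) /dsym; ring.
  rewrite -(eE V LV) mulrAC; apply: form_ext => //; first by rewrite mulr_ge0// nrm_ge0.
    exact: LV.
  move=> phi; rewrite eE; last exact: Linf_fevg.
  have [h _] := hC q phi u cpq; apply: (le_trans h); rewrite le_eqVlt; apply/orP; left; apply/eqP; ring.
exists U; split=> //; apply: (memL_le _ pm mU).1; lra.
Qed.

(** The adjoint statement, for (1 - L)^(-1/2) composed with the divergence, from the second bound of
    [beta_bound]. *)
Lemma S_ex U : Linf Q U -> exists V, Linf P V /\ forall k, sym V k = jm 1 k.1 * rsym U k.
Proof.
move=> LU; apply: Linf_sym => p p2; have [m pm] := pow2_ge p.
set p' := (2 ^ m.+1)%:R in pm; have p'2 : 2 <= p' by exact: le_trans pm.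
have p'1 : 1 <= p' by lra.
have [C C0 hC] := beta_bound G m; rewrite -/p' in hC.
have cpq := conj_exists p'2; set q := p' / (p' - 1) in cpq.
have [|v|V [mV _ hV]] := @repr R G p' q (C * nrm Q p' U) (fun k => jm 1 k.1 * rsym U k) p'2 cpq.
- by rewrite mulr_ge0// nrm_ge0.
- pose E z : R := \sum_(k <- v) k.1 * (jm 1 k.2.1 * rge (hat k.2) z).
  have LE : Linf Q E by apply: Linf_sum => k; apply: LinfZ; apply: LinfZ; exact: Linf_rge.
  have eE W : Linf Q W -> Ex Q (fun x => W x * E x) = fval (fun k => jm 1 k.1 * rsym W k) v.
    move=> LF; rewrite (eq_Ex Q (g := fun x => \sum_(k <- v) (k.1 * jm 1 k.2.1) * (W x * rge (hat k.2) x))); last first.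
      by move=> x; rewrite /E mulr_sumr; apply: eq_bigr => k _; ring.
    have m1 (k : R * (nat * gI G)) : memL Q 1 (fun x => W x * rge (hat k.2) x).
      by apply: Linf1; apply: LinfM => //; exact: Linf_rge.
    have [_ ->] := Ex_sum v (fun k => (nrmZ (k.1 * jm 1 k.2.1) ltr01 (m1 k)).1).
    by rewrite /fval; apply: eq_bigr => k _; rewrite (ExZ _ (m1 k)) /rsym; ring.
  rewrite -(eE U LU) mulrAC; apply: (form_ext (G := S)) => //; first by rewrite mulr_ge0// nrm_ge0.
    exact: LU.
  move=> u; rewrite eE; last exact: Linf_fevg.
  rewrite /fval rsym_beta; have [_ h] := hC q v u cpq.
  by apply: (le_trans h); rewrite le_eqVlt; apply/orP; left; apply/eqP; ring.
exists V; split=> //; apply: (memL_le _ pm mV).1; lra.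
Qed.

(** Degree multipliers commute with the gradient, so the gradient of [F] is the potential of order
    [s] of the operator of [T_ex] applied to [V]. *)
Lemma Dsp_deriv (s : R) F : 0 <= s -> Dsp (s + 1) F ->
  exists U, Dsp (G := S) s U /\ wder (fun z => F z.1) U.
Proof.
move=> s0 [LF [V [LV pV]]]; have [F' [LF' pF']] := bessel_Linf s0 LV.
have p1 : pot 1 F' F by move=> l; rewrite pV addrC jmD -mulrA -pF'.
have [U [LU hU]] := T_ex LF'; have [W [LW hW]] := T_ex LV.
have d1 := dsym_mul (Linf2 LF) (Linf2 LF') p1; have d2 := dsym_mul (Linf2 LF') (Linf2 LV) pF'.
exists U; split; last by apply/(wder_dsym _ (Linf2 LF)) => l; rewrite hU d1.
by split=> //; exists W; split=> // l; rewrite hU hW d2; ring.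
Qed.

(** The divergence of the gradient is - L. The pairing of the rotated [F] with the diagonal index is
    cos^(n-1) sin times [dsym F], and on the diagonal [dge] collapses to n he_n by the
    recurrence. *)
Lemma rsym_wder F U : Linf P F -> Linf Q U -> wder (fun z => F z.1) U ->
  forall k, rsym U k = k.1%:R * sym F k.
Proof.
move=> LF LU h k; have LF1 := fst_Linf LF; have m1 := Linf2 LF1; have m2 := Linf2 LU.
have sd := wder_sder (lexx 2) m1 m2 h.
apply: (sder_pair m1 m2 (Linf2 (Linf_rge (hat k))) sd).
have e : dsym F (k.1, (k.2, k.2)) = k.1%:R * sym F k.
  rewrite /dsym -(ExZ k.1%:R); last by apply: Linf1; apply: LinfM => //; exact: Linf_ge.
  apply: eq_Ex => x; rewrite /dge /ge/=; case: (k.1) => [|n]; first by rewrite !mul0r mulr0.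
  by rewrite heS /=; ring.
have D : is_derive (0 : R) 1 (fun t => cos t ^+ k.1.-1 * (sin t * dsym F (k.1, (k.2, k.2)))) (dsym F (k.1, (k.2, k.2))).
  have D1 := is_deriveX k.1.-1 (is_derive_cos (0 : R)).
  have D2 := is_derive_mul (is_derive_sin (0 : R)) (is_derive_cst (dsym F (k.1, (k.2, k.2))) (0 : R) 1).
  apply: (is_derive_ext (is_derive_mul D1 D2)) => [t|]; first by rewrite exprfctE.
  by rewrite exprfctE /= cos0 sin0 !expr1n /cst /GRing.scale/=; ring.
apply: (is_derive_ext D) => [t|]; last by [].
rewrite (eq_Ex Q (g := fun z => F (rot (cos t) (sin t) z).1 * ge1 (k.1, (k.2, k.2)) z)); last first.
  by move=> z; rewrite rge_hat.
by rewrite ge1_dsym ?cs1//=; [ring|exact: Linf2].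
Qed.

(** F = (1 - L)^(-1) (F + div grad F). One factor (1 - L)^(-1/2) is spent by [S_ex] on the
    divergence; the other gains one order. *)
Lemma Dsp_integr (s : R) F U : 0 <= s -> Dsp s F -> Dsp (G := S) s U -> wder (fun z => F z.1) U -> Dsp (s + 1) F.
Proof.
move=> s0 [LF [F' [LF' pF]]] [LU [U' [LU' pU]]] h.
have [V1 [LV1 p1]] := bessel_Linf ler01 LF'; have [V2 [LV2 p2]] := S_ex LU'.
split=> //; exists (fun x => V1 x + 1 * V2 x); split.
  by apply: LinfD => //; exact: LinfZ.
move=> k; rewrite symD; [|exact: Linf2..]; rewrite mul1r p1 p2 -mulrDr.
have e := rsym_wder LF LU h k; have e2 := rsym_mul (Linf2 LU) (Linf2 LU') pU (hat k).
rewrite -/(rsym U k) e -/(rsym U' k) /= in e2.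
have j2 : jm 1 k.1 * jm 1 k.1 * k.1.+1%:R = 1 :> R.
  rewrite -jmD /jm (_ : - ((1 + 1) / 2) = - 1 :> R); last by field.
  by rewrite powR_inv1 ?mulVf// pnatr_eq0.
rewrite jmD; have -> : jm s k.1 * jm 1 k.1 * (jm 1 k.1 * (sym F' k + rsym U' k)) =
  jm 1 k.1 * jm 1 k.1 * (jm s k.1 * sym F' k + jm s k.1 * rsym U' k) by ring.
by rewrite -pF -e2 -[LHS]mul1r -{1}j2 -natr1; ring.
Qed.
End operators.

(** * Products and quotients *)

Section limits.
Context {R : realType} (G : gspace R).
Local Notation S := (gsq G).
Local Notation Q := (gP S).
Implicit Types (f : R -> gT S -> R) (g H U : gT S -> R) (p t : R).

(** Convergence as t tends to 0 in every L^p at once, hence stable under products. The value at t =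
    0 is excluded because difference quotients are meant. *)
Definition cv f g := [/\ Linf Q g, forall t, t != 0 -> Linf Q (f t) &
  forall p, 1 <= p -> forall eps : R, 0 < eps -> exists2 dl : R, 0 < dl &
    forall t, t != 0 -> `|t| <= dl -> nrm Q p (fun z => f t z - g z) <= eps].

Lemma cv_cst g : Linf Q g -> cv (fun _ => g) g.
Proof.
move=> Lg; split=> // p p1 eps e0; exists 1 => // t _ _.
rewrite (nrm_ext Q p (g := fun z => 0 * g z)); last by move=> z; rewrite subrr mul0r.
by have [_ ->] := nrmZ 0 (lt_le_trans ltr01 p1) (Lg p p1); rewrite normr0 mul0r ltW.
Qed.

Lemma cvD f g f' g' : cv f g -> cv f' g' -> cv (fun t z => f t z + f' t z) (fun z => g z + g' z).
Proof.
move=> [Lg Lf h] [Lg' Lf' h']; split=> [|t t0|p p1 eps e0].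
- exact: LinfD.
- by apply: LinfD; [exact: Lf|exact: Lf'].
have e2 : 0 < eps / 2 by rewrite divr_gt0.
have [d d0 hd] := h p p1 _ e2; have [d' d'0 hd'] := h' p p1 _ e2.
exists (Num.min d d') => [|t t0]; first by rewrite lt_min d0.
rewrite le_min => /andP[td td'].
rewrite (nrm_ext Q p (g := fun z => (f t z - g z) + (f' t z - g' z))); last by move=> z; congr (`|_|); ring.
have m1 := LinfB (Lf t t0) Lg p1; have m2 := LinfB (Lf' t t0) Lg' p1.
apply: (le_trans (nrmD p1 m1 m2).2); rewrite [leRHS]splitr.
by apply: lerD; [exact: hd|exact: hd'].
Qed.

Lemma cvM f g f' g' : cv f g -> cv f' g' -> cv (fun t z => f t z * f' t z) (fun z => g z * g' z).
Proof.
move=> [Lg Lf h] [Lg' Lf' h']; split=> [|t t0|p p1 eps e0].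
- exact: LinfM.
- by apply: LinfM; [exact: Lf|exact: Lf'].
have p2 : 1 <= 2 * p by lra.
set N := nrm Q (2 * p) g; set N' := nrm Q (2 * p) g'.
have N0 : 0 <= N by exact: nrm_ge0. have N'0 : 0 <= N' by exact: nrm_ge0.
pose e : R := Num.min 1 (eps / (N + N' + 1)).
have k0 : 0 < N + N' + 1 by lra.
have ee : 0 < e by rewrite lt_min ltr01 divr_gt0.
have e1 : e <= 1 by rewrite ge_min lexx.
have e3 : e * (N + N' + 1) <= eps by rewrite -ler_pdivlMr// ge_min lexx orbT.
have [d d0 hd] := h _ p2 _ ee; have [d' d'0 hd'] := h' _ p2 _ ee.
exists (Num.min d d') => [|t t0]; first by rewrite lt_min d0.
rewrite le_min => /andP[td td'].
have m1 := LinfB (Lf t t0) Lg; have m2 := LinfB (Lf' t t0) Lg'.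
rewrite (nrm_ext Q p (g := fun z => (f t z - g z) * (f' t z - g' z) +
   (g z * (f' t z - g' z) + (f t z - g z) * g' z))); last by move=> z; congr (`|_|); ring.
have b1 := (nrmM2 p1 (m1 _ p2) (m2 _ p2)).2.
have b2 := (nrmM2 p1 (Lg _ p2) (m2 _ p2)).2.
have b3 := (nrmM2 p1 (m1 _ p2) (Lg' _ p2)).2.
have c1 := LinfM m1 m2 p1; have c2 := LinfM Lg m2 p1; have c3 := LinfM m1 Lg' p1.
apply: (le_trans (nrmD p1 c1 (nrmD p1 c2 c3).1).2).
apply: (le_trans (lerD b1 (le_trans (nrmD p1 c2 c3).2 (lerD b2 b3)))).
have h1 := hd t t0 td; have h2 := hd' t t0 td'; apply: le_trans e3.
have n1 := nrm_ge0 Q (2 * p) (fun z => f t z - g z); have n2 := nrm_ge0 Q (2 * p) (fun z => f' t z - g' z).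
have x1 : nrm Q (2 * p) (fun z => f t z - g z) * nrm Q (2 * p) (fun z => f' t z - g' z) <= e * 1.
  by apply: ler_pM => //; exact: le_trans e1.
have x2 := ler_wpM2l N0 h2; have x3 := ler_wpM2r N'0 h1; rewrite -/N -/N'; lra.
Qed.

Lemma cv_uniq f g g' : cv f g -> cv f g' -> {ae Q, forall z, g z = g' z}.
Proof.
move=> [Lg Lf h] [Lg' _ h'].
have m := LinfB Lg Lg' (lexx 1).
suff /(nrm_eq0 ltr01 m) : nrm Q 1 (fun z => g z - g' z) = 0.
  by apply: filterS => z /eqP; rewrite subr_eq0 => /eqP.
apply/eqP; rewrite eq_le nrm_ge0 andbT; apply/ler_addgt0Pr => eps e0; rewrite add0r.
have e2 : 0 < eps / 2 by rewrite divr_gt0.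
have [d d0 hd] := h 1 (lexx 1) _ e2; have [d' d'0 hd'] := h' 1 (lexx 1) _ e2.
pose t := Num.min d d'; have t0 : 0 < t by rewrite lt_min d0.
have tn : t != 0 by rewrite gt_eqF.
have td : `|t| <= d by rewrite gtr0_norm// ge_min lexx.
have td' : `|t| <= d' by rewrite gtr0_norm// ge_min lexx orbT.
rewrite (nrm_ext Q 1 (g := fun z => (f t z - g' z) - (f t z - g z))); last by move=> z; congr (`|_|); ring.
have m1 := LinfB (Lf t tn) Lg (lexx 1); have m2 := LinfB (Lf t tn) Lg' (lexx 1).
apply: (le_trans (nrmB (lexx 1) m2 m1).2); rewrite [leRHS]splitr.
by apply: lerD; [exact: hd'|exact: hd].
Qed.

Lemma cv_rotate H : Linf Q H -> cv (fun t z => H (rotate t z)) H.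
Proof.
move=> LH; split=> // [t _|p p1 eps e0]; first exact: Linf_rotate.
have p2 : 2 <= Num.max 2 p by rewrite le_max lexx.
have pp : p <= Num.max 2 p by rewrite le_max lexx orbT.
have p1' : 1 <= Num.max 2 p by lra.
have [d d0 hd] := rotate_cont p2 (LH _ p1') e0; exists d => // t _ /hd; apply: le_trans.
by apply: (memL_le _ pp _).2; [lra|exact: LinfB (Linf_rotate t LH) LH _ p1'].
Qed.

Lemma wder_cv H U : Linf Q H -> Linf Q U -> wder H U ->
  cv (fun t z => t^-1 * (H (rotate t z) - H z)) U.
Proof.
move=> LH LU h; split=> // [t _|p p1 eps e0]; first by apply: LinfZ; apply: LinfB => //; exact: Linf_rotate.
have p2 : 2 <= Num.max 2 p by rewrite le_max lexx.
have pp : p <= Num.max 2 p by rewrite le_max lexx orbT.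
have p1' : 1 <= Num.max 2 p by lra.
have [d d0 hd] := wder_sder p2 (LH _ p1') (LU _ p1') h e0; exists d => // t t0 /hd ht.
have Ld := LinfB (LinfB (Linf_rotate t LH) LH) (LinfZ t LU).
apply: (@le_trans _ _ (nrm Q (Num.max 2 p) (fun z => t^-1 * (H (rotate t z) - H z - t * U z)))).
  rewrite (nrm_ext Q p (g := fun z => t^-1 * (H (rotate t z) - H z - t * U z))); last first.
    by move=> z; congr (`|_|); field.
  by apply: (memL_le _ pp _).2; [lra|exact: LinfZ Ld _ p1'].
rewrite (nrmZ _ _ (Ld _ p1')).2; last by lra.
by rewrite normfV ler_pdivrMl ?normr_gt0// mulrC.
Qed.

Lemma cv_wder H U : Linf Q H -> cv (fun t z => t^-1 * (H (rotate t z) - H z)) U -> wder H U.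
Proof.
move=> LH [LU Lf h]; apply: sder_wder; [exact: Linf2|exact: Linf2|].
have p1 : 1 <= 2 :> R by rewrite ler1n.
move=> eps e0; have [d d0 hd] := h 2 p1 eps e0; exists d => // t td.
have [->|t0] := eqVneq t 0.
  rewrite normr0 mulr0 (nrm_ext Q 2 (g := fun z => 0 * U z)); last first.
    by move=> z; rewrite rotate0 subrr sub0r mul0r oppr0.
  by have [_ ->] := nrmZ 0 (ltr0n R 2) (Linf2 LU); rewrite normr0 mul0r.
rewrite (nrm_ext Q 2 (g := fun z => t * (t^-1 * (H (rotate t z) - H z) - U z))); last first.
  by move=> z; congr (`|_|); field.
rewrite (nrmZ _ _ (LinfB (Lf t t0) LU p1)).2; last by lra.
by rewrite mulrC ler_wpM2r// hd.
Qed.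
End limits.

(** * Induction on the integer part of the order *)

Section classes.
Context {R : realType} (B : R -> Prop).
Hypothesis B0 : B 0.
Hypothesis B_ge0 : forall r, B r -> 0 <= r.

(** [B] collects the orders allowed beyond [k]: the singleton 0 for an integer order, the interval
    [0, sigma) for the spaces of all orders below k + sigma. *)
Definition cls (k : nat) (G : gspace R) (F : gT G -> R) := forall r, B r -> Dsp (r + k%:R) F.
Definition cls_mul k := forall (G : gspace R) (F N : gT G -> R), cls k F -> cls k N ->
  cls k (fun x => F x * N x).
(** [a] stands for the indicator of A and [I] for 1/F off A. The relations are purely algebraic,
    survive the passage to the square space, and make [a] idempotent. *)
Definition cls_quot k := forall (G : gspace R) (F N I a : gT G -> R), cls k F -> cls k N ->
  Linf (gP G) I -> Linf (gP G) a -> (forall x, F x * I x = 1 - a x) -> (forall x, a x * I x = 0) ->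
  (forall x, N x * a x = 0) -> cls k (fun x => N x * I x).

Lemma cls_Linf k (G : gspace R) (F : gT G -> R) : cls k F -> Linf (gP G) F.
Proof. by move=> /(_ 0 B0) []. Qed.

Lemma cls_ae k (G : gspace R) (F V : gT G -> R) : {ae gP G, forall x, F x = V x} ->
  measurable_fun setT V -> cls k F -> cls k V.
Proof. by move=> e mV h r Br; apply: Dsp_ae e mV (h r Br). Qed.

Lemma cls_lin k (G : gspace R) b (F V : gT G -> R) : cls k F -> cls k V -> cls k (fun x => F x + b * V x).
Proof. by move=> h1 h2 r Br; apply: Dsp_lin; [exact: h1|exact: h2]. Qed.

Lemma cls_fst k (G : gspace R) (F : gT G -> R) : cls k F -> cls k (G := gsq G) (fun z => F z.1).
Proof. by move=> h r Br; apply: Dsp_fst; exact: h. Qed.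

Lemma cls_le k (G : gspace R) (F : gT G -> R) : cls k.+1 F -> cls k F.
Proof. by move=> h r Br; apply: Dsp_le (h r Br); rewrite lerD2l ler_nat. Qed.

(** The derivatives found for different [r] have the same symbols, so one of them serves all [r]. *)
Lemma cls_deriv k (G : gspace R) (F : gT G -> R) : cls k.+1 F ->
  exists2 U, cls k (G := gsq G) U & wder (fun z => F z.1) U.
Proof.
move=> h; have hD r : B r -> exists U, Dsp (G := gsq G) (r + k%:R) U /\ wder (fun z => F z.1) U.
  move=> Br; apply: Dsp_deriv; first by rewrite addr_ge0// B_ge0.
  by rewrite -addrA natr1; exact: h.
have [U [[LU _] hU]] := hD 0 B0; exists U => // r Br; have [V [DV hV]] := hD r Br.
have [LV _] := DV; apply: (@Dsp_ae _ _ _ V) DV; last exact: Linf_meas LU.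
by apply: sym_uniq; [exact: Linf2|exact: Linf2|move=> l; rewrite hU hV].
Qed.

Lemma cls_integr k (G : gspace R) (F : gT G -> R) U : cls k F -> cls k (G := gsq G) U ->
  wder (fun z => F z.1) U -> cls k.+1 F.
Proof.
move=> hF hU h r Br; rewrite -natr1 addrA; apply: (Dsp_integr _ (hF r Br) (hU r Br) h).
by rewrite addr_ge0// B_ge0.
Qed.

(** Leibniz's rule on difference quotients, with the factor [N] taken at the rotated point in one of
    the two terms. *)
Lemma cls_mulS k : cls_mul k -> cls_mul k.+1.
Proof.
move=> hk G F N hF hN; have [U cU dU] := cls_deriv hF; have [V cV dV] := cls_deriv hN.
have F1 := cls_fst (cls_le hF); have N1 := cls_fst (cls_le hN).
have LF := cls_Linf F1; have LN := cls_Linf N1.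
have c1 := hk _ _ _ F1 cV; have c2 := hk _ _ _ N1 cU.
apply: (cls_integr (hk _ _ _ (cls_le hF) (cls_le hN)) (cls_lin 1 c1 c2)).
apply: (cv_wder (H := fun z => F z.1 * N z.1)); first exact: LinfM.
have h1 := cvM (cv_cst LF) (wder_cv LN (cls_Linf cV) dV).
have h2 := cvM (cv_rotate LN) (cvM (cv_cst (Linf_cst _ 1)) (wder_cv LF (cls_Linf cU) dU)).
have := cvD h1 h2; set f := (X in cv X _); set f' := (X in _ -> cv X _).
set g := (X in cv f X); set g' := (X in _ -> cv _ X).
have -> : g' = g by apply/funext => z; rewrite /g /g'; ring.
have -> // : f' = f by apply/funext => t; apply/funext => z; rewrite /f /f'; ring.
Qed.

(** The quotient rule. The obstacle is that the derivative [V] of [N] must again vanish where [a] is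
    1 before the induction hypothesis applies to [V I]. *)
Lemma cls_quotS k : cls_mul k -> cls_quot k -> cls_quot k.+1.
Proof.
move=> hm hq G F N I a hF hN LI La FI aI Na.
have [U cU dU] := cls_deriv hF; have [V cV dV] := cls_deriv hN.
have F1 := cls_fst (cls_le hF); have N1 := cls_fst (cls_le hN).
have LF := cls_Linf F1; have LN := cls_Linf N1; have LV := cls_Linf cV; have LU := cls_Linf cU.
have LI1 := fst_Linf LI; have La1 := fst_Linf La.
have cQ := hq _ _ _ _ _ (cls_le hF) (cls_le hN) LI La FI aI Na; have cQ1 := cls_fst cQ.
have dN := wder_cv LN LV dV; have dF := wder_cv LF LU dU.
pose V' := fun z : gT (gsq G) => V z * (1 - a z.1).
have LaC : Linf (gP (gsq G)) (fun z => 1 - a z.1) by apply: LinfB => //; exact: Linf_cst.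
have aa x : a x * a x = a x.
  have := congr1 ( *%R (a x)) (FI x); rewrite mulrCA aI mulr0 mulrBr mulr1 => /eqP.
  by rewrite eq_sym subr_eq0 => /eqP.
(* a(R_t z) a(z) times the difference quotient of [N] is identically zero and converges to a V, so
   [V] may be replaced by [V']. *)
have aV : {ae gP (gsq G), forall z, V z = V' z}.
  have h := cvM (cvM (cv_rotate La1) (cv_cst La1)) dN.
  have e : (fun t z => a (rotate t z).1 * a z.1 * (t^-1 * (N (rotate t z).1 - N z.1))) = (fun _ => fun=> 0).
    apply/funext => t; apply/funext => z.
    have -> : a (rotate t z).1 * a z.1 * (t^-1 * (N (rotate t z).1 - N z.1)) =
      t^-1 * (a z.1 * (N (rotate t z).1 * a (rotate t z).1) - a (rotate t z).1 * (N z.1 * a z.1)) by ring.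
    by rewrite !Na !mulr0 subrr mulr0.
  rewrite e in h; have := cv_uniq h (cv_cst (Linf_cst _ 0)).
  by apply: filterS => z; rewrite aa /V' mulrBr mulr1 mulrC => ->; rewrite subr0.
have LV' : Linf (gP (gsq G)) V' by exact: LinfM.
have cV' : cls k (G := gsq G) V' by apply: cls_ae aV _ cV; exact: Linf_meas LV'.
have c1 : cls k (G := gsq G) (fun z => V' z * I z.1).
  apply: (hq (gsq G) (fun z => F z.1) V' (fun z => I z.1) (fun z => a z.1)) => // z.
  by rewrite /V' -mulrA mulrBl mul1r aa subrr mulr0.
have c2 : cls k (G := gsq G) (fun z => N z.1 * I z.1 * U z * I z.1).
  apply: (hq (gsq G) (fun z => F z.1) _ (fun z => I z.1) (fun z => a z.1)) => //; first exact: hm.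
  move=> z; have -> : N z.1 * I z.1 * U z * a z.1 = N z.1 * U z * (a z.1 * I z.1) by ring.
  by rewrite aI mulr0.
apply: (cls_integr cQ (cls_lin (-1) c1 c2)).
apply: (cv_wder (H := fun z => N z.1 * I z.1)); first exact: LinfM.
have rI := cv_rotate LI1; have ra := cv_rotate La1.
have h1 := cvM dN rI.
have h2 := cvM (cvM (cv_cst (LinfM (Linf_cst _ (-1)) (LinfM LN LI1))) rI) dF.
(* Where the rotated point lies in A, [I] vanishes and the identity F I = 1 fails; this third term
   repairs the quotient rule, and its limit a I V is zero. *)
have h3 := cvM (cvM ra (cv_cst LI1)) dN.
have := cvD h1 (cvD h2 h3); set f := (X in cv X _); set f' := (X in _ -> cv X _).
set g := (X in cv f X); set g' := (X in _ -> cv _ X).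
have -> : f' = f.
  apply/funext => t; apply/funext => z; rewrite /f /f'; set w := rotate t z.
  have e1 : N z.1 * I z.1 = N z.1 * I z.1 * (F w.1 * I w.1 + a w.1) by rewrite FI subrK mulr1.
  have e2 : N z.1 * (F z.1 * I z.1) = N z.1 by rewrite FI mulrBr Na subr0 mulr1.
  rewrite {1}e1.
  have -> : t^-1 * (N w.1 - N z.1) * I w.1 + (-1 * (N z.1 * I z.1) * I w.1 * (t^-1 * (F w.1 - F z.1)) +
      a w.1 * I z.1 * (t^-1 * (N w.1 - N z.1))) =
    t^-1 * (N w.1 * I w.1 - N z.1 * I w.1 - N z.1 * I z.1 * I w.1 * F w.1 +
      N z.1 * (F z.1 * I z.1) * I w.1 + I z.1 * (N w.1 * a w.1) - a w.1 * I z.1 * N z.1) by ring.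
  by rewrite e2 Na; ring.
move=> [Lg Lf hf]; have eg : {ae gP (gsq G), forall z, g z = g' z}.
  apply: filterS aV => z Vz; rewrite /g /g' Vz /V'.
  have -> : a z.1 * I z.1 * (V z * (1 - a z.1)) = V z * (1 - a z.1) * (a z.1 * I z.1) by ring.
  by rewrite aI mulr0 addr0; ring.
have Lg' : Linf (gP (gsq G)) g'.
  by apply: (cls_Linf (k := k)); exact: cls_lin c1 c2.
split=> // p p1 eps e0; have [d d0 hd] := hf p p1 eps e0; exists d => // t t0 td.
apply: le_trans (hd t t0 td); rewrite le_eqVlt; apply/orP; left; apply/eqP.
apply: (ae_nrm (f := fun z => f t z - g z) _ (LinfB (Lf t t0) Lg p1) _).2.
  by apply: filterS eg => z ->.
exact: Linf_meas (LinfB (Lf t t0) Lg').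
Qed.

Lemma cls_closed k : cls_mul 0 -> cls_quot 0 -> cls_mul k /\ cls_quot k.
Proof.
move=> m0 q0; elim: k => [//|k [IH1 IH2]]; split; first exact: cls_mulS.
exact: cls_quotS.
Qed.
End classes.

(** * Products and quotients in the Hoelder classes *)

Section hoelder_classes.
Context {R : realType} (G : gspace R).
Local Notation S := (gsq G).
Local Notation P := (gP G).
Local Notation Q := (gP S).
Implicit Types (f g : R -> gT S -> R) (H : gT S -> R) (F N : gT G -> R) (p s th : R).

(** O(|th|^s) in every L^p, for p >= 2, with a constant depending on p: an ideal over the bounded
    families [bd]. *)
Definition sm s f := (forall th, Linf Q (f th)) /\
  forall p, 2 <= p -> exists2 M : R, 0 <= M & forall th, nrm Q p (f th) <= M * `|th| `^ s.
Definition bd f := (forall th, Linf Q (f th)) /\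
  forall p, 1 <= p -> exists2 M : R, 0 <= M & forall th, nrm Q p (f th) <= M.
Definition rot_hoelder s F := sm s (fun th z => F (rotate th z).1 - F z.1).

Lemma bd_rot H : Linf Q H -> bd (fun th z => H (rotate th z)).
Proof.
move=> LH; split=> [th|p p1]; first exact: Linf_rotate.
by exists (nrm Q p H) => [|th]; [exact: nrm_ge0|rewrite (rotate_nrm th (LH p p1)).2].
Qed.

Lemma bd_cst H : Linf Q H -> bd (fun _ => H).
Proof. by move=> LH; split=> // p p1; exists (nrm Q p H) => // ; exact: nrm_ge0. Qed.

Lemma bdM f g : bd f -> bd g -> bd (fun th z => f th z * g th z).
Proof.
move=> [Lf hf] [Lg hg]; split=> [th|p p1]; first exact: LinfM.
have p2 : 1 <= 2 * p by lra.
have [M M0 hM] := hf _ p2; have [M' M'0 hM'] := hg _ p2.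
exists (M * M') => [|th]; first exact: mulr_ge0.
by apply: (le_trans (nrmM2 p1 (Lf th _ p2) (Lg th _ p2)).2); apply: ler_pM; rewrite ?nrm_ge0.
Qed.

Lemma smD s f g : sm s f -> sm s g -> sm s (fun th z => f th z + g th z).
Proof.
move=> [Lf hf] [Lg hg]; split=> [th|p p2]; first exact: LinfD.
have p1 : 1 <= p by lra.
have [M M0 hM] := hf _ p2; have [M' M'0 hM'] := hg _ p2.
exists (M + M') => [|th]; first exact: addr_ge0.
by apply: (le_trans (nrmD p1 (Lf th _ p1) (Lg th _ p1)).2); rewrite mulrDl lerD.
Qed.

Lemma smM s f g : bd f -> sm s g -> sm s (fun th z => f th z * g th z).
Proof.
move=> [Lf hf] [Lg hg]; split=> [th|p p2]; first exact: LinfM.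
have p1 : 1 <= p by [lra]; have q1 : 1 <= 2 * p by [lra]; have q2 : 2 <= 2 * p by lra.
have [M M0 hM] := hf _ q1; have [M' M'0 hM'] := hg _ q2.
exists (M * M') => [|th]; first exact: mulr_ge0.
apply: (le_trans (nrmM2 p1 (Lf th _ q1) (Lg th _ q1)).2); rewrite -mulrA.
by apply: ler_pM; rewrite ?nrm_ge0.
Qed.

Lemma sm_ext s f g : sm s f -> (forall th z, g th z = f th z) -> sm s g.
Proof. by move=> h e; have -> : g = f by apply/funext => t; apply/funext => x. Qed.

Lemma hol_mul s F N : Linf P F -> Linf P N -> rot_hoelder s F -> rot_hoelder s N -> rot_hoelder s (fun x => F x * N x).
Proof.
move=> LF LN hF hN; have LF1 := fst_Linf LF; have LN1 := fst_Linf LN.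
apply: (sm_ext (smD (smM (bd_rot LN1) hF) (smM (bd_cst LF1) hN))) => th z; ring.
Qed.

(** The same three-term identity as for the derivative of a quotient, now for increments and without
    division by the angle. *)
Lemma hol_quot s F N (I a : gT G -> R) : Linf P F -> Linf P N -> Linf P I -> Linf P a ->
  (forall x, F x * I x = 1 - a x) -> (forall x, N x * a x = 0) ->
  rot_hoelder s F -> rot_hoelder s N -> rot_hoelder s (fun x => N x * I x).
Proof.
move=> LF LN LI La FI Na hF hN.
have LF1 := fst_Linf LF; have LN1 := fst_Linf LN; have LI1 := fst_Linf LI; have La1 := fst_Linf La.
have bI := bd_rot LI1; have ba := bd_rot La1.
have b1 := bdM (bd_cst (LinfM (Linf_cst _ (-1)) (LinfM LN1 LI1))) bI.
have b2 := bdM ba (bd_cst LI1).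
apply: (sm_ext (smD (smM bI hN) (smD (smM b1 hF) (smM b2 hN)))) => th z; set w := rotate th z.
have e1 : N z.1 * I z.1 = N z.1 * I z.1 * (F w.1 * I w.1 + a w.1) by rewrite FI subrK mulr1.
have e2 : N z.1 * (F z.1 * I z.1) = N z.1 by rewrite FI mulrBr Na subr0 mulr1.
rewrite {1}e1.
have -> : I w.1 * (N w.1 - N z.1) + (-1 * (N z.1 * I z.1) * I w.1 * (F w.1 - F z.1) +
      a w.1 * I z.1 * (N w.1 - N z.1)) =
    N w.1 * I w.1 - N z.1 * I w.1 - N z.1 * I z.1 * I w.1 * F w.1 +
      N z.1 * (F z.1 * I z.1) * I w.1 + I z.1 * (N w.1 * a w.1) - a w.1 * I z.1 * N z.1 by ring.
by rewrite e2 Na; ring.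
Qed.

Lemma jm_gt0 (a : R) n : 0 < jm a n.
Proof. by rewrite /jm powR_gt0. Qed.

Lemma Dsp_all_p (r : R) F : Linf P F -> (forall p, 2 <= p -> exists V, memL P p V /\ pot r V F) -> Dsp r F.
Proof.
move=> LF h; split=> //.
have [p p2|V [LV hV]] := @Linf_sym R G (fun l => (jm r l.1)^-1 * sym F l).
  by have [V [mV hV]] := h p p2; exists V; split=> // l; rewrite hV mulKf// gt_eqF// jm_gt0.
by exists V; split=> // l; rewrite hV mulVKf// gt_eqF// jm_gt0.
Qed.

Lemma hol_Dsp s r F : 0 < r -> r < s -> s <= 1 -> Linf P F -> rot_hoelder s F -> Dsp r F.
Proof.
move=> r0 rs s1 LF [_ hF]; apply: Dsp_all_p => // p p2; have [M M0 hM] := hF p p2.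
by apply: pot_of_hold r0 rs s1 M0 hM => //; apply: LF; lra.
Qed.

Lemma Dsp_hol s r F : 0 < r -> r < s -> r <= 1 -> Dsp s F -> rot_hoelder r F.
Proof.
move=> r0 rs r1 [LF [V [LV pV]]]; have LF1 := fst_Linf LF; split=> [th|p p2].
  by apply: LinfB => //; exact: (Linf_rotate th LF1).
have p1 : 1 <= p by lra.
have [C C0 hC] := hold_of_pot G p2 r0 rs r1; exists (C * nrm P p V) => [|th].
  by rewrite mulr_ge0// nrm_ge0.
by apply: hC pV th; [exact: LV|exact: LF].
Qed.
End hoelder_classes.

Section base_classes.
Context {R : realType}.

Definition zeroB (r : R) := r = 0.
Definition ltB (sigma : R) (r : R) := 0 <= r /\ r < sigma.

Lemma zero_mul : cls_mul zeroB 0.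
Proof.
move=> G F N hF hN r ->; rewrite addr0; apply: Dsp0; apply: LinfM.
  by have [] := hF 0 erefl.
by have [] := hN 0 erefl.
Qed.

Lemma zero_quot : cls_quot zeroB 0.
Proof.
move=> G F N I a hF hN LI La _ _ _ r ->; rewrite addr0; apply: Dsp0; apply: LinfM => //.
by have [] := hN 0 erefl.
Qed.

(** Each passage between potentials and Hoelder bounds loses a little of the order; since all orders
    below [sigma] are allowed, a midpoint absorbs the loss. *)
Lemma lt_cls0 (sigma : R) (G : gspace R) (F : gT G -> R) : 0 < sigma -> sigma <= 1 ->
  cls (ltB sigma) 0 F <-> Linf (gP G) F /\ forall s, 0 < s -> s < sigma -> rot_hoelder s F.
Proof.
move=> s0 s1; split=> [h|[LF h] r [r0 r1]].
  split=> [|s h0 h1]; first by have [] := h 0 (conj (lexx 0) s0).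
  apply: (@Dsp_hol _ _ ((s + sigma) / 2)) => //; try lra.
  by have := h ((s + sigma) / 2); rewrite addr0; apply; split; lra.
rewrite addr0; move: r0; rewrite le_eqVlt => /predU1P[<-|r0]; first exact: Dsp0.
apply: (@hol_Dsp _ _ ((r + sigma) / 2)) => //; try lra.
by apply: h; lra.
Qed.

Lemma lt_mul (sigma : R) : 0 < sigma -> sigma <= 1 -> cls_mul (ltB sigma) 0.
Proof.
move=> s0 s1 G F N /(lt_cls0 _ s0 s1)[LF hF] /(lt_cls0 _ s0 s1)[LN hN]; apply/(lt_cls0 _ s0 s1).
by split=> [|s h0 h1]; [exact: LinfM|apply: hol_mul => //; [exact: hF|exact: hN]].
Qed.

Lemma lt_quot (sigma : R) : 0 < sigma -> sigma <= 1 -> cls_quot (ltB sigma) 0.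
Proof.
move=> s0 s1 G F N I a /(lt_cls0 _ s0 s1)[LF hF] /(lt_cls0 _ s0 s1)[LN hN] LI La FI aI Na.
apply/(lt_cls0 _ s0 s1); split=> [|s h0 h1]; first exact: LinfM.
by apply: (hol_quot LF LN LI La FI Na); [exact: hF|exact: hN].
Qed.

Lemma Dsp_quot (k : nat) (G : gspace R) (F N I a : gT G -> R) : Dsp k%:R F -> Dsp k%:R N ->
  Linf (gP G) I -> Linf (gP G) a -> (forall x, F x * I x = 1 - a x) -> (forall x, a x * I x = 0) ->
  (forall x, N x * a x = 0) -> Dsp k%:R (fun x => N x * I x).
Proof.
have B0 : zeroB (0 : R) by [].
have Bge (r : R) : zeroB r -> 0 <= r by move=> ->.
have [_ h] := cls_closed B0 Bge k zero_mul zero_quot => hF hN LI La FI aI Na.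
have := h G F N I a _ _ LI La FI aI Na 0 erefl; rewrite add0r; apply=> r ->; by rewrite add0r.
Qed.

Lemma Dsp_quot_lt (k : nat) (sigma : R) (G : gspace R) (F N I a : gT G -> R) : 0 < sigma -> sigma <= 1 ->
  (forall r, 0 <= r -> r < sigma -> Dsp (r + k%:R) F) -> (forall r, 0 <= r -> r < sigma -> Dsp (r + k%:R) N) ->
  Linf (gP G) I -> Linf (gP G) a -> (forall x, F x * I x = 1 - a x) -> (forall x, a x * I x = 0) ->
  (forall x, N x * a x = 0) -> forall r, 0 <= r -> r < sigma -> Dsp (r + k%:R) (fun x => N x * I x).
Proof.
move=> s0 s1; have B0 : ltB sigma (0 : R) by [].
have Bge (r : R) : ltB sigma r -> 0 <= r by case.
have [_ h] := cls_closed B0 Bge k (lt_mul s0 s1) (lt_quot s0 s1) => hF hN LI La FI aI Na r r0 r1.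
by apply: (h G F N I a _ _ LI La FI aI Na r (conj r0 r1)) => t [t0 t1]; [exact: hF|exact: hN].
Qed.
End base_classes.

(** * The Gaussian space of an abstract Wiener space *)

Section hahn_banach.
Context {R : realType} {V : normedModType R}.
Implicit Types (q : V -> R) (x y : V).

Definition sublinear q := (forall x y, q (x + y) <= q x + q y) /\
  forall (t : R) x, 0 < t -> q (t *: x) <= t * q x.

Lemma sublinear0 q : sublinear q -> q 0 = 0.
Proof.
move=> [_ h]; have := h 2 0 (ltr0n R 2); rewrite scaler0 => h1.
have h2' : (0 : R) < 2^-1 by rewrite invr_gt0.
have := h 2^-1 0 h2'; rewrite scaler0 => h2; lra.
Qed.

Lemma sublinearZ q (t : R) x : sublinear q -> 0 <= t -> q (t *: x) = t * q x.
Proof.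
move=> sq; rewrite le_eqVlt => /predU1P[<-|t0]; first by rewrite scale0r mul0r sublinear0.
apply/eqP; rewrite eq_le; have [_ h] := sq; rewrite h//=.
have ti : 0 < t^-1 by rewrite invr_gt0.
have := h t^-1 (t *: x) ti; rewrite scalerA mulVf ?gt_eqF// scale1r => h1.
by rewrite -ler_pdivlMl.
Qed.

Lemma sublinear_ge q x : sublinear q -> - q (- x) <= q x.
Proof. by move=> sq; have := sq.1 x (- x); rewrite subrr sublinear0//; lra. Qed.

(* A minimal sublinear functional is linear: it equals each of the smaller
   sublinear functionals [x |-> inf_t q (x + t y) - t q y]. *)
Lemma sublinear_step q y : sublinear q -> exists r, [/\ sublinear r, forall x, r x <= q x &
  forall x, r x <= q (x + y) - q y].
Proof.
move=> sq; pose A x := [set q (x + t *: y) - t * q y | t in [set t : R | 0 <= t]].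
have An x : A x !=set0 by exists (q (x + 0 *: y) - 0 * q y), 0 => //=.
have Alb x : lbound (A x) (- q (- x)).
  move=> _ [t /= t0 <-]; rewrite -(sublinearZ y sq t0).
  have := sq.1 (x + t *: y) (- x); rewrite addrC addKr; lra.
have Ab x : has_lbound (A x) by exists (- q (- x)).
have Ale x t : 0 <= t -> inf (A x) <= q (x + t *: y) - t * q y.
  by move=> t0; apply: ge_inf => //; exists t.
exists (fun x => inf (A x)); split=> [|x|x].
- split=> [x x'|t x t0].
    rewrite -lerBlDr; apply: lb_le_inf => // _ [t /= t0 <-].
    rewrite lerBlDr -lerBlDl; apply: lb_le_inf => // _ [t' /= t'0 <-].
    have := Ale (x + x') (t + t') (addr_ge0 t0 t'0).
    have := sq.1 (x + t *: y) (x' + t' *: y).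
    by rewrite addrACA -scalerDl mulrDl; lra.
  rewrite -ler_pdivrMl//; apply: lb_le_inf => // _ [s /= s0 <-].
  rewrite ler_pdivrMl//; apply: (le_trans (Ale _ (t * s) (mulr_ge0 (ltW t0) s0))).
  by rewrite mulrBr mulrA lerB// -scalerA -scalerDr; exact: sq.2.
- by have := Ale x 0 (lexx 0); rewrite scale0r addr0 mul0r subr0.
- by have := Ale x 1 ler01; rewrite scale1r mul1r.
Qed.

Lemma minimal_linear q : sublinear q ->
  (forall r, sublinear r -> (forall x, r x <= q x) -> forall x, q x <= r x) -> linear_for *%R q.
Proof.
move=> sq mq; have qD x y : q (x + y) = q x + q y.
  apply/eqP; rewrite eq_le sq.1/=; have [r [sr rq rq2]] := sublinear_step y sq.
  by have := mq r sr rq x; have := rq2 x; lra.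
have qN x : q (- x) = - q x by have := qD x (- x); rewrite subrr sublinear0//; lra.
move=> a x y; rewrite qD; congr (_ + _).
have [a0|a0] := leP 0 a; first exact: sublinearZ.
have : q (- a *: x) = - a * q x by apply: sublinearZ => //; lra.
by rewrite scaleNr qN mulNr => /oppr_inj.
Qed.

Definition minorant (p : V -> R) := {q : V -> R | sublinear q /\ forall x, q x <= p x}.

(** Zorn's lemma on the sublinear minorants, ordered downwards. The pointwise infimum of a chain is
    again sublinear, and is bounded below by - p(- x). *)
Lemma linear_minorant (p : V -> R) : sublinear p -> exists q, linear_for *%R q /\ forall x, q x <= p x.
Proof.
move=> sp; pose rl (a b : minorant p) : bool := `[< forall x, sval b x <= sval a x >].
have [||||[q [sq qp]] mq] := @Zorn (minorant p) rl.
- by move=> a; apply/asboolP.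
- by move=> a b c /asboolP h1 /asboolP h2; apply/asboolP => x; exact: le_trans (h2 x) (h1 x).
- move=> [a ha] [b hb] /asboolP h1 /asboolP h2; apply: eq_exist; apply/funext => x.
  by apply/eqP; rewrite eq_le; apply/andP; split; [exact: h2|exact: h1].
- move=> A tot; have [[a0 Aa0]|An] := pselect (exists a, A a); last first.
    exists (exist _ p (conj sp (fun x => lexx _))) => s As; exfalso; apply: An; by exists s.
  pose S x := [set sval a x | a in A].
  have Sn x : S x !=set0 by exists (sval a0 x), a0.
  have Sb x : has_lbound (S x).
    exists (- p (- x)) => _ [a _ <-]; have [sa ap] := svalP a.
    by have := sublinear_ge x sa; have := ap (- x); lra.
  have Sle x a : A a -> inf (S x) <= sval a x by move=> Aa; apply: ge_inf => //; exists a.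
  have sg : sublinear (fun x => inf (S x)).
    split=> [x y|t x t0].
      rewrite -lerBlDr; apply: lb_le_inf => // _ [a Aa <-].
      rewrite lerBlDr -lerBlDl; apply: lb_le_inf => // _ [b Ab <-]; rewrite lerBlDl.
      have [sa _] := svalP a; have [sb _] := svalP b.
      have [] := tot a b Aa Ab => /asboolP h.
        by apply: (le_trans (Sle _ b Ab)); apply: (le_trans (sb.1 _ _)); rewrite lerD2r h.
      by apply: (le_trans (Sle _ a Aa)); apply: (le_trans (sa.1 _ _)); rewrite lerD2l h.
    rewrite -ler_pdivrMl//; apply: lb_le_inf => // _ [a Aa <-]; rewrite ler_pdivrMl//.
    by apply: (le_trans (Sle _ a Aa)); have [sa _] := svalP a; exact: sa.2.
  have gp x : inf (S x) <= p x.
    by apply: (le_trans (Sle x a0 Aa0)); have [_] := svalP a0; apply.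
  by exists (exist _ (fun x => inf (S x)) (conj sg gp)) => a Aa; apply/asboolP => x; exact: Sle.
exists q; split=> //; apply: minimal_linear => // r sr rq x.
have rp y : r y <= p y by exact: le_trans (rq y) (qp y).
have := mq (exist _ r (conj sr rp)) ltac:(by apply/asboolP => y; exact: rq).
by move=> /(congr1 sval)/= <-.
Qed.

(** [sublinear_step] applied to the norm at [x0] yields a sublinear functional whose value at - x0
    is at most - |x0|; every linear minorant of it then attains the norm at [x0]. *)
Lemma norming_functional (x0 : V) : exists l : {scalar V},
  (forall x, `|l x| <= `|x|) /\ l x0 = `|x0|.
Proof.
have sn : sublinear (fun x => `|x|).
  by split=> [x y|t x t0]; [exact: ler_normD|rewrite normrZ gtr0_norm].
have [r [sr rn rx]] := sublinear_step x0 sn.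
have [q [lq qr]] := linear_minorant sr.
pose l : {scalar V} := HB.pack q (GRing.isLinear.Build R V R *%R q lq).
have lb x : `|l x| <= `|x|.
  rewrite ler_norml; have h y : l y <= `|y| by exact: le_trans (qr y) (rn y).
  by have := h (- x); rewrite linearN normrN h andbT; lra.
exists l; split=> //; apply/eqP; rewrite eq_le; apply/andP; split.
  by apply: le_trans (lb x0); exact: ler_norm.
by have := le_trans (qr (- x0)) (rx (- x0)); rewrite addNr normr0 sub0r -[q _]/(l _) linearN lerN2.
Qed.

Lemma norm1_continuous (l : {scalar V}) (C : R) : (forall x, `|l x| <= C * `|x|) -> continuous (l : V -> R).
Proof.
move=> h; apply/linear_bounded_continuous/linear_boundedP; near=> r => x.
apply: le_trans (h x) _; apply: ler_wpM2r => //; near: r; exact: nbhs_pinfty_ge.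
Unshelve. all: by end_near.
Qed.
End hahn_banach.

Section normed_space.
Context {R : realType} {V : normedModType R}.

Lemma half_small (eps : R) : 0 < eps -> exists n, 2^-1 ^+ n < eps.
Proof.
move=> e0; exists (Num.truncn eps^-1).+1; rewrite exprVn -[ltRHS]invrK ltf_pV2 ?posrE ?invr_gt0 ?exprn_gt0//.
apply: (lt_trans (truncnS_gt _)); rewrite -natrX ltr_nat; exact: ltn_expl.
Qed.

Lemma dense_seq : separable V -> exists e : nat -> V, forall x (eps : R), 0 < eps -> exists n, `|x - e n| < eps.
Proof.
move=> [A [/countable_injP [f finj] dA]].
have /choice [e he] n : exists y : V, forall x, A x -> f x = n -> x = y.
  have [[x [Ax fx]]|h] := pselect (exists x, A x /\ f x = n).
    by exists x => x' Ax' fx'; apply: finj; rewrite ?inE// fx'.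
  by exists 0 => x Ax fx; exfalso; apply: h; exists x.
exists e => x eps e0; have [|y [By Ay]] := dA (ball x eps) _ (ball_open x eps).
  by exists x; exact: ballxx.
by exists (f y); rewrite -(he _ y Ay erefl); move: By; rewrite -ball_normE.
Qed.

Definition slin (a : R) (l : {scalar V}) (b : R) (l' : {scalar V}) : V -> R := fun x => a * l x + b * l' x.
Lemma slin_linear a l b l' : linear_for *%R (slin a l b l').
Proof. by move=> c x y; rewrite /slin !linearP /=; ring. Qed.
HB.instance Definition _ a l b l' := GRing.isLinear.Build R V R *%R (slin a l b l') (slin_linear a l b l').

Lemma slin_continuous a (l : {scalar V}) b (l' : {scalar V}) :
  continuous (l : V -> R) -> continuous (l' : V -> R) -> continuous (slin a l b l').
Proof.
move=> cl cl' x; apply: cvgD; (apply: cvgM; first exact: cvg_cst); [exact: cl|exact: cl'].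
Qed.

Lemma scalar_bounded (l : {scalar V}) : continuous (l : V -> R) ->
  exists2 C : R, 0 < C & forall x, `|l x| <= C * `|x|.
Proof.
move=> /linear_bounded_continuous /linear_boundedP [M [_ hM]]; exists (Num.max 1 (M + 1)).
  by rewrite lt_max ltr01.
by apply: hM; rewrite lt_max ltrDl ltr01 orbT.
Qed.
End normed_space.

Section generation.
Context {R : realType} {V : completeNormedModType R}.
Variable S : set (set V).
Hypothesis hS : sigma_algebra setT S.

Let SC A : S A -> S (~` A). Proof. by move=> SA; rewrite -setTD; have [_ h _] := hS; exact: h. Qed.
Let SI (A : nat -> set V) : (forall n, S (A n)) -> S (\bigcap_n A n).
Proof.
move=> h; rewrite -[X in S X]setCK setC_bigcap; apply: SC; have [_ _ hU] := hS; apply: hU => n; exact: SC.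
Qed.

(** With functionals norming a dense sequence, a closed ball is a countable intersection of
    half-spaces, and an open set is a countable union of such balls. *)
Lemma scalar_generation : separable V ->
  (forall (l : {scalar V}) (c : R), continuous (l : V -> R) -> S [set x | l x < c]) ->
  <<s @open V >> `<=` S.
Proof.
move=> sV hl; apply: smallest_sub => // U oU; have [e he] := dense_seq sV.
have /choice [l hL] n := norming_functional (e n).
have cl n : continuous (l n : V -> R) by apply: (@norm1_continuous _ _ _ 1) => x; rewrite mul1r; exact: (hL n).1.
have S_le n c : S [set x | l n x <= c].
  rewrite (_ : [set x | l n x <= c] = \bigcap_k [set x | l n x < c + k.+1%:R^-1]).
    by apply: SI => k; exact: hl.
  apply/seteqP; split=> x /= h => [k _|]; first by rewrite /= (le_lt_trans h)// ltrDl invr_gt0.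
  apply/ler_addgt0Pr => eps e0; have := h (Num.truncn eps^-1) Logic.I; rewrite /= => /ltW /le_trans; apply.
  rewrite lerD2l -[leRHS]invrK lef_pV2 ?posrE ?invr_gt0//; exact/ltW/truncnS_gt.
have S_ball a r : S [set x | `|x - a| <= r].
  rewrite (_ : [set x | `|x - a| <= r] = \bigcap_n [set x | l n x <= r + l n a]); first by apply: SI => n.
  apply/seteqP; split=> x /= h => [n _ /=|].
    rewrite -lerBlDr -linearB; apply: le_trans h; apply: le_trans ((hL n).1 _); exact: ler_norm.
  apply/ler_addgt0Pr => eps e0; have [n hn] := he (x - a) (eps / 2) ltac:(by rewrite divr_gt0).
  have h1 := h n Logic.I; rewrite /= -lerBlDr -linearB in h1.
  have h2 : `|e n| <= l n (x - a) + `|x - a - e n|.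
    rewrite -(hL n).2 -lerBlDl -linearB distrC; apply: le_trans ((hL n).1 _); exact: ler_norm.
  have := ler_normD (x - a - e n) (e n); rewrite subrK; lra.
pose r (m : nat) : R := m.+1%:R^-1.
pose A n m := if `[< [set x | `|x - e n| <= r m] `<=` U >] then [set x | `|x - e n| <= r m] else set0.
rewrite (_ : U = \bigcup_n \bigcup_m A n m).
  have [h0 _ hU] := hS; apply: (hU) => n; apply: (hU) => m; rewrite /A; case: ifP => // _; exact: S_ball.
apply/seteqP; split=> x /= h; last first.
  by move: h => [n _ [m _]]; rewrite /A; case: asboolP => // h; exact: h.
have : nbhs x U by exact: open_nbhs_nbhs.
move=> /nbhs_ballP [eps /= e0 hb]; have h2 : 0 < eps / 2 by rewrite divr_gt0.
pose m := Num.truncn (eps / 2)^-1.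
have rm : r m < eps / 2 by rewrite /r -[ltRHS]invrK ltf_pV2 ?posrE ?invr_gt0//; exact: truncnS_gt.
have rm0 : 0 < r m by rewrite invr_gt0.
have [n hn] := he x (r m) rm0; exists n => //; exists m => //; rewrite /A; case: asboolP => [_|]; first exact/ltW.
case=> y /= hy; apply: hb; rewrite -ball_normE /=; have := ler_normD (x - e n) (e n - y).
rewrite addrA subrK [`|e n - y|]distrC; lra.
Qed.
End generation.

(** * Riesz representatives and the Gaussian structure *)

Section wiener_gspace.
Context {R : realType} (W : abstractWienerSpace R).
Local Notation B := (wB W).
Local Notation H := (wH W).
Local Notation dot := (wdot W).
Implicit Types (u v w h : H).

Lemma dotC u v : dot u v = dot v u.
Proof. by rewrite hermC /= expr0 mul1r. Qed.

Lemma dotDl u (a : R) v w : dot (u + a *: v) w = dot u w + a * dot v w.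
Proof. by rewrite linearDl linearZl_LR. Qed.

Lemma dot_ge0 u : 0 <= dot u u. Proof. by rewrite wdotE sqr_ge0. Qed.

Lemma dot_cs u v : `|dot u v| <= `|u| * `|v|.
Proof.
rewrite -(@ler_sqr R) ?nnegrE ?mulr_ge0// real_normK ?num_real// exprMn -!wdotE.
apply: discr_le => [|t]; first exact: dot_ge0.
have := dot_ge0 (u + t *: v); rewrite dotDl dotC dotDl [dot v (_ + _)]dotC dotDl [dot v u]dotC.
by move=> h; apply: le_trans h _; rewrite le_eqVlt; apply/orP; left; apply/eqP; ring.
Qed.

(** The almost minimisers of [riesz_seq] are Cauchy in H, and completeness provides the
    representative. *)
Lemma dot_riesz (l : {scalar B}) : continuous (l : B -> R) -> exists h, forall k, l (wi W k) = dot h k.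
Proof.
move=> cl; have [C C0 hC] := scalar_bounded cl.
have lin0 : linear_for *%R (fun k => l (wi W k)).
  by move=> a x y; rewrite linearP linearD linearZ.
pose m : {scalar H} := HB.pack (fun k => l (wi W k)) (GRing.isLinear.Build R H R *%R _ lin0).
have cm : continuous (m : H -> R) by move=> x; apply: continuous_comp; [exact: wi_continuous|exact: cl].
have [D D0 hD] := scalar_bounded cm.
have [v hv] := @riesz_seq R H 0 (fun u a v => u + a *: v) dot m (D ^+ 2) (sqr_ge0 D) dotC dot_ge0 dotDl
   ltac:(by move=> u a v; rewrite linearD linearZ)
   ltac:(by move=> u; rewrite wdotE -exprMn -[leLHS]real_normK ?num_real// ler_sqr ?nnegrE ?mulr_ge0 ?(ltW D0)).
have hv' n w : `|dot (v n) w - m w| <= 2^-1 ^+ n * `|w|.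
  rewrite -(@ler_sqr R) ?nnegrE ?mulr_ge0 ?exprn_ge0 ?invr_ge0// real_normK ?num_real// exprMn -wdotE.
  apply: le_trans (hv n w) _; rewrite exprAC (_ : 2^-1 ^+ 2 = 4^-1)//; by field.
have vv n k : `|v n - v k| <= 2^-1 ^+ n + 2^-1 ^+ k.
  set w := v n - v k; have [->|w0] := eqVneq w 0; first by rewrite normr0 addr_ge0 ?exprn_ge0 ?invr_ge0.
  rewrite -(ler_pM2r (x := `|w|)) ?normr_gt0// -expr2 -wdotE {1}/w -scaleN1r dotDl mulrDl.
  have := ler_normB (dot (v n) w - m w) (dot (v k) w - m w); have := hv' n w; have := hv' k w.
  have := ler_norm (dot (v n) w - m w - (dot (v k) w - m w)); lra.
have cv : cvg (v @ \oo).
  apply/cauchy_cvgP/cauchy_exP => eps e0; have [N hN] := half_small (divr_gt0 e0 (ltr0n R 2)).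
  exists (v N); exists N => // n /= Nn; rewrite -ball_normE /=; apply: le_lt_trans (vv N n) _.
  have : 2^-1 ^+ n <= 2^-1 ^+ N :> R by apply: ler_wiXn2l; rewrite ?invr_ge0// invf_le1// ler1n.
  lra.
exists (lim (v @ \oo)) => k; set h := lim _; apply/esym/eqP; rewrite -subr_eq0 -normr_eq0 eq_le normr_ge0 andbT.
apply/ler_addgt0Pr => eps e0; rewrite add0r.
pose e := eps / (2 * (`|k| + 1)); have k1 : 0 < `|k| + 1 by rewrite ltr_wpDl.
have ee : 0 < e by rewrite divr_gt0// mulr_gt0.
have ek : e * `|k| <= eps / 2.
  rewrite /e invfM mulrA -[leRHS]mulr1 -mulrA; apply: ler_wpM2l; first by rewrite divr_ge0// ltW.
  by rewrite mulrC ler_pdivrMr// mul1r lerDl.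
have /cvgrPdist_lt /(_ _ ee) [N1 _ h1] := cv; have [N2 h2] := half_small ee.
pose n := maxn N1 N2.
have a1 : `|h - v n| < e by apply: h1; rewrite /= leq_maxl.
have a2 : 2^-1 ^+ n < e.
  by apply: le_lt_trans h2; apply: ler_wiXn2l; rewrite ?leq_maxr// ?invr_ge0// invf_le1// ler1n.
have -> : dot h k - l (wi W k) = dot (h - v n) k + (dot (v n) k - m k).
  by rewrite -[- v n]scaleN1r dotDl mulN1r addrA subrK.
apply: le_trans (ler_normD _ _) _.
have b1 := le_trans (dot_cs (h - v n) k) (ler_wpM2r (normr_ge0 k) (ltW a1)).
have b2 := le_trans (hv' n k) (ler_wpM2r (normr_ge0 k) (ltW a2)).
lra.
Qed.

Definition dualB := {l : {scalar B} | continuous (l : B -> R)}.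
Definition wX (l : dualB) : wspace W -> R := sval l.

Lemma dualB_rep_ex : exists r : dualB -> H, forall l k, wX l (wi W k) = dot (r l) k.
Proof.
have h (l : dualB) : exists h, forall k, wX l (wi W k) = dot h k by case: l => l cl; exact: dot_riesz.
by have [r hr] := choice h; exists r.
Qed.
(** The image of a functional under the adjoint of the inclusion of H into B; its inner products are
    the covariances. *)
Definition wrep : dualB -> H := sval (cid dualB_rep_ex).
Lemma wrepE l k : wX l (wi W k) = dot (wrep l) k.
Proof. exact: (svalP (cid dualB_rep_ex)). Qed.

Definition wlin (a : R) (l : dualB) (b : R) (l' : dualB) : dualB :=
  exist _ (slin a (sval l) b (sval l') : {scalar B}) (@slin_continuous _ _ a _ b _ (svalP l) (svalP l')).
Definition wmix (a : R) (x : wspace W) (b : R) (y : wspace W) : wspace W := (a *: (x : B) + b *: (y : B) : B).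
Definition wcov (l l' : dualB) : R := dot (wrep l) (wrep l').

Lemma scalar0_continuous : continuous ((\0 : {scalar B}) : B -> R).
Proof. exact: cst_continuous. Qed.
Definition w0 : dualB := exist _ (\0 : {scalar B}) scalar0_continuous.

Lemma wX_meas l : measurable_fun setT (wX l).
Proof.
apply: (measurability _ (RGenOInfty.measurableE R)) => _ [_ [c ->] <-]; rewrite setTI.
apply: sub_sigma_algebra; apply: open_comp; last exact: rray_open.
by move=> x _; exact: (svalP l).
Qed.

Lemma w_lin a l b l' x : wX (wlin a l b l') x = a * wX l x + b * wX l' x. Proof. by []. Qed.
Lemma w_mix l a x b y : wX l (wmix a x b y) = a * wX l x + b * wX l y.
Proof. by rewrite /wX linearD !linearZ. Qed.
Lemma w_covC l l' : wcov l l' = wcov l' l. Proof. exact: dotC. Qed.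
Lemma w_covDl a l b l' k : wcov (wlin a l b l') k = a * wcov l k + b * wcov l' k.
Proof. by rewrite /wcov -!wrepE w_lin. Qed.

Lemma w_sep (x y : wspace W) : (forall l, wX l x = wX l y) -> x = y.
Proof.
move=> h; have [l [lb lx]] := norming_functional ((x : B) - y).
have cl : continuous (l : B -> R) by apply: (@norm1_continuous _ _ _ 1) => z; rewrite mul1r.
apply/eqP; rewrite -subr_eq0 -normr_eq0 -lx linearB subr_eq0.
by apply/eqP; exact: (h (exist _ l cl)).
Qed.

Lemma w_gen (S : set (set (wspace W))) : sigma_algebra setT S ->
  (forall l c, S [set x | wX l x < c]) -> measurable `<=` S.
Proof.
move=> hS h; apply: (scalar_generation hS (wB_separable W)) => l c cl; exact: (h (exist _ l cl)).
Qed.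

Lemma w_char l (t : R) : Ex (wmu W) (fun x => cos (t * wX l x)) = expR (- (t ^+ 2 * wcov l l / 2)) /\
  Ex (wmu W) (fun x => sin (t * wX l x)) = 0.
Proof.
pose l' := wlin t l 0 l.
have r k : sval l' (wi W k) = dot (t *: wrep l) k.
  by rewrite -[LHS]/(wX l' (wi W k)) w_lin mul0r addr0 wrepE linearZl_LR.
have e x : t * wX l x = sval l' x by rewrite -[RHS]/(wX l' x) w_lin mul0r addr0.
have [h1 h2] := wmu_gauss (svalP l') r.
have n : `|t *: wrep l| ^+ 2 = t ^+ 2 * wcov l l.
  by rewrite normrZ exprMn real_normK ?num_real// /wcov wdotE.
split; [rewrite -n -h1|rewrite -h2]; by apply: eq_Ex => x; rewrite e.
Qed.

Definition gW : gspace R := @Gspace R _ (wspace W) (wmu W) dualB w0 wX wlin wmix wcov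
  w_lin w_mix w_covC w_covDl w_sep wX_meas w_gen (fun l t => (w_char l t).1) (fun l t => (w_char l t).2).
End wiener_gspace.

(** * The Malliavin gradient and the Sobolev spaces *)

Section cylinder.
Context {R : realType} (W : abstractWienerSpace R).
Local Notation B := (wB W).
Local Notation H := (wH W).
Local Notation dot := (wdot W).
Local Notation G := (gW W).
Local Notation S := (gsq G).
Local Notation P := (gP G).
Local Notation Q := (gP S).
Implicit Types (f g F : wspace W -> R) (h : H) (l : dualB W).

Lemma is_derive_scalar (l : {scalar B}) (x v : B) : continuous (l : B -> R) -> is_derive x v (l : B -> R) (l v).
Proof.
move=> cl; have D : differentiable (l : B -> R) x by exact: linear_differentiable.
apply: DeriveDef; first exact: diff_derivable.
by rewrite deriveE// diff_lin.
Qed.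

Lemma dotZl a (u v : H) : dot (a *: u) v = a * dot u v. Proof. by rewrite linearZl_LR. Qed.

(** For a cylinder polynomial, [cyl_U (x, y)] is the derivative of [f] at [x] in the random
    direction [y]. The last field recovers from it the component of the gradient along the
    representative of a functional. *)
Record cyl_data f := CylData {
  cyl_U : gT S -> R;
  cyl_d : B -> H -> R;
  cyl_Linf : Linf P f;
  cyl_jet : jet Q (fun t z => f (rotate t z).1) (fun t z => cyl_U (rotate t z));
  cyl_der : forall x h, is_derive (x : B) (wi W h) (f : B -> R) (cyl_d x h);
  cyl_dL : forall h, Linf P (fun x => cyl_d x h);
  cyl_slice : forall x l, Linf P (fun y => cyl_U (x, y)) /\
    Ex P (fun y => cyl_U (x, y) * wX l y) = cyl_d x (wrep l)
}.

Lemma jet_lin (l : dualB W) : jet Q (fun t z => wX l (rotate t z).1) (fun t z => wX l (rotate t z).2).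
Proof.
have L1 := fst_Linf (@Linf_gX R G l); have L2 := snd_Linf (@Linf_gX R G l).
have J := jetD (jet_term (fun t => is_derive_cos t) L1) (jet_term (fun t => is_derive_sin t) L2).
by apply: (jet_ext J) => t z; rewrite /rotate /rot/= w_mix.
Qed.

Lemma cyl_ex f : cylinder_poly f -> inhabited (cyl_data f).
Proof.
elim=> [c|l cl|{}f g _ [[U d Lf Jf df dL sf]] _ [[U' d' Lg Jg dg dL' sg]]
  |{}f g _ [[U d Lf Jf df dL sf]] _ [[U' d' Lg Jg dg dL' sg]]]; constructor.
- apply: (@CylData _ (fun=> 0) (fun _ _ => 0)).
  + exact: Linf_cst.
  + by apply: jet_cst; exact: Linf_cst.
  + by move=> h; exact: Linf_cst.
  + move=> x l; split; first exact: Linf_cst.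
    by rewrite (eq_Ex P (g := fun=> 0)) ?Ex_cst// => y; rewrite mul0r.
- pose l' : dualB W := exist _ l cl.
  apply: (@CylData _ (fun z => wX l' z.2) (fun _ h => l (wi W h))).
  + exact: (@Linf_gX R G l').
  + exact: (jet_lin l').
  + by move=> x h; exact: is_derive_scalar.
  + by move=> h; exact: Linf_cst.
  + move=> x k; split; first exact: (@Linf_gX R G l').
    by rewrite (@Ex_gXX R G l' k); rewrite -[RHS]/(wX l' _) wrepE.
- apply: (@CylData _ (fun z => U z + U' z) (fun x h => d x h + d' x h)).
  + exact: LinfD.
  + exact: jetD.
  + by move=> h; exact: LinfD.
  + move=> x k; have [h1 h2] := sf x k; have [h3 h4] := sg x k; split; first exact: LinfD.
    have Lk := @Linf_gX R G k.
    rewrite -h2 -h4 -ExD; try by apply: Linf1; exact: LinfM.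
    by apply: eq_Ex => y; rewrite mulrDl.
- apply: (@CylData _ (fun z => U z * g z.1 + f z.1 * U' z) (fun x h => d x h * g x + f x * d' x h)).
  + exact: LinfM.
  + by apply: (jet_ext (jetM Jf Jg)) => t z.
  + move=> x h; have D := is_deriveM (df x h) (dg x h).
    apply: is_derive_eq; rewrite /GRing.scale/=; ring.
  + by move=> h; apply: LinfD; exact: LinfM.
  + move=> x k; have [h1 h2] := sf x k; have [h3 h4] := sg x k.
    have Lk := @Linf_gX R G k.
    split; first by apply: LinfD; [exact: (LinfM h1 (Linf_cst P (g x)))|exact: (LinfM (Linf_cst P (f x)) h3)].
    have m1 : memL P 1 (fun y => U (x, y) * wX k y) by apply: Linf1; exact: LinfM.
    have m2 : memL P 1 (fun y => U' (x, y) * wX k y) by apply: Linf1; exact: LinfM.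
    rewrite -h2 -h4 mulrC -(ExZ (g x) m1) -(ExZ (f x) m2) -ExD.
    * by apply: eq_Ex => y /=; ring.
    * exact: (nrmZ (g x) ltr01 m1).1.
    * exact: (nrmZ (f x) ltr01 m2).1.
Qed.

Lemma jet_wder f (U : gT S -> R) : Linf P f ->
  jet Q (fun t z => f (rotate t z).1) (fun t z => U (rotate t z)) -> wder (G := G) (fun z => f z.1) U.
Proof.
move=> Lf J l; have L1 := fst_Linf Lf; have La := Linf_ge l.
have D1 := jet_Ex (Linf2 La) J 0; have D2 := der_rotate [:: (1 : R, l)] 0 (Linf2 L1).
have e : (fun t : R => Ex Q (fun z => f (rotate t z).1 * fev ge [:: (1 : R, l)] z)) =
    (fun t => Ex Q (fun z => ge l z * f (rotate t z).1)).
  by apply/funext => t; apply: eq_Ex => z; rewrite /fev big_seq1 mul1r mulrC.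
rewrite e in D2; have := etrans (esym (derive_val (is_derive := D1))) (derive_val (is_derive := D2)).
move=> h; rewrite /sym (eq_Ex Q (g := fun z => ge l z * U (rotate 0 z))); last first.
  by move=> z; rewrite rotate0 mulrC.
rewrite h; congr (- _); apply: eq_Ex => z.
by rewrite oppr0 rotate0 /fev big_seq1 mul1r.
Qed.

Definition dhe (k : nat * gI G) (x : wspace W) : R := k.1%:R * he (gvar k.2) k.1.-1 (gX k.2 x).

Lemma Linf_dhe k : Linf P (dhe k).
Proof. by apply: LinfZ; apply: Linf_he; exact: Linf_gX. Qed.

(** Integration by parts against [ge k]: [rsym_wder] on the square space, with the second coordinate
    integrated out by [cyl_slice]. *)
Lemma cyl_ibp f (u : B -> H) k : cylinder_poly f -> cylinder_grad f u ->
  (forall h, Linf P (fun x => dot (u x) h)) /\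
  k.1%:R * sym (G := G) f k = Ex P (fun x => dhe k x * dot (u x) (wrep k.2)).
Proof.
move=> cf gf; have [[U d Lf Jf df dL sf]] := cyl_ex cf.
have ud x h : dot (u x) h = d x h.
  by rewrite -(derive_val (is_derive := gf x h)) (derive_val (is_derive := df x h)).
have LU : Linf Q U.
  have [_ h] := jet_Linf Jf 0; rewrite (_ : U = fun z => U (rotate 0 z))//.
  by apply/funext => z; rewrite rotate0.
split=> [h|]; first by under eq_fun do rewrite ud; exact: dL.
rewrite -(rsym_wder Lf LU (jet_wder Lf Jf)) /rsym.
have m : memL Q 1 (fun z => U z * rge (hat k) z) by apply: Linf1; apply: LinfM => //; exact: Linf_rge.
rewrite (Ex_fubini (P1 := P) (P2 := P) m); apply: eq_Ex => x; have [h1 h2] := sf x k.2.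
rewrite ud -h2 -(ExZ (dhe k x)); last by apply: Linf1; apply: LinfM => //; exact: (@Linf_gX R G k.2).
by apply: eq_Ex => y; rewrite rge_hat /ge1 /dhe /=; ring.
Qed.

(** Read off the supremum over simple functions, so that it applies to integrands, such as the
    K-functional, whose measurability is not established. *)
Lemma ge0_le_int d (T : measurableType d) (m : {measure set T -> \bar R}) (f g : T -> \bar R) :
  (forall x, 0 <= f x)%E -> (forall x, f x <= g x)%E -> (\int[m]_x f x <= \int[m]_x g x)%E.
Proof.
move=> f0 fg; rewrite !ge0_integralTE//; last by move=> x; exact: le_trans (f0 x) (fg x).
apply: le_ereal_sup => _ [a ha <-]; exists a => // x; exact: le_trans (ha x) (fg x).
Qed.

Lemma ecvg0 (u : nat -> \bar R) (eps : R) : u n @[n --> \oo] --> 0%E -> 0 < eps ->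
  \forall n \near \oo, (u n < eps%:E)%E.
Proof.
move=> h e0; have [h1 h2] := (fine_cvgP _ _).1 h.
have h3 : \forall n \near \oo, `|0 - fine (u n)| < eps by move/cvgrPdist_lt : h2; apply.
near=> n; have fn : u n \is a fin_num by near: n.
rewrite -(fineK fn) lte_fin; apply: le_lt_trans (ler_norm _) _.
by rewrite -normrN -sub0r; near: n.
Unshelve. all: by end_near.
Qed.

Lemma L2H_dot (D : wspace W -> H) (C : R) h : 0 <= C -> measurable_fun setT (fun x => dot (D x) h) ->
  (\int[wmu W]_x (`|D x| ^+ 2)%:E <= (C ^+ 2)%:E)%E ->
  memL P 2 (fun x => dot (D x) h) /\ nrm P 2 (fun x => dot (D x) h) <= C * `|h|.
Proof.
move=> C0 mD iD; have [h0|hn] := eqVneq h 0.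
  have [m1 m2] := nrmZ 0 (ltr0n R 2) (Linf2 (Linf_cst P 1)).
  have e x : dot (D x) h = 0 * 1 by rewrite h0 linear0r mul0r.
  split; first by under eq_fun do rewrite e.
  by rewrite (nrm_ext P 2 (g := fun=> 0 * 1)) => [|x]; rewrite ?m2 ?e// h0 !normr0 mul0r mulr0.
have n0 : 0 < `|h| by rewrite normr_gt0.
pose f x := `|h|^-1 * dot (D x) h.
have mf : measurable_fun setT f by apply: measurable_funM.
have [m1 m2] : memL P 2 f /\ nrm P 2 f <= C.
  apply: (memLX (ltr0n R 2) mf _ C0); rewrite powR_mulrn//; apply: le_trans iD.
  apply: ge0_le_int => x; first by rewrite lee_fin powR_ge0.
  rewrite lee_fin powR_mulrn//; apply: lerXn2r; rewrite ?nnegrE//.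
  by rewrite /f normrM gtr0_norm ?invr_gt0// ler_pdivrMl// mulrC; exact: dot_cs.
have e x : dot (D x) h = `|h| * f x by rewrite /f mulVKf// gt_eqF.
have [m3 m4] := nrmZ `|h| (ltr0n R 2) m1.
split; first by under eq_fun do rewrite e.
by rewrite (nrm_ext P 2 (g := fun x => `|h| * f x)) => [|x]; rewrite ?e// m4 normr_id mulrC ler_wpM2r.
Qed.

Lemma L2H_bound (D : wspace W -> H) : (\int[wmu W]_x (`|D x| ^+ 2)%:E < +oo)%E ->
  exists2 C : R, 0 <= C & (\int[wmu W]_x (`|D x| ^+ 2)%:E <= (C ^+ 2)%:E)%E.
Proof.
move=> iD; have i0 : (0 <= \int[wmu W]_x (`|D x| ^+ 2)%:E)%E.
  by apply: integral_ge0 => x _; rewrite lee_fin sqr_ge0.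
exists (Num.sqrt (fine (\int[wmu W]_x (`|D x| ^+ 2)%:E))); first exact: sqrtr_ge0.
by rewrite sqr_sqrtr ?fine_ge0// fineK// ge0_fin_numE.
Qed.

(** Both sides of [cyl_ibp] are continuous along the sequences that define the closed gradient. *)
Lemma mall_ibp F DF k : malliavin_grad F DF ->
  [/\ memL P 2 F, forall h, memL P 2 (fun x => dot (DF x) h) &
    k.1%:R * sym (G := G) F k = Ex P (fun x => dhe k x * dot (DF x) (wrep k.2))].
Proof.
move=> [mF [mD iD] [f [u [cf hf hu]]]].
have [C C0 hC] := L2H_bound iD; have mDh h := (L2H_dot C0 (mD h) hC).1.
split=> //; set w := wrep k.2.
have Ld := Linf2 (Linf_dhe k); have Lg := Linf2 (@Linf_ge R G k).
apply/eqP; rewrite -subr_eq0 -normr_eq0 eq_le normr_ge0 andbT; apply/ler_addgt0Pr => eps e0; rewrite add0r.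
pose M := k.1%:R * nrm P 2 (ge (G := G) k) + nrm P 2 (dhe k) * `|w|.
have M0 : 0 <= M by rewrite addr_ge0 ?mulr_ge0 ?nrm_ge0.
have M1 : 0 < M + 1 by rewrite ltr_wpDl.
pose e := eps / (M + 1); have ee : 0 < e by rewrite divr_gt0.
have eM : e * M <= eps by rewrite -[leRHS](divfK (lt0r_neq0 M1)) ler_wpM2l ?(ltW ee)// lerDl.
have [n [h1 h2]] : exists n, (norm_Lp 2 (f n \- F)%R < e%:E)%E /\ (\int[wmu W]_x (`|u n x - DF x| ^+ 2)%:E < (e ^+ 2)%:E)%E.
  near \oo => n; exists n; split; near: n; first exact: ecvg0.
  by apply: ecvg0 hu _; rewrite exprn_gt0.
have [cn gn] := cf n; have [dL ibp] := cyl_ibp k cn gn.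
have [[_ _ Lf _ _ _ _]] := cyl_ex cn; have mf := Linf2 Lf.
have p12 : 1 <= 2 :> R by rewrite ler1n.
have [mB _] := nrmB p12 mf mF.
have nB : nrm P 2 (fun x => f n x - F x) <= e by rewrite -lee_fin -nrmE//; exact: ltW.
have eD x : dot (u n x - DF x) w = dot (u n x) w - dot (DF x) w by rewrite -scaleN1r dotDl mulN1r.
have mw : measurable_fun setT (fun x : wspace W => dot (u n x - DF x) w).
  under eq_fun do rewrite eD; apply: measurable_funB; first exact: Linf_meas (dL w).
  exact: (mDh w).1.
have [m2 n2] := L2H_dot (ltW ee) mw (ltW h2).
have -> : k.1%:R * sym (G := G) F k - Ex P (fun x => dhe k x * dot (DF x) w) =
   Ex P (fun x => dhe k x * dot (u n x - DF x) w) - k.1%:R * Ex P (fun x => (f n x - F x) * ge k x).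
  have x1 := (memLM22 Ld (Linf2 (dL w))).1; have x2 := (memLM22 Ld (mDh w)).1.
  have x3 := (memLM22 mf Lg).1; have x4 := (memLM22 mF Lg).1.
  rewrite (eq_Ex P (f := fun x => dhe k x * dot (u n x - DF x) w) (g := fun x => dhe k x * dot (u n x) w - dhe k x * dot (DF x) w)); last first.
    by move=> x; rewrite eD mulrBr.
  rewrite (eq_Ex P (f := fun x => (f n x - F x) * ge k x) (g := fun x => f n x * ge k x - F x * ge k x)); last first.
    by move=> x; rewrite mulrBl.
  by rewrite (ExB x1 x2) (ExB x3 x4) -ibp /sym; ring.
apply: le_trans (ler_normB _ _) _; rewrite normrM normr_nat; apply: le_trans eM.
have b1 := le_trans (memLM22 Ld m2).2 (ler_wpM2l (nrm_ge0 _ _ _) n2).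
have b2 := ler_wpM2l (ler0n R k.1) (le_trans (memLM22 mB Lg).2 (ler_wpM2r (nrm_ge0 _ _ _) nB)).
rewrite -/w in b1; rewrite /M; lra.
Unshelve. all: by end_near.
Qed.

Lemma ge_cyl k : cylinder_poly (ge (G := G) k : B -> R).
Proof.
case: k => n l; rewrite /ge /=; elim/he_ind2: n => [|n IH1 IH2]; first exact: cylinder_cst.
have e : (fun x : B => he (wcov l l) n.+1 (wX l x)) =
    (fun x => wX l x * he (wcov l l) n (wX l x) + - (n%:R * wcov l l) * he (wcov l l) n.-1 (wX l x)).
  by apply/funext => x; rewrite heS mulNr.
rewrite -[X in cylinder_poly X]/(fun x : B => he (wcov l l) n.+1 (wX l x)) e.
apply: cylinder_add; apply: cylinder_mul => //; last exact: cylinder_cst.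
by apply: cylinder_lin; exact: (svalP l).
Qed.

Lemma he_derive (q : R) (f : B -> R) (x v : B) (df : R) n : is_derive x v f df ->
  is_derive x v (fun x => he q n (f x)) (n%:R * he q n.-1 (f x) * df).
Proof.
move=> D; elim/he_ind2: n => [|n IH1 IH2].
  by rewrite mul0r mul0r; exact: is_derive_cst.
have e : (fun x : B => he q n.+1 (f x)) = (fun x => f x * he q n (f x) + - (n%:R * q) * he q n.-1 (f x)).
  by apply/funext => y; rewrite heS mulNr.
rewrite e; have D1 := is_deriveM D IH1; have D2 := is_deriveM (is_derive_cst (- (n%:R * q)) x v) IH2.
have D3 := is_deriveD D1 D2; apply: is_derive_eq; rewrite /GRing.scale/=.
case: n {IH1 IH2 e D1 D2 D3} => [|n] /=; first by rewrite he0; ring.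
by rewrite heS /= -!natr1; ring.
Qed.

Definition ge_grad (c : R) k (x : B) : H := (c * dhe k x) *: wrep k.2.

Lemma cge_mall (c : R) k : malliavin_grad (fun x : wspace W => c * ge (G := G) k x) (ge_grad c k).
Proof.
have L : Linf P (fun x => c * ge (G := G) k x) by apply: LinfZ; exact: Linf_ge.
have Ld := Linf_dhe k.
have gd x h : is_derive (x : B) (wi W h) (fun x : B => c * ge (G := G) k x) (dot (ge_grad c k x) h).
  have D := he_derive (gvar k.2) k.1 (@is_derive_scalar (sval k.2) x (wi W h) (svalP k.2)).
  have D2 := is_deriveM (is_derive_cst c x (wi W h)) D.
  apply: is_derive_eq; rewrite /GRing.scale/= /ge_grad dotZl -wrepE /dhe /cst /=; ring.
split; first exact: (Linf2 L).
- split=> [h|].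
    rewrite (_ : (fun x => _) = (fun x => c * dhe k x * dot (wrep k.2) h)); last first.
      by apply/funext => x; rewrite /ge_grad dotZl.
    by apply: measurable_funM => //; apply: measurable_funM => //; exact: Linf_meas Ld.
  rewrite (eq_integral (fun x => (`|(c * `|wrep k.2|) * dhe k x| `^ 2)%:E)); last first.
    move=> x _; congr EFin; rewrite /ge_grad normrZ powR_mulrn// !normrM normr_id; congr (_ ^+ 2); ring.
  by rewrite powR_nrm ?ltry ?pnatr_eq0//; apply: Linf2; exact: LinfZ.
- exists (fun _ => fun x => c * ge (G := G) k x), (fun _ => ge_grad c k); split=> [n||].
  + split=> //; apply: cylinder_mul; [exact: cylinder_cst|exact: ge_cyl].
  + rewrite (_ : (fun n => _) = (fun=> 0%E)); first exact: cvg_cst.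
    apply/funext => n; have [m1 m2] := nrmZ 0 (ltr0n R 2) (Linf2 (Linf_cst P 1)).
    have z : nrm P 2 (fun=> 0 * 1) = 0 by rewrite m2 normr0 mul0r.
    rewrite -[RHS]/((0 : R)%:E) -[X in _ = X%:E]z -nrmE//; congr ('N[_]_ _ [_])%E.
    by apply/funext => x /=; rewrite subrr mul0r.
  + rewrite (_ : (fun n => _) = (fun=> 0%E)); first exact: cvg_cst.
    by apply/funext => n; apply: integral0_eq => x _; rewrite subrr normr0 expr0n.
Qed.

(** By [mall_ibp] the divergence of the gradient of [ge k] is [k.1] times [ge k]. *)
Lemma cge_ou (c : R) k : ornstein_uhlenbeck (fun x : wspace W => c * ge (G := G) k x)
  (fun x => - k.1%:R * (c * ge (G := G) k x)).
Proof.
exists (ge_grad c k); split; first exact: cge_mall.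
split; first by have [_ h _] := cge_mall c k.
  by apply: Linf2; apply: LinfN; apply: LinfZ; apply: LinfZ; exact: (@Linf_ge R G k).
move=> F DF mF; have [m1 m2 ibp] := mall_ibp k mF.
have x1 := (memLM22 (Linf2 (Linf_dhe k)) (m2 (wrep k.2))).1.
have x2 := (memLM22 m1 (Linf2 (@Linf_ge R G k))).1.
rewrite -[LHS]/(Ex P _) -[RHS]/(Ex P _).
rewrite (eq_Ex P (g := fun x => c * (dhe k x * dot (DF x) (wrep k.2)))); last first.
  by move=> x; rewrite /ge_grad dotC dotZl dotC mulrA.
rewrite (ExZ c x1) -ibp (eq_Ex P (f := fun x => F x * _) (g := fun x => (c * k.1%:R) * (F x * ge k x))); last first.
  by move=> x; ring.
by rewrite (ExZ _ x2) /sym; ring.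
Qed.

(** The pairing of the gradients of [F] and [ge k], computed from either side, gives lam E(F ge k) =
    n E(F ge k). *)
Lemma ou_orth (F : wspace W -> R) (lam : R) k : ornstein_uhlenbeck F (fun x => - lam * F x) ->
  memL P 2 F /\ (lam != k.1%:R -> sym (G := G) F k = 0).
Proof.
move=> [U [mF [_ _ dU]]]; have [m1 m2 ibp] := mall_ibp k mF; split=> // lk.
have := dU _ _ (cge_mall 1 k); rewrite -[X in X = _ -> _]/(Ex P _) -[X in _ = X -> _]/(Ex P _).
have x2 := (memLM22 m1 (Linf2 (@Linf_ge R G k))).1.
rewrite (eq_Ex P (g := fun x => dhe k x * dot (U x) (wrep k.2))); last first.
  by move=> x; rewrite /ge_grad mul1r dotZl dotC.
rewrite -ibp (eq_Ex P (f := fun x => 1 * ge k x * _) (g := fun x => lam * (F x * ge k x))); last first.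
  by move=> x; ring.
rewrite (ExZ _ x2) -/(sym (G := G) F k) => /eqP; rewrite -subr_eq0 -mulrBl mulf_eq0 subr_eq0 eq_sym (negPf lk).
by move=> /eqP.
Qed.
End cylinder.

(** * Sobolev spaces in terms of symbols *)

Section sobolev_spaces.
Context {R : realType} (W : abstractWienerSpace R).
Local Notation G := (gW W).
Local Notation P := (gP G).
Implicit Types (f v F V : wspace W -> R) (a p s : R) (k : nat * gI G).

(** An eigenvector with eigenvalue - lam has symbols only in degree lam, so spectral calculus acts
    on symbols as a degree multiplier. *)
Lemma eigensum_sym s v f : power_eigensum s v f -> [/\ memL P 2 v, memL P 2 f &
  forall k, sym (G := G) f k = k.1.+1%:R `^ s * sym (G := G) v k].
Proof.
move=> [n [lam [Phi [hP hv hf]]]]; have mP j := (ou_orth (0%N, w0 W) (hP j).2).1.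
have Lg k := Linf2 (@Linf_ge R G k).
have key (c : 'I_n -> R) g : (forall x, g x = \sum_(j < n) c j * Phi j x) -> memL P 2 g /\
    forall k, sym (G := G) g k = \sum_(j < n) c j * sym (G := G) (Phi j) k.
  move=> hg; have p12 : 1 <= 2 :> R by rewrite ler1n.
  split=> [|k].
    have -> : g = (fun x => \sum_(j <- index_enum 'I_n) c j * Phi j x) by apply/funext => x; rewrite hg.
    elim: (index_enum _) => [|j r IH].
      by under eq_fun do rewrite big_nil; exact: Linf2 (Linf_cst P 0).
    under eq_fun do rewrite big_cons; apply: (nrmD p12 _ IH).1.
    exact: (nrmZ (c j) (ltr0n R 2) (mP j)).1.
  have m1 j := (nrmZ (c j) ltr01 (memLM22 (mP j) (Lg k)).1).1.
  rewrite (eq_bigr (fun j => Ex P (fun x => c j * (Phi j x * ge k x)))) => [|j _]; last first.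
    by rewrite (ExZ (c j) (memLM22 (mP j) (Lg k)).1).
  have [_ <-] := Ex_sum (index_enum 'I_n) m1.
  rewrite /sym; apply: eq_Ex => x; rewrite hg mulr_suml; apply: eq_bigr => j _; ring.
have [m1 s1] := key (fun=> 1) v ltac:(by move=> x; rewrite hv; apply: eq_bigr => j _; rewrite mul1r).
have [m2 s2] := key _ f hf; split=> // k.
rewrite s1 s2 mulr_sumr; apply: eq_bigr => j _; have [l0 ou] := hP j.
have [->|lk] := eqVneq (lam j) k.1%:R; first by rewrite mul1r nat1r.
by rewrite (ou_orth k ou).2// !mulr0.
Qed.

Lemma bessel_pot a p V F : 2 <= p -> bessel_potential a p V F ->
  [/\ memL P p V, memL P p F & pot (G := G) a V F].
Proof.
move=> p2 [mV mF [v [f [hp hv hf]]]]; split=> // k; have p1 : 1 <= p by lra.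
have p12 : 1 <= 2 :> R by rewrite ler1n.
have Lg := Linf2 (@Linf_ge R G k).
have j0 : 0 <= jm a k.1 by exact: ltW (jm_gt0 a k.1).
apply/eqP; rewrite -subr_eq0 -normr_eq0 eq_le normr_ge0 andbT; apply/ler_addgt0Pr => eps e0; rewrite add0r.
pose M := (1 + jm a k.1) * nrm P 2 (ge (G := G) k).
have M0 : 0 <= M by rewrite mulr_ge0 ?addr_ge0 ?nrm_ge0.
have M1 : 0 < M + 1 by rewrite ltr_wpDl.
pose e := eps / (M + 1); have ee : 0 < e by rewrite divr_gt0.
have eM : e * M <= eps by rewrite -[leRHS](divfK (lt0r_neq0 M1)) ler_wpM2l ?(ltW ee)// lerDl.
have [n [h1 h2]] : exists n, (norm_Lp p (v n \- V)%R < e%:E)%E /\ (norm_Lp p (f n \- F)%R < e%:E)%E.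
  by near \oo => n; exists n; split; near: n; exact: ecvg0.
have [m1 m2 hs] := eigensum_sym (hp n).
have bnd g g' : memL P 2 g -> memL P p g' -> (norm_Lp p (g \- g')%R < e%:E)%E ->
    memL P 2 g' /\ `|sym (G := G) g k - sym (G := G) g' k| <= e * nrm P 2 (ge (G := G) k).
  move=> mg mg' h; have mg2 := (memL_le (ltr0n R 2) p2 mg').1.
  have md : memL P p (fun x => g x - g' x).
    split; first by apply: measurable_funB; [exact: mg.1|exact: mg'.1].
    by apply: lt_trans h _; exact: ltry.
  have [md2 n2] := memL_le (ltr0n R 2) p2 md.
  have nd : nrm P p (fun x => g x - g' x) <= e by rewrite -lee_fin -nrmE//; exact: ltW.
  split=> //; rewrite /sym -(ExB (memLM22 mg Lg).1 (memLM22 mg2 Lg).1).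
  rewrite (eq_Ex P (g := fun x => (g x - g' x) * ge k x)) => [|x]; last by rewrite mulrBl.
  apply: le_trans (memLM22 md2 Lg).2 _; apply: ler_wpM2r; first exact: nrm_ge0.
  exact: le_trans n2 nd.
have [_ b1] := bnd _ _ m1 mV h1; have [_ b2] := bnd _ _ m2 mF h2.
have -> : sym (G := G) F k - jm a k.1 * sym (G := G) V k =
   jm a k.1 * (sym (G := G) (v n) k - sym (G := G) V k) - (sym (G := G) (f n) k - sym (G := G) F k).
  by rewrite (hs k) /jm; ring.
apply: le_trans (ler_normB _ _) _; rewrite normrM (ger0_norm j0); apply: le_trans eM.
by have := ler_wpM2l j0 b1; rewrite /M; lra.
Unshelve. all: by end_near.
Qed.

Lemma pot_fmul a (phi : seq (R * (nat * gI G))) : pot (G := G) a (fev ge phi) (fev ge (fmul (jm a) phi)).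
Proof.
have e (psi : seq (R * (nat * gI G))) k : sym (G := G) (fev ge psi) k = \sum_(c <- psi) c.1 * sym (G := G) (ge c.2) k.
  rewrite /sym (eq_Ex P (g := fun x => ge k x * fev ge psi x)); last by move=> x; rewrite mulrC.
  rewrite (Ex_fev (@Linf_ge R G)); last by apply: Linf2; exact: Linf_ge.
  by apply: eq_bigr => c _; congr (_ * _); apply: eq_Ex => x; rewrite mulrC.
move=> k; rewrite !e /fmul big_map mulr_sumr; apply: eq_bigr => -[c l] _ /=.
have [->|lk] := eqVneq l.1 k.1; first by ring.
by rewrite [sym _ _]ge_orth// !mulr0.
Qed.

Lemma fev_eigensum a (phi : seq (R * (nat * gI G))) :
  power_eigensum (- (a / 2)) (fev ge phi : wspace W -> R) (fev ge (fmul (jm a) phi)).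
Proof.
pose c (j : 'I_(size phi)) := tnth (in_tuple phi) j.
exists (size phi), (fun j => (c j).2.1%:R), (fun j x => (c j).1 * ge (c j).2 x); split=> [j|x|x].
- by split=> //; exact: cge_ou.
- by rewrite /fev big_tnth.
- by rewrite fev_fmul big_tnth; apply: eq_bigr => j _; rewrite -/(c j) nat1r /jm; ring.
Qed.

(** Approximate [V] by Hermite combinations and apply the multiplier to them. The potential of the
    error is controlled by the contraction [bessel_ex], and is the error of the potential because
    the symbols agree. *)
Lemma pot_bessel a p V F : 0 <= a -> 1 < p -> Linf P V -> Linf P F -> pot (G := G) a V F ->
  bessel_potential a p V F.
Proof.
move=> a0 p1 LV LF pV; have p1' := ltW p1.
(* Symbols are used in L^2 only, so the approximation is made in L^r with r >= 2 and restricted to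
   L^p afterwards. *)
pose r := Num.max 2 p; have r2 : 2 <= r by rewrite le_max lexx.
have pr : p <= r by rewrite le_max lexx orbT.
have r1 : 1 <= r by lra.
have hphi n : exists phi, nrm P r (fun x => V x - fev ge phi x) <= 2^-1 ^+ n.
  by apply: chaos_dense; rewrite ?exprn_gt0 ?invr_gt0//; exact: LV.
have /choice [phi hp] := hphi.
have Lv n := Linf_fevg (phi n); have Lf n := Linf_fevg (fmul (jm a) (phi n)).
have hf n : nrm P r (fun x => F x - fev ge (fmul (jm a) (phi n)) x) <= 2^-1 ^+ n.
  have mB := LinfB LV (Lv n).
  have [F' [mF' nF' pF']] := bessel_ex a0 r2 (mB r r1).
  have [|_ ->] := memL_sym r2 (Linf2 (LinfB LF (Lf n))) mF'; last by apply: le_trans nF' (hp n).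
  move=> k; rewrite pF'.
  have eB f g : Linf P f -> Linf P g -> sym (G := G) (fun x => f x - g x) k = sym (G := G) f k - sym (G := G) g k.
    move=> h1 h2; rewrite -[RHS](_ : sym (G := G) (fun x => f x + (-1) * g x) k = _).
      by apply: eq_Ex => x; rewrite mulN1r.
    by rewrite symD; [rewrite mulN1r|exact: Linf2|exact: Linf2].
  by rewrite !eB// pV pot_fmul mulrBr.
have cv0 (u : nat -> wspace W -> R) g : (forall n, Linf P (u n)) -> Linf P g ->
    (forall n, nrm P r (fun x => g x - u n x) <= 2^-1 ^+ n) -> norm_Lp p (u n \- g) @[n --> \oo] --> 0%E.
  move=> Lu Lg h; have m n := LinfB (Lu n) Lg p1'.
  rewrite (_ : (fun n => _) = (fun n => (nrm P p (fun x => u n x - g x))%:E)); last first.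
    by apply/funext => n; rewrite -nrmE.
  apply: cvg_EFin; first by near=> n.
  apply/cvgrPdist_lt => eps e0; have [N hN] := half_small e0; exists N => // n /= Nn.
  rewrite sub0r normrN ger0_norm ?nrm_ge0//; apply: le_lt_trans hN.
  apply: le_trans (memL_le (lt_trans ltr01 p1) pr (LinfB (Lu n) Lg r1)).2 _.
  rewrite (nrm_ext P r (g := fun x => g x - u n x)) => [|x]; last by rewrite distrC.
  apply: le_trans (h n) _; by apply: ler_wiXn2l; rewrite ?invr_ge0// invf_le1// ler1n.
split; [exact: LV|exact: LF|].
exists (fun n => fev ge (phi n)), (fun n => fev ge (fmul (jm a) (phi n))); split=> [n||].
- exact: fev_eigensum.
- exact: cv0.
- exact: cv0.
Unshelve. all: by end_near.
Qed.

Lemma Dsp_sobolev a F : 0 <= a -> Dsp (G := G) a F -> sobolev_infty a F.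
Proof. by move=> a0 [LF [V [LV pV]]] p p1; exists V; exact: pot_bessel. Qed.

Lemma Linf_ge2 F : (forall p, 2 <= p -> memL P p F) -> Linf P F.
Proof.
move=> h p p1; have r2 : 2 <= Num.max 2 p by rewrite le_max lexx.
by apply: (memL_le (lt_le_trans ltr01 p1) _ (h _ r2)).1; rewrite le_max lexx orbT.
Qed.

Lemma sobolev_Dsp a F : sobolev_infty a F -> Dsp (G := G) a F.
Proof.
move=> h; have key p : 2 <= p -> exists V, [/\ memL P p V, memL P p F & pot (G := G) a V F].
  by move=> p2; have [|V hV] := h p; [lra|exists V; exact: bessel_pot].
apply: Dsp_all_p => [|p p2]; first by apply: Linf_ge2 => p p2; have [V []] := key p p2.
by have [V [mV _ pV]] := key p p2; exists V.
Qed.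
End sobolev_spaces.

(** * Interpolation spaces *)

Section interpolation.
Context {R : realType} (W : abstractWienerSpace R).
Local Notation G := (gW W).
Local Notation P := (gP G).
Local Notation Q := (gP (gsq G)).
Local Notation mu := (@lebesgue_measure R).
Implicit Types (F V : wspace W -> R) (p s r eps : R).

Lemma sobolev_norm_ge0 a p F : (0 <= sobolev_norm a p F)%E.
Proof. by apply/ereal_infP => _ [V _ <-]; exact: Lnorm_ge0. Qed.

Lemma K_mono k p F eps eps' : eps <= eps' -> (K_functional k p eps F <= K_functional k p eps' F)%E.
Proof.
move=> ee; apply/ereal_infP => _ [F12 h <-]; apply: ge_ereal_inf; eexists; first by exists F12.
by apply: leeD2l; apply: lee_wpmul2r; rewrite ?lee_fin// sobolev_norm_ge0.
Qed.

Lemma const_le_integral (f : R -> \bar R) (c a b : R) : 0 <= c -> 0 <= a -> a < b -> b <= 1 ->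
  (forall x, 0 < x < 1 -> (0 <= f x)%E) -> (forall x, a < x < b -> (c%:E <= f x)%E) ->
  ((c * (b - a))%:E <= \int[mu]_(x in `]0%R, 1%R[) f x)%E.
Proof.
move=> c0 a0 ab b1 f0 fc.
have -> : ((c * (b - a))%:E = \int[mu]_(x in `]a, b[) cst c%:E x)%E.
  by rewrite integral_cst//= lebesgue_measure_itv/= lte_fin ab -EFinB -EFinM.
rewrite integral_mkcond [leRHS]integral_mkcond; apply: ge0_le_int => x; rewrite !patchE !mem_setE !in_itv/=.
  by case: ifP.
have [h|h] := boolP (a < x < b).
  have -> : 0 < x < 1 by case/andP: h => h1 h2; apply/andP; split; [exact: le_lt_trans h1|exact: lt_le_trans b1].
  exact: fc.
by case: ifP => // hx; exact: f0.
Qed.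

(** K is nondecreasing in eps, so a finite integral near eps bounds K(eps) itself; eps < 1/2 keeps
    the interval from eps to 2 eps inside the domain of integration. *)
Lemma K_bound k (sigma p : R) F : 0 < sigma -> sigma <= 1 -> 1 <= p ->
  (interpolation_norm k sigma p F < +oo)%E ->
  exists2 C : R, 0 < C & forall eps, 0 < eps -> eps < 2^-1 -> (K_functional k p eps F <= (C * eps `^ sigma)%:E)%E.
Proof.
move=> s0 s1 p1 /lty_poweRy h; have p0 : 0 < p by lra.
have {h} := h ltac:(by rewrite invr_eq0 gt_eqF).
set f := (fun eps : R => _ : \bar R); set I := (\int[mu]_(x in _) _)%E => Ioo.
have f0 x : 0 < x < 1 -> (0 <= f x)%E.
  by move=> /andP[x0 x1]; rewrite mule_ge0 ?poweR_ge0// lee_fin invr_ge0 ltW.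
have I0 : (0 <= I)%E by apply: integral_ge0 => x; rewrite /= in_itv/=; exact: f0.
have [i iE] : exists i : R, I = i%:E.
  by exists (fine I); rewrite fineK// ge0_fin_numE.
have i0 : 0 <= i by rewrite -lee_fin -iE.
(* If K(eps) exceeded 2 M eps^sigma, the integrand would be at least M^p / (2 eps) on an interval of
   length eps, and the integral [i] at least M^p / 2 = i + 1. *)
pose M := (2 * (i + 1)) `^ p^-1; have M0 : 0 < M by rewrite powR_gt0; lra.
have Mp : M `^ p = 2 * (i + 1) by rewrite -powRrM mulVf ?gt_eqF// powRr1//; lra.
exists (2 * M) => [|eps e0 e2]; first lra.
rewrite leNgt; apply/negP => hK.
have es : 0 < eps `^ sigma by exact: powR_gt0.
pose c := M `^ p / (2 * eps); have c0 : 0 <= c by rewrite divr_ge0 ?powR_ge0//; lra.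
have fc x : eps < x < 2 * eps -> (c%:E <= f x)%E.
  move=> /andP[x1 x2]; have x0 : 0 < x by lra.
  have hx : ((2 * M * eps `^ sigma)%:E <= K_functional k p x F)%E.
    by apply: le_trans (ltW hK) _; apply: K_mono; exact: ltW.
  have g1 : (M%:E <= (x `^ (- sigma))%:E * K_functional k p x F)%E.
    apply: (@le_trans _ _ ((x `^ (- sigma))%:E * (2 * M * eps `^ sigma)%:E)%E); last first.
      by apply: lee_wpmul2l hx; rewrite lee_fin powR_ge0.
    rewrite -EFinM lee_fin powRN ler_pdivlMl ?powR_gt0//.
    have : x `^ sigma <= 2 * eps `^ sigma.
      apply: (@le_trans _ _ ((2 * eps) `^ sigma)); first by apply: ge0_ler_powR; rewrite ?nnegrE; lra.
      rewrite powRM//; last by exact: ltW.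
      apply: ler_wpM2r; first exact: ltW.
      by rewrite -[leRHS]powRr1//; apply: ler_powR => //; rewrite ler1n.
    by move=> hh; have := ler_wpM2r (ltW M0) hh; lra.
  rewrite /c EFinM; apply: lee_pmul.
  - by rewrite lee_fin powR_ge0.
  - by rewrite lee_fin invr_ge0; lra.
  - have mem (y : \bar R) : (0 <= y)%E -> y \in `[0%E, +oo%E] by move=> y0; rewrite in_itv/= y0 leey.
    rewrite -poweR_EFin; apply: (gt0_ler_poweR (ltW p0) (mem _ _) (mem _ _) g1); first by rewrite lee_fin ltW.
    by apply: le_trans g1; rewrite lee_fin ltW.
  - by rewrite lee_fin lef_pV2 ?posrE//; [exact: ltW|lra].
have e4 : eps < 2 * eps by lra. have e3 : 2 * eps <= 1 by lra.
have := const_le_integral c0 (ltW e0) e4 e3 f0 fc.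
rewrite -/I iE lee_fin /c Mp (_ : _ / _ * _ = i + 1); first lra.
by field; rewrite gt_eqF.
Qed.

(** All pieces are expressed at order [k]: [V1] and [W2] are (1 - L)^(k/2) applied to the two parts
    of [F], and [W2] still has one more order, as the potential of [V2]. *)
Lemma K_split k p eps F (C : R) : 2 <= p -> 0 < eps -> measurable_fun setT F ->
  (K_functional k p eps F < C%:E)%E ->
  exists V1 V2 W2 : wspace W -> R, [/\ [/\ memL P p V1, nrm P p V1 <= C, memL P p V2 & nrm P p V2 <= C / eps],
    memL P p W2, pot (G := G) 1 V2 W2, memL P p F & pot (G := G) k%:R (fun x => V1 x + W2 x) F].
Proof.
move=> p2 e0 mF /ereal_inf_lt [_ [[F1 F2] /= ae12 <-] hC]; have p1 : 1 <= p by lra.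
have a0 := sobolev_norm_ge0 k%:R p F1; have b0 := sobolev_norm_ge0 k.+1%:R p F2.
have ha : (sobolev_norm k%:R p F1 < C%:E)%E.
  by apply: le_lt_trans hC; apply: leeDl; rewrite mule_ge0// lee_fin ltW.
have hb : (sobolev_norm k.+1%:R p F2 < (C / eps)%:E)%E.
  have h1 : (eps%:E * sobolev_norm k.+1%:R p F2 < C%:E)%E by apply: le_lt_trans hC; apply: leeDr.
  by rewrite mulrC EFinM lte_pdivlMl.
have [_ [V1 bV1 <-] n1] := ereal_inf_lt ha; have [_ [V2 bV2 <-] n2] := ereal_inf_lt hb.
have [m1 mF1 p1V] := bessel_pot p2 bV1; have [m2 mF2 p2V] := bessel_pot p2 bV2.
have [W2 [mW2 _ pW]] := bessel_ex (G := G) ler01 p2 m2.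
have [mF' _] := nrmD p1 mF1 mF2; have [mF2' _] := ae_nrm ae12 mF' mF.
have le2 f : memL P p f -> memL P 2 f by move=> mf; exact: (memL_le (ltr0n R 2) p2 mf).1.
exists V1, V2, W2; split=> //.
  by split=> //; rewrite -lee_fin -nrmE//; exact: ltW.
move=> l; rewrite -(sym_ae (G := G) mF'.1 mF ae12).
have -> : sym (G := G) (fun x => F1 x + F2 x) l = sym (G := G) (fun x => F1 x + 1 * F2 x) l.
  by apply: eq_Ex => x; rewrite mul1r.
rewrite symD; [|exact: le2..].
have -> : sym (G := G) (fun x => V1 x + W2 x) l = sym (G := G) (fun x => V1 x + 1 * W2 x) l.
  by apply: eq_Ex => x; rewrite mul1r.
rewrite symD; [|exact: le2..]; rewrite p1V p2V pW -natr1 jmD; ring.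
Qed.

Lemma shift_nrm p V th : 1 <= p -> memL P p V -> memL Q p (fun z => V (rotate th z).1 - V z.1) /\
  nrm Q p (fun z => V (rotate th z).1 - V z.1) <= 2 * nrm P p V.
Proof.
move=> p1 mV; have [m1 n1] := mpres_memL (mpres_fst P P) mV.
have [m2 n2] := mpres_memL (rot1_mpres G (cs1 th)) mV.
have [m3 n3] := nrmB p1 m2 m1; split=> //.
by apply: le_trans n3 _; rewrite n1 n2 mulr_natl mulr2n.
Qed.

(** The increment of V = (1 - L)^(k/2) F at angle th is estimated by splitting at eps = |th|: the
    rough part costs its norm, of order eps^sigma, and the smooth part has norm of order
    eps^(sigma-1) and is almost Lipschitz. *)
Lemma interp_Dsp k (sigma : R) F : 0 < sigma -> sigma < 1 ->
  (forall p, 1 < p -> interpolation_space k sigma p F) ->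
  forall r, 0 <= r -> r < sigma -> Dsp (G := G) (r + k%:R) F.
Proof.
move=> s0 s1 hF.
suff key p s : 2 <= p -> 0 < s -> s < sigma -> exists V (M : R), [/\ memL P p V, memL P p F,
    pot (G := G) k%:R V F, 0 <= M & forall th, nrm Q p (fun z => V (rotate th z).1 - V z.1) <= M * `|th| `^ s].
  move=> r r0 rs; have LF : Linf P F.
    by apply: Linf_ge2 => p p2; have [V [M []]] := key p (sigma / 2) p2 ltac:(lra) ltac:(lra).
  apply: (@Dsp_le _ _ _ ((r + sigma) / 2 + k%:R)); first by rewrite lerD2r; lra.
  apply: Dsp_all_p => // p p2.
  have [r' [s' [re h1 h2 h3]]] : exists r' s' : R, [/\ r' = (r + sigma) / 2, 0 < r', r' < s' & s' < sigma].
    by exists ((r + sigma) / 2), ((r + sigma) / 2 + (sigma - r) / 4); split; lra.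
  have [V [M [mV _ pV M0 hM]]] := key p s' p2 (lt_trans h1 h2) h3; rewrite -re.
  have [V' [mV' pV']] := pot_of_hold p2 mV h1 h2 (ltW (lt_trans h3 s1)) M0 hM.
  by exists V'; split=> //; rewrite addrC; exact: potD pV pV'.
move=> p2 h0 hs; have p1 : 1 <= p by lra.
have [mF nF] := hF p ltac:(lra).
have [C C0 hC] := K_bound s0 (ltW s1) p1 nF.
have spl eps : 0 < eps -> eps < 2^-1 -> exists V1 V2 W2 : wspace W -> R,
    [/\ [/\ memL P p V1, nrm P p V1 <= (C + 1) * eps `^ sigma, memL P p V2 & nrm P p V2 <= (C + 1) * eps `^ sigma / eps],
    memL P p W2, pot (G := G) 1 V2 W2, memL P p F & pot (G := G) k%:R (fun x => V1 x + W2 x) F].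
  move=> e0 e2; apply: K_split => //; apply: le_lt_trans (hC eps e0 e2) _.
  by rewrite lte_fin ltr_pM2r ?powR_gt0// ltrDl.
have q0 : 0 < 4^-1 :> R by rewrite invr_gt0.
have q1 : 4^-1 < 2^-1 :> R by lra.
(* One fixed splitting, at an arbitrary eps below 1/2, defines [V]. *)
have [V1 [V2 [W2 [[m1 _ _ _] m2 _ mF' pF]]]] := spl _ q0 q1.
have [mV _] := nrmD p1 m1 m2; pose V := fun x => V1 x + W2 x; rewrite -/V in mV pF.
(* The smooth part is Hoelder of any order below 1; this one gives |th|^(sigma - 1) |th|^rho =
   |th|^s. *)
pose rho := 1 - (sigma - s); have rho0 : 0 < rho by rewrite /rho; lra.
have rho1 : rho < 1 by rewrite /rho; lra.
have [D D0 hD] := hold_of_pot G p2 rho0 rho1 (ltW rho1).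
have n0 := nrm_ge0 P p V.
have A0 : 0 <= 2 * (C + 1) by lra.
have B0 : 0 <= D * (C + 1) by rewrite mulr_ge0//; lra.
exists V, (2 * (C + 1) + D * (C + 1) + 4 * nrm P p V); split=> //; first lra.
move=> th; have [->|thn] := eqVneq th 0.
  rewrite (nrm_ext Q p (g := fun z => 0 * V z.1)) => [|z]; last by rewrite rotate0 subrr mul0r.
  have [_ ->] := nrmZ 0 (lt_le_trans ltr01 p1) (mpres_memL (mpres_fst P P) mV).1.
  by rewrite normr0 mul0r powR0 ?mulr0// gt_eqF.
have th0 : 0 < `|th| by rewrite normr_gt0.
have ts0 : 0 < `|th| `^ s by rewrite powR_gt0.
have [tl|tl] := leP 2^-1 `|th|.
  apply: le_trans (shift_nrm th p1 mV).2 _.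
  have : 2^-1 <= `|th| `^ s.
    apply: (@le_trans _ _ (2^-1 `^ s)); last by apply: ge0_ler_powR; rewrite ?nnegrE; lra.
    rewrite -[leLHS]powRr1; last lra.
    by apply: ger_powR; [apply/andP; split; lra|lra].
  move=> h; have := ler_wpM2l n0 h; have := mulr_ge0 A0 (ltW ts0); have := mulr_ge0 B0 (ltW ts0); lra.
have [U1 [U2 [Z2 [[k1 nk1 k2 nk2] k3 pk _ pF2]]]] := spl _ th0 tl.
have [mU _] := nrmD p1 k1 k3.
(* The sum obtained by splitting at |th| has the symbols of [V], hence equals it almost
   everywhere. *)
have ae : {ae P, forall x, V x = U1 x + Z2 x}.
  apply: (sym_uniq (G := G)); [exact: (memL_le (ltr0n R 2) p2 mV).1|exact: (memL_le (ltr0n R 2) p2 mU).1|move=> l].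
  by apply: (mulfI (lt0r_neq0 (jm_gt0 k%:R l.1))); rewrite -pF -pF2.
have aeQ : {ae Q, forall z : gT (gsq G), V (rotate th z).1 - V z.1 = (U1 (rotate th z).1 - U1 z.1) + (Z2 (rotate th z).1 - Z2 z.1)}.
  have a1 := mpres_ae (mpres_fst P P) ae; have a2 := mpres_ae (rot1_mpres G (cs1 th)) ae.
  by apply: filterS2 a1 a2 => z e1 e2; rewrite e1 [V (rotate th z).1]e2; ring.
have [x1 y1] := shift_nrm th p1 k1; have [x2 _] := shift_nrm th p1 k3.
have [x3 y3] := nrmD p1 x1 x2.
have [_ <-] := ae_nrm (f := fun z : gT (gsq G) => V (rotate th z).1 - V z.1) aeQ (shift_nrm th p1 mV).1 x3.1.
apply: le_trans y3 _; have y2 := hD _ _ k2 k3 pk th.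
have e1 : `|th| `^ sigma / `|th| * `|th| `^ rho = `|th| `^ s.
  have -> : `|th| `^ sigma / `|th| = `|th| `^ (sigma - 1).
    have -> : `|th| `^ (sigma - 1) = `|th| `^ sigma * `|th| `^ (- 1) by apply: powRD; rewrite (gt_eqF th0) implybT.
    by rewrite powR_inv1.
  rewrite -powRD; first by congr (_ `^ _); rewrite /rho; ring.
  by rewrite (gt_eqF th0) implybT.
have e2 : `|th| `^ sigma <= `|th| `^ s.
  by apply: ger_powR; [rewrite th0/= ltW// (lt_trans tl)//; lra|exact: ltW].
have z1 : 2 * nrm P p U1 <= 2 * (C + 1) * `|th| `^ s.
  have := ler_wpM2l (_ : 0 <= C + 1) e2; move/(_ ltac:(lra)); lra.
have z2 : D * nrm P p U2 * `|th| `^ rho <= D * (C + 1) * `|th| `^ s.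
  rewrite -e1; have := ler_wpM2l D0 nk2; move/(ler_wpM2r (powR_ge0 `|th| rho)); lra.
have := mulr_ge0 n0 (ltW ts0); lra.
Qed.
End interpolation.

(** * Quotients on the Wiener space *)

Section quotient.
Context {R : realType} (W : abstractWienerSpace R).
Local Notation G := (gW W).
Local Notation P := (gP G).
Implicit Types (F N : wspace W -> R) (A : set (wspace W)).

Lemma regular_Dsp (alpha sigma : R) (k : nat) F : alpha = k%:R + sigma -> 0 < sigma <= 1 ->
  fractional_sobolev_infty alpha F \/ sobolev_infty alpha F ->
  forall r, 0 <= r -> r < sigma -> Dsp (G := G) (r + k%:R) F.
Proof.
move=> aE /andP[s0 s1] h r r0 rs.
have sob : sobolev_infty alpha F -> Dsp (G := G) (r + k%:R) F.
  by move=> /sobolev_Dsp; apply: Dsp_le; rewrite aE addrC lerD2l ltW.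
case: h => // h; move: s1; rewrite le_eqVlt => /predU1P[s1|s1].
  (* For sigma = 1 the order is the integer k + 1, where the fractional space is the Sobolev
     space. *)
  apply: sob => p p1; have := h p p1; rewrite /fractional_sobolev aE s1 natr1.
  by rewrite natrK eqxx.
apply: (interp_Dsp s0 s1) => // p p1; have := h p p1; rewrite /fractional_sobolev.
have -> : Num.truncn alpha = k.
  by apply/eqP; rewrite truncn_eq aE; [apply/andP; split; rewrite -?natr1; lra|rewrite addr_ge0// ltW].
have -> : alpha - k%:R = sigma by rewrite aE; ring.
by case: eqP => // e; move: aE; rewrite e; lra.
Qed.

Lemma inv_measurable : measurable_fun setT (fun x : R => x^-1).
Proof.
rewrite (_ : (fun x : R => x^-1) = (fun x => x * (x ^+ 2) `^ (- 1))); last first.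
  apply/funext => x; rewrite powR_inv1 ?sqr_ge0//.
  by have [->|x0] := eqVneq x 0; [rewrite invr0 mul0r|field].
apply: measurable_funM => //; apply: (measurableT_comp (f := fun t : R => t `^ (- 1))); first by apply: meas_pow.
exact: measurable_funX.
Qed.

(* [F] may vanish on a null set off [A]: the functionals fed to [Dsp_quot] are
   changed there so that its hypotheses hold everywhere. *)
Lemma quotient_data F N A : measurable_fun setT F -> measurable_fun setT N -> measurable A ->
  {ae wmu W, forall x, N x * \1_A x = 0} ->
  (forall p : R, 1 < p -> (\int[wmu W]_(x in ~` A) (`|((F x)%:E)^-1| `^ p) < +oo)%E) ->
  exists F' N' I : wspace W -> R,
    [/\ [/\ measurable_fun setT F', measurable_fun setT N', {ae P, forall x, F x = F' x} & {ae P, forall x, N x = N' x}],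
        Linf P I, forall x, F' x * I x = 1 - \1_A x,
        forall x, \1_A x * I x = 0 & (forall x, N' x * \1_A x = 0) /\
        {ae P, forall x, N' x * I x = quotient_off A F N x} /\ measurable_fun setT (quotient_off A F N)].
Proof.
move=> mF mN mA NA hI.
pose Z := [set x | F x = 0] `&` ~` A.
have mZ0 : measurable [set x : wspace W | F x = 0].
  rewrite (_ : [set x | F x = 0] = setT `&` F @^-1` [set 0]); first exact: mF.
  by rewrite setTI.
have mZ : measurable Z by apply: measurableI => //; exact: measurableC.
have m1A (B : set (wspace W)) : measurable B -> measurable_fun setT (\1_B : wspace W -> R).
  by move=> mB; exact: measurable_indic.
pose F' x : R := F x + \1_Z x; pose N' x : R := N x * (1 - \1_A x).
pose I x : R := (1 - \1_A x) * (F' x)^-1.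
have mF' : measurable_fun setT F' by apply: measurable_funD => //; exact: m1A.
have mC : measurable_fun setT (fun x => 1 - \1_A x : R) by apply: measurable_funB => //; exact: m1A.
have mN' : measurable_fun setT N' by exact: measurable_funM.
have mI : measurable_fun setT I by apply: measurable_funM => //; exact: (measurableT_comp inv_measurable).
have in01 x : (\1_A x = 1 :> R /\ A x) \/ (\1_A x = 0 :> R /\ ~ A x).
  rewrite indicE; have [h|h] := boolP (x \in A); [left|right]; split=> //; first by move: h; rewrite inE.
  by move=> Ax; move/negP: h; apply; rewrite inE.
have F'n x : ~ A x -> F' x != 0.
  move=> nA; rewrite /F' indicE; have [h|h] := boolP (x \in Z).
    by move: h; rewrite inE => -[-> _]; rewrite add0r oner_neq0.
  rewrite addr0; apply/negP => /eqP F0; move/negP: h; apply; rewrite inE; split=> //.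
pose h (p : R) := (fun x => `|((F x)%:E)^-1| `^ p)%E \_ (~` A).
have h0 p x : (0 <= h p x)%E by rewrite /h patchE; case: ifP => // _; exact: poweR_ge0.
have hH p : 1 < p -> exists2 H : R, 0 <= H & (\int[P]_x h p x = H%:E)%E.
  move=> p1; have := hI p p1; rewrite integral_mkcond -/(h p) => hlt.
  have H0 : (0 <= \int[P]_x h p x)%E by apply: integral_ge0 => x _; exact: h0.
  exists (fine (\int[P]_x h p x)); first exact: fine_ge0.
  by rewrite fineK// ge0_fin_numE.
have hZ p x : p != 0 -> Z x -> h p x = +oo%E.
  by move=> p0 [F0 nA]; rewrite /h patchE mem_set// [F x]F0 /inve eqxx /= (negPf p0).
(* The extended inverse is infinite on [Z], so a finite moment forces [Z] to be null. *)
have Z0 : P Z = 0%E.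
  have [H H0 eH] := hH 2 ltac:(by rewrite ltr1n).
  have PZ : P Z = (fine (P Z))%:E by rewrite fineK// fin_num_measure.
  have key (M : R) : 0 <= M -> M * fine (P Z) <= H.
    move=> M0; rewrite -lee_fin EFinM -PZ -eH.
    rewrite (_ : (M%:E * P Z = \int[P]_x (cst M%:E \_ Z) x)%E); last first.
      by rewrite -integral_mkcond integral_cst.
    apply: ge0_le_int => x; rewrite patchE; case: ifP => // xZ.
    by rewrite hZ ?leey//; move: xZ; rewrite inE.
  have f0 : 0 <= fine (P Z) by exact: fine_ge0.
  rewrite PZ; congr EFin; apply/eqP; rewrite eq_le f0 andbT leNgt; apply/negP => fp.
  have := key ((H + 1) / fine (P Z)) ltac:(by rewrite divr_ge0//; lra).
  by rewrite divfK ?gt_eqF//; lra.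
have aeZ : {ae P, forall x, ~ Z x}.
  by exists Z; split=> // x /= /contrapT.
exists F', N', I; split.
- split=> //.
    by apply: filterS aeZ => x nZ; rewrite /F' indicE memNset// addr0.
  by apply: filterS NA => x NAx; rewrite /N' mulrBr NAx mulr1 subr0.
- apply: Linf_ge2 => p p2; have p1 : 1 < p by lra.
  have p0 : 0 < p by lra.
  have [H H0 eH] := hH p p1.
  apply: (memLX (C := H `^ p^-1) p0 mI _ _).1; last exact: powR_ge0.
  rewrite -powRrM mulVf ?gt_eqF// powRr1// -eH.
  apply: ge0_le_int => x; first by rewrite lee_fin powR_ge0.
  have [xZ|nZ] := pselect (Z x); first by rewrite hZ ?leey// gt_eqF.
  rewrite /I; have [[e Ax]|[e nA]] := in01 x; rewrite e.
    by rewrite subrr mul0r normr0 powR0 ?gt_eqF.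
  rewrite subr0 mul1r /F' indicE memNset// addr0 /h patchE mem_set// /inve.
  case: eqP => [F0|_]; first by exfalso; apply: nZ.
  by rewrite abse_EFin poweR_EFin.
- move=> x; rewrite /I mulrCA; have [[-> _]|[-> nA]] := in01 x; first by rewrite subrr mul0r.
  by rewrite subr0 mul1r mulfV// F'n.
- by move=> x; rewrite /I; have [[-> _]|[-> _]] := in01 x; rewrite ?subrr ?mul0r ?mulr0// mul0r.
- split; first by move=> x; rewrite /N'; have [[-> _]|[-> _]] := in01 x; rewrite ?subrr ?mulr0 ?mul0r.
  split.
    apply: filterS aeZ => x nZ; rewrite /quotient_off patchE.
    have [[e Ax]|[e nA]] := in01 x; rewrite /N' /I e.
      by rewrite memNset ?subrr ?mul0r ?mulr0//; exact.
    by rewrite mem_set// /F' indicE memNset// addr0 subr0 mulr1 mul1r mulrC.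
  apply/(measurable_restrictT _ _).1; first exact: measurableC.
  apply: (measurable_funS (E := setT)) => //; apply: measurable_funM => //; exact: (measurableT_comp inv_measurable).
Qed.
End quotient.

Theorem theorem3p1 (R : realType) (W : abstractWienerSpace R)
    (alpha sigma : R) (k : nat) (F G : wspace W -> R) (A : set (wspace W))
    (alphaE : alpha = k%:R + sigma)
    (sigma_bounds : 0 < sigma <= 1)
    (F_reg : fractional_sobolev_infty alpha F \/ sobolev_infty alpha F)
    (F_ge0 : {ae wmu W, forall x, 0 <= F x})
    (G_reg : sobolev_infty k.+1%:R G)
    (A_meas : measurable A)
    (G_A : {ae wmu W, forall x, G x * \1_A x = 0})
    (F_inv : forall p : R, 1 < p ->
       (\int[wmu W]_(x in ~` A) (`|((F x)%:E)^-1| `^ p) < +oo)%E) :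
  sobolev_minus_infty alpha (quotient_off A F G) /\
  ((exists n : nat, (0 < n)%N /\ alpha = n%:R) ->
   sobolev_infty alpha F -> sobolev_infty alpha G ->
   sobolev_infty alpha (quotient_off A F G)).
Proof.
have DF := regular_Dsp alphaE sigma_bounds F_reg; have [s0 s1] := andP sigma_bounds.
have DG := sobolev_Dsp G_reg.
have LF : Linf (wmu W) F by have [] := DF 0 (lexx 0) s0.
have LG : Linf (wmu W) G by have [] := DG.
have [F' [G' [I [[mF' mG' eF eG] LI FI aI [Ga [eQ mQ]]]]]] :=
  quotient_data (Linf_meas LF) (Linf_meas LG) A_meas G_A F_inv.
have La : Linf (gP (gW W)) (\1_A : wspace W -> R).
  apply: (@Linf_bounded _ _ _ _ _ 1); first exact: measurable_indic.
  by move=> x; rewrite indicE normr_nat lern1 leq_b1.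
split=> [b /andP[b0 ba]|[n [n0 aE]] SF SG].
  apply: Dsp_sobolev; first exact: ltW.
  (* The order [b] may lie below [k]; the induction works with nonnegative excess over [k]. *)
  pose r := Num.max 0 (b - k%:R).
  have r0 : 0 <= r by rewrite le_max lexx.
  have rs : r < sigma by rewrite gt_max s0; lra.
  have br : b <= r + k%:R by rewrite -lerBlDr le_max lexx orbT.
  apply: (Dsp_le br); apply: Dsp_ae eQ mQ _.
  apply: (Dsp_quot_lt s0 s1 _ _ LI La FI aI Ga r0 rs) => t t0 ts.
    exact: Dsp_ae eF mF' (DF t t0 ts).
  (* The order k + 1 of [G] exceeds t + k, since t < sigma <= 1. *)
  apply: Dsp_ae eG mG' _; apply: Dsp_le DG; rewrite -natr1; lra.
apply: Dsp_sobolev; first by rewrite aE.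
rewrite aE in SF SG *; apply: Dsp_ae eQ mQ _.
apply: (Dsp_quot _ _ LI La FI aI Ga).
  by apply: Dsp_ae eF mF' _; exact: sobolev_Dsp.
by apply: Dsp_ae eG mG' _; exact: sobolev_Dsp.
Qed.
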